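(* Let $\lambda<0$, let $B^{\lambda,br}$ be a Brownian bridge of length $1$ from $0$ to $\lambda$, and let $V(B^{\lambda,br})$ be its Vervaat transform. Let $Z^{\lambda}:=\inf\{t>0: V(B^{\lambda,br})_t=0\}$ be the first return to $0$ of $V(B^{\lambda,br})$. Then $Z^{\lambda}$ has density $$f_{Z^{\lambda}}(t)=\frac{|\lambda|}{\sqrt{2 \pi t(1-t)^3}} \exp\left(-\frac{\lambda^2 t}{2(1-t)}\right),\qquad 0<t<1,$$ and, given $Z^{\lambda}$, the path of $V(B^{\lambda,br})$ is decomposed into two conditionally independent pieces: (i) $(V(B^{\lambda,br})_{u};\ 0 \leq u \leq Z^{\lambda})$ is a Brownian excursion of length $Z^{\lambda}$; (ii) $(V(B^{\lambda,br})_{u};\ Z^{\lambda} \leq u \leq 1)$ is a first passage bridge through level $\lambda$ of length $1-Z^{\lambda}$.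
   Context: Vervaat transform: for continuous $f:[0,1]\to\mathbb{R}$ with $f(0)=0$, let $\tau(f)$ be the first time at which $f$ attains its minimum on $[0,1]$. Define $V(f)(t)=f(\tau(f)+t)-f(\tau(f))$ for $0\le t\le 1-\tau(f)$ and $V(f)(t)=f(\tau(f)+t-1)+f(1)-f(\tau(f))$ for $1-\tau(f)\le t\le 1$. A Brownian excursion of length $\ell>0$ is a three-dimensional Bessel bridge from $0$ to $0$ of length $\ell$. A first passage bridge through level $\lambda<0$ of length $\ell>0$ is standard Brownian motion $(B_t;0\le t\le \ell)$ started at $0$ and conditioned on the event that its first hitting time of $\lambda$ equals $\ell$; equivalently, it has the law of $\lambda$ plus a three-dimensional Bessel bridge from $|\lambda|$ to $0$ of length $\ell$. The piece on $[Z^\lambda,1]$ is re-indexed by $u-Z^\lambda\in[0,1-Z^\lambda]$. *)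

(* Defs.v *)
From HB Require Import structures.
From mathcomp Require Import all_boot all_order all_algebra.
From mathcomp Require Import all_classical all_reals all_analysis.
From mathcomp Require Import measurable_realfun.
Set Implicit Arguments.
Unset Strict Implicit.
Unset Printing Implicit Defensive.
Import Order.TTheory GRing.Theory Num.Theory.
Import numFieldNormedType.Exports.
Local Open Scope classical_set_scope.
Local Open Scope ring_scope.

Section vervaat.
Context {R : realType}.
Implicit Types f : R -> R.

Definition argmin01 f : R :=
  inf [set t | 0 <= t <= 1 /\ forall s, 0 <= s <= 1 -> f t <= f s].

(* Only meaningful for 0 <= t <= 1. *)
Definition vervaat f (t : R) : R :=
  let tau := argmin01 f in
  if t <= 1 - tau then f (tau + t) - f tau
  else f (tau + t - 1) + f 1 - f tau.

Definition first_return f : R := inf [set t | 0 < t <= 1 /\ f t = 0].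

End vervaat.

(* A finite-dimensional event {X_t1 in A1, ..., X_tn in An} is encoded by the
   list [:: (t1, A1); ...; (tn, An)]. *)
Section cylinders.
Context {R : realType}.
Implicit Types c : seq (R * set R).

(* 0 < t1 < ... < tn, and A1, ..., An are Borel sets *)
Definition is_cylinder c : Prop :=
  path <%R 0 (map fst c) /\ forall i, measurable (nth (0, set0) c i).2.

Definition last_time c : R := last 0 (map fst c).

Definition cylinder (T : Type) (X : R -> T -> R) c : set T :=
  \big[setI/setT]_(p <- c) (X p.1 @^-1` p.2).

End cylinders.

(* Finite-dimensional laws of the bridges of a Markov process whose transition
   probabilities are k t x z * w z dz.  The bridge of length l from x to y has
   density, with respect to the product of the measures w (z_i) dz_i,
     k t1 x z1 * k (t2 - t1) z1 z2 * ... * k (l - tn) zn y / k l x y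
   at times 0 < t1 < ... < tn < l. *)
Section bridge_fdd.
Context {R : realType}.
Variables (w : R -> R) (k : R -> R -> R -> R).
Implicit Types (c : seq (R * set R)).

(* The process sits at x at time s. *)
Fixpoint bridge_mass (l y s x : R) c : \bar R :=
  if c is (t, A) :: c' then
    (\int[@lebesgue_measure R]_(z in A)
        ((k (t - s) x z * w z)%:E * bridge_mass l y t z c'))%E
  else (k (l - s) x y)%:E.

Definition bridge_fdd (l x y : R) c : \bar R :=
  (bridge_mass l y 0 x c * ((k l x y)^-1)%:E)%E.

End bridge_fdd.

Section kernels.
Context {R : realType}.
Implicit Types t x y z l lam : R.

Definition bm_kernel t x y : R := normal_pdf x (Num.sqrt t) y.

(* Transition density of the three-dimensional Bessel process with respect to
   y^2 dy on the positive half-line.  For x, y > 0 it comes from the h-transform,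
   with h x = x, of Brownian motion killed at 0; the value for x = 0 or y = 0 is
   the continuous extension. *)
Definition bes3_kernel t x y : R :=
  if x * y == 0 then
    Num.sqrt (2 / (pi * t ^+ 3)) * expR (- (x ^+ 2 + y ^+ 2) / (2 * t))
  else (bm_kernel t x y - bm_kernel t x (- y)) / (x * y).

Definition bes3_weight z : R := if 0 < z then z ^+ 2 else 0.

Definition brownian_bridge_fdd l x y (c : seq (R * set R)) : \bar R :=
  bridge_fdd (fun=> 1) bm_kernel l x y c.

Definition bes3_bridge_fdd l x y (c : seq (R * set R)) : \bar R :=
  bridge_fdd bes3_weight bes3_kernel l x y c.

Definition brownian_excursion_fdd l (c : seq (R * set R)) : \bar R :=
  bes3_bridge_fdd l 0 0 c.

(* lam plus a three-dimensional Bessel bridge from `|lam| to 0 *)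
Definition first_passage_bridge_fdd lam l (c : seq (R * set R)) : \bar R :=
  bes3_bridge_fdd l `|lam| 0 [seq (p.1, [set r | p.2 (lam + r)]) | p <- c].

End kernels.

Section processes.
Context {R : realType} {d : measure_display} {T : measurableType d}.
Variable P : probability T R.

Record is_brownian_bridge (l x y : R) (X : R -> T -> R) : Prop := {
  bb_measurable : forall t, 0 <= t <= l -> measurable_fun setT (X t) ;
  bb_continuous : forall o, {within `[0, l], continuous (fun t => X t o)} ;
  bb_start : forall o, X 0 o = x ;
  bb_end : forall o, X l o = y ;
  bb_fdd : forall c, is_cylinder c -> last_time c < l ->
    P (cylinder X c) = brownian_bridge_fdd l x y c }.

Definition has_density (Z : T -> R) (D : set R) (f : R -> R) : Prop :=
  measurable_fun setT Z /\
  forall A : set R, measurable A ->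
    P (Z @^-1` A) = (\int[@lebesgue_measure R]_(t in A `&` D) (f t)%:E)%E.

(* q Z is a version of the conditional probability of E given Z. *)
Definition is_cond_prob (Z : T -> R) (E : set T) (q : R -> \bar R) : Prop :=
  [/\ measurable E, measurable_fun setT q &
    forall A : set R, measurable A ->
      P (E `&` Z @^-1` A) = (\int[P]_(o in Z @^-1` A) q (Z o))%E].

Definition sigma_path (Y : R -> T -> R) : set (set T) :=
  <<s [set E | exists u A, [/\ 0 <= u, measurable A & E = Y u @^-1` A]] >>.

Definition cond_independent (Z : T -> R) (Y1 Y2 : R -> T -> R) : Prop :=
  forall E1 E2, sigma_path Y1 E1 -> sigma_path Y2 E2 ->
  exists q1 q2 : R -> \bar R,
    [/\ is_cond_prob Z E1 q1, is_cond_prob Z E2 q2 &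
        is_cond_prob Z (E1 `&` E2) (fun z => q1 z * q2 z)%E].

(* Given Z = z, the path (Y u; 0 <= u <= L z) is a continuous path from x to y
   with the finite-dimensional laws fdd (L z).  As the length is random, the
   finite-dimensional events are those of a path with a lifetime:
   {Y_t1 in A1, ..., Y_tn in An, tn < L Z}. *)
Record cond_path_law (Z : T -> R) (Y : R -> T -> R) (L : R -> R) (x y : R)
    (fdd : R -> seq (R * set R) -> \bar R) : Prop := {
  cpl_path : {ae P, forall o,
    [/\ {within `[0, L (Z o)], continuous (fun u => Y u o)},
        Y 0 o = x & Y (L (Z o)) o = y]} ;
  cpl_fdd : forall c, is_cylinder c ->
    is_cond_prob Z ([set o | last_time c < L (Z o)] `&` cylinder Y c)
      (fun z => if last_time c < L z then fdd (L z) c else 0%E) }.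

Definition cond_brownian_excursion Z Y L : Prop :=
  cond_path_law Z Y L 0 0 brownian_excursion_fdd.

Definition cond_first_passage_bridge lam Z Y L : Prop :=
  cond_path_law Z Y L 0 lam (first_passage_bridge_fdd lam).

End processes.

(* Main.v *)
Require Import Defs.
From HB Require Import structures.
From mathcomp Require Import all_boot all_order all_algebra.
From mathcomp Require Import all_classical all_reals all_analysis.
From mathcomp Require Import measurable_realfun ring lra.
Import Order.TTheory GRing.Theory Num.Theory.
Import numFieldNormedType.Exports.
Set Implicit Arguments.
Unset Strict Implicit.
Unset Printing Implicit Defensive.
Local Open Scope classical_set_scope.
Local Open Scope ring_scope.

(** Let [l = - lambda], let [tau] and [m] be the argmin and the minimum of the
    bridge [b], and let [T0] be the first time at which [b] hits [m + l]; the first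
    return to [0] of the Vervaat transform is [Z = 1 - tau + T0].  For small [e] and
    parameters [s < r] and [x], consider the window event: [b + x] stays above [l] on
    [[0, r - s]], falls below [l - e] but not below [0] during [[r - s, r - s + e]],
    stays above [0] until [1 - s - e], falls below [0] but not below [- e] during
    [[1 - s - e, 1 - s]], and stays above [0] until [1].  On this event [x], [s]
    and [r] lie within [e] of [- m], [1 - tau] and [Z], on a prescribed side, so
    that the volume of the set of such [(s, r, x)] is at most [e ^ 3].  The probability
    of the event is a product of kernels of killed Brownian motion, by reflection.
    Integrating it over [x] closes the path into a loop, which can be cut open at
    the minimum: what appears, after division by [e ^ 3] and as [e] tends to [0], is
    a positive excursion of length [r] followed by a path of length [1 - r] from [l] to
    [0], that is, Bessel kernels; the integral over [0 < s < r] then contributes the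
    factor [r].  Fatou's lemma makes the joint law of [Z] and of the two pieces
    dominate the announced one on open sets, and both have total mass [1]. *)

(** The time of the minimum is not a stopping time, and prescribing it is an event of probability
    zero, so neither the Markov property nor elementary conditioning applies there. The windows
    replace the conditioning by an average over [(s, r, x)], of which only one-sided bounds are
    asked: an upper bound on the volume for each path, a lower limit for the integral of the
    probabilities. The same [e], the square of [mesh n], serves for times and levels: during a time
    [e] the path moves by order [sqrt e], much more than [e], so in Brownian scale the shift of the
    barrier is infinitesimal and the limits are explicit Gaussian integrals. The sets are eroded
    before the limit, because a window determines the path only up to a small error; this is why
    open sets come first and Borel sets are reached one coordinate at a time. The total mass of the
    announced law comes from a substitution: it is the law of [N ^ 2 / (lambda ^ 2 + N ^ 2)] for a
    standard normal [N]. *)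

Lemma measurable_comp_pair d1 d2 d3 d4 (T1 : measurableType d1) (T2 : measurableType d2)
    (T3 : measurableType d3) (T4 : measurableType d4) (h : T2 * T3 -> T4)
    (f : T1 -> T2) (g : T1 -> T3) :
  measurable_fun setT h -> measurable_fun setT f -> measurable_fun setT g ->
  measurable_fun setT (fun x => h (f x, g x)).
Proof.
move=> mh mf mg; apply: (measurableT_comp mh (g := fun x => (f x, g x))).
exact: measurable_fun_pair.
Qed.

(** * Measurability and changes of variables *)

Section measurability.
Context {R : realType}.
Local Notation mu := (@lebesgue_measure R).

Lemma measurable_sqrt : measurable_fun setT (@Num.sqrt R).
Proof. by apply: continuous_measurable_fun => x; exact: sqrt_continuous. Qed.

Lemma measurable_inv : measurable_fun setT (@GRing.inv R).
Proof.
have -> : [set: R] = [set 0] `|` ~` [set 0] by rewrite setUv.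
apply/measurable_funU => //; first exact: measurableC.
split; first exact: measurable_fun_set1.
apply: open_continuous_measurable_fun; first exact/closed_openC/accessible_closed_set1/hausdorff_accessible/Rhausdorff.
by move=> x; rewrite inE/= => /eqP x0; exact: inv_continuous.
Qed.

Lemma measurable_integral_param d (U : measurableType d) (A : set R)
    (g : U * R -> \bar R) : measurable A -> measurable_fun setT g ->
  (forall p, 0 <= g p)%E ->
  measurable_fun setT (fun u => (\int[mu]_(z in A) g (u, z))%E).
Proof.
move=> mA mg g0.
pose h (p : U * R) : \bar R := if p.2 \in A then g p else 0%E.
rewrite (_ : (fun u => _) = fubini_F mu h).
  apply: measurable_fun_fubini_tonelli_F => //.
    apply: measurable_fun_ifT => //.
    apply: (measurableT_comp (f := fun z : R => z \in A)) => //.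
    by apply: (measurable_fun_bool true); rewrite setTI preimage_mem_true.
  by move=> p; rewrite /h; case: ifP.
by apply/funext => u; rewrite integral_mkcond; apply: eq_integral => z _.
Qed.

Lemma measurable_patch0 d (U : measurableType d) (A : set U) (f : U -> \bar R) :
  measurable A -> measurable_fun setT f -> measurable_fun setT (f \_ A).
Proof.
move=> mA mf; rewrite (_ : f \_ A = fun x => if x \in A then f x else 0%E)//.
apply: measurable_fun_ifT => //.
by apply: (measurable_fun_bool true); rewrite setTI preimage_mem_true.
Qed.

Lemma tonelli_set d1 d2 (T1 : measurableType d1) (T2 : measurableType d2)
    (m1 : {sigma_finite_measure set T1 -> \bar R})
    (m2 : {sigma_finite_measure set T2 -> \bar R})
    (A : set T1) (B : set T2) (g : T1 * T2 -> \bar R) :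
  measurable A -> measurable B -> measurable_fun setT g ->
  (forall p, 0 <= g p)%E ->
  (\int[m1]_(x in A) \int[m2]_(y in B) g (x, y) =
   \int[m2]_(y in B) \int[m1]_(x in A) g (x, y))%E.
Proof.
move=> mA mB mg g0.
pose h (p : T1 * T2) : \bar R := if (p.1 \in A) && (p.2 \in B) then g p else 0%E.
transitivity (\int[m1]_x \int[m2]_y h (x, y))%E.
  rewrite integral_mkcond; apply: eq_integral => x _.
  rewrite patchE; case: ifPn => xA.
    by rewrite integral_mkcond; apply: eq_integral => y _; rewrite patchE /h/= xA.
  by rewrite integral0_eq// => y _; rewrite /h/= (negbTE xA).
rewrite fubini_tonelli//; last 2 first.
- apply: measurable_fun_ifT => //; apply: measurable_and.
    apply: (measurableT_comp (f := fun z : T1 => z \in A)) => //.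
    by apply: (measurable_fun_bool true); rewrite setTI preimage_mem_true.
  apply: (measurableT_comp (f := fun z : T2 => z \in B)) => //.
    by apply: (measurable_fun_bool true); rewrite setTI preimage_mem_true.
- by move=> p; rewrite /h; case: ifP.
rewrite [RHS]integral_mkcond; apply: eq_integral => y _.
rewrite patchE; case: ifPn => yB.
  by rewrite [RHS]integral_mkcond; apply: eq_integral => x _; rewrite patchE /h/= yB andbT.
by rewrite integral0_eq// => x _; rewrite /h/= (negbTE yB) andbF.
Qed.

(** The measure [a] times the image of [mu] under [x -> a * x + b] gives every half-open interval
    its length, so it is [mu] by uniqueness. *)
Lemma integral_affine_pos (a b : R) (f : R -> \bar R) : 0 < a ->
  measurable_fun setT f -> (forall x, 0 <= f x)%E ->
  (\int[mu]_x f x = a%:E * \int[mu]_x f (a * x + b)%R)%E.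
Proof.
move=> a0 mf f0.
have mg : measurable_fun setT (fun x : measurableTypeR R => a * x + b : measurableTypeR R).
  by apply: measurable_funD => //; apply: measurable_funM.
pose nu := mscale (NngNum (ltW a0)) (measure_function_pushforward__canonical__measure_function_Measure mu mg).
have -> : (\int[mu]_x f x = \int[nu]_x f x)%E.
  apply: eq_measure_integral => /= A mA _.
  apply: (@lebesgue_measure_unique _ nu) => // _ [[c d]] _ <-/=.
  rewrite /nu /mscale/= /pushforward.
  rewrite (_ : _ @^-1` _ = `](c - b) / a, (d - b) / a]%classic); last first.
    by apply/seteqP; split => x/=;
      rewrite !in_itv/= ltr_pdivrMr// ler_pdivlMr// ltrBlDr lerBrDr mulrC.
  rewrite !lebesgue_measure_itv/= !lte_fin ltr_pM2r ?invr_gt0// ltrD2r.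
  case: ifPn => _; last by rewrite mule0.
  rewrite -!EFinD -EFinM -mulrBl opprB addrA subrK mulrC divfK ?gt_eqF//.
by rewrite ge0_integral_mscale//= (ge0_integral_pushforward mg).
Qed.

Lemma integral_opp (f : R -> \bar R) :
  measurable_fun setT f -> (forall x, 0 <= f x)%E ->
  (\int[mu]_x f x = \int[mu]_x f (- x)%R)%E.
Proof.
move=> mf f0.
have -> : (\int[mu]_x f x = \int[pushforward mu (-%R : _ -> measurableTypeR R)]_x f x)%E.
  by apply: eq_measure_integral => /= A mA _; exact/esym/lebesgue_measureN.
by rewrite ge0_integral_pushforward.
Qed.

Lemma integral_shift (c : R) (f : R -> \bar R) :
  measurable_fun setT f -> (forall x, 0 <= f x)%E ->
  (\int[mu]_x f (x + c)%R = \int[mu]_x f x)%E.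
Proof.
move=> mf f0; rewrite [RHS](integral_affine_pos c ltr01)// mul1e.
by apply: eq_integral => x _; rewrite mul1r.
Qed.

Lemma integral_reflect (c : R) (f : R -> \bar R) :
  measurable_fun setT f -> (forall x, 0 <= f x)%E ->
  (\int[mu]_x f (c - x)%R = \int[mu]_x f x)%E.
Proof.
move=> mf f0; rewrite -[RHS](integral_shift c)// integral_opp//.
  by apply: eq_integral => x _; rewrite opprK addrC.
by apply: (measurableT_comp mf); exact: measurable_funB.
Qed.

Lemma ge0_integral_EFinD (f g : R -> R) :
  measurable_fun setT f -> measurable_fun setT g ->
  (forall x, 0 <= f x) -> (forall x, 0 <= g x) ->
  (\int[mu]_x (f x + g x)%:E = \int[mu]_x (f x)%:E + \int[mu]_x (g x)%:E)%E.
Proof.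
move=> mf mg f0 g0; under eq_integral do rewrite EFinD.
by rewrite ge0_integralD//; [move=> x _; rewrite lee_fin|exact/measurable_EFinP
  |move=> x _; rewrite lee_fin|exact/measurable_EFinP].
Qed.
End measurability.

(** * Killed Brownian motion *)

Section heat_kernel.
Context {R : realType}.
Implicit Types a s t x y z : R.
Local Notation mu := (@lebesgue_measure R).

Lemma bm_kernelE t x y : 0 < t ->
  bm_kernel t x y = (Num.sqrt (2 * pi * t))^-1 * expR (- ((y - x) ^+ 2 / (2 * t))).
Proof.
move=> t0; rewrite /bm_kernel normal_pdfE ?gt_eqF ?sqrtr_gt0//.
rewrite /normal_peak /normal_fun sqr_sqrtr ?ltW//.
congr (_^-1 * expR _); first by congr Num.sqrt; rewrite -mulr_natr; ring.
by rewrite mulNr -(mulr_natr t) (mulrC t).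
Qed.

Lemma bm_kernel_ge0 t x y : 0 <= bm_kernel t x y.
Proof. exact: normal_pdf_ge0. Qed.

Lemma bm_kernel_gt0 t x y : 0 < t -> 0 < bm_kernel t x y.
Proof.
move=> t0; rewrite bm_kernelE// mulr_gt0 ?expR_gt0// invr_gt0 sqrtr_gt0.
by rewrite !mulr_gt0// pi_gt0.
Qed.

Lemma bm_kernel_ub t x y : 0 < t -> bm_kernel t x y <= (Num.sqrt (2 * pi * t))^-1.
Proof.
move=> t0; rewrite bm_kernelE// ler_piMr ?invr_ge0 ?sqrtr_ge0//.
by rewrite -[leRHS]expR0 ler_expR oppr_le0 divr_ge0 ?sqr_ge0// mulr_ge0// ltW.
Qed.

Lemma bm_kernelC t x y : 0 < t -> bm_kernel t x y = bm_kernel t y x.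
Proof. by move=> t0; rewrite !bm_kernelE// -sqrrN opprB. Qed.

Lemma bm_kernel_shift c t x y : 0 < t -> bm_kernel t (x + c) (y + c) = bm_kernel t x y.
Proof. by move=> t0; rewrite !bm_kernelE// opprD addrACA subrr addr0. Qed.

Lemma bm_kernelN t x y : 0 < t -> bm_kernel t (- x) (- y) = bm_kernel t x y.
Proof. by move=> t0; rewrite !bm_kernelE// -opprD sqrrN. Qed.

Lemma measurable_bm_kernel d (U : measurableType d) (t x y : U -> R) :
  measurable_fun setT t -> measurable_fun setT x -> measurable_fun setT y ->
  measurable_fun setT (fun u => bm_kernel (t u) (x u) (y u)).
Proof.
move=> mt mx my.
have ms : measurable_fun setT (fun u => Num.sqrt (t u)).
  by apply: (measurableT_comp measurable_sqrt).
(* At a vanishing deviation [normal_pdf] takes a default value, the indicator of [[0, 1]], and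
   measurability in [t] has to cover that branch. *)
apply: (@measurable_fun_ifT _ _ _ _ _ _ (fun u => Num.sqrt (t u) == 0)).
- exact: measurable_fun_eqr.
- by apply: (measurableT_comp (f := (\1_`[0, 1] : R -> R))) => //; exact: measurable_indic.
- apply: measurable_funM.
    apply: (measurableT_comp measurable_inv); apply: (measurableT_comp measurable_sqrt).
    under eq_fun do rewrite -mulr_natr.
    by apply: measurable_funM => //; apply: measurable_funM => //; exact: measurable_funX.
  apply: (measurableT_comp (f := expR)) => //.
  apply: measurable_funM.
    apply: measurable_funN; apply: measurable_funX.
    exact: measurable_funB.
  apply: (measurableT_comp measurable_inv); apply: (measurableT_comp (f := fun z : R => z *+ 2)).
    by under eq_fun do rewrite -mulr_natr; apply: measurable_funM.
  exact: measurable_funX.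
Qed.

Opaque bm_kernel.

(** Completing the square in [z]: the second factor on the right is the density at time [s] of the
    Brownian bridge of length [s + t] from [x] to [y]. As it integrates to [1], Chapman-Kolmogorov
    follows. *)
Lemma bm_kernel_mul s t x y z : 0 < s -> 0 < t ->
  bm_kernel s x z * bm_kernel t z y = bm_kernel (s + t) x y *
    normal_pdf ((t * x + s * y) / (s + t)) (Num.sqrt (s * t / (s + t))) z.
Proof.
move=> s0 t0; have st0 : 0 < s + t by rewrite addr_gt0.
have q0 : 0 < s * t / (s + t) by rewrite divr_gt0// mulr_gt0.
have pi0 : 0 < (pi : R) := pi_gt0 R.
rewrite !bm_kernelE// normal_pdfE ?gt_eqF ?sqrtr_gt0//.
rewrite /normal_peak /normal_fun sqr_sqrtr ?ltW//.
rewrite mulrACA [RHS]mulrACA -!expRD -!invfM; congr (_^-1 * expR _).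
  rewrite -!sqrtrM; last 2 first.
  - by rewrite !mulr_ge0// ltW.
  - by rewrite !mulr_ge0// ltW.
  by congr Num.sqrt; rewrite -mulr_natr; field; rewrite gt_eqF.
by rewrite -[s * t / _ *+ 2]mulr_natr; field; rewrite !gt_eqF.
Qed.

Lemma bm_chapman_kolmogorov s t x y : 0 < s -> 0 < t ->
  (\int[mu]_z (bm_kernel s x z * bm_kernel t z y)%:E = (bm_kernel (s + t) x y)%:E)%E.
Proof.
move=> s0 t0; under eq_integral do rewrite bm_kernel_mul// EFinM.
rewrite integralZl//; last exact: integrable_normal_pdf.
by rewrite integral_normal_pdf mule1.
Qed.

Lemma integral_bm_kernel t x : (\int[mu]_z (bm_kernel t x z)%:E = 1)%E.
Proof. exact: integral_normal_pdf. Qed.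

(* Transition density of Brownian motion killed below [a], by reflection at [a]. *)
Definition killed_kernel a t x y : R :=
  if (a <= x) && (a <= y) then bm_kernel t x y - bm_kernel t x (2 * a - y) else 0.

Lemma measurable_killed_kernel a d (U : measurableType d) (t x y : U -> R) :
  measurable_fun setT t -> measurable_fun setT x -> measurable_fun setT y ->
  measurable_fun setT (fun u => killed_kernel a (t u) (x u) (y u)).
Proof.
move=> mt mx my; apply: measurable_fun_ifT => //.
  by apply: measurable_and; exact: measurable_fun_ler.
apply: measurable_funB; first exact: measurable_bm_kernel.
by apply: measurable_bm_kernel => //; exact: measurable_funB.
Qed.

Lemma killed_kernelE a t x y : a <= x -> a <= y ->
  killed_kernel a t x y = bm_kernel t x y - bm_kernel t x (2 * a - y).
Proof. by rewrite /killed_kernel => -> ->. Qed.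

(** The squares [(2 a - y - x) ^ 2] and [(y - x) ^ 2] differ by [4 (x - a) (y - a)]. The second
    factor is the probability that the bridge of length [t] from [x] to [y] stays above [a]; the
    sign and the monotonicity in [a] are read off it. *)
Lemma killed_kernel_expE a t x y : 0 < t -> a <= x -> a <= y ->
  killed_kernel a t x y = bm_kernel t x y * (1 - expR (- (2 * (x - a) * (y - a) / t))).
Proof.
move=> t0 ax ay; rewrite /killed_kernel ax ay/= !bm_kernelE//.
rewrite [RHS]mulrBr mulr1 -[X in _ = _ - X]mulrA -expRD; congr (_ - _ * expR _).
by field; rewrite gt_eqF.
Qed.

Lemma killed_kernel_ge0 a t x y : 0 < t -> 0 <= killed_kernel a t x y.
Proof.
move=> t0; have [/andP[ax ay]|h] := boolP ((a <= x) && (a <= y)); last first.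
  by rewrite /killed_kernel (negbTE h).
rewrite killed_kernel_expE// mulr_ge0 ?bm_kernel_ge0// subr_ge0.
rewrite -[leRHS]expR0 ler_expR oppr_le0 divr_ge0 ?(ltW t0)//.
by rewrite !mulr_ge0// subr_ge0.
Qed.

Lemma killed_kernel_le a t x y : killed_kernel a t x y <= bm_kernel t x y.
Proof.
by rewrite /killed_kernel; case: ifP => _; rewrite ?bm_kernel_ge0// gerBl bm_kernel_ge0.
Qed.

Lemma killed_kernel0l a t x y : x < a -> killed_kernel a t x y = 0.
Proof. by move=> xa; rewrite /killed_kernel leNgt xa. Qed.

Lemma killed_kernel0r a t x y : y < a -> killed_kernel a t x y = 0.
Proof. by move=> xa; rewrite /killed_kernel (leNgt a y) xa andbF. Qed.

Lemma killed_kernel_shift c a t x y : 0 < t ->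
  killed_kernel (a + c) t (x + c) (y + c) = killed_kernel a t x y.
Proof.
move=> t0; rewrite /killed_kernel !lerD2r bm_kernel_shift//.
rewrite (_ : 2 * (a + c) - (y + c) = 2 * a - y + c); last by ring.
by rewrite bm_kernel_shift.
Qed.

Lemma killed_kernel_homo a b t x y : 0 < t -> a <= b ->
  killed_kernel b t x y <= killed_kernel a t x y.
Proof.
move=> t0 ab; have [/andP[ax ay]|h] := boolP ((b <= x) && (b <= y)); last first.
  by rewrite {1}/killed_kernel (negbTE h) killed_kernel_ge0.
rewrite !killed_kernel_expE ?(le_trans ab)//.
rewrite ler_wpM2l ?bm_kernel_ge0// lerD2l lerN2 ler_expR lerN2 ler_pM2r ?invr_gt0//.
rewrite ler_pM ?lerD2l ?lerN2// ?subr_ge0// ?mulr_ge0 ?subr_ge0//.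
by rewrite ler_pM2l// lerD2l lerN2.
Qed.

(** With a margin [e] above the barrier, killing costs a factor that is uniform in the end points
    and exponentially close to [1] for small [h]; a fine grid can afford one such factor per
    cell. *)
Lemma bm_le_killed_kernel a e h x z : 0 < h -> 0 < e -> a <= x -> a <= z ->
  bm_kernel h x z <= (1 - expR (- (2 * e ^+ 2 / h)))^-1 * killed_kernel (a - e) h x z.
Proof.
move=> h0 e0 ax az; rewrite killed_kernel_expE ?(le_trans _ ax) ?(le_trans _ az) ?gerBl ?(ltW e0)//.
have e1 : expR (- (2 * e ^+ 2 / h)) < 1.
  by rewrite -[ltRHS]expR0 ltr_expR oppr_lt0 divr_gt0// mulr_gt0// exprn_gt0.
rewrite [leRHS]mulrCA ler_peMr ?bm_kernel_ge0// mulrC ler_pdivlMr ?subr_gt0// mul1r.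
rewrite lerD2l lerN2 ler_expR lerN2 ler_pM2r ?invr_gt0// -mulrA ler_pM2l// expr2.
by rewrite ler_pM ?(ltW e0)//; lra.
Qed.

Opaque killed_kernel.

(** Method of images. Above [a] the product [G] expands into [F1 - F2], both invariant under the
    reflection at [a], and [G] vanishes below [a]. Hence [F1] is the sum of [G], its reflection and
    [F2] on the whole line, where the Gaussian identity applies. Sums are used instead of
    differences until the integrals are known to be finite. *)
Lemma killed_chapman_kolmogorov a s t x y : 0 < s -> 0 < t ->
  (\int[mu]_z (killed_kernel a s x z * killed_kernel a t z y)%:E =
   (killed_kernel a (s + t) x y)%:E)%E.
Proof.
move=> s0 t0; have st0 : 0 < s + t by rewrite addr_gt0.
have [ax|xa] := leP a x; last first.
  by rewrite integral0_eq ?killed_kernel0l// => z _; rewrite killed_kernel0l// mul0r.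
have [ay|ya] := leP a y; last first.
  by rewrite integral0_eq ?killed_kernel0r// => z _; rewrite (killed_kernel0r _ _ ya) mulr0.
pose G z := killed_kernel a s x z * killed_kernel a t z y.
have mp u v (f : R -> R) : measurable_fun setT f -> measurable_fun setT (fun z => bm_kernel u v (f z)).
  by move=> mf; apply: measurable_bm_kernel.
have mp' u v : measurable_fun setT (fun z => bm_kernel u z v) by apply: measurable_bm_kernel.
have mC : measurable_fun setT (fun z => 2 * a - z) by exact: measurable_funB.
have mG : measurable_fun setT G by apply: measurable_funM; exact: measurable_killed_kernel.
have G0 z : 0 <= G z by rewrite mulr_ge0 ?killed_kernel_ge0.
have sym z : 2 * a - (2 * a - z) = z by ring.
have pR u v z : 0 < u -> bm_kernel u (2 * a - v) z = bm_kernel u v (2 * a - z).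
  by move=> u0; rewrite !bm_kernelE// -[in LHS]sqrrN opprB (addrAC (2 * a)).
have refl w : (\int[mu]_z (bm_kernel s x (2 * a - z) * bm_kernel t z w)%:E =
    (bm_kernel (s + t) x (2 * a - w))%:E)%E.
  rewrite -[RHS](@bm_chapman_kolmogorov s t x (2 * a - w) s0 t0).
  rewrite -[RHS](integral_reflect (2 * a) (f := fun z => (bm_kernel s x z * bm_kernel t z (2 * a - w))%:E)); last 2 first.
  - by apply/measurable_EFinP/measurable_funM; [exact: mp|exact: mp'].
  - by move=> z; rewrite lee_fin mulr_ge0 ?bm_kernel_ge0.
  by apply: eq_integral => z _; rewrite pR// sym.
pose F1 z := bm_kernel s x z * bm_kernel t z y + bm_kernel s x (2 * a - z) * bm_kernel t z (2 * a - y).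
pose F2 z := bm_kernel s x z * bm_kernel t z (2 * a - y) + bm_kernel s x (2 * a - z) * bm_kernel t z y.
have mF u (f : R -> R) : measurable_fun setT f ->
    measurable_fun setT (fun z => bm_kernel s x (f z) * bm_kernel t z u).
  by move=> mf; apply: measurable_funM; [exact: mp|exact: mp'].
have F0 u (f : R -> R) z : 0 <= bm_kernel s x (f z) * bm_kernel t z u.
  by rewrite mulr_ge0 ?bm_kernel_ge0.
have mid : measurable_fun setT (idfun : R -> R) by exact: measurable_id.
have iF1 : (\int[mu]_z (F1 z)%:E = (bm_kernel (s + t) x y *+ 2)%:E)%E.
  rewrite (ge0_integral_EFinD (mF y idfun mid) (mF (2 * a - y) _ mC) (F0 _ _) (F0 _ _))//.
  by rewrite (@bm_chapman_kolmogorov s t x y s0 t0) refl sym -EFinD.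
have iF2 : (\int[mu]_z (F2 z)%:E = (bm_kernel (s + t) x (2 * a - y) *+ 2)%:E)%E.
  rewrite (ge0_integral_EFinD (mF (2 * a - y) idfun mid) (mF y _ mC) (F0 _ _) (F0 _ _))//.
  by rewrite (@bm_chapman_kolmogorov s t x (2 * a - y) s0 t0) refl -EFinD.
have key z : F1 z = G z + G (2 * a - z) + F2 z.
  rewrite /F1 /F2 /G.
  have [->|] := eqVneq z a.
    rewrite (_ : 2 * a - a = a); last by ring.
    rewrite !killed_kernelE// (_ : 2 * a - a = a); last by ring.
    by ring.
  case: ltgtP => // [za|az] _.
    rewrite (killed_kernel0r _ _ za) mul0r add0r !killed_kernelE//; last 2 first.
    - by lra.
    - by lra.
    rewrite sym !pR// sym; ring.
  rewrite (killed_kernel0r _ x (_ : 2 * a - z < a)); last by lra.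
  rewrite mul0r addr0 !killed_kernelE ?(ltW az)//; ring.
have : (\int[mu]_z (F1 z)%:E = \int[mu]_z (G z)%:E + \int[mu]_z (G z)%:E + \int[mu]_z (F2 z)%:E)%E.
  rewrite -[X in (_ + X + _)%E](integral_reflect (2 * a) (f := fun z => (G z)%:E)); last 2 first.
  - exact/measurable_EFinP.
  - by move=> z; rewrite lee_fin.
  have mGr : measurable_fun setT (fun z => G (2 * a - z)) by exact: (measurableT_comp mG).
  rewrite -(ge0_integral_EFinD mG mGr G0 (fun z => G0 _)).
  rewrite -(@ge0_integral_EFinD R (fun z => G z + G (2 * a - z)) F2).
  - by apply: eq_integral => z _; rewrite key.
  - exact: measurable_funD.
  - by apply: measurable_funD; [apply: (mF _ idfun); exact: measurable_id|exact: mF].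
  - by move=> z; rewrite addr_ge0.
  - by move=> z; rewrite /F2 addr_ge0// mulr_ge0// bm_kernel_ge0.
rewrite iF1 iF2.
have : (0 <= \int[mu]_z (G z)%:E)%E by apply: integral_ge0 => z _; rewrite lee_fin.
case: (\int[mu]_z (G z)%:E)%E => //= g g0; rewrite -!EFinD => -[] h.
congr EFin; rewrite killed_kernelE//; lra.
Qed.
End heat_kernel.

(** * Eventual lower bounds and Fatou's lemma *)

Section lower_limit.
Context {R : realType}.
Implicit Types (u v : (\bar R)^nat) (l m : \bar R).

(** This says that [l] is at most the inferior limit of [u]. Testing against the reals below [l]
    covers [l = +oo] and passes well to products, where extended inferior limits would meet
    [0 * +oo]. *)
Definition lower_limit_ge u l :=
  forall r : R, (r%:E < l)%E -> \forall n \near \oo, (r%:E <= u n)%E.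

Lemma lower_limit_geP u l : lower_limit_ge u l <-> (l <= limn_einf u)%E.
Proof.
split=> [h|h r rl].
  rewrite leNgt; apply/negP => ul.
  have [r /andP[ur rl]] : exists r : R, (limn_einf u < r%:E < l)%E.
    move: l ul h => [l| |] ul h; last by case: (limn_einf u) ul.
      move: (limn_einf u) ul => [a| |]//.
        by rewrite lte_fin => al; exists ((a + l) / 2); rewrite !lte_fin; lra.
      by move=> _; exists (l - 1); rewrite ltNyr lte_fin; lra.
    move: (limn_einf u) ul => [a| |]//.
      by move=> _; exists (a + 1); rewrite ltry lte_fin; lra.
    by move=> _; exists 0; rewrite ltNyr ltry.
  have [N _ hN] := h _ rl.
  suff : (r%:E <= limn_einf u)%E by rewrite leNgt ur.
  rewrite limn_einf_lim; apply: lime_ge; first exact: is_cvg_einfs.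
  near=> n; apply: le_ereal_inf_tmp => _ [k /= nk <-]; apply: hN => /=.
  by apply: leq_trans nk; near: n; exact: nbhs_infty_ge.
have := lt_le_trans rl h; rewrite limn_einf_lim => rlim.
have lu : limn (einfs u) = ereal_sup (range (einfs u)) by apply/cvg_lim => //; exact: cvg_einfs_sup.
move: rlim; rewrite lu => /ereal_sup_gt[_ [N _ <-]] rN.
exists N => // n /= Nn; apply: (le_trans (ltW rN)).
by apply: ereal_inf_lbound; exists n.
Unshelve. all: by end_near. Qed.

Lemma cvg_lower_limit u l : u @ \oo --> l -> lower_limit_ge u l.
Proof. by move=> /cvg_limn_einf_sup[ul _]; apply/lower_limit_geP; rewrite ul. Qed.

Lemma cst_lower_limit l : lower_limit_ge (fun=> l) l.
Proof. by move=> r /ltW rl; near=> n. Unshelve. all: by end_near. Qed.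

Lemma lower_limit_near u v l : (\forall n \near \oo, (u n <= v n)%E) ->
  lower_limit_ge u l -> lower_limit_ge v l.
Proof.
by move=> uv h r /h ru; near=> n; apply: (@le_trans _ _ (u n)); near: n.
Unshelve. all: by end_near. Qed.

Lemma lower_limit_cvg u l m : lower_limit_ge u l -> u @ \oo --> m -> (l <= m)%E.
Proof. by move=> /lower_limit_geP + /cvg_limn_einf_sup[um _]; rewrite um. Qed.

(** For a nonnegative [r] below [l * m] both limits are positive, and [r] is at most a product
    [r1 * r2] with [r1 < l] and [r2 < m]; for a negative [r] the signs suffice. *)
Lemma lower_limit_mul u v l m : (forall n, 0 <= u n)%E -> (forall n, 0 <= v n)%E ->
  (0 <= l)%E -> (0 <= m)%E -> lower_limit_ge u l -> lower_limit_ge v m ->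
  lower_limit_ge (fun n => u n * v n)%E (l * m)%E.
Proof.
move=> u0 v0 l0 m0 ul vm r rlm.
have [r0|r0] := ltP r 0.
  by near=> n; apply: (@le_trans _ _ 0%E); [rewrite lee_fin ltW|rewrite mule_ge0].
have lm0 : (0 < l * m)%E by rewrite (le_lt_trans _ rlm)// lee_fin.
have {}l0 : (0 < l)%E.
  by rewrite lt_neqAle l0 andbT; apply: contraTneq lm0 => <-; rewrite mul0e ltxx.
have {}m0 : (0 < m)%E.
  by rewrite lt_neqAle m0 andbT; apply: contraTneq lm0 => <-; rewrite mule0 ltxx.
suff [r1 [r2 [r10 r20 r1l r2m rr]]] : exists r1 r2 : R,
    [/\ 0 <= r1, 0 <= r2, (r1%:E < l)%E, (r2%:E < m)%E & r <= r1 * r2].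
  have h1 := ul _ r1l; have h2 := vm _ r2m.
  near=> n; apply: (@le_trans _ _ (r1%:E * r2%:E)%E); first by rewrite -EFinM lee_fin.
  by apply: lee_pmul; rewrite ?lee_fin//; near: n.
move: l m l0 m0 rlm {ul vm lm0} => [l| |] [m| |]//; rewrite ?lte_fin.
- move=> l0 m0 rlm.
  have rm : r / m < l by rewrite ltr_pdivrMr.
  have rm0 : 0 <= r / m by rewrite divr_ge0// ltW.
  have c0 : 0 < (r / m + l) / 2 by lra.
  (* The midpoint of [r / m] and [l] is below [l], and dividing [r] by it gives a number below
     [m]. *)
  exists ((r / m + l) / 2), (r / ((r / m + l) / 2)); rewrite !lte_fin; split.
  + exact: ltW.
  + by rewrite divr_ge0// ltW.
  + by lra.
  + by rewrite ltr_pdivrMr// -ltr_pdivrMl// mulrC; lra.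
  + by rewrite mulrC divfK// gt_eqF.
- move=> l0 _ _; exists (l / 2), (r / (l / 2)); rewrite ltry lte_fin; split => //; try lra.
  + by rewrite divr_ge0//; lra.
  + by rewrite mulrC divfK//; lra.
- move=> _ m0 _; exists (r / (m / 2)), (m / 2); rewrite ltry lte_fin; split => //; try lra.
  + by rewrite divr_ge0//; lra.
  + by rewrite divfK//; lra.
- move=> _ _ _; exists r, 1; rewrite !ltry mulr1; split => //.
Unshelve. all: by end_near. Qed.

(** Fatou's lemma in a form that can be iterated: its conclusion for an inner integral is the
    pointwise hypothesis for the outer one. *)
Lemma lower_limit_integral d (T : measurableType d) (mu : {measure set T -> \bar R})
    (D : set T) (f : (T -> \bar R)^nat) (g : T -> \bar R) :
  measurable D -> (forall n, measurable_fun D (f n)) -> measurable_fun D g ->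
  (forall n x, D x -> 0 <= f n x)%E -> (forall x, D x -> 0 <= g x)%E ->
  (forall x, D x -> lower_limit_ge (f ^~ x) (g x)) ->
  lower_limit_ge (fun n => \int[mu]_(x in D) f n x)%E (\int[mu]_(x in D) g x)%E.
Proof.
move=> mD mf mg f0 g0 fg; apply/lower_limit_geP.
apply: le_trans (fatou mu mD mf f0).
apply: ge0_le_integral => //.
- by apply: measurableT_comp => //; apply: measurable_fun_limn_esup => n; apply: measurableT_comp.
- by move=> x Dx; apply/lower_limit_geP; exact: fg.
Qed.
End lower_limit.

(** * Masses of chains of kernels *)

Section path_mass.
Context {R : realType}.
Local Notation mu := (@lebesgue_measure R).
Definition step := ((R -> R -> R) * set R)%type.
Implicit Types (c : seq step) (F G : R -> \bar R) (x y z : R).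

(* Total mass of the paths from [x] which make the steps [c], weighted by [F] at their end. *)
Fixpoint path_mass F c x : \bar R :=
  if c is (k, A) :: c' then (\int[mu]_(z in A) ((k x z)%:E * path_mass F c' z))%E
  else F x.

Fixpoint good_steps c : Prop :=
  if c is (k, A) :: c' then
    [/\ measurable_fun setT (fun p : R * R => k p.1 p.2), forall x y, 0 <= k x y,
        measurable A & good_steps c']
  else True.

Lemma path_mass_cat F c1 c2 x : path_mass F (c1 ++ c2) x = path_mass (path_mass F c2) c1 x.
Proof.
elim: c1 x => //= -[k A] c1 ih x.
by apply: eq_integral => z _; rewrite ih.
Qed.

Lemma good_steps_cat c1 c2 : good_steps (c1 ++ c2) <-> good_steps c1 /\ good_steps c2.
Proof.
elim: c1 => /= [|[k A] c1 ih]; first by split => // -[].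
by split => [[? ? ? /ih[]]|[[? ? ? ?] ?]]; split => //; exact/ih.
Qed.

Lemma path_mass_ge0 F c x : (forall x, 0 <= F x)%E -> good_steps c ->
  (0 <= path_mass F c x)%E.
Proof.
move=> F0; elim: c x => //= -[k A] c ih x [mk k0 mA gc].
by apply: integral_ge0 => z _; rewrite mule_ge0 ?lee_fin ?ih.
Qed.

Lemma measurable_path_mass_param d (U : measurableType d) (F : U * R -> \bar R) c :
  measurable_fun setT F -> (forall p, 0 <= F p)%E -> good_steps c ->
  measurable_fun setT (fun p : U * R => path_mass (fun x => F (p.1, x)) c p.2).
Proof.
move=> mF F0; elim: c => /= [_|[k A] c ih [mk k0 mA gc]].
  by under eq_fun do rewrite -surjective_pairing.
pose g (q : (U * R) * R) := ((k q.1.2 q.2)%:E * path_mass (fun x => F (q.1.1, x)) c q.2)%E.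
apply: (@measurable_integral_param _ _ _ A g) => //.
- apply: emeasurable_funM.
    apply/measurable_EFinP.
    apply: (measurable_comp_pair mk); last exact: measurable_snd.
    exact: (measurableT_comp measurable_snd measurable_fst).
  apply: (measurable_comp_pair (ih gc)); last exact: measurable_snd.
  exact: (measurableT_comp measurable_fst measurable_fst).
- by move=> q; rewrite mule_ge0 ?lee_fin//; exact: path_mass_ge0.
Qed.

Lemma measurable_path_mass F c : measurable_fun setT F -> (forall x, 0 <= F x)%E ->
  good_steps c -> measurable_fun setT (path_mass F c).
Proof.
move=> mF F0 gc.
have h := @measurable_path_mass_param _ R (fun p => F p.2) c (measurableT_comp mF measurable_snd) (fun p => F0 p.2) gc.
have := @measurable_comp_pair _ _ _ _ _ _ _ _ _ (fun=> 0 : R) (idfun : R -> R) h.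
by apply; [exact: measurable_cst|exact: measurable_id].
Qed.

Lemma measurable_step k A c F x : measurable_fun setT F -> (forall x, 0 <= F x)%E ->
  good_steps ((k, A) :: c) -> measurable_fun A (fun z => (k x z)%:E * path_mass F c z)%E.
Proof.
move=> mF F0 /= [mk k0 mA gc]; apply: measurable_funTS.
apply: emeasurable_funM; last exact: measurable_path_mass.
apply/measurable_EFinP; apply: (measurable_comp_pair mk (f := fun=> x) (g := idfun)); first exact: measurable_cst.
exact: measurable_id.
Qed.

Lemma path_massZ F c x (r : \bar R) : measurable_fun setT F -> (forall x, 0 <= F x)%E ->
  (0 <= r)%E -> good_steps c ->
  path_mass (fun x => r * F x)%E c x = (r * path_mass F c x)%E.
Proof.
move=> mF F0 r0; elim: c x => //= -[k A] c ih x gc.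
have mFc := measurable_step x mF F0 gc; case: gc => mk k0 mA gc.
rewrite -ge0_integralZl//; last first.
  by move=> z _; rewrite mule_ge0 ?lee_fin//; exact: path_mass_ge0.
by apply: eq_integral => z _; rewrite ih// muleCA.
Qed.

Lemma path_mass_integral d (U : measurableType d) (m : {sigma_finite_measure set U -> \bar R})
    (B : set U) (G : U * R -> \bar R) c x :
  measurable B -> measurable_fun setT G -> (forall p, 0 <= G p)%E -> good_steps c ->
  path_mass (fun x => \int[m]_(u in B) G (u, x))%E c x =
  (\int[m]_(u in B) path_mass (fun x => G (u, x)) c x)%E.
Proof.
move=> mB mG G0; elim: c x => //= -[k A] c ih x [mk k0 mA gc].
pose g (p : R * U) := ((k x p.1)%:E * path_mass (fun x => G (p.2, x)) c p.1)%E.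
transitivity (\int[mu]_(z in A) \int[m]_(u in B) g (z, u))%E; last first.
  apply: tonelli_set => //.
    apply: emeasurable_funM.
      apply/measurable_EFinP.
      by apply: (measurable_comp_pair mk (f := fun=> x)).
    by apply: (measurable_comp_pair (measurable_path_mass_param mG G0 gc)).
  by move=> p; rewrite mule_ge0 ?lee_fin//; exact: path_mass_ge0.
apply: eq_integral => z _; rewrite ih//.
rewrite -ge0_integralZl_EFin//.
- by move=> u _; exact: path_mass_ge0.
- apply: measurable_funTS.
  apply: (measurable_comp_pair (measurable_path_mass_param mG G0 gc) (f := idfun) (g := fun=> z)).
    exact: measurable_id.
  exact: measurable_cst.
Qed.

(** Serves to regard a mass of cylinders as a measure in each coordinate separately. *)
Lemma path_mass_bigcup F c1 k (A : nat -> set R) c2 x :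
  measurable_fun setT F -> (forall x, 0 <= F x)%E ->
  (forall n, measurable (A n)) -> trivIset setT A ->
  (forall n, good_steps (c1 ++ (k, A n) :: c2)) ->
  path_mass F (c1 ++ (k, \bigcup_n A n) :: c2) x =
  (\sum_(n <oo) path_mass F (c1 ++ (k, A n) :: c2) x)%E.
Proof.
move=> mF F0 mA tA; elim: c1 x => [|[k' B] c1 ih] x gc /=.
  have [mk k0 _ gc2] := gc 0%N.
  rewrite ge0_integral_bigcup//.
    by apply: (measurable_step x mF F0); split => //; exact: bigcup_measurable.
  by move=> z _; rewrite mule_ge0 ?lee_fin//; exact: path_mass_ge0.
have gc1 n : good_steps (c1 ++ (k, A n) :: c2) by case: (gc n).
rewrite -integral_nneseries//.
- apply: eq_integral => z _; rewrite ih//.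
  case: (gc 0%N) => _ k0 _ _.
  rewrite -nneseriesZl ?lee_fin//.
  by move=> n _; exact: path_mass_ge0.
- by case: (gc 0%N).
- by move=> n; apply: (measurable_step x mF F0); exact: (gc n).
- move=> n z _; case: (gc n) => _ k0 _ _.
  by rewrite mule_ge0 ?lee_fin//; exact: path_mass_ge0.
Qed.

(** The recursion integrates the last position innermost; Tonelli's theorem brings it outermost, so
    that the two ends of a loop can be joined there. *)
Lemma path_mass_rcons F c k A x : measurable_fun setT F -> (forall x, 0 <= F x)%E ->
  good_steps (c ++ [:: (k, A)]) ->
  path_mass F (c ++ [:: (k, A)]) x =
  (\int[mu]_(z in A) (path_mass (fun u => (k u z)%:E) c x * F z))%E.
Proof.
move=> mF F0 /good_steps_cat[gc [mk k0 mA _]].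
rewrite path_mass_cat/=.
pose G (p : R * R) := ((k p.2 p.1)%:E * F p.1)%E.
have mG : measurable_fun setT G.
  apply: emeasurable_funM; last exact: (measurableT_comp mF).
  by apply/measurable_EFinP; exact: (measurable_comp_pair mk).
have G0 p : (0 <= G p)%E by rewrite mule_ge0// lee_fin.
rewrite (path_mass_integral mu x mA mG G0 gc).
apply: eq_integral => z _; rewrite /G/= [RHS]muleC -path_massZ//.
- by congr (path_mass _ c x); apply/funext => u; rewrite muleC.
- apply/measurable_EFinP.
  apply: (measurable_comp_pair mk (f := idfun) (g := fun=> z)); first exact: measurable_id.
  exact: measurable_cst.
- by move=> u; rewrite lee_fin.
Qed.

(** Linearity in one kernel, stated with a sum: the kernels to be inserted are differences, but
    extended values do not subtract freely. *)
Lemma path_mass_stepD F c1 k k1 k2 A c2 x :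
  measurable_fun setT F -> (forall x, 0 <= F x)%E ->
  (forall x y, k x y = k1 x y + k2 x y) ->
  good_steps (c1 ++ (k1, A) :: c2) -> good_steps (c1 ++ (k2, A) :: c2) ->
  path_mass F (c1 ++ (k, A) :: c2) x =
  (path_mass F (c1 ++ (k1, A) :: c2) x + path_mass F (c1 ++ (k2, A) :: c2) x)%E.
Proof.
move=> mF F0 kD; elim: c1 x => [|[k' B] c1 ih] x /= gc1 gc2.
  have m1 := measurable_step x mF F0 gc1; have m2 := measurable_step x mF F0 gc2.
  case: gc1 => mk1 k10 mA gc; case: gc2 => mk2 k20 _ _.
  rewrite -ge0_integralD//.
  - by apply: eq_integral => z _; rewrite kD EFinD ge0_muleDl ?lee_fin.
  - by move=> z _; rewrite mule_ge0 ?lee_fin//; exact: path_mass_ge0.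
  - by move=> z _; rewrite mule_ge0 ?lee_fin//; exact: path_mass_ge0.
have m1 := measurable_step x mF F0 gc1; have m2 := measurable_step x mF F0 gc2.
case: gc1 => mk' k'0 mB gc1; case: gc2 => _ _ _ gc2.
rewrite -ge0_integralD//.
- apply: eq_integral => z _; rewrite ih// ge0_muleDr//; exact: path_mass_ge0.
- by move=> z _; rewrite mule_ge0 ?lee_fin//; exact: path_mass_ge0.
- by move=> z _; rewrite mule_ge0 ?lee_fin//; exact: path_mass_ge0.
Qed.

(* A closed loop may be cut open at any of its points. *)
Lemma loop_integral k c1 k2 c3 :
  good_steps ((k, setT) :: c1 ++ (k2, setT) :: c3) ->
  (\int[mu]_x path_mass (fun u => (k u x)%:E) (c1 ++ (k2, setT) :: c3) x =
   \int[mu]_w path_mass (fun u => (k2 u w)%:E) (c3 ++ (k, setT) :: c1) w)%E.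
Proof.
move=> [mk k0 _ /good_steps_cat[gc1 [mk2 k20 _ gc3]]].
have mkf x : measurable_fun setT (fun u => (k u x)%:E).
  apply/measurable_EFinP.
  apply: (measurable_comp_pair mk (f := idfun) (g := fun=> x)); first exact: measurable_id.
  exact: measurable_cst.
have mk2f x : measurable_fun setT (fun u => (k2 u x)%:E).
  apply/measurable_EFinP.
  apply: (measurable_comp_pair mk2 (f := idfun) (g := fun=> x)); first exact: measurable_id.
  exact: measurable_cst.
pose M1 (p : R * R) := path_mass (fun u => (k2 u p.1)%:E) c1 p.2.
pose M3 (p : R * R) := path_mass (fun u => (k u p.1)%:E) c3 p.2.
have mM1 : measurable_fun setT M1.
  apply: (@measurable_path_mass_param _ R (fun p => (k2 p.2 p.1)%:E) c1) => //.
    by apply/measurable_EFinP; exact: (measurable_comp_pair mk2).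
  by move=> p; rewrite lee_fin.
have mM3 : measurable_fun setT M3.
  apply: (@measurable_path_mass_param _ R (fun p => (k p.2 p.1)%:E) c3) => //.
    by apply/measurable_EFinP; exact: (measurable_comp_pair mk).
  by move=> p; rewrite lee_fin.
have M10 p : (0 <= M1 p)%E by apply: path_mass_ge0 => // u; rewrite lee_fin.
have M30 p : (0 <= M3 p)%E by apply: path_mass_ge0 => // u; rewrite lee_fin.
transitivity (\int[mu]_x \int[mu]_w (M1 (w, x) * M3 (x, w)))%E.
  apply: eq_integral => x _; rewrite -cat1s catA path_mass_cat path_mass_rcons//.
  - by apply: measurable_path_mass => // u; rewrite lee_fin.
  - by move=> w; apply: path_mass_ge0 => // u; rewrite lee_fin.
  - by apply/good_steps_cat; split.
transitivity (\int[mu]_w \int[mu]_x (M1 (w, x) * M3 (x, w)))%E.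
  apply: (tonelli_set mu mu measurableT measurableT (g := fun p => M1 (p.2, p.1) * M3 p)%E) => //.
  - by apply: emeasurable_funM => //; exact: (measurable_comp_pair mM1).
  - by move=> p; rewrite mule_ge0.
apply: eq_integral => w _; rewrite -cat1s catA path_mass_cat path_mass_rcons//.
- by apply: eq_integral => x _; rewrite muleC.
- by apply: measurable_path_mass => // u; rewrite lee_fin.
- by move=> x; apply: path_mass_ge0 => // u; rewrite lee_fin.
- by apply/good_steps_cat; split.
Qed.
End path_mass.

(** * Three-dimensional Bessel kernels *)

Section bessel_kernel.
Context {R : realType}.
Implicit Types a s t x y z u : R.
Local Notation mu := (@lebesgue_measure R).

Lemma cvg_bm_kernel (t_ x_ y_ : R^nat) t x y : 0 < t -> (forall n, 0 < t_ n) ->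
  t_ @ \oo --> t -> x_ @ \oo --> x -> y_ @ \oo --> y ->
  (fun n => bm_kernel (t_ n) (x_ n) (y_ n)) @ \oo --> bm_kernel t x y.
Proof.
move=> t0 tn0 ct cx cy; rewrite bm_kernelE//.
under eq_fun do rewrite bm_kernelE//.
apply: cvgM.
  apply: cvgV; first by rewrite gt_eqF// sqrtr_gt0 !mulr_gt0// pi_gt0.
  apply: (cvg_comp _ Num.sqrt); last exact: sqrt_continuous.
  by apply: cvgM => //; exact: cvg_cst.
apply: (cvg_comp _ expR); last exact: continuous_expR.
apply: cvgN; apply: cvgM.
  rewrite expr2; under eq_fun do rewrite expr2.
  by apply: cvgM; apply: cvgB.
apply: cvgV; first by rewrite gt_eqF// mulr_gt0.
by apply: cvgM => //; exact: cvg_cst.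
Qed.

(** The value of the Bessel kernel where [x * y = 0]; elsewhere the kernel is this factor times
    [sinh u / u] with [u = x * y / t]. *)
Definition bes3_front t x y : R :=
  Num.sqrt (2 / (pi * t ^+ 3)) * expR (- (x ^+ 2 + y ^+ 2) / (2 * t)).

Lemma bes3_frontE t x y : 0 < t ->
  bes3_front t x y * expR (x * y / t) = 2 / t * bm_kernel t x y.
Proof.
move=> t0; have pi0 := pi_gt0 R; rewrite bm_kernelE// /bes3_front -[LHS]mulrA -expRD [RHS]mulrA.
congr (_ * expR _); last by field; rewrite gt_eqF.
rewrite -[2 / t in RHS]ger0_norm ?divr_ge0 ?(ltW t0)// -sqrtr_sqr.
rewrite -sqrtrV ?mulr_ge0 ?(ltW pi0) ?(ltW t0)// -sqrtrM ?sqr_ge0//.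
by move: (pi : R) pi0 => c c0; congr Num.sqrt; field; rewrite !gt_eqF.
Qed.

Lemma bes3_front_gt0 t x y : 0 < t -> 0 < bes3_front t x y.
Proof.
move=> t0; rewrite mulr_gt0 ?expR_gt0// sqrtr_gt0 divr_gt0// mulr_gt0 ?pi_gt0//.
exact: exprn_gt0.
Qed.

Lemma bes3_kernel0 t x y : x * y = 0 -> bes3_kernel t x y = bes3_front t x y.
Proof. by move=> xy0; rewrite /bes3_kernel xy0 eqxx. Qed.

Lemma bes3_kernelE t x y : 0 < t -> x * y != 0 ->
  bes3_kernel t x y =
  bes3_front t x y * ((expR (x * y / t) - expR (- (x * y / t))) / (2 * (x * y / t))).
Proof.
move=> t0 xy; rewrite /bes3_kernel (negbTE xy).
have -> : bm_kernel t x y = t / 2 * (bes3_front t x y * expR (x * y / t)).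
  by rewrite bes3_frontE//; field; rewrite gt_eqF.
have -> : bm_kernel t x (- y) = t / 2 * (bes3_front t x y * expR (- (x * y / t))).
  have := bes3_frontE x (- y) t0; rewrite {1}/bes3_front sqrrN -/(bes3_front t x y).
  by rewrite mulrN mulNr => ->; field; rewrite gt_eqF.
move: xy; rewrite mulf_eq0 negb_or => /andP[x0 y0].
by field; rewrite x0 y0 gt_eqF.
Qed.

Lemma sinh_ge u : 0 <= u -> 2 * u <= expR u - expR (- u).
Proof.
move=> u0; pose f (v : R) := expR v - expR (- v) - 2 * v.
have df (v : R) : is_derive v (1 : R) f (expR v + expR (- v) - 2).
  rewrite /f; apply: is_derive_eq.
  by rewrite /GRing.scale/=; ring.
suff : f 0 <= f u by rewrite /f oppr0 subrr mulr0 subrr subr_ge0.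
apply: (@ger0_derive1_le_cc R f 0 u) => //.
- move=> v _; rewrite derive1E (@derive_val _ _ _ _ _ _ _ (df v)).
  (* After multiplication by [exp v] the derivative becomes [(exp v - 1) ^ 2]. *)
  have e0 := expR_gt0 v; have eN : expR v * expR (- v) = 1 by rewrite expRxMexpNx_1.
  rewrite -(pmulr_rge0 _ e0) mulrBr mulrDr eN.
  by rewrite (_ : _ - _ = (expR v - 1) ^+ 2) ?sqr_ge0//; ring.
- apply: derivable_within_continuous => v _; exact: ex_derive.
- by rewrite in_itv/= lexx.
- by rewrite in_itv/= u0 lexx.
Qed.

Lemma sinh_le u : 0 <= u -> expR u - expR (- u) <= 2 * u * expR u.
Proof.
move=> u0; have := expR_ge1Dx (- (2 * u)) => h.
have -> : expR (- u) = expR u * expR (- (2 * u)) by rewrite -expRD; congr expR; ring.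
rewrite -{1}[expR u]mulr1 -mulrBr mulrC ler_pM2r ?expR_gt0//; lra.
Qed.

Lemma bes3_kernel_ge_front t x y : 0 < t -> 0 <= x -> 0 <= y ->
  bes3_front t x y <= bes3_kernel t x y.
Proof.
move=> t0 x0 y0; have [/bes3_kernel0 ->//|xy] := eqVneq (x * y) 0.
rewrite bes3_kernelE// ler_peMr ?(ltW (bes3_front_gt0 _ _ _))//.
have u0 : 0 < x * y / t by rewrite divr_gt0// lt_neqAle eq_sym xy mulr_ge0.
rewrite ler_pdivlMr; last by rewrite mulr_gt0.
by rewrite mul1r sinh_ge// ltW.
Qed.

Lemma bes3_kernel_le_bm t x y : 0 < t -> 0 <= x -> 0 <= y ->
  bes3_kernel t x y <= 2 / t * bm_kernel t x y.
Proof.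
move=> t0 x0 y0; rewrite -bes3_frontE//.
have [/[dup] xy /bes3_kernel0 ->//|xy] := eqVneq (x * y) 0.
  by rewrite xy mul0r expR0 mulr1.
rewrite bes3_kernelE// ler_pM2l ?bes3_front_gt0//.
have u0 : 0 < x * y / t by rewrite divr_gt0// lt_neqAle eq_sym xy mulr_ge0.
rewrite ler_pdivrMr; last by rewrite mulr_gt0.
by rewrite [leRHS]mulrC sinh_le// ltW.
Qed.

Lemma bes3_kernel_ge0 t x y : 0 < t -> 0 <= bes3_kernel t x y.
Proof.
move=> t0; have [xy|xy] := eqVneq (x * y) 0.
  by rewrite bes3_kernel0// ltW// bes3_front_gt0.
rewrite bes3_kernelE// mulr_ge0 ?(ltW (bes3_front_gt0 _ _ _))//.
set u := x * y / t; have u0 : u != 0 by rewrite /u mulf_neq0// invr_neq0// gt_eqF.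
(* The function [sinh u / u] is even, so a negative [u] reduces to [- u]. *)
case: (ltgtP u 0) => [un|up|]; last by move/eqP; rewrite (negbTE u0).
  have := sinh_ge (_ : 0 <= - u); rewrite opprK => /(_ _) h.
  have {}h := h (ltac:(by rewrite oppr_ge0 ltW)).
  rewrite -mulrNN -invrN mulr_ge0// ?invr_ge0; lra.
have := sinh_ge (ltW up) => h.
rewrite mulr_ge0// ?invr_ge0; lra.
Qed.

(** Doob transform of killed Brownian motion by [h x = x], multiplied out so that it also covers end
    points at [0], where both sides vanish. *)
Lemma killed_kernel_bes3 t x y : 0 < t -> 0 <= x -> 0 <= y ->
  killed_kernel 0 t x y = x * y * bes3_kernel t x y.
Proof.
move=> t0 x0 y0; rewrite killed_kernelE// mulr0 sub0r.
have [xy|xy] := eqVneq (x * y) 0.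
  rewrite xy mul0r; apply/eqP; rewrite subr_eq0 !bm_kernelE//; apply/eqP.
  suff -> : (y - x) ^+ 2 = (- y - x) ^+ 2 by [].
  have -> : (y - x) ^+ 2 = (- y - x) ^+ 2 - 4 * (x * y) by ring.
  by rewrite xy mulr0 subr0.
rewrite /bes3_kernel (negbTE xy) mulrC divfK//.
Qed.

Lemma measurable_bes3_kernel d (U : measurableType d) (t x y : U -> R) :
  measurable_fun setT t -> measurable_fun setT x -> measurable_fun setT y ->
  measurable_fun setT (fun o => bes3_kernel (t o) (x o) (y o)).
Proof.
move=> mt mx my; apply: measurable_fun_ifT.
- by apply: measurable_fun_eqr => //; exact: measurable_funM.
- apply: measurable_funM.
    apply: (measurableT_comp measurable_sqrt); apply: measurable_funM => //.
    apply: (measurableT_comp measurable_inv); apply: measurable_funM => //.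
    exact: measurable_funX.
  apply: (measurableT_comp (f := expR)) => //; apply: measurable_funM.
    by apply: measurable_funN; apply: measurable_funD; exact: measurable_funX.
  by apply: (measurableT_comp measurable_inv); apply: measurable_funM.
- apply: measurable_funM.
    apply: measurable_funB; apply: measurable_bm_kernel => //.
    exact: measurable_funN.
  by apply: (measurableT_comp measurable_inv); apply: measurable_funM.
Qed.

Lemma cvg_bes3_front (t_ x_ y_ : R^nat) t x y : 0 < t -> 
  t_ @ \oo --> t -> x_ @ \oo --> x -> y_ @ \oo --> y ->
  (fun n => bes3_front (t_ n) (x_ n) (y_ n)) @ \oo --> bes3_front t x y.
Proof.
move=> t0 ct cx cy; apply: cvgM.
  apply: (cvg_comp _ Num.sqrt); last exact: sqrt_continuous.
  apply: cvgM; first exact: cvg_cst.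
  apply: cvgV; first by rewrite gt_eqF// mulr_gt0 ?pi_gt0 ?exprn_gt0.
  apply: cvgM; first exact: cvg_cst.
  by rewrite !exprS expr0; under eq_fun do rewrite !exprS expr0; do ?apply: cvgM => //; exact: cvg_cst.
apply: (cvg_comp _ expR); last exact: continuous_expR.
apply: cvgM.
  apply: cvgN; rewrite !expr2; under eq_fun do rewrite !expr2.
  by apply: cvgD; apply: cvgM.
apply: cvgV; first by rewrite gt_eqF// mulr_gt0.
by apply: cvgM => //; exact: cvg_cst.
Qed.

(** Joint continuity up to the boundary: [1 <= sinh u / u <= exp u] squeezes the kernel between
    [bes3_front] and [2 / t] times the Gaussian kernel, and these two agree where [x * y = 0]. *)
Lemma cvg_bes3_kernel (t_ x_ y_ : R^nat) t x y : 0 < t -> (forall n, 0 < t_ n) ->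
  (forall n, 0 <= x_ n) -> (forall n, 0 <= y_ n) -> 0 <= x -> 0 <= y ->
  t_ @ \oo --> t -> x_ @ \oo --> x -> y_ @ \oo --> y ->
  (fun n => bes3_kernel (t_ n) (x_ n) (y_ n)) @ \oo --> bes3_kernel t x y.
Proof.
move=> t0 tn0 xn0 yn0 x0 y0 ct cx cy.
have [xy|xy] := eqVneq (x * y) 0.
  rewrite bes3_kernel0//.
  apply: (@squeeze_cvgr _ _ _ _ (fun n => bes3_front (t_ n) (x_ n) (y_ n))
     (fun n => 2 / t_ n * bm_kernel (t_ n) (x_ n) (y_ n))).
  - by apply: nearW => n; rewrite bes3_kernel_ge_front//= bes3_kernel_le_bm.
  - exact: cvg_bes3_front.
  - rewrite (_ : bes3_front _ _ _ = 2 / t * bm_kernel t x y); last first.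
      by rewrite -bes3_frontE// xy mul0r expR0 mulr1.
    apply: cvgM; last exact: cvg_bm_kernel.
    by apply: cvgM; [exact: cvg_cst|apply: cvgV => //; rewrite gt_eqF].
have cxy : (fun n => x_ n * y_ n) @ \oo --> x * y by exact: cvgM.
have -> : bes3_kernel t x y = (bm_kernel t x y - bm_kernel t x (- y)) / (x * y).
  by rewrite /bes3_kernel (negbTE xy).
have e : \forall n \near \oo, (bm_kernel (t_ n) (x_ n) (y_ n) - bm_kernel (t_ n) (x_ n) (- y_ n)) / (x_ n * y_ n) =
    bes3_kernel (t_ n) (x_ n) (y_ n).
  have : \forall n \near \oo, x_ n * y_ n != 0.
    by apply: (cvgr_neq0 (x * y)).
  by apply: filterS => n h; rewrite /bes3_kernel (negbTE h).
apply: cvg_trans (near_eq_cvg e) _.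
apply: cvgM; last exact: cvgV.
by apply: cvgB; apply: cvg_bm_kernel => //; exact: cvgN.
Qed.
End bessel_kernel.

Section dominated.
Context {R : realType}.
Local Notation mu := (@lebesgue_measure R).

Lemma dominated_cvg_EFin (A : set R) (f_ : nat -> R -> R) (f g : R -> R) :
  measurable A ->
  (forall n, measurable_fun setT (f_ n)) -> measurable_fun setT f -> measurable_fun setT g ->
  (forall x, A x -> f_ ^~ x @ \oo --> f x) ->
  (forall n x, A x -> `|f_ n x| <= g x) -> (\int[mu]_(x in A) (g x)%:E < +oo)%E ->
  (fun n => \int[mu]_(x in A) (f_ n x)%:E)%E @ \oo --> (\int[mu]_(x in A) (f x)%:E)%E.
Proof.
move=> mA mf_ mf mg ff fg ig.
have g0 x : A x -> 0 <= g x by move=> Ax; exact: le_trans (fg 0%N _ Ax).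
have h1 n : measurable_fun A (fun x => (f_ n x)%:E).
  by apply/measurable_EFinP; exact: measurable_funTS.
have h2 : measurable_fun A (fun x => (f x)%:E).
  by apply/measurable_EFinP; exact: measurable_funTS.
have h3 : {ae mu, forall x, A x -> (fun n => (f_ n x)%:E) @ \oo --> (f x)%:E}.
  apply: aeW => x Ax; apply: cvg_EFin; [exact: nearW|exact: ff].
have h4 : mu.-integrable A (fun x => (g x)%:E).
  apply/integrableP; split; first by apply/measurable_EFinP; exact: measurable_funTS.
  rewrite [X in (X < _)%E](_ : _ = (\int[mu]_(x in A) (g x)%:E)%E)//.
  by apply: eq_integral => x /set_mem Ax; rewrite /= ger0_norm// g0.
have h5 : {ae mu, forall x n, A x -> `|(f_ n x)%:E| <= (g x)%:E}%E.
  by apply: aeW => x n Ax; rewrite /= lee_fin fg.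
by have [] := @dominated_convergence _ (measurableTypeR R) R mu A mA _ _ _ h1 h2 h3 h4 h5.
Qed.
End dominated.

(** * Chapman-Kolmogorov for the Bessel kernels *)

Section bessel_semigroup.
Context {R : realType}.
Implicit Types s t x y z l : R.
Local Notation mu := (@lebesgue_measure R).

Lemma bes3_weight_ge0 z : 0 <= bes3_weight z.
Proof. by rewrite /bes3_weight; case: ifP => // _; rewrite sqr_ge0. Qed.

Lemma measurable_bes3_weight : measurable_fun setT (@bes3_weight R).
Proof.
by apply: measurable_fun_ifT => //; exact: measurable_fun_ltr.
Qed.

Lemma sqr_le_expR z : 0 <= z -> z ^+ 2 <= 2 * expR z.
Proof.
move=> z0; have := expR_ge1Dxn 1 z0; rewrite factE/= => h.
have : z ^+ 2 / 2 <= expR z by apply: le_trans h; rewrite lerDr.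
by rewrite ler_pdivrMr// mulrC.
Qed.

(** The factor [z ^ 2] is at most [2 exp z], and an exponential weight moves a Gaussian of variance
    [t] by [t]. The bound is uniform in the end point [y'], as a dominating function has to be. *)
Lemma bm_kernel_moment t y y' z : 0 < t -> 0 <= y' <= y + 1 -> 0 <= z ->
  z ^+ 2 * bm_kernel t z y' <=
  2 * expR ((y + 1 + t) ^+ 2 / (2 * t)) * bm_kernel t z (y + 1 + t).
Proof.
move=> t0 /andP[y'0 y'y] z0.
have c0 : 0 <= (Num.sqrt (2 * pi * t))^-1 by rewrite invr_ge0 sqrtr_ge0.
rewrite !bm_kernelE// mulrCA [leRHS]mulrCA ler_wpM2l// -[leRHS]mulrA -expRD.
apply: (@le_trans _ _ (2 * expR z * expR (- ((y' - z) ^+ 2 / (2 * t))))).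
  by rewrite ler_wpM2r ?expR_ge0// sqr_le_expR.
rewrite -mulrA -expRD ler_pM2l// ler_expR.
have h1 : 0 <= z * (y + 1 - y') by rewrite mulr_ge0// subr_ge0.
have h2 : 0 <= y' ^+ 2 by rewrite sqr_ge0.
rewrite -subr_ge0 (_ : _ - _ = (y' ^+ 2 + 2 * (z * (y + 1 - y'))) / (2 * t)).
  by rewrite divr_ge0 ?mulr_ge0 ?(ltW t0)// addr_ge0// mulr_ge0.
by field; rewrite gt_eqF.
Qed.

(** For positive [x] and [y] it is the identity for killed motion divided by [x * y], the weight
    [z ^ 2] collecting the two factors [z]. The boundary values, which are those of the excursion,
    follow by moving both ends by [e n] and dominated convergence. *)
Lemma bes3_chapman_kolmogorov s t x y : 0 < s -> 0 < t -> 0 <= x -> 0 <= y ->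
  (\int[mu]_z (bes3_kernel s x z * bes3_weight z * bes3_kernel t z y)%:E =
   (bes3_kernel (s + t) x y)%:E)%E.
Proof.
move=> s0 t0 x0 y0; have st0 : 0 < s + t by rewrite addr_gt0.
pose F x y z : R := bes3_kernel s x z * bes3_weight z * bes3_kernel t z y.
have mF x' y' : measurable_fun setT (F x' y').
  by apply: measurable_funM; [apply: measurable_funM => //; [exact: measurable_bes3_kernel|exact: measurable_bes3_weight]|exact: measurable_bes3_kernel].
have F0 x' y' z : 0 <= F x' y' z.
  by rewrite !mulr_ge0 ?bes3_kernel_ge0 ?bes3_weight_ge0.
have pos x' y' : 0 < x' -> 0 < y' ->
    (\int[mu]_z (F x' y' z)%:E = (bes3_kernel (s + t) x' y')%:E)%E.
  move=> x'0 y'0; have xy0 : 0 < x' * y' by rewrite mulr_gt0.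
  have := @killed_chapman_kolmogorov R 0 s t x' y' s0 t0.
  rewrite (killed_kernel_bes3 st0 (ltW x'0) (ltW y'0)).
  have -> : (\int[mu]_z (killed_kernel 0 s x' z * killed_kernel 0 t z y')%:E =
    \int[mu]_z ((x' * y')%:E * (F x' y' z)%:E))%E.
    apply: eq_integral => z _; rewrite -EFinM; congr EFin; rewrite /F.
    have [z0|z0] := ltP z 0.
      by rewrite killed_kernel0r// mul0r /bes3_weight ltNge (ltW z0)/= mulr0 mul0r mulr0.
    rewrite (killed_kernel_bes3 s0 (ltW x'0) z0) (killed_kernel_bes3 t0 z0 (ltW y'0)).
    rewrite /bes3_weight; case: ltgtP z0 => // [z0 _|<- _]; ring.
  rewrite ge0_integralZl_EFin//; last 3 first.
  - by move=> z _; rewrite lee_fin.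
  - by apply/measurable_EFinP; exact: mF.
  - exact: ltW.
  have : (0 <= \int[mu]_z (F x' y' z)%:E)%E by apply: integral_ge0 => z _; rewrite lee_fin.
  case: (\int[mu]_z (F x' y' z)%:E)%E => [r| |] // r0.
    by rewrite -!EFinM => -[/mulfI ->//]; rewrite gt_eqF.
  by rewrite mulry gtr0_sg// mul1e.
pose e n : R := n.+1%:R^-1.
have e0 n : 0 < e n by rewrite invr_gt0.
have e1 n : e n <= 1 by rewrite invf_le1// ler1n.
have ce : e @ \oo --> 0 by exact: cvg_harmonic.
have cx u : (fun n => u + e n) @ \oo --> u.
  by rewrite -[X in _ --> X]addr0; apply: cvgD => //; exact: cvg_cst.
have cF : (fun n => \int[mu]_z (F (x + e n) (y + e n) z)%:E)%E @ \oo --> (\int[mu]_z (F x y z)%:E)%E.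
  pose K1 : R := 2 / s * (Num.sqrt (2 * pi * s))^-1.
  pose K2 : R := 2 / t * (2 * expR ((y + 1 + t) ^+ 2 / (2 * t))).
  pose K := K1 * K2.
  have K0 : 0 <= K by rewrite /K /K1 /K2 !mulr_ge0 ?invr_ge0 ?sqrtr_ge0 ?expR_ge0 ?(ltW s0) ?(ltW t0).
  apply: (@dominated_cvg_EFin _ _ _ _ (fun z => K * bm_kernel t z (y + 1 + t))) => //.
  - by apply: measurable_funM => //; exact: measurable_bm_kernel.
  - move=> z _; rewrite /F.
    have [z0|z0] := leP z 0.
      rewrite /bes3_weight ltNge z0/= mulr0 mul0r; under eq_fun do rewrite mulr0 mul0r.
      exact: cvg_cst.
    have xe n : 0 <= x + e n by rewrite addr_ge0// ltW.
    have ye n : 0 <= y + e n by rewrite addr_ge0// ltW.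
    apply: cvgM; first apply: cvgM; try exact: cvg_cst.
    + by apply: cvg_bes3_kernel => //; try exact: cvg_cst; [exact: (fun=> ltW z0)|exact: ltW].
    + by apply: cvg_bes3_kernel => //; try exact: cvg_cst; [exact: (fun=> ltW z0)|exact: ltW].
  - move=> n z _; rewrite ger0_norm//.
    have [z0|z0] := leP z 0.
      rewrite /F /bes3_weight ltNge z0/= mulr0 mul0r mulr_ge0 ?bm_kernel_ge0//.
    rewrite /F /bes3_weight z0 /K -[leLHS]mulrA -[leRHS]mulrA.
    apply: ler_pM.
    + exact: bes3_kernel_ge0.
    + by rewrite mulr_ge0 ?sqr_ge0 ?bes3_kernel_ge0.
    + apply: le_trans (bes3_kernel_le_bm _ _ _) _; rewrite ?(ltW z0) ?addr_ge0 ?(ltW (e0 _))//.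
      by rewrite ler_wpM2l ?bm_kernel_ub// divr_ge0// ltW.
    + apply: (@le_trans _ _ (z ^+ 2 * (2 / t * bm_kernel t z (y + e n)))).
        by rewrite ler_wpM2l ?sqr_ge0// bes3_kernel_le_bm ?(ltW z0) ?addr_ge0 ?(ltW (e0 _)).
      rewrite /K2 [leLHS]mulrCA -[leRHS]mulrA ler_wpM2l//; first by rewrite divr_ge0// ltW.
      rewrite bm_kernel_moment ?(ltW z0)//.
      by rewrite addr_ge0 ?(ltW (e0 _))//= lerD2l.
  - under eq_integral do rewrite EFinM.
    rewrite ge0_integralZl_EFin//.
    + under eq_integral do rewrite bm_kernelC//.
      by rewrite integral_bm_kernel mule1 ltry.
    + by move=> z _; rewrite lee_fin bm_kernel_ge0.
    + by apply/measurable_EFinP; exact: measurable_bm_kernel.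
apply/esym/(cvg_unique _ _ cF) => //=.
under eq_fun do rewrite pos ?ltr_wpDl//.
apply: cvg_EFin; first exact: nearW.
apply: cvg_bes3_kernel => //; try exact: cvg_cst.
- by move=> n; rewrite addr_ge0// ltW.
- by move=> n; rewrite addr_ge0// ltW.
Qed.

(* Steps of the bridge of [bridge_mass], the last one excepted. *)
Fixpoint bridge_steps (w : R -> R) (k : R -> R -> R -> R) s (c : seq (R * set R)) : seq (@step R) :=
  if c is (t, A) :: c' then
    (fun x z => k (t - s) x z * w z, A) :: bridge_steps w k t c'
  else [::].

Lemma bridge_massE w k l y s x c : bridge_mass w k l y s x c =
  path_mass (fun z => (k (l - last s (map fst c)) z y)%:E) (bridge_steps w k s c) x.
Proof.
elim: c s x => //= -[t A] c ih s x /=.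
by apply: eq_integral => z _; rewrite ih.
Qed.

Lemma bridge_steps_cat w k s c1 c2 :
  bridge_steps w k s (c1 ++ c2) =
  bridge_steps w k s c1 ++ bridge_steps w k (last s (map fst c1)) c2.
Proof. by elim: c1 s => //= -[t A] c1 ih s /=; rewrite ih. Qed.

Lemma good_bes3_steps s c : path <%R s (map fst c) ->
  (forall i, measurable (nth (0, set0) c i).2) ->
  good_steps (bridge_steps bes3_weight bes3_kernel s c).
Proof.
elim: c s => //= -[t A] c ih s /= /andP[st pc] mc; split.
- apply: measurable_funM; first by apply: measurable_bes3_kernel.
  exact: (measurableT_comp measurable_bes3_weight).
- by move=> x y; rewrite mulr_ge0 ?bes3_weight_ge0// bes3_kernel_ge0// subr_gt0.
- exact: (mc 0%N).
- by apply: ih => // i; exact: (mc i.+1).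
Qed.
End bessel_semigroup.

(** * Brownian bridges above barriers *)

Section killed_mass.
Context {R : realType}.
Implicit Types (a s t x y z l h e : R) (c : seq (R * set R * R)).
Local Notation mu := (@lebesgue_measure R).
Local Notation bm_mass := (bridge_mass (fun=> 1) (@bm_kernel R)).

Lemma measurable_bm_mass l y s (c : seq (R * set R)) : (forall i, measurable (nth (0, set0) c i).2) ->
  measurable_fun setT (fun x => bm_mass l y s x c).
Proof.
move=> mc; under eq_fun do rewrite bridge_massE.
apply: measurable_path_mass.
- by apply/measurable_EFinP; exact: measurable_bm_kernel.
- by move=> x; rewrite lee_fin bm_kernel_ge0.
- elim: c s mc => //= -[t A] c ih s mc; split.
  + by apply: measurable_funM => //; exact: measurable_bm_kernel.
  + by move=> *; rewrite mulr1 bm_kernel_ge0.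
  + exact: (mc 0%N).
  + by apply: ih => i; exact: (mc i.+1).
Qed.

Lemma bm_mass_ge0 l y s x (c : seq (R * set R)) : (0 <= bm_mass l y s x c)%E.
Proof.
elim: c s x => /= [|[t A] c ih] s x; first by rewrite lee_fin bm_kernel_ge0.
by apply: integral_ge0 => z _; rewrite mule_ge0// lee_fin mulr1 bm_kernel_ge0.
Qed.

(* An item [(t, A, a')] asks the path to be in [A] at time [t] and to stay above [a']
   until the time of the next item. *)
Fixpoint killed_mass l y a s x c : \bar R :=
  if c is (t, A, a') :: c' then
    (\int[mu]_(z in A) ((killed_kernel a (t - s) x z)%:E * killed_mass l y a' t z c'))%E
  else (killed_kernel a (l - s) x y)%:E.

Fixpoint killed_steps a s c : seq (@step R) :=
  if c is (t, A, a') :: c' then (killed_kernel a (t - s), A) :: killed_steps a' t c'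
  else [::].

Lemma killed_massE l y a s x c : killed_mass l y a s x c =
  path_mass (fun z => (killed_kernel (last a (map snd c))
                         (l - last s (map (fun p => p.1.1) c)) z y)%:E)
    (killed_steps a s c) x.
Proof.
elim: c a s x => //= -[[t A] a'] c ih a s x /=.
by apply: eq_integral => z _; rewrite ih.
Qed.

Fixpoint barrier_list s l c : Prop :=
  if c is (t, A, a) :: c' then [/\ s < t, measurable A & barrier_list t l c'] else s < l.

Lemma barrier_list_lt s l c : barrier_list s l c -> s < l.
Proof. by elim: c s => //= -[[t A] a] c ih s [st _ /ih]; exact: lt_trans. Qed.

Lemma good_killed_steps a s l c : barrier_list s l c -> good_steps (killed_steps a s c).
Proof.
elim: c a s => //= -[[t A] a'] c ih a s [st mA bl]; split => //.
- by apply: measurable_killed_kernel.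
- by move=> x y; rewrite killed_kernel_ge0// subr_gt0.
- exact: ih bl.
Qed.

Lemma barrier_list_last s l c : barrier_list s l c -> last s (map (fun p => p.1.1) c) < l.
Proof. by elim: c s => //= -[[t A] a'] c ih s [_ _ /ih]. Qed.

Lemma killed_mass_ge0 l y a s x c : barrier_list s l c -> (0 <= killed_mass l y a s x c)%E.
Proof.
move=> bl; rewrite killed_massE; apply: path_mass_ge0.
  by move=> z; rewrite lee_fin killed_kernel_ge0// subr_gt0; exact: barrier_list_last.
exact: good_killed_steps bl.
Qed.

Lemma measurable_killed_mass l y a s c : barrier_list s l c ->
  measurable_fun setT (fun x => killed_mass l y a s x c).
Proof.
move=> bl; under eq_fun do rewrite killed_massE.
apply: measurable_path_mass.
- by apply/measurable_EFinP; exact: measurable_killed_kernel.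
- by move=> z; rewrite lee_fin killed_kernel_ge0// subr_gt0; exact: barrier_list_last.
- exact: good_killed_steps bl.
Qed.

Lemma killed_mass0l l y a s x c : x < a -> killed_mass l y a s x c = 0%E.
Proof.
move=> xa; case: c => [|[[t A] a'] c] /=; first by rewrite killed_kernel0l.
by rewrite integral0_eq// => z _; rewrite killed_kernel0l// mul0e.
Qed.

(** Interior points only: the end [s + h * j.+1] is left to the next item. *)
Fixpoint grid (j : nat) s h : seq R :=
  if j is j'.+1 then s + h :: grid j' (s + h) h else [::].

Definition above a : set R := [set z | a <= z].

Lemma measurable_above a : measurable (above a).
Proof.
rewrite (_ : above a = `[a, +oo[%classic)//.
by apply/seteqP; split => z; rewrite /above/= in_itv/= andbT.
Qed.

Local Notation grid_list a j s h := (map (fun u => (u, above a)) (grid j s h)).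

Lemma measurable_grid_list a j s h (c : seq (R * set R)) :
  (forall i, measurable (nth (0, set0) c i).2) ->
  forall i, measurable (nth (0, set0) (grid_list a j s h ++ c) i).2.
Proof.
move=> mc; elim: j s => //= j ih s [|i] /=; first exact: measurable_above.
exact: ih.
Qed.

(** [Psi] stands for what comes after the grid: the final kernel, or the integral over the next
    item. The induction uses its semigroup relation [ck], and each step releases the constraint
    between two grid times. *)
Lemma grid_mass_lower l y a h j s x (Psi : R -> R -> \bar R) rest : 0 < h ->
  (forall i, measurable (nth (0, set0) rest i).2) ->
  (forall t z, 0 < t -> (0 <= Psi t z)%E) -> (forall t, 0 < t -> measurable_fun setT (Psi t)) ->
  (forall t1 t2 z, 0 < t1 -> 0 < t2 ->
     Psi (t1 + t2)%R z = (\int[mu]_z' ((killed_kernel a t1 z z')%:E * Psi t2 z'))%E) ->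
  (forall z, Psi h z <= bm_mass l y (s + h * j%:R)%R z rest)%E ->
  (Psi (h * j.+1%:R)%R x <= bm_mass l y s x (grid_list a j s h ++ rest))%E.
Proof.
move=> h0 mrest Psi0 mPsi ck; elim: j s x => [|j ih] s x hr /=.
  by have := hr x; rewrite mulr0 addr0 mulr1.
have {}ih z : (Psi (h * j.+1%:R)%R z <= bm_mass l y (s + h)%R z (grid_list a j (s + h)%R h ++ rest))%E.
  apply: ih => z'; apply: le_trans (hr z') _.
  by rewrite (_ : s + h * j.+1%:R = s + h + h * j%:R)// -natr1; ring.
have hj0 : 0 < h * j.+1%:R by rewrite mulr_gt0.
rewrite (_ : h * j.+2%:R = h + h * j.+1%:R); last by rewrite -[j.+2%:R]natr1; ring.
rewrite ck// (_ : s + h - s = h); last by ring.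
rewrite [leRHS]integral_mkcond; apply: ge0_le_integral => //.
- by move=> z _; rewrite mule_ge0 ?lee_fin ?killed_kernel_ge0 ?Psi0.
- apply: emeasurable_funM; last exact: mPsi.
  by apply/measurable_EFinP; exact: measurable_killed_kernel.
- apply: measurable_patch0; first exact: measurable_above.
  apply: emeasurable_funM; last by apply: measurable_bm_mass; exact: measurable_grid_list.
  by apply/measurable_EFinP; apply: measurable_funM => //; exact: measurable_bm_kernel.
- move=> z _; rewrite patchE; case: ifPn => [/set_mem az|/negP az].
    apply: lee_pmul => //; rewrite ?lee_fin ?killed_kernel_ge0 ?Psi0//.
    by rewrite mulr1 killed_kernel_le.
  rewrite killed_kernel0r ?mul0e// ltNge; apply/negP => az'.
  by apply: az; apply/mem_set.
Qed.

(** Converse of [grid_mass_lower]: a barrier lowered from [a] to [b] leaves room between grid times,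
    at the price of a factor [d] per cell. The exponent [e] counts the factors spent on the last
    cell and on [rest]. *)
Lemma grid_mass_upper l y a b h d (e j : nat) s x (Psi : R -> R -> \bar R) rest : 0 < h -> 0 <= d ->
  (forall i, measurable (nth (0, set0) rest i).2) ->
  (forall t z, 0 < t -> (0 <= Psi t z)%E) -> (forall t, 0 < t -> measurable_fun setT (Psi t)) ->
  (forall t1 t2 z, 0 < t1 -> 0 < t2 ->
     Psi (t1 + t2)%R z = (\int[mu]_z' ((killed_kernel b t1 z z')%:E * Psi t2 z'))%E) ->
  (forall z z', a <= z -> a <= z' -> d * bm_kernel h z z' <= killed_kernel b h z z') ->
  (forall z, (a <= z)%R -> (d ^+ e)%R%:E * bm_mass l y (s + h * j%:R)%R z rest <= Psi h z)%E ->
  a <= x ->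
  ((d ^+ (e + j))%R%:E * bm_mass l y s x (grid_list a j s h ++ rest) <= Psi (h * j.+1%:R)%R x)%E.
Proof.
move=> h0 d0 mrest Psi0 mPsi ck dq; elim: j s x => [|j ih] s x hr ax /=.
  by have := hr x ax; rewrite mulr0 addr0 mulr1 addn0.
have {}ih z : (a <= z)%R -> ((d ^+ (e + j))%R%:E * bm_mass l y (s + h)%R z (grid_list a j (s + h)%R h ++ rest) <= Psi (h * j.+1%:R)%R z)%E.
  apply: ih => z' az'; apply: le_trans (hr z' az').
  by rewrite (_ : s + h * j.+1%:R = s + h + h * j%:R)// -natr1; ring.
have hj0 : 0 < h * j.+1%:R by rewrite mulr_gt0.
rewrite (_ : h * j.+2%:R = h + h * j.+1%:R); last by rewrite -[j.+2%:R]natr1; ring.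
rewrite ck// (_ : s + h - s = h); last by ring.
have mk z : measurable_fun setT (fun z' => (bm_kernel h z z' * 1)%:E).
  by apply/measurable_EFinP; apply: measurable_funM => //; exact: measurable_bm_kernel.
have mM : measurable_fun setT (fun z => bm_mass l y (s + h)%R z (grid_list a j (s + h)%R h ++ rest)).
  by apply: measurable_bm_mass; exact: measurable_grid_list.
rewrite -ge0_integralZl_EFin//; last 4 first.
- exact: measurable_above.
- by move=> z _; rewrite mule_ge0 ?bm_mass_ge0// lee_fin mulr1 bm_kernel_ge0.
- by apply: measurable_funTS; apply: emeasurable_funM; [exact: mk|exact: mM].
- exact: exprn_ge0.
rewrite [leLHS]integral_mkcond; apply: ge0_le_integral => //.
- move=> z _; rewrite patchE; case: ifP => // _.
  by rewrite !mule_ge0 ?bm_mass_ge0// lee_fin ?exprn_ge0// mulr1 bm_kernel_ge0.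
- apply: measurable_patch0; first exact: measurable_above.
  by apply: measurable_funeM; apply: emeasurable_funM; [exact: mk|exact: mM].
- apply: emeasurable_funM; last exact: mPsi.
  by apply/measurable_EFinP; exact: measurable_killed_kernel.
- move=> z _; rewrite patchE; case: ifPn => [/set_mem az|_]; last first.
    by rewrite mule_ge0 ?Psi0// lee_fin killed_kernel_ge0.
  rewrite addnS exprS mulr1 EFinM muleACA -EFinM; apply: lee_pmul.
  + by rewrite lee_fin mulr_ge0 ?bm_kernel_ge0.
  + by rewrite mule_ge0 ?bm_mass_ge0// lee_fin exprn_ge0.
  + by rewrite lee_fin dq.
  + exact: ih.
Qed.

Lemma killed_integral_ck a t1 t2 z (A : set R) (M : R -> \bar R) : 0 < t1 -> 0 < t2 ->
  measurable A -> measurable_fun setT M -> (forall z, 0 <= M z)%E ->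
  (\int[mu]_(z' in A) ((killed_kernel a (t1 + t2) z z')%:E * M z') =
   \int[mu]_z' ((killed_kernel a t1 z z')%:E *
     \int[mu]_(z'' in A) ((killed_kernel a t2 z' z'')%:E * M z'')))%E.
Proof.
move=> t10 t20 mA mM M0.
have q0 t u v : 0 < t -> (0 <= (killed_kernel a t u v)%:E)%E.
  by move=> t0; rewrite lee_fin killed_kernel_ge0.
pose G (p : R * R) := ((killed_kernel a t1 z p.1)%:E * ((killed_kernel a t2 p.1 p.2)%:E * M p.2))%E.
have mG : measurable_fun setT G.
  apply: emeasurable_funM; first by apply/measurable_EFinP; exact: measurable_killed_kernel.
  apply: emeasurable_funM; first by apply/measurable_EFinP; exact: measurable_killed_kernel.
  exact: (measurableT_comp mM).
have G0 p : (0 <= G p)%E by rewrite !mule_ge0 ?q0.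
transitivity (\int[mu]_z' \int[mu]_(z'' in A) G (z', z''))%E; last first.
  apply: eq_integral => z' _; rewrite -ge0_integralZl_EFin ?killed_kernel_ge0//.
  - by move=> z'' _; rewrite mule_ge0 ?q0.
  - apply: measurable_funTS; apply: emeasurable_funM => //.
    by apply/measurable_EFinP; exact: measurable_killed_kernel.
rewrite (tonelli_set mu mu measurableT mA mG G0).
apply: eq_integral => z'' _; rewrite /G/=.
under eq_integral do rewrite muleA -EFinM.
rewrite ge0_integralZr//.
- by rewrite killed_chapman_kolmogorov.
- by apply/measurable_EFinP; apply: measurable_funM; exact: measurable_killed_kernel.
- by move=> z' _; rewrite lee_fin mulr_ge0// killed_kernel_ge0.
Qed.

Lemma measurable_killed_integral a t (A : set R) (M : R -> \bar R) : 0 < t ->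
  measurable A -> measurable_fun setT M -> (forall z, 0 <= M z)%E ->
  measurable_fun setT (fun z => \int[mu]_(z' in A) ((killed_kernel a t z z')%:E * M z'))%E.
Proof.
move=> t0 mA mM M0.
apply: (@measurable_integral_param _ _ _ A (fun p : R * R => (killed_kernel a t p.1 p.2)%:E * M p.2)%E) => //.
- apply: emeasurable_funM; first by apply/measurable_EFinP; exact: measurable_killed_kernel.
  exact: (measurableT_comp mM).
- by move=> p; rewrite mule_ge0// lee_fin killed_kernel_ge0.
Qed.

(** Finite-dimensional approximation of the constraints: each interval is cut into [j.+1] equal
    cells, and the time of an item belongs to two intervals, so both barriers are imposed there. *)
Fixpoint refine (j : nat) l a s c : seq (R * set R) :=
  if c is (t, A, a') :: c' then
    grid_list a j s ((t - s) / j.+1%:R) ++ (t, A `&` above a `&` above a') :: refine j l a' t c'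
  else grid_list a j s ((l - s) / j.+1%:R).

Lemma measurable_refine j l a s c : barrier_list s l c ->
  forall i, measurable (nth (0, set0) (refine j l a s c) i).2.
Proof.
elim: c a s => [|[[t A] a'] c ih] a s /=.
  by move=> _; rewrite -[grid_list _ _ _ _]cats0; apply: measurable_grid_list => i; rewrite nth_nil; exact: measurable0.
move=> [_ mA bl]; apply: measurable_grid_list => -[|i] /=; last exact: ih.
by apply: measurableI; [apply: measurableI => //|]; exact: measurable_above.
Qed.

Lemma path_grid (P : seq R) j s h t : 0 < h -> s + h * j.+1%:R = t -> path <%R t P ->
  path <%R s (grid j s h ++ t :: P).
Proof.
move=> h0; elim: j s => [|j ih] s st pP /=.
  by rewrite pP andbT -st mulr1 ltrDl.
rewrite ltrDl h0/=; apply: ih => //.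
by rewrite -st -[j.+2%:R]natr1; ring.
Qed.

Lemma path_refine j l a s c : barrier_list s l c ->
  path <%R s (rcons (map fst (refine j l a s c)) l).
Proof.
have hj t u : u + (t - u) / j.+1%:R * j.+1%:R = t :> R.
  by rewrite divfK ?pnatr_eq0//; ring.
elim: c a s => [|[[t A] a'] c ih] a s /=.
  move=> sl; rewrite -map_comp map_id_in// -cats1; apply: (path_grid (P := [::])) => //.
  by rewrite divr_gt0// subr_gt0.
move=> [st mA bl]; rewrite map_cat/= -map_comp map_id_in// rcons_cat/=.
by apply: path_grid => //; [rewrite divr_gt0// subr_gt0|exact: ih].
Qed.

Lemma refine_lower j l y a s x c : barrier_list s l c ->
  (killed_mass l y a s x c <= bm_mass l y s x (refine j l a s c))%E.
Proof.
have j0 : 0 < j.+1%:R :> R by rewrite ltr0n.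
have hj t u : (t - u) / j.+1%:R * j.+1%:R = t - u :> R by rewrite divfK ?gt_eqF.
have hj' t u : t - (u + (t - u) / j.+1%:R * j%:R) = (t - u) / j.+1%:R.
  have := hj t u; rewrite -[X in _ / X * X]natr1 => h.
  by rewrite opprD addrA -{1}h -natr1; ring.
elim: c a s x => [|[[t A] a'] c ih] a s x /=.
  move=> sl; have h0 : 0 < (l - s) / j.+1%:R by rewrite divr_gt0// subr_gt0.
  have := @grid_mass_lower l y a _ j s x (fun t z => (killed_kernel a t z y)%:E) [::] h0.
  rewrite cats0 hj; apply.
  - by move=> i; rewrite nth_nil; exact: measurable0.
  - by move=> t z t0; rewrite lee_fin killed_kernel_ge0.
  - by move=> t t0; apply/measurable_EFinP; exact: measurable_killed_kernel.
  - by move=> t1 t2 z t10 t20; rewrite -killed_chapman_kolmogorov.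
  - by move=> z /=; rewrite hj' lee_fin killed_kernel_le.
move=> [st mA bl]; have h0 : 0 < (t - s) / j.+1%:R by rewrite divr_gt0// subr_gt0.
pose M z := killed_mass l y a' t z c.
have mM : measurable_fun setT M by exact: measurable_killed_mass.
have M0 z : (0 <= M z)%E by exact: killed_mass_ge0.
set rest := (t, _) :: _.
have mrest : forall i, measurable (nth (0, set0) rest i).2.
  move=> [|i] /=; last exact: measurable_refine.
  by apply: measurableI; [apply: measurableI => //|]; exact: measurable_above.
have := @grid_mass_lower l y a _ j s x (fun t z => \int[mu]_(z' in A) ((killed_kernel a t z z')%:E * M z'))%E rest h0 mrest.
rewrite hj; apply.
- by move=> u z u0; apply: integral_ge0 => z' _; rewrite mule_ge0// lee_fin killed_kernel_ge0.
- by move=> u u0; exact: measurable_killed_integral.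
- by move=> t1 t2 z t10 t20; exact: killed_integral_ck.
- move=> z /=; rewrite hj' integral_mkcond [leRHS]integral_mkcond.
  have mrefine := measurable_refine j a' bl.
  apply: ge0_le_integral => //.
  + move=> z' _; rewrite patchE; case: ifP => // _.
    by rewrite mule_ge0// lee_fin killed_kernel_ge0.
  + apply: measurable_patch0 => //; apply: emeasurable_funM => //.
    by apply/measurable_EFinP; exact: measurable_killed_kernel.
  + apply: measurable_patch0; first exact: (mrest 0%N).
    apply: emeasurable_funM; last exact: measurable_bm_mass.
    by apply/measurable_EFinP; apply: measurable_funM => //; exact: measurable_bm_kernel.
  + move=> z' _; rewrite patchE; case: ifPn => [/set_mem Az'|_]; last first.
      by rewrite patchE; case: ifP => // _; rewrite mule_ge0 ?bm_mass_ge0// lee_fin mulr1 bm_kernel_ge0.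
    rewrite patchE; case: ifPn => [_|].
      apply: lee_pmul => //; rewrite ?lee_fin ?killed_kernel_ge0 ?mulr1 ?killed_kernel_le//.
      exact: ih.
    move=> /negP nz.
    have [az'|z'a] := leP a z'; last by rewrite killed_kernel0r ?mul0e.
    have [a'z'|z'a'] := leP a' z'; last by rewrite /M killed_mass0l ?mule0.
    by exfalso; apply: nz; apply/mem_set.
Qed.

Definition lower_levels e c := [seq (p.1, p.2 - e) | p <- c].

Lemma lower_levels_list s l e c : barrier_list s l (lower_levels e c) <-> barrier_list s l c.
Proof.
elim: c s => //= -[[t A] a] c ih s /=.
by split => -[? ? /ih].
Qed.

(** There are [(size c).+1 * j.+1] cells, each of length at most [1 / j.+1] because the total length
    is at most [1]; [bm_le_killed_kernel] then gives a common factor. The exponential decay of its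
    defect beats the number of cells. *)
Lemma refine_upper j l y a s x c e : barrier_list s l c -> 0 < e -> l - s <= 1 ->
  a <= x -> last a (map snd c) <= y ->
  (((1 - expR (- (2 * e ^+ 2 * j.+1%:R))) ^+ ((size c).+1 * j.+1))%:E *
     bm_mass l y s x (refine j l a s c) <=
   killed_mass l y (a - e)%R s x (lower_levels e c))%E.
Proof.
move=> + e0; have j0 : 0 < j.+1%:R :> R by rewrite ltr0n.
have hj t u : (t - u) / j.+1%:R * j.+1%:R = t - u :> R by rewrite divfK ?gt_eqF.
have hj' t u : t - (u + (t - u) / j.+1%:R * j%:R) = (t - u) / j.+1%:R.
  have := hj t u; rewrite -[X in _ / X * X]natr1 => h.
  by rewrite opprD addrA -{1}h -natr1; ring.
set d := 1 - _; have d0 : 0 <= d.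
  rewrite subr_ge0 -[leRHS]expR0 ler_expR oppr_le0 mulr_ge0//.
  by rewrite mulr_ge0 ?sqr_ge0.
have dq b h z z' : 0 < h -> h <= j.+1%:R^-1 -> b <= z -> b <= z' ->
    d * bm_kernel h z z' <= killed_kernel (b - e) h z z'.
  move=> h0 hj1 bz bz'.
  have e1 : 0 < 1 - expR (- (2 * e ^+ 2 / h)).
    by rewrite subr_gt0 -[ltRHS]expR0 ltr_expR oppr_lt0 divr_gt0// mulr_gt0// exprn_gt0.
  have := bm_le_killed_kernel h0 e0 bz bz'; rewrite mulrC ler_pdivlMr// mulrC.
  apply: le_trans; rewrite ler_wpM2r ?bm_kernel_ge0//.
  rewrite lerD2l lerN2 ler_expR lerN2 ler_pM2l ?mulr_gt0 ?exprn_gt0//.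
  by rewrite -[leLHS]invrK lef_pV2 ?posrE ?invr_gt0.
elim: c a s x => [|[[t A] a'] c ih] a s x.
  move=> /= sl ls ax ay; have h0 : 0 < (l - s) / j.+1%:R by rewrite divr_gt0// subr_gt0.
  have h1 : (l - s) / j.+1%:R <= j.+1%:R^-1 by rewrite ler_piMl ?invr_ge0.
  have := @grid_mass_upper l y a (a - e) _ d 1%N j s x (fun t z => (killed_kernel (a - e) t z y)%:E) [::] h0 d0.
  rewrite cats0 hj mul1n add1n; apply => //.
  - by move=> i; rewrite nth_nil; exact: measurable0.
  - by move=> t z t0; rewrite lee_fin killed_kernel_ge0.
  - by move=> t t0; apply/measurable_EFinP; exact: measurable_killed_kernel.
  - by move=> t1 t2 z t10 t20; rewrite -killed_chapman_kolmogorov.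
  - by move=> z z' az az'; exact: dq.
  - by move=> z az /=; rewrite hj' -EFinM lee_fin dq.
move=> /= [st mA bl] ls ax ay; have h0 : 0 < (t - s) / j.+1%:R by rewrite divr_gt0// subr_gt0.
have tl := barrier_list_lt bl.
have h1 : (t - s) / j.+1%:R <= j.+1%:R^-1.
  by rewrite ler_piMl ?invr_ge0// (le_trans _ ls)// lerD2r ltW.
have bl' : barrier_list t l (lower_levels e c) by apply/lower_levels_list.
pose M z := killed_mass l y (a' - e) t z (lower_levels e c).
have mM : measurable_fun setT M by exact: measurable_killed_mass.
have M0 z : (0 <= M z)%E by exact: killed_mass_ge0.
set rest := (t, _) :: _.
have mrest : forall i, measurable (nth (0, set0) rest i).2.
  move=> [|i] /=; last exact: measurable_refine.
  by apply: measurableI; [apply: measurableI => //|]; exact: measurable_above.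
have := @grid_mass_upper l y a (a - e) _ d ((size c).+1 * j.+1).+1 j s x
  (fun t z => \int[mu]_(z' in A) ((killed_kernel (a - e)%R t z z')%:E * M z'))%E rest h0 d0 mrest.
rewrite hj (_ : (_ + j = (size c).+2 * j.+1)%N); last by rewrite addSnnS [in RHS]mulSn addnC.
apply => //.
- by move=> u z u0; apply: integral_ge0 => z' _; rewrite mule_ge0// lee_fin killed_kernel_ge0.
- by move=> u u0; exact: measurable_killed_integral.
- by move=> t1 t2 z t10 t20; exact: killed_integral_ck.
- by move=> z z' az az'; exact: dq.
- move=> z az /=; rewrite hj'.
  have mrefine := measurable_refine j a' bl.
  rewrite -ge0_integralZl_EFin//; last 4 first.
  + exact: (mrest 0%N).
  + by move=> z' _; rewrite mule_ge0 ?bm_mass_ge0// lee_fin mulr1 bm_kernel_ge0.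
  + apply: measurable_funTS; apply: emeasurable_funM; last exact: measurable_bm_mass.
    by apply/measurable_EFinP; apply: measurable_funM => //; exact: measurable_bm_kernel.
  + exact: exprn_ge0.
  rewrite integral_mkcond [leRHS]integral_mkcond.
  apply: ge0_le_integral => //.
  + move=> z' _; rewrite patchE; case: ifP => // _.
    by rewrite !mule_ge0 ?bm_mass_ge0// lee_fin ?exprn_ge0// mulr1 bm_kernel_ge0.
  + apply: measurable_patch0; first exact: (mrest 0%N).
    apply: measurable_funeM; apply: emeasurable_funM; last exact: measurable_bm_mass.
    by apply/measurable_EFinP; apply: measurable_funM => //; exact: measurable_bm_kernel.
  + apply: measurable_patch0 => //; apply: emeasurable_funM => //.
    by apply/measurable_EFinP; exact: measurable_killed_kernel.
  + move=> z' _; rewrite patchE; case: ifPn => [/set_mem [[Az' az'] a'z']|_]; last first.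
      by rewrite patchE; case: ifP => // _; rewrite mule_ge0// lee_fin killed_kernel_ge0.
    rewrite patchE ifT; last by apply/mem_set.
    rewrite exprS mulr1 EFinM muleACA -EFinM; apply: lee_pmul.
    * by rewrite lee_fin mulr_ge0 ?bm_kernel_ge0.
    * by rewrite mule_ge0 ?bm_mass_ge0// lee_fin exprn_ge0.
    * by rewrite lee_fin dq.
    * by apply: ih => //; rewrite (le_trans _ ls)// lerD2l lerN2 ltW.
Qed.
End killed_mass.

Section killed_mass_continuity.
Context {R : realType}.
Implicit Types (a s t x y z l : R) (c : seq (R * set R * R)).
Local Notation mu := (@lebesgue_measure R).

Lemma cvg_invS : (fun n => n.+1%:R^-1 : R) @ \oo --> (0 : R).
Proof. exact: cvg_harmonic. Qed.

(** Lowering the barrier, rather than raising it, makes the convergence hold at every point: above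
    [a] the formula persists, and a point strictly below [a] is eventually below [a - e_ n]. *)
Lemma killed_kernel_cvg (e_ : R^nat) a t x z : 0 < t -> (forall n, 0 <= e_ n) ->
  e_ @ \oo --> 0 ->
  (fun n => killed_kernel (a - e_ n) t x z) @ \oo --> killed_kernel a t x z.
Proof.
move=> t0 e0 ce; have ca : (fun n => a - e_ n) @ \oo --> a.
  by rewrite -[X in _ --> X]subr0; apply: cvgB => //; exact: cvg_cst.
have near0 u : u < a -> \forall n \near \oo, u < a - e_ n by move=> ua; apply: (cvgr_gt a).
have [ax|xa] := leP a x; last first.
  rewrite killed_kernel0l//; apply: cvg_near_cst.
  by apply: filterS (near0 _ xa) => n xn; rewrite killed_kernel0l.
have [az|za] := leP a z; last first.
  rewrite killed_kernel0r//; apply: cvg_near_cst.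
  by apply: filterS (near0 _ za) => n xn; rewrite killed_kernel0r.
rewrite killed_kernelE//.
have ea n : a - e_ n <= a by rewrite gerBl.
under eq_fun do rewrite killed_kernelE ?(le_trans (ea _))//.
apply: cvgB; first exact: cvg_cst.
apply: cvg_bm_kernel => //; try exact: cvg_cst.
by apply: cvgB; [apply: cvgM => //; exact: cvg_cst|exact: cvg_cst].
Qed.

(** All kernels but the last have mass at most [1], and the last is bounded by the maximum of the
    Gaussian. The bound is independent of the barriers, hence fit for domination. *)
Lemma killed_mass_le l y a s x c : barrier_list s l c ->
  (killed_mass l y a s x c <=
   ((Num.sqrt (2 * pi * (l - last s (map (fun p => p.1.1) c))))^-1)%:E)%E.
Proof.
elim: c a s x => [|[[t A] a'] c ih] a s x /=.
  by move=> sl; rewrite lee_fin (le_trans (killed_kernel_le _ _ _ _))// bm_kernel_ub// subr_gt0.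
move=> [st mA bl]; set K := (_^-1)%R.
have K0 : 0 <= K by rewrite invr_ge0 sqrtr_ge0.
apply: (@le_trans _ _ (\int[mu]_z ((bm_kernel (t - s) x z)%:E * K%:E))%E); last first.
  rewrite ge0_integralZr//; last 2 first.
  - by apply/measurable_EFinP; exact: measurable_bm_kernel.
  - by move=> z _; rewrite lee_fin bm_kernel_ge0.
  by rewrite integral_bm_kernel mul1e.
rewrite integral_mkcond; apply: ge0_le_integral => //.
- move=> z _; rewrite patchE; case: ifP => // _.
  by rewrite mule_ge0 ?(killed_mass_ge0 _ _ _ bl)// lee_fin killed_kernel_ge0// subr_gt0.
- apply: measurable_patch0 => //; apply: emeasurable_funM; last exact: (measurable_killed_mass _ _ bl).
  by apply/measurable_EFinP; exact: measurable_killed_kernel.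
- by apply/measurable_EFinP; apply: measurable_funM => //; exact: measurable_bm_kernel.
- move=> z _; rewrite patchE; case: ifP => [_|_]; last by rewrite mule_ge0// lee_fin bm_kernel_ge0.
  apply: lee_pmul.
  + by rewrite lee_fin killed_kernel_ge0// subr_gt0.
  + exact: (killed_mass_ge0 _ _ _ bl).
  + by rewrite lee_fin killed_kernel_le.
  + exact: ih.
Qed.

Lemma killed_mass_fin l y a s x c : barrier_list s l c -> killed_mass l y a s x c \is a fin_num.
Proof.
move=> bl; rewrite ge0_fin_numE; last exact: killed_mass_ge0.
exact: le_lt_trans (killed_mass_le _ _ _ bl) (ltry _).
Qed.

Lemma killed_mass_cvg (e_ : R^nat) l y a s x c : barrier_list s l c ->
  (forall n, 0 <= e_ n) -> e_ @ \oo --> 0 ->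
  (fun n => killed_mass l y (a - e_ n) s x (lower_levels (e_ n) c)) @ \oo -->
  killed_mass l y a s x c.
Proof.
move=> + e0 ce; elim: c a s x => [|[[t A] a'] c ih] a s x /=.
  move=> sl; apply: cvg_EFin; first exact: nearW.
  by apply: killed_kernel_cvg => //; rewrite subr_gt0.
move=> [st mA bl]; have ts : 0 < t - s by rewrite subr_gt0.
have bl' e : barrier_list t l (lower_levels e c) by apply/lower_levels_list.
set K : R := (Num.sqrt (2 * pi * (l - last t (map (fun p => p.1.1) c))))^-1.
have K0 : 0 <= K by rewrite invr_ge0 sqrtr_ge0.
have lastE e : last t (map (fun p => p.1.1) (lower_levels e c)) = last t (map (fun p => p.1.1) c).
  by rewrite -map_comp.
pose f n z := ((killed_kernel (a - e_ n) (t - s) x z)%:E *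
   killed_mass l y (a' - e_ n) t z (lower_levels (e_ n) c))%E.
pose g z := ((killed_kernel a (t - s) x z)%:E * killed_mass l y a' t z c)%E.
pose h z := (bm_kernel (t - s) x z * K)%:E.
have mf n : measurable_fun A (f n).
  apply: measurable_funTS; apply: emeasurable_funM; last exact: measurable_killed_mass.
  by apply/measurable_EFinP; exact: measurable_killed_kernel.
have mg : measurable_fun A g.
  apply: measurable_funTS; apply: emeasurable_funM; last exact: measurable_killed_mass.
  by apply/measurable_EFinP; exact: measurable_killed_kernel.
have fg : {ae mu, forall z, A z -> (f ^~ z) @ \oo --> g z}.
  apply: aeW => z Az; apply: cvgeM.
  - by rewrite mule_def_fin// killed_mass_fin.
  - by apply: cvg_EFin; [exact: nearW|exact: killed_kernel_cvg].
  - exact: ih.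
have ih' : mu.-integrable A h.
  have mh : measurable_fun setT (fun z => bm_kernel (t - s) x z * K).
    by apply: measurable_funM => //; exact: measurable_bm_kernel.
  apply/integrableP; split; first by apply/measurable_EFinP; exact: measurable_funTS.
  have h0 z : (0 <= h z)%E by rewrite lee_fin mulr_ge0// bm_kernel_ge0.
  rewrite [X in (X < _)%E](_ : _ = (\int[mu]_(z in A) (h z))%E); last first.
    by apply: eq_integral => z _; rewrite gee0_abs.
  apply: (@le_lt_trans _ _ (\int[mu]_z (h z))%E).
    by apply: ge0_subset_integral => //; apply/measurable_EFinP.
  under eq_integral do rewrite /h EFinM.
  rewrite ge0_integralZr//; last 2 first.
  - by apply/measurable_EFinP; exact: measurable_bm_kernel.
  - by move=> z _; rewrite lee_fin bm_kernel_ge0.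
  by rewrite integral_bm_kernel mul1e ltry.
have fh : {ae mu, forall z n, A z -> `|f n z| <= h z}%E.
  apply: aeW => z n Az; have M0 := killed_mass_ge0 y (a' - e_ n) z (bl' (e_ n)).
  have k0 : (0 <= (killed_kernel (a - e_ n) (t - s) x z)%:E)%E by rewrite lee_fin killed_kernel_ge0.
  rewrite gee0_abs; last by rewrite mule_ge0.
  rewrite /h EFinM; apply: lee_pmul => //; first by rewrite lee_fin killed_kernel_le.
  by apply: (le_trans (killed_mass_le _ _ _ (bl' _))); rewrite lastE.
by have [] := @dominated_convergence _ (measurableTypeR R) R mu A mA _ _ _ mf mg fg ih' fh.
Qed.
End killed_mass_continuity.

(** * Probability that a Brownian bridge stays above barriers *)

Section barrier_event.
Context {R : realType} {d : measure_display} {T : measurableType d}.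
Variables (P : probability T R) (X : R -> T -> R).
Implicit Types (a s t x y z l : R) (c : seq (R * set R * R)) (o : T).
Local Notation grid_list a j s h := (map (fun u => (u, above a)) (grid j s h)).

Fixpoint barrier_event l a s c : set T :=
  if c is (t, A, a') :: c' then
    [set o | forall u, s <= u <= t -> a <= X u o] `&` X t @^-1` A `&` barrier_event l a' t c'
  else [set o | forall u, s <= u <= l -> a <= X u o].

Fixpoint grid_event j l a s c : set T :=
  if c is (t, A, a') :: c' then
    [set o | forall k, (k <= j.+1)%N -> a <= X (s + (t - s) / j.+1%:R * k%:R) o] `&`
    X t @^-1` A `&` grid_event j l a' t c'
  else [set o | forall k, (k <= j.+1)%N -> a <= X (s + (l - s) / j.+1%:R * k%:R) o].

Lemma cylinder_cons p (c : seq (R * set R)) :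
  cylinder X (p :: c) = X p.1 @^-1` p.2 `&` cylinder X c.
Proof. by rewrite /cylinder big_cons. Qed.

Lemma cylinder_nil : cylinder X [::] = setT.
Proof. by rewrite /cylinder big_nil. Qed.

Lemma cylinder_cat (c1 c2 : seq (R * set R)) :
  cylinder X (c1 ++ c2) = cylinder X c1 `&` cylinder X c2.
Proof.
by elim: c1 => [|p c1 ih]; rewrite ?cylinder_nil ?setTI//= !cylinder_cons ih setIA.
Qed.

Lemma cylinder_grid a j s h o : cylinder X (grid_list a j s h) o <->
  forall k, (0 < k <= j)%N -> a <= X (s + h * k%:R) o.
Proof.
elim: j s => [|j ih] s /=.
  by rewrite cylinder_nil; split => // _ [|k].
rewrite cylinder_cons; split => [[/= Xa /ih h1] [|[|k]]//= kj|h1].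
- by rewrite mulr1.
- have := h1 k.+1 kj; rewrite -[k.+2%:R]natr1.
  by rewrite (_ : s + h + h * k.+1%:R = s + h * (k.+1%:R + 1))//; ring.
- split; first by have := h1 1%N isT; rewrite mulr1.
  apply/ih => k /andP[k0 kj]; have := h1 k.+1 kj; rewrite -natr1.
  by rewrite (_ : s + h + h * k%:R = s + h * (k%:R + 1))//; ring.
Qed.

(** The cylinder omits the two extreme grid times, where the bridge takes prescribed values; the
    hypotheses at [s] and [l] supply them. An inner item carries both its barriers, so the induction
    can start again from [X t o]. *)
Lemma grid_eventE j l a s c o : barrier_list s l c -> a <= X s o ->
  last a (map snd c) <= X l o ->
  cylinder X (refine j l a s c) o <-> grid_event j l a s c o.
Proof.
have hj t u : u + (t - u) / j.+1%:R * j.+1%:R = t :> R.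
  by rewrite divfK ?pnatr_eq0//; ring.
elim: c a s => [|[[t A] a'] c ih] a s /=.
  move=> sl ax ay; rewrite cylinder_grid; split => h1 k kj; last first.
    by apply: h1; case/andP: kj => _ /leqW.
  have [->|k0] := posnP k; first by rewrite mulr0 addr0.
  move: kj; rewrite leq_eqVlt => /predU1P[->|kj]; first by rewrite hj.
  by apply: h1; rewrite k0.
move=> [st mA bl] ax ay; rewrite cylinder_cat cylinder_cons/=.
split=> [[/cylinder_grid h1 [[[At at1] a't]]] h2|[[h1 At] h2]].
  have {}h2 := (ih a' t bl a't ay).1 h2; split => //; split => // k kj.
  have [->|k0] := posnP k; first by rewrite mulr0 addr0.
  move: kj; rewrite leq_eqVlt => /predU1P[->|kj]; first by rewrite hj.
  by apply: h1; rewrite k0.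
have at1 : a <= X t o by have := h1 j.+1 (leqnn _); rewrite hj.
have a't : a' <= X t o.
  case: (c) bl ay h2 => [|[[t' A'] a''] c'] /=.
    by move=> _ _ /(_ 0%N isT); rewrite mulr0 addr0.
  by move=> _ _ [[/(_ 0%N isT)]]; rewrite mulr0 addr0.
split; first by apply/cylinder_grid => k /andP[_ kj]; apply: h1; exact: leqW.
by split => //; exact: (ih a' t bl a't ay).2.
Qed.

Lemma barrier_grid_event j l a s c : barrier_list s l c ->
  barrier_event l a s c `<=` grid_event j l a s c.
Proof.
have j0 : 0 < j.+1%:R :> R by rewrite ltr0n.
have kb k t u : (k <= j.+1)%N -> u < t -> u <= u + (t - u) / j.+1%:R * k%:R <= t.
  move=> kj ut; rewrite lerDl mulr_ge0 ?divr_ge0 ?subr_ge0 ?(ltW ut)//=.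
  rewrite -lerBrDl -mulrA ler_piMr ?subr_ge0 ?(ltW ut)//.
  by rewrite mulrC ler_pdivrMr// mul1r ler_nat.
elim: c a s => [|[[t A] a'] c ih] a s /=.
  by move=> sl o h1 k kj; apply: h1; exact: kb.
move=> [st _ bl] o [[h1 At] h2]; split; last exact: ih.
by split => // k kj; apply: h1; exact: kb.
Qed.

(** Doubling the number of cells keeps the old grid times. The parameter is [(2 ^ n).-1] because [j]
    stands for [j.+1] cells. *)
Lemma grid_event_nested n l a s c :
  grid_event (2 ^ n.+1).-1 l a s c `<=` grid_event (2 ^ n).-1 l a s c.
Proof.
have kE k t u : (k <= (2 ^ n).-1.+1)%N ->
    u + (t - u) / (2 ^ n).-1.+1%:R * k%:R = u + (t - u) / (2 ^ n.+1).-1.+1%:R * (2 * k)%:R :> R.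
  move=> _; rewrite !prednK ?expn_gt0// expnS !natrM; field.
  by rewrite pnatr_eq0 expn_eq0.
have kj k : (k <= (2 ^ n).-1.+1)%N -> (2 * k <= (2 ^ n.+1).-1.+1)%N.
  by rewrite !prednK ?expn_gt0// expnS leq_pmul2l.
elim: c a s => [|[[t A] a'] c ih] a s /=.
  by move=> o h1 k kn; rewrite kE//; apply: h1; exact: kj.
move=> o [[h1 At] h2]; split; last exact: ih.
by split => // k kn; rewrite kE//; apply: h1; exact: kj.
Qed.

Lemma within_itv_ball (f : R -> R) l u (e : R) : {within `[0, l], continuous f} ->
  0 <= u <= l -> 0 < e ->
  exists2 r : R, 0 < r & forall v, 0 <= v <= l -> `|u - v| < r -> `|f u - f v| < e.
Proof.
move=> /subspace_continuousP cf ul e0.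
have /= := cf u; rewrite in_itv/= => /(_ ul) /cvgrPdist_lt /(_ e e0) [r /= r0 hr].
by exists r => // v vl uv; apply: hr => //=; rewrite in_itv/=.
Qed.

(** If [f u < a], the last grid point before [u] is eventually so close to [u] that [f] is still
    below [a] there. *)
Lemma dyadic_above (f : R -> R) a s t l : 0 <= s -> s < t -> t <= l ->
  {within `[0, l], continuous f} ->
  (forall n k, (k <= (2 ^ n).-1.+1)%N -> a <= f (s + (t - s) / (2 ^ n).-1.+1%:R * k%:R)) ->
  forall u, s <= u <= t -> a <= f u.
Proof.
move=> s0 st tl cf ha u /andP[su ut]; rewrite leNgt; apply/negP => fua.
have ts : 0 < t - s by rewrite subr_gt0.
have ul : 0 <= u <= l by rewrite (le_trans s0 su) (le_trans ut tl).
have afu : 0 < a - f u by rewrite subr_gt0.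
have [e e0 he] := within_itv_ball cf ul afu.
have [n hn] : exists n, (t - s) / (2 ^ n)%:R < e.
  have [n _ hn] := near_infty_natSinv_expn_lt (PosNum (divr_gt0 e0 ts)).
  exists n; have := hn n (leqnn n); rewrite /= natrX => h.
  by move: h; rewrite div1r ltr_pdivlMr// mulrC.
have N0 : 0 < (2 ^ n)%:R :> R by rewrite ltr0n expn_gt0.
pose k := Num.truncn ((u - s) / (t - s) * (2 ^ n)%:R).
have v0 : 0 <= (u - s) / (t - s) * (2 ^ n)%:R.
  by rewrite mulr_ge0// divr_ge0 ?subr_ge0 ?(ltW st).
have /andP[k1 k2] := truncn_itv v0; rewrite -/k in k1 k2.
have kn : (k <= (2 ^ n).-1.+1)%N.
  rewrite prednK ?expn_gt0// -(ler_nat R) (le_trans k1)//.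
  by rewrite ler_piMl ?(ltW N0)// ler_pdivrMr// mul1r lerD2r.
have := ha n k kn; rewrite prednK ?expn_gt0//; set v := s + _ => hav.
have vu : v <= u.
  rewrite /v -lerBrDl mulrAC ler_pdivrMr//.
  by move: k1; rewrite mulrAC ler_pdivlMr// mulrC.
have k2' : u - s <= (t - s) / (2 ^ n)%:R * k.+1%:R.
  by rewrite mulrAC ler_pdivlMr// [leRHS]mulrC; move: k2; rewrite mulrAC ltr_pdivrMr// => /ltW.
have uv : u - v < e.
  apply: le_lt_trans hn; rewrite /v opprD addrA lerBlDr.
  by apply: (le_trans k2'); rewrite -natr1 mulrDr mulr1 addrC.
have sv : s <= v by rewrite /v lerDl mulr_ge0 ?divr_ge0 ?(ltW ts) ?(ltW N0).
have hh : `|f u - f v| < a - f u.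
  by apply: he; rewrite ?(le_trans s0 sv) ?(le_trans vu (le_trans ut tl))// ger0_norm ?subr_ge0.
have := ler_norm (f v - f u); rewrite distrC; lra.
Qed.

Lemma barrier_eventE l a s c o : barrier_list s l c -> 0 <= s ->
  {within `[0, l], continuous (fun t => X t o)} ->
  (forall n, grid_event (2 ^ n).-1 l a s c o) -> barrier_event l a s c o.
Proof.
move=> + + cX; elim: c a s => [|[[t A] a'] c ih] a s /=.
  by move=> sl s0 h; exact: (dyadic_above s0 sl (lexx l) cX).
move=> [st mA bl] s0 h; split; last first.
  by apply: ih => //; [exact: le_trans s0 (ltW st)|move=> n; have [] := h n].
split; last by have [[]] := h 0%N.
apply: (dyadic_above s0 st (ltW (barrier_list_lt bl)) cX) => n k.
by have [[+ _] _] := h n; apply.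
Qed.

Lemma measurable_cylinder l (c : seq (R * set R)) :
  (forall t, 0 <= t <= l -> measurable_fun setT (X t)) -> path <%R 0 (rcons (map fst c) l) ->
  (forall i, measurable (nth (0, set0) c i).2) -> measurable (cylinder X c).
Proof.
move=> mX; suff : forall s, 0 <= s -> path <%R s (rcons (map fst c) l) ->
    (forall i, measurable (nth (0, set0) c i).2) -> measurable (cylinder X c).
  by move=> /(_ 0 (lexx _)).
elim: c => [|[t A] c ih] s s0 /=.
  by rewrite cylinder_nil => _ _; exact: measurableT.
move=> /andP[st pc] mc; rewrite cylinder_cons; apply: measurableI => /=; last first.
  by apply: (ih t) => //; [exact: le_trans s0 (ltW st)|move=> i; exact: (mc i.+1)].
rewrite -[X in measurable X]setTI; apply: mX => //; last exact: (mc 0%N).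
rewrite (le_trans s0 (ltW st))/=.
elim: c t pc {ih mc st} => /= [t|[t' A'] c ih t]; first by rewrite andbT => /ltW.
by move=> /andP[tt' /ih]; exact/le_trans/ltW.
Qed.

Lemma bernoulli (e : R) k : 0 <= e <= 1 -> 1 - k%:R * e <= (1 - e) ^+ k.
Proof.
move=> /andP[e0 e1]; elim: k => [|k ih]; first by rewrite mul0r subr0.
rewrite exprS; apply: (@le_trans _ _ ((1 - e) * (1 - k%:R * e))); last first.
  by rewrite ler_wpM2l// subr_ge0.
rewrite -natr1 -subr_ge0 (_ : _ - _ = k%:R * e ^+ 2); last by ring.
by rewrite mulr_ge0 ?sqr_ge0.
Qed.

Lemma le_div_S (A B C : R) : (forall n : nat, A - C / n.+1%:R <= B) -> A <= B.
Proof.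
move=> h; have cA : (fun n : nat => A - C * n.+1%:R^-1) @ \oo --> A.
  rewrite -[X in _ --> X]subr0 -[X in _ - X](mulr0 C).
  by apply: cvgB; [exact: cvg_cst|apply: cvgM; [exact: cvg_cst|exact: cvg_invS]].
have <- : limn (fun n : nat => A - C * n.+1%:R^-1) = A by exact/cvg_lim.
by apply: limr_le; [exact: cvgP cA|exact: nearW].
Qed.

Hypothesis (x0 y0 : R) (bX : is_brownian_bridge P 1 x0 y0 X).

Lemma cylinder_refine_prob j a c : barrier_list 0 1 c ->
  [/\ measurable (cylinder X (refine j 1 a 0 c)) &
  P (cylinder X (refine j 1 a 0 c)) =
  (bridge_mass (fun=> 1%R) (@bm_kernel R) 1%R y0 0%R x0 (refine j 1 a 0 c) * ((bm_kernel 1 x0 y0)^-1)%:E)%E].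
Proof.
move=> bl; have pc := path_refine j a bl; have mc := measurable_refine j a bl.
split; first exact: (measurable_cylinder (bb_measurable bX) pc).
rewrite (bb_fdd bX)//.
- by split => //; move: pc; rewrite -cats1 cat_path => /andP[].
- by rewrite /last_time; move: pc; rewrite -cats1 cat_path/= andbT => /andP[].
Qed.

(** Every grid probability is at least the killed mass, and along dyadic grids these probabilities
    decrease to that of the event. Conversely the event lies in all grid events, whose mass is at
    most the killed mass with lowered barriers, up to a factor tending to [1]; the barriers are then
    brought back. *)
Lemma barrier_event_prob a c : barrier_list 0 1 c -> a <= x0 -> last a (map snd c) <= y0 ->
  measurable (barrier_event 1 a 0 c) /\
  P (barrier_event 1 a 0 c) = (killed_mass 1%R y0 a 0%R x0 c * ((bm_kernel 1 x0 y0)^-1)%:E)%E.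
Proof.
move=> bl ax ay.
have gE j : grid_event j 1 a 0 c = cylinder X (refine j 1 a 0 c).
  by apply/seteqP; split => o /(@grid_eventE j 1 a 0 c o bl);
    rewrite (bb_start bX) (bb_end bX); apply.
have EE : barrier_event 1 a 0 c = \bigcap_n grid_event (2 ^ n).-1 1 a 0 c.
  apply/seteqP; split => o; first by move=> h n _; exact: barrier_grid_event h.
  by move=> h; apply: barrier_eventE => //; [exact: (bb_continuous bX)|move=> n; exact: h].
have mg j : measurable (grid_event j 1 a 0 c) by rewrite gE; case: (cylinder_refine_prob j a bl).
have mE : measurable (barrier_event 1 a 0 c) by rewrite EE; exact: bigcap_measurable.
split => //.
set p1 := bm_kernel 1 x0 y0.
have p10 : 0 < p1 by rewrite bm_kernel_gt0.
have Pg j : P (grid_event j 1 a 0 c) = (bridge_mass (fun=> 1%R) (@bm_kernel R) 1%R y0 0%R x0 (refine j 1 a 0 c) * (p1^-1)%:E)%E.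
  by rewrite gE; case: (cylinder_refine_prob j a bl).
apply/eqP; rewrite eq_le; apply/andP; split; last first.
  have cP : (fun n => P (grid_event (2 ^ n).-1 1 a 0 c)) @ \oo --> P (barrier_event 1 a 0 c).
    rewrite EE; apply: nonincreasing_cvg_mu => //.
    - by rewrite (le_lt_trans (probability_le1 _ _))// ltry.
    - by rewrite -EE.
    - apply/nonincreasing_seqP => n; apply/subsetPset; exact: grid_event_nested.
  have <- : limn (fun n => P (grid_event (2 ^ n).-1 1 a 0 c)) = P (barrier_event 1 a 0 c) by exact/cvg_lim.
  apply: lime_ge; first exact: cvgP cP.
  apply: nearW => n; rewrite Pg; apply: lee_wpmul2r; first by rewrite lee_fin invr_ge0 ltW.
  exact: refine_lower.
have PEfin : P (barrier_event 1 a 0 c) \is a fin_num by exact: fin_num_measure.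
rewrite lee_pdivlMr//.
have key (e : R) : 0 < e ->
    (P (barrier_event 1 a 0 c) * p1%:E <= killed_mass 1%R y0 (a - e)%R 0%R x0 (lower_levels e c))%E.
  move=> e0.
  have bl' : barrier_list 0 1 (lower_levels e c) by apply/lower_levels_list.
  have mfin := killed_mass_fin y0 (a - e) x0 bl'.
  rewrite -(fineK PEfin) -(fineK mfin) -EFinM lee_fin.
  set Pr := fine (P _); set m := fine (killed_mass _ _ _ _ _ _).
  have Pr0 : 0 <= Pr by rewrite fine_ge0.
  (* By [exp (- w) <= 2 / w ^ 2] with [w = 2 e ^ 2 (n + 1)], the number of cells times the defect
     [v] of one cell is at most [C / (n + 1)]. *)
  pose C := (size c).+1%:R * (2 / (2 * e ^+ 2) ^+ 2).
  apply: (@le_div_S _ _ (Pr * p1 * C)) => n.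
  pose v : R := expR (- (2 * e ^+ 2 * n.+1%:R)).
  have v01 : 0 <= v <= 1.
    rewrite expR_ge0/= -[leRHS]expR0 ler_expR oppr_le0 mulr_ge0//.
    by rewrite mulr_ge0// sqr_ge0.
  have w0 : 0 < 2 * e ^+ 2 * n.+1%:R by rewrite !mulr_gt0// exprn_gt0.
    have vle : v <= 2 / (2 * e ^+ 2 * n.+1%:R) ^+ 2.
      rewrite ler_pdivlMr ?exprn_gt0// /v expRN mulrC ler_pdivrMr ?expR_gt0//.
      exact: sqr_le_expR (ltW w0).
    apply: (@le_trans _ _ (Pr * p1 * (1 - v) ^+ ((size c).+1 * n.+1))).
      rewrite (_ : _ - _ = Pr * p1 * (1 - C / n.+1%:R)); last by ring.
      rewrite ler_wpM2l ?mulr_ge0 ?(ltW p10)//.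
      apply: le_trans (bernoulli _ v01); rewrite lerD2l lerN2 natrM /C -!mulrA.
      rewrite ler_wpM2l// (le_trans (ler_wpM2l _ vle))//.
      rewrite le_eqVlt; apply/orP; left; apply/eqP; field.
      by rewrite (gt_eqF e0) nat1r pnatr_eq0.
    rewrite -lee_fin EFinM muleC.
    have := @refine_upper R n 1 y0 a 0 x0 c e bl e0 _ ax ay.
    rewrite subr0 => /(_ (lexx _)) up; rewrite fineK//.
    apply: le_trans up; apply: lee_wpmul2l.
      by rewrite lee_fin exprn_ge0// subr_ge0; case/andP: v01.
    have -> : bridge_mass (fun=> 1) (@bm_kernel R) 1 y0 0 x0 (refine n 1 a 0 c) =
        (P (grid_event n 1 a 0 c) * p1%:E)%E.
      by rewrite Pg -muleA -EFinM mulVf ?gt_eqF// mule1.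
    rewrite EFinM fineK//; apply: lee_wpmul2r; first by rewrite lee_fin ltW.
    by apply: le_measure; rewrite ?inE//; exact: barrier_grid_event.
have e0 n : 0 <= n.+1%:R^-1 :> R by rewrite invr_ge0.
have ck := @killed_mass_cvg R (fun n => n.+1%:R^-1) 1 y0 a 0 x0 c bl e0 cvg_invS.
have <- : limn (fun n => killed_mass 1 y0 (a - n.+1%:R^-1) 0 x0 (lower_levels n.+1%:R^-1 c)) =
    killed_mass 1 y0 a 0 x0 c by exact/cvg_lim.
apply: lime_ge; first exact: cvgP ck.
by apply: nearW => n; apply: key; rewrite invr_gt0.
Qed.
End barrier_event.

(** * Space shifts, free times and Bessel form of the killed masses *)

Section killed_bridge.
Context {R : realType}.
Implicit Types (a s t x y z l e : R) (c : seq (R * set R)) (F : R -> \bar R).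
Local Notation mu := (@lebesgue_measure R).

Fixpoint level_steps a s c : seq (@step R) :=
  if c is (t, A) :: c' then (killed_kernel a (t - s), A) :: level_steps a t c' else [::].

Definition borel_sets c := forall i, measurable (nth (0, set0) c i).2.

Lemma borel_sets_cons p c : borel_sets (p :: c) <-> measurable p.2 /\ borel_sets c.
Proof.
split=> [h|[mp mc] [|i]//]; last exact: mc.
by split => [|i]; [exact: (h 0%N)|exact: (h i.+1)].
Qed.

Lemma borel_sets_cat c1 c2 : borel_sets (c1 ++ c2) <-> borel_sets c1 /\ borel_sets c2.
Proof.
elim: c1 => [|p c1 ih] /=.
  by split => [|[]//]; split => // i; rewrite nth_nil; exact: measurable0.
by rewrite !borel_sets_cons ih; split => [[? []]|[[]]].
Qed.

Lemma borel_sets_nil : borel_sets [::].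
Proof. by move=> i; rewrite nth_nil; exact: measurable0. Qed.

Lemma good_level_steps a s c : path <%R s (map fst c) -> borel_sets c ->
  good_steps (level_steps a s c).
Proof.
elim: c s => //= -[t A] c ih s /= /andP[st pc] /borel_sets_cons[mA mc]; split => //.
- by apply: measurable_killed_kernel.
- by move=> x y; rewrite killed_kernel_ge0// subr_gt0.
- exact: ih.
Qed.

Lemma level_steps_cat a s c1 c2 :
  level_steps a s (c1 ++ c2) =
  level_steps a s c1 ++ level_steps a (last s (map fst c1)) c2.
Proof. by elim: c1 s => //= -[t A] c1 ih s /=; rewrite ih. Qed.

Lemma killed_steps_cat a s (c1 c2 : seq (R * set R * R)) :
  killed_steps a s (c1 ++ c2) =
  killed_steps a s c1 ++
  killed_steps (last a (map snd c1)) (last s (map (fun p => p.1.1) c1)) c2.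
Proof. by elim: c1 a s => //= -[[t A] a'] c1 ih a s /=; rewrite ih. Qed.

Lemma killed_steps_level a s c : killed_steps a s [seq (p, a) | p <- c] = level_steps a s c.
Proof. by elim: c s => //= -[t A] c ih s /=; rewrite ih. Qed.

Lemma last_level a c : last a (map snd [seq (p, a) | p <- c]) = a.
Proof. by elim: c. Qed.

Lemma last_level_time a s c :
  last s (map (fun p : R * set R * R => p.1.1) [seq (p, a) | p <- c]) = last s (map fst c).
Proof. by rewrite -map_comp. Qed.

Lemma level_steps_time e a s c :
  level_steps a (s + e) [seq (p.1 + e, p.2) | p <- c] = level_steps a s c.
Proof.
elim: c s => //= -[t A] c ih s /=; rewrite ih; congr ((killed_kernel a _, _) :: _).
by rewrite opprD addrACA subrr addr0.
Qed.

Definition shift_set e (A : set R) : set R := [set r | A (r - e)].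

Lemma measurable_shift_set e A : measurable A -> measurable (shift_set e A).
Proof.
move=> mA; rewrite -[shift_set e A]setTI.
have : measurable_fun setT (fun r : R => r - e) by exact: measurable_funB.
by apply.
Qed.

Lemma integral_shift_set e A F : measurable A -> measurable_fun setT F ->
  (forall x, 0 <= F x)%E ->
  (\int[mu]_(x in shift_set e A) F x = \int[mu]_(x in A) F (x + e)%R)%E.
Proof.
move=> mA mF F0; rewrite integral_mkcond [RHS]integral_mkcond.
have mFA : measurable_fun setT (F \_ (shift_set e A)).
  by apply: measurable_patch0 => //; exact: measurable_shift_set.
have FA0 x : (0 <= (F \_ (shift_set e A)) x)%E by rewrite patchE; case: ifP.
rewrite -(integral_shift e mFA FA0).
apply: eq_integral => x _; rewrite !patchE; congr (if _ then _ else _).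
by apply/idP/idP; rewrite !inE /shift_set/= addrK.
Qed.

Lemma path_mass_shift_level e a s c F x : path <%R s (map fst c) -> borel_sets c ->
  measurable_fun setT F -> (forall x, 0 <= F x)%E ->
  path_mass F (level_steps (a + e) s [seq (p.1, shift_set e p.2) | p <- c]) (x + e) =
  path_mass (fun u => F (u + e)) (level_steps a s c) x.
Proof.
move=> + + mF F0; elim: c s x => //= -[t A] c ih s x /= /andP[st pc] /borel_sets_cons[mA mc].
have ts : 0 < t - s by rewrite subr_gt0.
have pc' : path <%R t (map fst [seq (p.1, shift_set e p.2) | p <- c]) by rewrite -map_comp.
have mc' : borel_sets [seq (p.1, shift_set e p.2) | p <- c].
  move=> i; have [ic|ci] := ltnP i (size c); last by rewrite nth_default ?size_map//; exact: measurable0.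
  by rewrite (nth_map (0, set0))//=; apply: measurable_shift_set; exact: mc.
have gc' := good_level_steps (a + e) pc' mc'.
rewrite integral_shift_set//.
- by apply: eq_integral => z _; rewrite killed_kernel_shift// ih.
- apply: emeasurable_funM; last exact: measurable_path_mass.
  by apply/measurable_EFinP; exact: measurable_killed_kernel.
- by move=> z; rewrite mule_ge0 ?lee_fin ?killed_kernel_ge0//; exact: path_mass_ge0.
Qed.

(** A time without constraint disappears by Chapman-Kolmogorov. This serves for the time [s], at
    which the bridge cuts the excursion in two but which is not a time of the cylinder. *)
Lemma level_steps_insert a s c t t' A c' F x :
  path <%R s (map fst (c ++ (t, setT) :: (t', A) :: c')) -> borel_sets (c ++ (t', A) :: c') ->
  measurable_fun setT F -> (forall x, 0 <= F x)%E ->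
  path_mass F (level_steps a s (c ++ (t, setT) :: (t', A) :: c')) x =
  path_mass F (level_steps a s (c ++ (t', A) :: c')) x.
Proof.
move=> + + mF F0; elim: c s x => [|[u B] c ih] s x /=.
  move=> /and3P[st tt' pc] /borel_sets_cons[mA mc].
  have gc := good_level_steps a pc mc.
  have ts : 0 < t - s by rewrite subr_gt0.
  have t't : 0 < t' - t by rewrite subr_gt0.
  have mM := measurable_path_mass mF F0 gc.
  have M0 z : (0 <= path_mass F (level_steps a t' c') z)%E by exact: path_mass_ge0.
  have := killed_integral_ck a x ts t't mA mM M0.
  by rewrite (_ : t - s + (t' - t) = t' - s)//; ring.
move=> /andP[su pc] /borel_sets_cons[mB mc].
by apply: eq_integral => z _; rewrite ih.
Qed.

Definition bes3_mass l y s x c := bridge_mass bes3_weight bes3_kernel l y s x c.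

(** The factors [x * y] of successive kernels combine: every intermediate position occurs twice and
    forms the weight [z ^ 2], and the two extreme ones remain in front. *)
Lemma killed_path_bes3 l y s x c : path <%R s (rcons (map fst c) l) -> borel_sets c ->
  0 <= x -> 0 <= y ->
  path_mass (fun u => (killed_kernel 0 (l - last s (map fst c)) u y)%:E) (level_steps 0 s c) x =
  ((x * y)%:E * bes3_mass l y s x c)%E.
Proof.
move=> + + + y0; elim: c s x => [|[t A] c ih] s x /=.
  move=> /andP[sl _] _ x0.
  by rewrite /bes3_mass/= killed_kernel_bes3 ?subr_gt0// EFinM.
move=> /andP[st pc] /borel_sets_cons[mA mc] x0.
have ts : 0 < t - s by rewrite subr_gt0.
have pc1 : path <%R t (map fst c) by move: pc; rewrite -cats1 cat_path => /andP[].
have lc : last t (map fst c) < l by move: pc; rewrite -cats1 cat_path/= andbT => /andP[].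
have gc := good_bes3_steps pc1 mc.
have F0 z : (0 <= (bes3_kernel (l - last t (map fst c)) z y)%:E)%E.
  by rewrite lee_fin bes3_kernel_ge0// subr_gt0.
have mF : measurable_fun setT (fun z => (bes3_kernel (l - last t (map fst c)) z y)%:E).
  by apply/measurable_EFinP; exact: measurable_bes3_kernel.
rewrite /bes3_mass/= -ge0_integralZl_EFin//; last 3 first.
- move=> z _; rewrite mule_ge0//; last by rewrite bridge_massE; exact: path_mass_ge0.
  by rewrite lee_fin mulr_ge0 ?bes3_weight_ge0// bes3_kernel_ge0.
- apply: measurable_funTS; apply: emeasurable_funM.
    apply/measurable_EFinP; apply: measurable_funM; first exact: measurable_bes3_kernel.
    exact: measurable_bes3_weight.
  by under eq_fun do rewrite bridge_massE; exact: measurable_path_mass.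
- by rewrite mulr_ge0.
apply: eq_integral => z _.
have [z0|z0] := ltP z 0.
  by rewrite killed_kernel0r// mul0e /bes3_weight ltNge (ltW z0)/= mulr0 mul0e mule0.
rewrite ih// killed_kernel_bes3// !muleA -!EFinM; congr (_%:E * _)%E.
by rewrite /bes3_weight; case: ltgtP z0 => // [z0 _|<- _]; ring.
Qed.
End killed_bridge.

(** * Windows around the minimum and their probability *)

Section barrier_shape.
Context {R : realType} {d : measure_display} {T : measurableType d}.
Variable (X : R -> T -> R).
Implicit Types (a s t l : R) (c : seq (R * set R)) (o : T).

Definition stays a s t : set T := [set o | forall u, s <= u <= t -> a <= X u o].

Lemma stays_cat a s t l o : s <= t -> t <= l -> stays a s l o <-> stays a s t o /\ stays a t l o.
Proof.
move=> st tl; split=> [h|[h1 h2] u /andP[su ul]].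
  by split => u /andP[u1 u2]; apply: h; rewrite ?u1 ?u2 ?(le_trans u2)// (le_trans st).
by have [ut|tu] := leP u t; [apply: h1; rewrite su|apply: h2; rewrite ul ltW].
Qed.

Lemma barrier_event_level l a s c o : path <%R s (rcons (map fst c) l) ->
  barrier_event X l a s [seq (p, a) | p <- c] o <-> stays a s l o /\ cylinder X c o.
Proof.
elim: c s => [|[t A] c ih] s /=.
  by rewrite cylinder_nil => _; split => [|[]].
move=> /andP[st pc]; have := ih _ pc; rewrite cylinder_cons => ih'.
have tl : t <= l.
  by elim: c t {ih ih' st} pc => /= [|q c ih] t; [rewrite andbT => /ltW|move=> /andP[/ltW tq /ih]; exact: le_trans].
split=> [[[h1 h2] /ih'[h3 h4]]|[/(stays_cat _ _ (ltW st) tl)[h1 h2] [h3 h4]]].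
  by split => //; exact/(stays_cat _ _ (ltW st) tl).
by split => //; exact/ih'.
Qed.

Lemma barrier_event_level_cat l a s c t A a' (c' : seq (R * set R * R)) o : path <%R s (rcons (map fst c) t) ->
  barrier_event X l a s ([seq (p, a) | p <- c] ++ (t, A, a') :: c') o <->
  [/\ stays a s t o, cylinder X c o, A (X t o) & barrier_event X l a' t c' o].
Proof.
elim: c s => [|[u B] c ih] s /=.
  by rewrite cylinder_nil => _; split => [[[]]|[]].
move=> /andP[su pc]; have := ih _ pc; rewrite cylinder_cons => ih'.
have ut : u <= t.
  by elim: c u {ih ih' su} pc => /= [|q c ih] u; [rewrite andbT => /ltW|move=> /andP[/ltW tq /ih]; exact: le_trans].
split=> [[[h1 h2] /ih'[h3 h4 h5 h6]]|[/(stays_cat _ _ (ltW su) ut)[h1 h2] [h3 h4] h5 h6]].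
  by split => //; exact/(stays_cat _ _ (ltW su) ut).
by split => //; exact/ih'.
Qed.
End barrier_shape.

Section path_times.
Context {R : realType}.
Implicit Types (s t l e : R) (c : seq (R * set R)).

Lemma barrier_listP s l (c : seq (R * set R * R)) :
  path <%R s (rcons (map (fun p => p.1.1) c) l) -> borel_sets (map fst c) ->
  barrier_list s l c.
Proof.
elim: c s => /= [|[[t A] a] c ih] s /=; first by rewrite andbT.
by move=> /andP[st pc] /borel_sets_cons[mA mc]; split => //; exact: ih.
Qed.

Lemma path_rcons_lt s (c : seq R) l : path <%R s (rcons c l) <-> path <%R s c /\ last s c < l.
Proof. by rewrite rcons_path; split => [/andP[]|[-> ->]]. Qed.

Lemma path_shift e s (c : seq R) : path <%R (s + e) [seq t + e | t <- c] = path <%R s c.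
Proof. by elim: c s => //= t c ih s; rewrite ih ltrD2r. Qed.

Lemma last_shift e s (c : seq R) : last (s + e) [seq t + e | t <- c] = last s c + e.
Proof. by elim: c s => //=. Qed.

Lemma map_level_time (a : R) c : map (fun p : R * set R * R => p.1.1) [seq (p, a) | p <- c] = map fst c.
Proof. by rewrite -map_comp. Qed.

Lemma map_level_fst (a : R) c : map fst [seq (p, a) | p <- c] = c.
Proof. by rewrite -map_comp map_id. Qed.

Lemma borel_sets_map (f : R * set R -> R * set R) c :
  (forall p, measurable p.2 -> measurable (f p).2) -> borel_sets c -> borel_sets (map f c).
Proof.
move=> mf; elim: c => //= p c ih /borel_sets_cons[mp mc].
by apply/borel_sets_cons; split; [exact: mf|exact: ih].
Qed.
End path_times.

(** * Window events as loops of killed Brownian motion *)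

Section loop.
Context {R : realType}.
Variables (l de s r : R) (ca cb c2 : seq (R * set R)).
Implicit Types (x y z w al be : R) (k : R -> R -> R).
Local Notation mu := (@lebesgue_measure R).
Hypotheses (de0 : 0 < de) (s0 : 0 < s) (sr : s < r).
Hypothesis pa : path <%R 0 (rcons (map fst ca) s).
Hypothesis pb : path <%R s (rcons (map fst cb) r).
Hypothesis p2 : path <%R 0 (rcons (map fst c2) (1 - r - 2 * de)).
Hypotheses (ma : borel_sets ca) (mb : borel_sets cb) (m2 : borel_sets c2).

Let cb' := [seq (p.1 - s, shift_set l p.2) | p <- cb].
Let c2' := [seq (p.1 + (r - s + de), shift_set l p.2) | p <- c2].
Let ca' := [seq (p.1 + (1 - s), p.2) | p <- ca].

(** In the clock of the bridge the second part [cb] of the excursion comes first, then the passage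
    [c2], then the first part [ca]. The sets of [cb] and [c2] are raised by [l], the amount by which
    the bridge descends from start to end. The levels [al] and [be] of the two short intervals are
    left free for inclusion-exclusion. *)
Definition loop_barriers al be : seq (R * set R * R) :=
  [seq (p, l) | p <- cb'] ++ (r - s, setT, al) :: (r - s + de, setT, 0) ::
  [seq (p, 0) | p <- c2'] ++ (1 - s - de, setT, be) :: (1 - s, setT, 0) ::
  [seq (p, 0) | p <- ca'].

Let pcb' : path <%R 0 (rcons (map fst cb') (r - s)).
Proof.
have -> : rcons (map fst cb') (r - s) = [seq t - s | t <- rcons (map fst cb) r].
  by rewrite map_rcons -!map_comp.
by rewrite -{1}(subrr s) path_shift.
Qed.

Let pc2' : path <%R (r - s + de) (rcons (map fst c2') (1 - s - de)).
Proof.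
have -> : rcons (map fst c2') (1 - s - de) =
    [seq t + (r - s + de) | t <- rcons (map fst c2) (1 - r - 2 * de)].
  by rewrite map_rcons -!map_comp; congr rcons; ring.
by rewrite -{1}[r - s + de]add0r path_shift.
Qed.

Let pca' : path <%R (1 - s) (rcons (map fst ca') 1).
Proof.
have -> : rcons (map fst ca') 1 = [seq t + (1 - s) | t <- rcons (map fst ca) s].
  by rewrite map_rcons -!map_comp; congr rcons; ring.
by rewrite -{1}[1 - s]add0r path_shift.
Qed.

Let mcb' : borel_sets cb'.
Proof. by apply: borel_sets_map => // p; exact: measurable_shift_set. Qed.
Let mc2' : borel_sets c2'.
Proof. by apply: borel_sets_map => // p; exact: measurable_shift_set. Qed.
Let mca' : borel_sets ca'.
Proof. by apply: borel_sets_map. Qed.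

Lemma barrier_list_loop al be : barrier_list 0 1 (loop_barriers al be).
Proof.
apply: barrier_listP.
  rewrite /loop_barriers !map_cat/= !map_cat/= !map_level_time.
  move/path_rcons_lt: pcb' => [q1 q2]; move/path_rcons_lt: pc2' => [q3 q4].
  rewrite rcons_cat cat_path q1/= q2/= ltrDl de0/= rcons_cat cat_path q3/= q4/=.
  by rewrite gtrBl de0/= pca'.
rewrite /loop_barriers !map_cat/= !map_cat/= !map_level_fst.
have mT : measurable [set: R] := measurableT.
apply/borel_sets_cat; split => //; apply/borel_sets_cons; split => //.
apply/borel_sets_cons; split => //; apply/borel_sets_cat; split => //.
by apply/borel_sets_cons; split => //; apply/borel_sets_cons; split.
Qed.

Lemma loop_barriers_level al be : last l (map snd (loop_barriers al be)) = 0.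
Proof. by rewrite /loop_barriers !map_cat/= !last_cat/= !map_cat/= !last_cat/= last_level. Qed.

Lemma loop_eventP (d : measure_display) (T : measurableType d) (X : R -> T -> R) al be o :
  barrier_event X 1 l 0 (loop_barriers al be) o <->
  [/\ stays X l 0 (r - s) o /\ cylinder X cb' o, stays X al (r - s) (r - s + de) o,
      stays X 0 (r - s + de) (1 - s - de) o /\ cylinder X c2' o,
      stays X be (1 - s - de) (1 - s) o &
      stays X 0 (1 - s) 1 o /\ cylinder X ca' o].
Proof.
rewrite /loop_barriers; split.
  move=> /barrier_event_level_cat => /(_ pcb')[h1 h2 _ /= [[h3 _]]].
  move=> /barrier_event_level_cat => /(_ pc2')[h4 h5 _ /= [[h6 _]]].
  by move=> /barrier_event_level => /(_ pca')[h7 h8].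
move=> [[h1 h2] h3 [h4 h5] h6 [h7 h8]].
apply/barrier_event_level_cat => //; split => //=; split => //.
apply/barrier_event_level_cat => //; split => //=; split => //.
exact/barrier_event_level.
Qed.

(** The kernels on the two short intervals are arbitrary, so that differences of killed kernels can
    be inserted. *)
Definition loop_steps k1 k2 : seq (@step R) :=
  level_steps l s [seq (p.1, shift_set l p.2) | p <- cb] ++
  (killed_kernel l (r - last s (map fst cb)), setT) :: (k1, setT) ::
  level_steps 0 0 [seq (p.1, shift_set l p.2) | p <- c2] ++
  (killed_kernel 0 (1 - r - 2 * de - last 0 (map fst c2)), setT) :: (k2, setT) ::
  level_steps 0 0 ca.

Lemma loop_massE al be x : killed_mass 1 (x - l) l 0 x (loop_barriers al be) =
  path_mass (fun u => (killed_kernel 0 (s - last 0 (map fst ca)) u (x - l))%:E)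
    (loop_steps (killed_kernel al de) (killed_kernel be de)) x.
Proof.
rewrite killed_massE loop_barriers_level.
have lastcb' : last 0 (map fst cb') = last s (map fst cb) - s.
  by rewrite -last_shift subrr /cb' -!map_comp.
have lastc2' : last (r - s + de) (map fst c2') = last 0 (map fst c2) + (r - s + de).
  by rewrite -last_shift add0r /c2' /ca' -!map_comp.
have lastca' : last (1 - s) (map fst ca') = last 0 (map fst ca) + (1 - s).
  by rewrite -last_shift add0r /c2' /ca' -!map_comp.
rewrite /loop_barriers !map_cat/= !last_cat/= !map_cat/= !last_cat/= last_level_time lastca'.
congr (path_mass _ _ _).
  by apply/funext => u; congr (killed_kernel 0 _ _ _)%:E; ring.
rewrite /loop_steps killed_steps_cat/= killed_steps_cat/= !killed_steps_level.
rewrite !last_level_time !last_level lastcb' lastc2'.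
congr (_ ++ (killed_kernel _ _, _) :: (killed_kernel _ _, _) :: _ ++ (killed_kernel _ _, _) :: (killed_kernel _ _, _) :: _).
- by rewrite -[RHS](level_steps_time (- s)) subrr -map_comp.
- by ring.
- by ring.
- rewrite -[LHS](level_steps_time (- (r - s + de))) subrr -map_comp; congr level_steps.
  by apply: eq_map => p /=; rewrite addrK.
- by ring.
- by ring.
- rewrite -[LHS](level_steps_time (- (1 - s))) subrr -map_comp; congr level_steps.
  by rewrite -[RHS]map_id; apply: eq_map => -[u A] /=; rewrite addrK.
Qed.
End loop.

Section integral_monotonicity.
Context {R : realType} {d : measure_display} {T : measurableType d}.
Variable m : {measure set T -> \bar R}.
Implicit Types (A B D : set T) (f g : T -> \bar R).

(* The integral of a nonnegative function is a supremum over simple functions, so no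
   measurability is required. *)
Lemma le_ge0_integral D f g : (forall x, D x -> 0 <= f x)%E -> (forall x, D x -> f x <= g x)%E ->
  (\int[m]_(x in D) f x <= \int[m]_(x in D) g x)%E.
Proof.
move=> f0 fg; have g0 x : D x -> (0 <= g x)%E by move=> Dx; rewrite (le_trans (f0 _ Dx))// fg.
rewrite !ge0_integralE//; apply: le_ereal_sup => _ [h /= hf <-]; exists h => // x.
apply: (le_trans (hf x)); rewrite !patchE; case: ifPn => // /[!inE]; exact: fg.
Qed.

Lemma le_ge0_integral_subset A B f : A `<=` B -> (forall x, B x -> 0 <= f x)%E ->
  (\int[m]_(x in A) f x <= \int[m]_(x in B) f x)%E.
Proof.
move=> AB f0; rewrite integral_mkcond [leRHS]integral_mkcond; apply: le_ge0_integral => x _.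
  by rewrite patchE; case: ifPn => // /[!inE] /AB; exact: f0.
rewrite !patchE; case: ifPn => [/[!inE] /AB Bx|_]; first by rewrite mem_set.
by case: ifPn => // /[!inE]; exact: f0.
Qed.
End integral_monotonicity.

Section shifted_bridge.
Context {R : realType}.
Implicit Types (a s t x y z l e : R) (c : seq (R * set R)).
Local Notation mu := (@lebesgue_measure R).
Local Notation bm_mass := (bridge_mass (fun=> 1) (@bm_kernel R)).

Lemma bm_mass_shift e l y s x c : path <%R s (rcons (map fst c) l) -> borel_sets c ->
  bm_mass l (y + e) s (x + e) c =
  bm_mass l y s x [seq (p.1, shift_set (- e) p.2) | p <- c].
Proof.
elim: c s x => [|[t A] c ih] s x /=.
  by rewrite andbT => sl _; rewrite bm_kernel_shift// subr_gt0.
move=> /andP[st pc] /borel_sets_cons[mA mc].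
have mc' : borel_sets [seq (p.1, shift_set (- e) p.2) | p <- c].
  by apply: borel_sets_map => // p; exact: measurable_shift_set.
rewrite integral_shift_set//.
- apply: eq_integral => z _; rewrite -ih// subrK.
  by rewrite -[in RHS](bm_kernel_shift e) ?subr_gt0// subrK.
- apply: emeasurable_funM; last exact: measurable_bm_mass.
  apply/measurable_EFinP; apply: measurable_funM; last exact: measurable_cst.
  by apply: measurable_bm_kernel; [exact: measurable_cst|exact: measurable_cst|exact: measurable_id].
- move=> z; rewrite mule_ge0//; last exact: bm_mass_ge0.
  by rewrite lee_fin mulr1 bm_kernel_ge0.
Qed.

Lemma bridge_shift (d : measure_display) (T : measurableType d) (P : probability T R)
    l x y e (X : R -> T -> R) : 0 < l -> is_brownian_bridge P l x y X ->
  is_brownian_bridge P l (x + e) (y + e) (fun t o => X t o + e).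
Proof.
move=> l0 [mX cX X0 Xl fX]; split.
- by move=> t tl; apply: measurable_funD; [exact: mX|exact: measurable_cst].
- move=> o u; apply: cvgD; [exact: cX|exact: cvg_cst].
- by move=> o; rewrite X0.
- by move=> o; rewrite Xl.
- move=> c [pc mc] lc.
  pose c' := [seq (p.1, shift_set (- e) p.2) | p <- c].
  have c'1 : map fst c' = map fst c by rewrite -map_comp.
  have -> : cylinder (fun t o => X t o + e) c = cylinder X c'.
    rewrite /c'; elim: c {c' c'1 pc mc lc} => [|p c ih]; first by rewrite !cylinder_nil.
    by rewrite map_cons !cylinder_cons ih /shift_set/=; congr (_ `&` _); apply/seteqP; split => o /=; rewrite opprK.
  rewrite fX; last 2 first.
  - split; first by rewrite c'1.
    by apply: borel_sets_map => // p; exact: measurable_shift_set.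
  - by rewrite /last_time c'1.
  rewrite /brownian_bridge_fdd /bridge_fdd bm_mass_shift ?bm_kernel_shift//.
  by apply/path_rcons_lt; split.
Qed.
End shifted_bridge.

Section loop_probability.
Context {R : realType} {d : measure_display} {T : measurableType d}.
Variables (P : probability T R) (l de e s r : R) (ca cb c2 : seq (R * set R)).
Variable X : R -> T -> R.
Local Notation mu := (@lebesgue_measure R).
Hypotheses (de0 : 0 < de) (s0 : 0 < s) (sr : s < r).
Hypotheses (e0 : 0 < e) (el : e < l).
Hypothesis pa : path <%R 0 (rcons (map fst ca) s).
Hypothesis pb : path <%R s (rcons (map fst cb) r).
Hypothesis p2 : path <%R 0 (rcons (map fst c2) (1 - r - 2 * de)).
Hypotheses (ma : borel_sets ca) (mb : borel_sets cb) (m2 : borel_sets c2).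
Implicit Types x : R.

(** A difference of killed kernels counts the paths that respect the lower barrier and cross the
    higher one. This one locates the hitting time of the level [m + l], and [dip_kernel] the
    minimum. *)
Definition drop_kernel : R -> R -> R :=
  fun x y => killed_kernel 0 de x y - killed_kernel (l - e) de x y.
Definition dip_kernel : R -> R -> R :=
  fun x y => killed_kernel (- e) de x y - killed_kernel 0 de x y.

Lemma measurable_drop_kernel : measurable_fun setT (fun p : R * R => drop_kernel p.1 p.2).
Proof. by apply: measurable_funB; exact: measurable_killed_kernel. Qed.
Lemma measurable_dip_kernel : measurable_fun setT (fun p : R * R => dip_kernel p.1 p.2).
Proof. by apply: measurable_funB; exact: measurable_killed_kernel. Qed.
Lemma drop_kernel_ge0 x y : 0 <= drop_kernel x y.
Proof. by rewrite subr_ge0 killed_kernel_homo// subr_ge0 ltW. Qed.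
Lemma dip_kernel_ge0 x y : 0 <= dip_kernel x y.
Proof. by rewrite subr_ge0 killed_kernel_homo// oppr_le0 ltW. Qed.

Lemma good_loop_steps (k1 k2 : R -> R -> R) :
  measurable_fun setT (fun p : R * R => k1 p.1 p.2) -> (forall x y, 0 <= k1 x y) ->
  measurable_fun setT (fun p : R * R => k2 p.1 p.2) -> (forall x y, 0 <= k2 x y) ->
  good_steps (loop_steps l de s r ca cb c2 k1 k2).
Proof.
move=> mk1 k10 mk2 k20.
move/path_rcons_lt: pb => [pb1 pb2]; move/path_rcons_lt: pa => [pa1 pa2].
move/path_rcons_lt: p2 => [p21 p22].
have fstm e' (c : seq (R * set R)) : map fst [seq (p.1, shift_set e' p.2) | p <- c] = map fst c.
  by rewrite -map_comp.
have mm e' (c : seq (R * set R)) : borel_sets c -> borel_sets [seq (p.1, shift_set e' p.2) | p <- c].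
  by apply: borel_sets_map => // p; exact: measurable_shift_set.
apply/good_steps_cat; split; first by apply: good_level_steps; rewrite ?fstm//; exact: mm.
split; [by apply: measurable_killed_kernel|by move=> x y; rewrite killed_kernel_ge0// subr_gt0|exact: measurableT|].
split => //.
apply/good_steps_cat; split; first by apply: good_level_steps; rewrite ?fstm//; exact: mm.
split; [by apply: measurable_killed_kernel|by move=> x y; rewrite killed_kernel_ge0// subr_gt0|exact: measurableT|].
by split => //; exact: good_level_steps.
Qed.

Definition loop_event (X' : R -> T -> R) : set T :=
  barrier_event X' 1 l 0 (loop_barriers l de s r ca cb c2 0 (- e)) `\`
  (barrier_event X' 1 l 0 (loop_barriers l de s r ca cb c2 (l - e) (- e)) `|`
   barrier_event X' 1 l 0 (loop_barriers l de s r ca cb c2 0 0)).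

Definition loop_mass x : \bar R :=
  path_mass (fun u => (killed_kernel 0 (s - last 0 (map fst ca)) u (x - l))%:E)
    (loop_steps l de s r ca cb c2 drop_kernel dip_kernel) x.

(** Inclusion-exclusion over the levels of the two short intervals, each difference of kernels being
    expanded by linearity; written with sums because the terms are extended reals. *)
Lemma loop_mass_split x :
  let M al be := killed_mass 1 (x - l) l 0 x (loop_barriers l de s r ca cb c2 al be) in
  (M 0%R (- e)%R + M (l - e)%R 0%R = loop_mass x + (M (l - e)%R (- e)%R + M 0%R 0%R))%E.
Proof.
move=> M.
have ME al be : M al be = path_mass (fun u => (killed_kernel 0 (s - last 0 (map fst ca)) u (x - l))%:E)
    (loop_steps l de s r ca cb c2 (killed_kernel al de) (killed_kernel be de)) x.
  exact: loop_massE.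
have lca : 0 < s - last 0 (map fst ca) by rewrite subr_gt0; case/path_rcons_lt: pa.
pose F u : \bar R := (killed_kernel 0 (s - last 0 (map fst ca)) u (x - l))%:E.
have mF : measurable_fun setT F.
  by apply/measurable_EFinP; apply: measurable_killed_kernel; [exact: measurable_cst|exact: measurable_id|exact: measurable_cst].
have F0 u : (0 <= F u)%E by rewrite lee_fin killed_kernel_ge0.
have mk a : measurable_fun setT (fun p : R * R => killed_kernel a de p.1 p.2).
  exact: measurable_killed_kernel.
have k0 a (u v : R) : 0 <= killed_kernel a de u v by rewrite killed_kernel_ge0.
have split1 (k2 : R -> R -> R) : measurable_fun setT (fun p : R * R => k2 p.1 p.2) -> (forall x y, 0 <= k2 x y) ->
    path_mass F (loop_steps l de s r ca cb c2 (killed_kernel 0 de) k2) x =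
    (path_mass F (loop_steps l de s r ca cb c2 (killed_kernel (l - e) de) k2) x +
     path_mass F (loop_steps l de s r ca cb c2 drop_kernel k2) x)%E.
  move=> mk2 k20; rewrite /loop_steps.
  set c0 := level_steps l s _; set k0' := (killed_kernel l _, _); set c0' := level_steps 0 0 _ ++ _.
  have eq k : c0 ++ k0' :: (k, setT) :: c0' = (c0 ++ [:: k0']) ++ (k, setT) :: c0' by rewrite -catA.
  rewrite !eq; apply: path_mass_stepD => //.
  - by move=> u v; rewrite /drop_kernel; ring.
  - by rewrite -eq; apply: good_loop_steps.
  - by rewrite -eq; apply: good_loop_steps => //; [exact: measurable_drop_kernel|exact: drop_kernel_ge0].
have split2 : path_mass F (loop_steps l de s r ca cb c2 drop_kernel (killed_kernel (- e) de)) x =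
    (path_mass F (loop_steps l de s r ca cb c2 drop_kernel (killed_kernel 0 de)) x +
     path_mass F (loop_steps l de s r ca cb c2 drop_kernel dip_kernel) x)%E.
  rewrite /loop_steps.
  set c0 := level_steps l s _; set k0' := (killed_kernel l _, _); set c0' := level_steps 0 0 _.
  set k0'' := (killed_kernel 0 _, setT).
  have eq k : c0 ++ k0' :: (drop_kernel, setT) :: c0' ++ k0'' :: (k, setT) :: level_steps 0 0 ca =
     (c0 ++ k0' :: (drop_kernel, setT) :: c0' ++ [:: k0'']) ++ (k, setT) :: level_steps 0 0 ca.
    by rewrite -catA/= -catA.
  rewrite !eq; apply: path_mass_stepD => //.
  - by move=> u v; rewrite /dip_kernel; ring.
  - by rewrite -eq; apply: good_loop_steps => //; [exact: measurable_drop_kernel|exact: drop_kernel_ge0].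
  - rewrite -eq; apply: good_loop_steps; [exact: measurable_drop_kernel|exact: drop_kernel_ge0|exact: measurable_dip_kernel|exact: dip_kernel_ge0].
rewrite /loop_mass !ME (split1 (killed_kernel (- e) de))// (split1 (killed_kernel 0 de))// split2.
set a1 := path_mass _ _ _; set a2 := path_mass _ _ _; set a3 := path_mass _ _ _; set a4 := path_mass _ _ _.
by rewrite (addeCA a3) -addeA; congr (_ + _)%E; rewrite -addeA addeC -addeA.
Qed.

(** Each of the four barrier events has its killed mass, divided by the density of the bridge, as
    probability. The event for the levels [(l - e, 0)] is the intersection of the two that are
    removed, which matches [loop_mass_split]. *)
Lemma loop_event_prob x : is_brownian_bridge P 1 x (x - l) X ->
  measurable (loop_event X) /\
  P (loop_event X) = (loop_mass x * ((bm_kernel 1 x (x - l))^-1)%:E)%E.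
Proof.
move=> bX.
have bl al be := barrier_list_loop l de0 pa pb p2 ma mb m2 al be.
pose M al be := killed_mass 1 (x - l) l 0 x (loop_barriers l de s r ca cb c2 al be).
pose E al be := barrier_event X 1 l 0 (loop_barriers l de s r ca cb c2 al be).
pose q := ((bm_kernel 1 x (x - l))^-1)%:E.
have PE al be : measurable (E al be) /\ P (E al be) = (M al be * q)%E.
  have [lx|xl] := leP l x.
    by apply: (barrier_event_prob bX) => //; rewrite loop_barriers_level subr_ge0.
  (* For [x < l] the path starts below its first barrier: the event is empty and the mass
     vanishes. *)
  suff -> : E al be = set0.
    by split; [exact: measurable0|rewrite measure0 /M killed_mass0l// mul0e].
  rewrite -subset0 => o /(loop_eventP l pa pb p2)[[/(_ 0)]].
  by rewrite lexx subr_ge0 (ltW sr) (bb_start bX) => /(_ isT); rewrite leNgt xl.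
have fM al be : M al be \is a fin_num by exact: killed_mass_fin.
have EI : E (l - e) (- e) `&` E 0 0 = E (l - e) 0.
  have lE := loop_eventP l pa pb p2 X.
  apply/seteqP; split => o.
    by move=> [/lE[h1 h2 h3 h4 h5] /lE[g1 g2 g3 g4 g5]]; apply/lE; split.
  move=> /lE[h1 h2 h3 h4 h5]; split; apply/lE; split => //.
    by move=> u /h4; apply: le_trans; rewrite oppr_le0 ltW.
  by move=> u /h2; apply: le_trans; rewrite subr_ge0 ltW.
have EU : E (l - e) (- e) `|` E 0 0 `<=` E 0 (- e).
  have lE := loop_eventP l pa pb p2 X.
  move=> o [/lE[h1 h2 h3 h4 h5]|/lE[h1 h2 h3 h4 h5]]; apply/lE; split => //.
    by move=> u /h2; apply: le_trans; rewrite subr_ge0 ltW.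
  by move=> u /h4; apply: le_trans; rewrite oppr_le0 ltW.
have [m1 P1] := PE 0 (- e); have [m3 P3] := PE (l - e) (- e).
have [m4 P4] := PE 0 0; have [m5 P5] := PE (l - e) 0.
split; first by apply: measurableD => //; exact: measurableU.
have h : (M 0%R (- e)%R + M (l - e)%R 0%R = loop_mass x + (M (l - e)%R (- e)%R + M 0%R 0%R))%E.
  exact: loop_mass_split.
have hU : P (E (l - e) (- e) `|` E 0 0) =
    (P (E (l - e)%R (- e)%R) + P (E 0%R 0%R) - P (E (l - e)%R (- e)%R `&` E 0%R 0%R))%E.
  by apply: measureUfinl => //; rewrite (le_lt_trans (probability_le1 _ _)) ?ltry.
transitivity (P (E 0%R (- e)%R) - P (E (l - e)%R (- e)%R `|` E 0%R 0%R))%E.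
  rewrite /loop_event measureD//; first by rewrite (setIidr EU).
  - exact: measurableU.
  - by rewrite (le_lt_trans (probability_le1 _ _)) ?ltry.
rewrite hU EI P1 P3 P4 P5.
have fL : loop_mass x \is a fin_num.
  have : (loop_mass x + (M (l - e)%R (- e)%R + M 0%R 0%R))%E \is a fin_num by rewrite -h fin_numD !fM.
  by rewrite fin_numD => /andP[].
move: (fM 0%R (- e)) (fM (l - e) 0%R) (fM 0%R 0%R) (fM (l - e) (- e)) fL h.
case: (M 0 (- e)) => // a1 _; case: (M (l - e) 0) => // a2 _; case: (M 0 0) => // a3 _.
case: (M (l - e) (- e)) => // a4 _; case: (loop_mass x) => // a5 _.
rewrite /q -!EFinD -!EFinM => -[h]; congr EFin.
have -> : a1 = a5 + (a4 + a3) - a2 by rewrite -h addrK.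
by ring.
Qed.

Let L : R := 1 - r - 2 * de.
Let c2' := [seq (p.1, shift_set l p.2) | p <- c2].

Definition drop_return_mass w z : \bar R :=
  path_mass (fun u => (dip_kernel u w)%:E)
    ((drop_kernel, setT) :: level_steps 0 0 c2' ++
     [:: (killed_kernel 0 (L - last 0 (map fst c2)), setT)]) z.

Let mc2' : borel_sets c2'.
Proof. by apply: borel_sets_map => // p; exact: measurable_shift_set. Qed.
Let fc2' : map fst c2' = map fst c2.
Proof. by rewrite -map_comp. Qed.

Lemma good_return_steps : good_steps ((drop_kernel, setT) :: level_steps 0 0 c2' ++
     [:: (killed_kernel 0 (L - last 0 (map fst c2)), setT)]).
Proof.
move/path_rcons_lt: p2 => [p21 p22].
split; [exact: measurable_drop_kernel|exact: drop_kernel_ge0|exact: measurableT|].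
apply/good_steps_cat; split; first by apply: good_level_steps; rewrite ?fc2'.
split => //; first by apply: measurable_killed_kernel.
by move=> x y; rewrite killed_kernel_ge0// subr_gt0.
Qed.

Lemma measurable_dip_end w : measurable_fun setT (fun u => (dip_kernel u w)%:E).
Proof.
apply/measurable_EFinP.
apply: (measurable_comp_pair measurable_dip_kernel (f := idfun) (g := fun=> w)); first exact: measurable_id.
exact: measurable_cst.
Qed.

Lemma drop_return_mass_ge0 w z : (0 <= drop_return_mass w z)%E.
Proof. by apply: path_mass_ge0; [move=> u; rewrite lee_fin dip_kernel_ge0|exact: good_return_steps]. Qed.

Lemma measurable_drop_return_mass w : measurable_fun setT (drop_return_mass w).
Proof.
apply: measurable_path_mass; [exact: measurable_dip_end| |exact: good_return_steps].
by move=> u; rewrite lee_fin dip_kernel_ge0.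
Qed.

(** The kernel [k0] closes the path from its last constrained time to the end [x - l], identified
    with the start [x]; after a shift by [l] the excursion continues above [0]. Once the loop is cut
    at the end [w] of the dip and the time [s] is integrated out, [s] is left only in the splitting
    of [ca ++ cb], and this is what later produces the factor [r]. *)
Lemma integral_loop_mass :
  (\int[mu]_x loop_mass x =
   \int[mu]_w path_mass (fun z => drop_return_mass w (z + l)%R)
                (level_steps 0 0 (ca ++ cb ++ [:: (r, setT)])) w)%E.
Proof.
move/path_rcons_lt: (pa) => [pa1 pa2]; move/path_rcons_lt: (pb) => [pb1 pb2].
move/path_rcons_lt: (p2) => [p21 p22].
pose k0 : R -> R -> R := fun u x => killed_kernel 0 (s - last 0 (map fst ca)) u (x - l).
pose cb' := [seq (p.1, shift_set l p.2) | p <- cb].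
pose c1 := level_steps l s cb' ++ (killed_kernel l (r - last s (map fst cb)), setT) ::
  (drop_kernel, setT) :: level_steps 0 0 c2' ++ [:: (killed_kernel 0 (L - last 0 (map fst c2)), setT)].
have eq0 : loop_steps l de s r ca cb c2 drop_kernel dip_kernel = c1 ++ (dip_kernel, setT) :: level_steps 0 0 ca.
  by rewrite /loop_steps /c1 -catA/= -catA.
have gk0 : measurable_fun setT (fun p : R * R => k0 p.1 p.2).
  by apply: measurable_killed_kernel => //; exact: measurable_funB.
have gl : good_steps (c1 ++ (dip_kernel, setT) :: level_steps 0 0 ca).
  rewrite -eq0; apply: good_loop_steps.
  - exact: measurable_drop_kernel.
  - exact: drop_kernel_ge0.
  - exact: measurable_dip_kernel.
  - exact: dip_kernel_ge0.
have h := @loop_integral R k0 c1 dip_kernel (level_steps 0 0 ca).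
rewrite /loop_mass eq0 h {h}; last first.
  split => //.
  by move=> u x; rewrite killed_kernel_ge0// subr_gt0.
apply: eq_integral => /= w _; rewrite path_mass_cat.
have mb' : borel_sets (cb ++ [:: (r, setT)]).
  apply/borel_sets_cat; split => //; apply/borel_sets_cons; split; [exact: measurableT|exact: borel_sets_nil].
have pb' : path <%R s (map fst (cb ++ [:: (r, setT)])).
  by rewrite map_cat/= cats1.
have gb' : good_steps (level_steps 0 s (cb ++ [:: (r, setT)])) by exact: good_level_steps.
have mr : measurable_fun setT (fun z : R => drop_return_mass w (z + l)).
  apply: measurableT_comp; first exact: measurable_drop_return_mass.
  exact: measurable_funD.
have r0 z : (0 <= drop_return_mass w (z + l)%R)%E by exact: drop_return_mass_ge0.
transitivity (path_mass (fun z => drop_return_mass w (z + l)%R)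
    (level_steps 0 0 (ca ++ (s, setT) :: cb ++ [:: (r, setT)])) w); last first.
  have pab : path <%R 0 (map fst (ca ++ (s, setT) :: cb ++ [:: (r, setT)])).
    by rewrite map_cat cat_path pa1/= pa2.
  case: (cb) pab mb' => [|[t A] cb0] pab mb'/=.
    by apply: level_steps_insert => //; apply/borel_sets_cat.
  by apply: level_steps_insert => //; apply/borel_sets_cat.
rewrite level_steps_cat path_mass_cat/=.
congr (path_mass _ _ _); apply/funext => u.
pose G z := path_mass (fun z => drop_return_mass w (z + l)%R) (level_steps 0 s (cb ++ [:: (r, setT)])) z.
have mG : measurable_fun setT G by exact: measurable_path_mass.
have G0 z : (0 <= G z)%E by exact: path_mass_ge0.
have mk0u : measurable_fun setT (fun x => (k0 u x)%:E).
  apply/measurable_EFinP.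
  apply: (measurable_comp_pair gk0 (f := fun=> u) (g := idfun)); first exact: measurable_cst.
  exact: measurable_id.
have c1G x : path_mass (fun u => (dip_kernel u w)%:E) c1 x = G (x - l).
  have := @path_mass_shift_level R l 0 s (cb ++ [:: (r, setT)]) (drop_return_mass w) (x - l) pb' mb'
    (measurable_drop_return_mass w) (drop_return_mass_ge0 w).
  rewrite subrK /G => <-; rewrite add0r map_cat level_steps_cat/= path_mass_cat /c1 path_mass_cat/=.
  rewrite -map_comp/=.
  by congr (path_mass _ _ _).
under eq_integral do rewrite c1G.
rewrite -(integral_shift l (f := fun x : R => ((k0 u x)%:E * G (x - l)%R)%E)).
- by apply: eq_integral => z _; rewrite /k0 addrK.
- apply: emeasurable_funM => //; apply: measurableT_comp => //; exact: measurable_funB.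
- by move=> x; rewrite mule_ge0// lee_fin killed_kernel_ge0// subr_gt0.
Qed.

(** The factor [w * z] is the rate at which the killed mass of the excursion vanishes as both ends
    approach [0]; the Bessel mass keeps a limit there. *)
Definition outer_mass w z : \bar R := ((w * z)%:E * bes3_mass r z 0 w (ca ++ cb))%E.
Definition inner_mass y y' : \bar R := ((y * y')%:E * bes3_mass L y' 0 y c2')%E.

(** A lower bound obtained by monotonicity alone: the integrals are restricted to nonnegative
    positions, where the killed kernels have their Bessel form. *)
Lemma loop_mass_lower : (\int[mu]_(w in above 0) \int[mu]_(z in above 0)
     (outer_mass w z * \int[mu]_(y in above 0) ((drop_kernel (z + l) y)%:E *
        \int[mu]_(y' in above 0) (inner_mass y y' * (dip_kernel y' w)%:E)))
   <= \int[mu]_x loop_mass x)%E.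
Proof.
rewrite integral_loop_mass.
move/path_rcons_lt: (pa) => [pa1 pa2]; move/path_rcons_lt: (pb) => [pb1 pb2].
move/path_rcons_lt: (p2) => [p21 p22].
have pab : path <%R 0 (rcons (map fst (ca ++ cb)) r).
  rewrite map_cat rcons_cat cat_path pa1/=.
  case: (cb) pb => [|[t A] c0]/=; first by rewrite !andbT => _; exact: lt_trans pa2 sr.
  by move=> /andP[st ->]; rewrite andbT; exact: lt_trans pa2 st.
have mab : borel_sets (ca ++ cb) by apply/borel_sets_cat.
move/path_rcons_lt: (pab) => [pab1 pab2].
have p2' : path <%R 0 (rcons (map fst c2') L) by rewrite fc2'.
have p2'1 : path <%R 0 (map fst c2') by rewrite fc2'.
have gab : good_steps (level_steps 0 0 (ca ++ cb ++ [:: (r, setT)])).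
  apply: good_level_steps; first by rewrite catA map_cat cats1.
  rewrite catA; apply/borel_sets_cat; split => //.
  apply/borel_sets_cons; split; [exact: measurableT|exact: borel_sets_nil].
have mr w : measurable_fun setT (fun z : R => drop_return_mass w (z + l)).
  apply: measurableT_comp; first exact: measurable_drop_return_mass.
  exact: measurable_funD.
have r0 w z : (0 <= drop_return_mass w (z + l)%R)%E by exact: drop_return_mass_ge0.
have out0 w z : 0 <= w -> 0 <= z -> (0 <= outer_mass w z)%E.
  move=> w0 z0; rewrite mule_ge0 ?lee_fin ?mulr_ge0//.
  rewrite /bes3_mass bridge_massE; apply: path_mass_ge0; last exact: good_bes3_steps.
  by move=> u; rewrite lee_fin bes3_kernel_ge0// subr_gt0.
have inn0 y y' : 0 <= y -> 0 <= y' -> (0 <= inner_mass y y')%E.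
  move=> w0 z0; rewrite mule_ge0 ?lee_fin ?mulr_ge0//.
  rewrite /bes3_mass bridge_massE; apply: path_mass_ge0; last exact: good_bes3_steps.
  by move=> u; rewrite lee_fin bes3_kernel_ge0// subr_gt0 fc2'.
have I0 y w : 0 <= y -> (0 <= \int[mu]_(y' in above 0) (inner_mass y y' * (dip_kernel y' w)%:E))%E.
  by move=> y0; apply: integral_ge0 => y' /= y'0; rewrite mule_ge0 ?inn0// lee_fin dip_kernel_ge0.
have J0 z w : (0 <= \int[mu]_(y in above 0) ((drop_kernel (z + l) y)%:E *
        \int[mu]_(y' in above 0) (inner_mass y y' * (dip_kernel y' w)%:E)))%E.
  by apply: integral_ge0 => y /= y0; rewrite mule_ge0 ?I0// lee_fin drop_kernel_ge0.
have K0 w : 0 <= w -> (0 <= \int[mu]_(z in above 0) (outer_mass w z * \int[mu]_(y in above 0) ((drop_kernel (z + l)%R y)%:E *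
        \int[mu]_(y' in above 0) (inner_mass y y' * (dip_kernel y' w)%:E))))%E.
  by move=> w0; apply: integral_ge0 => z /= z0; rewrite mule_ge0 ?out0 ?J0.
apply: (@le_trans _ _ (\int[mu]_(w in above 0) path_mass (fun z => drop_return_mass w (z + l)%R)
                (level_steps 0 0 (ca ++ cb ++ [:: (r, setT)])) w)%E); last first.
  by apply: le_ge0_integral_subset => // w _; exact: path_mass_ge0.
apply: le_ge0_integral => /= w w0; first exact: K0.
rewrite catA level_steps_cat/=.
have rl : 0 < r - last 0 (map fst (ca ++ cb)) by rewrite subr_gt0.
have gab' : good_steps (level_steps 0 0 (ca ++ cb)) by exact: good_level_steps.
rewrite path_mass_rcons//; last first.
  by move: gab; rewrite catA level_steps_cat.
have pm0 z : (0 <= path_mass (fun u => (killed_kernel 0 (r - last 0 (map fst (ca ++ cb))) u z)%:E) (level_steps 0 0 (ca ++ cb)) w)%E.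
  by apply: path_mass_ge0 => // u; rewrite lee_fin killed_kernel_ge0.
apply: (@le_trans _ _ (\int[mu]_(z in above 0) (path_mass (fun u => (killed_kernel 0 (r - last 0 (map fst (ca ++ cb))) u z)%:E) (level_steps 0 0 (ca ++ cb)) w * drop_return_mass w (z + l)%R))%E); last first.
  by apply: le_ge0_integral_subset => // z _; rewrite mule_ge0.
apply: le_ge0_integral => /= z z0; first by rewrite mule_ge0 ?out0.
rewrite killed_path_bes3//; apply: lee_wpmul2l; first exact: out0.
have mF := measurable_dip_end w.
have F0 u : (0 <= (dip_kernel u w)%:E)%E by rewrite lee_fin dip_kernel_ge0.
set c3 : seq (@step R) := level_steps 0 0 c2' ++ [:: (killed_kernel 0 (L - last 0 (map fst c2)), setT)].
pose F (y : R) := ((drop_kernel (z + l) y)%:E * path_mass (fun u => (dip_kernel u w)%:E) c3 y)%E.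
have -> : drop_return_mass w (z + l) = (\int[mu]_y F y)%E by [].
apply: (@le_trans _ _ (\int[mu]_(y in above 0) F y)%E); last first.
  apply: le_ge0_integral_subset => // y _; rewrite mule_ge0 ?lee_fin ?drop_kernel_ge0//.
  by apply: path_mass_ge0 => //; case: good_return_steps.
apply: le_ge0_integral => /= y y0; first by rewrite mule_ge0 ?I0// lee_fin drop_kernel_ge0.
apply: lee_wpmul2l; first by rewrite lee_fin drop_kernel_ge0.
rewrite path_mass_rcons//; last by case: good_return_steps.
have lL : 0 < L - last 0 (map fst c2) by rewrite subr_gt0.
have gc2' : good_steps (level_steps 0 0 c2') by exact: good_level_steps.
have pm0' y' : (0 <= path_mass (fun u => (killed_kernel 0 (L - last 0 (map fst c2)) u y')%:E) (level_steps 0 0 c2') y)%E.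
  by apply: path_mass_ge0 => // u; rewrite lee_fin killed_kernel_ge0.
apply: (@le_trans _ _ (\int[mu]_(y' in above 0) (path_mass (fun u => (killed_kernel 0 (L - last 0 (map fst c2)) u y')%:E) (level_steps 0 0 c2') y * (dip_kernel y' w)%:E))%E); last first.
  by apply: le_ge0_integral_subset => // y' _; rewrite mule_ge0.
apply: le_ge0_integral => /= y' y'0; first by rewrite mule_ge0 ?inn0.
by rewrite /inner_mass -fc2' killed_path_bes3.
Qed.
End loop_probability.

(** * Gaussian integrals *)

Section gaussian_moments.
Context {R : realType}.
Implicit Types (h u v w x y z : R).
Local Notation mu := (@lebesgue_measure R).
Local Notation g := (bm_kernel 1 (0 : R)).

Lemma bm_kernel_scale h x y : 0 < h -> bm_kernel (h ^+ 2) (h * x) (h * y) = h^-1 * bm_kernel 1 x y.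
Proof.
move=> h0; rewrite !bm_kernelE ?exprn_gt0//.
have -> : 2 * pi * h ^+ 2 = h ^+ 2 * (2 * pi * 1) by ring.
have -> : (h * y - h * x) ^+ 2 / (2 * h ^+ 2) = (y - x) ^+ 2 / (2 * 1) by field; rewrite gt_eqF.
by rewrite sqrtrM ?sqr_ge0// sqrtr_sqr gtr0_norm// invfM mulrA.
Qed.

Lemma bm_kernel1E : g = fun y => (Num.sqrt (2 * pi))^-1 * expR (- (y ^+ 2 / 2)).
Proof. by apply/funext => y; rewrite bm_kernelE// subr0 !mulr1. Qed.

Lemma bm_kernel1N y : g (- y) = g y.
Proof. by rewrite bm_kernel1E sqrrN. Qed.

Lemma is_derive_bm_kernel1 y : is_derive y 1 g (- y * g y).
Proof.
rewrite bm_kernel1E; set c := (_^-1).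
have h1 : is_derive y 1 (fun y : R => - (y ^+ 2 / 2)) (- y).
  have -> : (fun y : R => - (y ^+ 2 / 2)) = (- 2^-1 : R) \*: (fun y : R => y ^+ 2).
    by apply/funext => u; rewrite /= /GRing.scale/=; ring.
  have := is_deriveZ (- 2^-1) (is_deriveX 2 (is_derive_id y 1)).
  have -> : (@id R ^+ 2)%R = (fun y : R => y ^+ 2) by apply/funext => u; rewrite expr2.
  by move=> h; apply: is_derive_eq; rewrite /GRing.scale/= expr1; field.
have h2 := is_derive1_comp (is_derive_expR _) h1.
have := is_deriveZ c h2.
by move=> h3; apply: is_derive_eq; rewrite /GRing.scale/=; ring.
Qed.

Lemma bm_kernel1_le y : g y <= (Num.sqrt (2 * pi))^-1 * expR 1 * expR (- y).
Proof.
rewrite bm_kernel1E -mulrA -expRD ler_wpM2l ?invr_ge0 ?sqrtr_ge0// ler_expR.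
by have := sqr_ge0 (y - 1); rewrite sqrrB1; lra.
Qed.

Lemma cvg_bm_kernel1 : g y @[y --> +oo] --> 0.
Proof.
apply: (@squeeze_cvgr _ _ _ _ (fun=> 0) (fun y => (Num.sqrt (2 * pi))^-1 * expR 1 * expR (- y))).
- by near=> y; rewrite bm_kernel_ge0 bm_kernel1_le.
- exact: cvg_cst.
- by rewrite -[X in _ --> X](mulr0 ((Num.sqrt (2 * pi))^-1 * expR 1)); apply: cvgMr; exact: cvgr_expR.
Unshelve. all: by end_near. Qed.

Lemma continuous_bm_kernel1 : continuous g.
Proof.
move=> y; apply: differentiable_continuous; apply/derivable1_diffP.
by case: (is_derive_bm_kernel1 y).
Qed.

Lemma integral_bm_kernel1_tail v : 0 <= v ->
  (\int[mu]_(y in above v) (y * g y)%:E = (g v)%:E)%E.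
Proof.
move=> v0.
have -> : above v = `[v, +oo[%classic.
  by apply/seteqP; split => y; rewrite /above/= in_itv/= andbT.
have d y : is_derive y 1 (fun y => - g y) (y * g y).
  have := is_deriveN (is_derive_bm_kernel1 y); rewrite mulNr opprK; exact.
rewrite (@ge0_continuous_FTC2y _ _ (fun y => - g y) _ 0).
- by rewrite sub0e -EFinN opprK.
- by move=> y vy; rewrite mulr_ge0 ?bm_kernel_ge0// (le_trans v0).
- apply: continuous_subspaceT => y; apply: cvgM; first exact: cvg_id.
  exact: continuous_bm_kernel1.
- rewrite -[X in _ --> X]oppr0; apply: cvgN; exact: cvg_bm_kernel1.
- by move=> y _; case: (d y).
- apply: cvg_at_right_filter; apply: cvgN; exact: continuous_bm_kernel1.
- by move=> y _; rewrite derive1E; have [_ ->] := d y.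
Qed.

Lemma measurable_bm_kernel1 w : measurable_fun setT (fun y => g (y + w)).
Proof. by apply: measurable_bm_kernel; [exact: measurable_cst|exact: measurable_cst|exact: measurable_funD]. Qed.

Lemma integral_ge_shift (f : R -> \bar R) a w : measurable_fun setT f -> (forall x, 0 <= f x)%E ->
  (\int[mu]_(y in above a) f (y + w)%R = \int[mu]_(y in above (a + w)) f y)%E.
Proof.
move=> mf f0; rewrite -integral_shift_set//; last exact: measurable_above.
by congr (integral _ _ _); apply/seteqP; split => y; rewrite /shift_set/above/= lerBrDr.
Qed.

Lemma integral_first_moment : (\int[mu]_(y in above 0) (g y)%:E = (2^-1)%:E)%E.
Proof.
have := @ge0_symfun_integralT R g (fun x => bm_kernel_ge0 _ _ _) continuous_bm_kernel1.
move=> /(_ _)/wrap[]; first by move=> x /=; rewrite bm_kernel1N.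
rewrite integral_bm_kernel -/(above 0).
case: (integral _ _ _) => [r| |]//=.
- by rewrite -EFinM => -[h]; congr EFin; lra.
- by rewrite mulry gtr0_sg// mul1e.
- by rewrite mulrNy gtr0_sg// mul1e.
Qed.

Lemma measurable_first_moment : measurable_fun setT (fun u => `|u * g u|%:E).
Proof.
apply/measurable_EFinP; apply: measurableT_comp => //; apply: measurable_funM => //.
by have := measurable_bm_kernel1 0; under eq_fun do rewrite addr0.
Qed.

Lemma ge0_integral_aboveD (a : R) (f1 f2 : R -> \bar R) :
  measurable_fun setT f1 -> measurable_fun setT f2 ->
  (forall x, 0 <= f1 x)%E -> (forall x, 0 <= f2 x)%E ->
  (\int[mu]_(x in above a) (f1 x + f2 x) =
   \int[mu]_(x in above a) f1 x + \int[mu]_(x in above a) f2 x)%E.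
Proof.
move=> mf1 mf2 f10 f20; apply: ge0_integralD => //; first exact: measurable_above.
- exact: measurable_funTS.
- exact: measurable_funTS.
Qed.

Definition upper_mass w : \bar R := (\int[mu]_(y in above 0) (g (y + w))%:E)%E.

Lemma integral_upper_abs w : 0 <= w ->
  (\int[mu]_y (g (w + `|y|))%:E = 2%:E * upper_mass w)%E.
Proof.
move=> w0; rewrite ge0_symfun_integralT; first last.
- by move=> y /=; rewrite normrN.
- move=> y; apply: (@continuous_comp _ _ _ (fun y : R => w + `|y|) g); last exact: continuous_bm_kernel1.
  by apply: cvgD; [exact: cvg_cst|exact: norm_continuous].
- by move=> y; exact: bm_kernel_ge0.
congr (_ * _)%E; apply: eq_integral => y /[!inE] y0.
by rewrite ger0_norm// addrC.
Qed.

(** Write the factor [y] as the integral of [1] over [[0, y]] and exchange the integrals: that of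
    [u * g u] beyond [x + w] is [g (x + w)]. *)
Lemma integral_dip_profile w : 0 <= w ->
  (\int[mu]_(y in above 0) (y * ((y + w) * g (y + w)))%:E = upper_mass w)%E.
Proof.
move=> w0.
have m0 := measurable_above (0 : R).
pose k y := (y + w) * g (y + w).
have mk : measurable_fun setT k.
  by apply: measurable_funM; [exact: measurable_funD|exact: measurable_bm_kernel1].
have k0 y : 0 <= y -> 0 <= k y by move=> y0; rewrite mulr_ge0 ?addr_ge0 ?bm_kernel_ge0.
have mk' : measurable_fun setT (fun y => `|k y|) by exact: measurableT_comp.
pose f (p : R * R) : \bar R := (`|k p.2| * \1_[set p : R * R | p.1 <= p.2] p)%:E.
have mf : measurable_fun setT f.
  apply/measurable_EFinP; apply: measurable_funM; first exact: (measurableT_comp mk').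
  apply: measurable_indic; rewrite -[X in measurable X]setTI.
  by apply: measurable_fun_le.
have f0 p : (0 <= f p)%E by rewrite lee_fin mulr_ge0.
transitivity (\int[mu]_(y in above 0) \int[mu]_(x in above 0) f (x, y))%E.
  apply: eq_integral => /= y /[!inE] y0.
  transitivity (\int[mu]_(x in above 0) ((k y)%:E * (\1_(`[0, y]%classic : set R) x)%:E))%E.
    rewrite ge0_integralZl_EFin//; last 2 first.
    - by apply: measurable_funTS; apply/measurable_EFinP; exact: measurable_indic.
    - by rewrite k0.
    rewrite integral_indic// setIidl; last by move=> x /=; rewrite in_itv/= => /andP[].
    have my : lebesgue_measure (`[0, y]%classic : set R) = y%:E.
      rewrite lebesgue_measure_itv/= lte_fin; case: ifPn => [_|]; first by rewrite sube0.
      by rewrite -leNgt => y0'; congr EFin; apply/eqP; rewrite eq_le y0' y0.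
    transitivity ((k y)%:E * y%:E)%E; first by rewrite -EFinM mulrC.
    by congr (_ * _)%E; rewrite -my.
  apply: eq_integral => x /[!inE] x0; rewrite /f/= (ger0_norm (k0 _ y0)) -EFinM; congr (_ * _)%:E.
  rewrite !indicE; congr ((nat_of_bool _)%:R).
  by apply/idP/idP; rewrite !inE/= in_itv/= (_ : 0 <= x).
rewrite (tonelli_set mu mu m0 m0 (g := fun p => f (p.2, p.1)))//; last first.
  exact: (measurable_comp_pair mf).
rewrite /upper_mass; apply: eq_integral => /= x /[!inE] x0.
rewrite -(integral_bm_kernel1_tail (v := x + w)) ?addr_ge0//.
pose K : R -> \bar R := fun u => `|u * g u|%:E.
have mK : measurable_fun setT K := measurable_first_moment.
have K0 u : (0 <= K u)%E by rewrite lee_fin.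
transitivity (\int[mu]_(u in above (x + w)) K u)%E; last first.
  apply: eq_integral => u /[!inE] xu; rewrite /K ger0_norm// mulr_ge0 ?bm_kernel_ge0//.
  by apply: le_trans xu; rewrite addr_ge0.
rewrite -(integral_ge_shift x w mK K0) integral_mkcond [RHS]integral_mkcond.
apply: eq_integral => y _; rewrite !patchE /f indicE.
have [xy|yx] := leP x y.
  by rewrite !mem_set ?mulr1//= /above/= (le_trans x0).
rewrite [(x, y) \in _]memNset/= ?mulr0; last by rewrite leNgt yx.
rewrite [y \in above x]memNset/=; first by case: ifP.
by rewrite /above/= leNgt yx.
Qed.

Lemma measurable_upper_mass : measurable_fun setT upper_mass.
Proof.
apply: (@measurable_integral_param _ _ _ (above 0) (fun p : R * R => (g (p.2 + p.1))%:E)).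
- exact: measurable_above.
- apply/measurable_EFinP; apply: measurable_bm_kernel; [exact: measurable_cst|exact: measurable_cst|exact: measurable_funD].
- by move=> p; rewrite lee_fin bm_kernel_ge0.
Qed.

Lemma integral_norm_first_moment w : 0 <= w ->
  (\int[mu]_(y in above w) `|y * g y|%:E = (g w)%:E)%E.
Proof.
move=> w0; rewrite -(integral_bm_kernel1_tail w0).
apply: eq_integral => u /[!inE] wu; rewrite ger0_norm//.
by rewrite mulr_ge0 ?bm_kernel_ge0// (le_trans w0).
Qed.

Lemma integral_first_moment_split w : 0 <= w ->
  (\int[mu]_(y in above 0) (`|w| * g (y + w))%:E +
   \int[mu]_(y in above 0) (`|y| * g (w + y))%:E = (g w)%:E)%E.
Proof.
move=> w0.
have m1 : measurable_fun setT (fun y : R => (`|w| * g (y + w))%:E).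
  by apply/measurable_EFinP; apply: measurable_funM; [exact: measurable_cst|exact: measurable_bm_kernel1].
have m2 : measurable_fun setT (fun y : R => (`|y| * g (w + y))%:E).
  apply/measurable_EFinP; apply: measurable_funM; first exact: normr_measurable.
  by under eq_fun do rewrite addrC; exact: measurable_bm_kernel1.
have p1 (y : R) : (0 <= (`|w| * g (y + w))%:E)%E by rewrite lee_fin mulr_ge0 ?bm_kernel_ge0.
have p2 (y : R) : (0 <= (`|y| * g (w + y))%:E)%E by rewrite lee_fin mulr_ge0 ?bm_kernel_ge0.
rewrite -(ge0_integral_aboveD 0 m1 m2 p1 p2) -(integral_norm_first_moment w0).
have K0 u : (0 <= `|u * g u|%:E)%E by rewrite lee_fin.
rewrite -[in RHS](add0r w) -(integral_ge_shift 0 w measurable_first_moment K0).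
apply: eq_integral => y /[!inE] y0.
rewrite !ger0_norm// ?mulr_ge0 ?addr_ge0 ?bm_kernel_ge0//.
by rewrite -EFinD (addrC w y); congr EFin; ring.
Qed.

(** The double integral of [w * g (y + w)] over the quadrant is symmetric in [w] and [y]. Twice it
    is the integral of [(w + y) * g (w + y)], whose inner integral is [g w] and whose total is
    [1 / 2]. *)
Lemma integral_upper_mass : (\int[mu]_(w in above 0) (w%:E * upper_mass w) = (4^-1)%:E)%E.
Proof.
have half (t : \bar R) : (t + t = (2^-1)%:E -> t = (4^-1)%:E)%E.
  by case: t => [t| |]//; rewrite -EFinD => -[h]; congr EFin; lra.
have m0 := measurable_above (0 : R).
pose f (p : R * R) : \bar R := (`|p.1| * g (p.2 + p.1))%:E.
have mg (a b : R * R -> R) : measurable_fun setT a -> measurable_fun setT b ->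
    measurable_fun setT (fun p => g (a p + b p)).
  by move=> ma mb; apply: measurable_bm_kernel; [exact: measurable_cst|exact: measurable_cst|exact: measurable_funD].
have mf : measurable_fun setT f.
  apply/measurable_EFinP; apply: measurable_funM; last exact: mg.
  exact: (measurableT_comp (@normr_measurable R setT)).
have f0 p : (0 <= f p)%E by rewrite lee_fin mulr_ge0 ?bm_kernel_ge0.
pose I := (\int[mu]_(w in above 0) \int[mu]_(y in above 0) f (w, y))%E.
have I1 : (\int[mu]_(w in above 0) (w%:E * upper_mass w) = I)%E.
  apply: eq_integral => /= w /[!inE] w0.
  rewrite -ge0_integralZl_EFin//.
  - by apply: eq_integral => y _; rewrite /f/= ger0_norm// EFinM.
  - by move=> y _; rewrite lee_fin bm_kernel_ge0.
  - by apply: measurable_funTS; apply/measurable_EFinP; exact: measurable_bm_kernel1.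
have I2 : I = (\int[mu]_(w in above 0) \int[mu]_(y in above 0) f (y, w))%E.
  exact: (tonelli_set mu mu m0 m0 mf f0).
have I3 : (I + I = (2^-1)%:E)%E.
  pose J1 : R -> \bar R := fun w => (\int[mu]_(y in above 0) f (w, y))%E.
  pose J2 : R -> \bar R := fun w => (\int[mu]_(y in above 0) f (y, w))%E.
  have mJ1 : measurable_fun setT J1 by exact: (@measurable_integral_param _ _ _ (above 0) f m0 mf f0).
  have mJ2 : measurable_fun setT J2.
    have mf' : measurable_fun setT (fun p : R * R => f (p.2, p.1)).
      exact: (measurable_comp_pair mf measurable_snd measurable_fst).
    exact: (@measurable_integral_param _ _ _ (above 0) (fun p => f (p.2, p.1)) m0 mf' (fun p => f0 _)).
  transitivity (\int[mu]_(w in above 0) (J1 w + J2 w))%E.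
    have J10 w : (0 <= J1 w)%E by apply: integral_ge0.
    have J20 w : (0 <= J2 w)%E by apply: integral_ge0.
    apply: etrans (f_equal (fun t => I + t)%E I2) _; apply/esym.
    exact: (ge0_integral_aboveD 0 mJ1 mJ2 J10 J20).
  rewrite -integral_first_moment; apply: eq_integral => w /[!inE] w0.
  exact: integral_first_moment_split.
rewrite I1; exact: (half _ I3).
Qed.
End gaussian_moments.

(** * Brownian scaling on the two short intervals *)

Section window_profile.
Context {R : realType}.
Implicit Types (h l u v w x y z : R) (n : nat).
Local Notation mu := (@lebesgue_measure R).
Local Notation g := (bm_kernel 1 (0 : R)).

Definition mesh n : R := n.+1%:R^-1.

Lemma mesh_gt0 n : 0 < mesh n.
Proof. by rewrite /mesh invr_gt0. Qed.

Lemma cvg_mesh : mesh @ \oo --> 0.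
Proof. exact: cvg_invS. Qed.

Lemma near_mesh_affine l y : 0 < l -> \forall n \near \oo, 0 <= mesh n * y + l.
Proof.
move=> l0; have [y0|y0] := leP 0 y.
  by near=> n; rewrite addr_ge0 ?(ltW l0)// mulr_ge0// ltW// mesh_gt0.
have ly : 0 < l / - y by rewrite divr_gt0// oppr_gt0.
near=> n; rewrite -lerBlDr sub0r -[leRHS]opprK lerN2 -mulrN.
rewrite -ler_pdivlMr ?oppr_gt0//; apply: ltW; near: n.
by apply: (cvgr_lt (0 : R)) => //; exact: cvg_mesh.
Unshelve. all: by end_near. Qed.

(** With time [h ^ 2], positions of order [h] and a barrier lowered by [h ^ 2] only, the dip kernel
    is the quotient [(g a - g (a + 2 h)) / h] with [a = y + w]. This is a lower bound for it, with
    the same limit [2 a g a], that is, minus twice the derivative of [g]. *)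
Definition dip_profile h y w := 2 * ((y + w) * g (y + w + 2 * h)).
Definition drop_profile l h z y := h * drop_kernel l (h ^+ 2) (h ^+ 2) (h * z + l) (h * y + l).

Lemma bm_kernel_scale0 h a : 0 < h -> bm_kernel (h ^+ 2) 0 (h * a) = h^-1 * g a.
Proof. by move=> h0; rewrite -bm_kernel_scale// mulr0. Qed.

Lemma bm_kernel_diff t x y : 0 < t -> bm_kernel t x y = bm_kernel t 0 (y - x).
Proof. by move=> t0; rewrite -(bm_kernel_shift (- x))// subrr. Qed.

Lemma dip_profile_le h y w : 0 < h -> 0 <= y -> 0 <= w ->
  dip_profile h y w <= dip_kernel (h ^+ 2) (h ^+ 2) (h * y) (h * w).
Proof.
move=> h0 y0 w0; rewrite /dip_profile /dip_kernel.
have hh : 0 < h ^+ 2 by rewrite exprn_gt0.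
have hy : 0 <= h * y by rewrite mulr_ge0// ltW.
have hw : 0 <= h * w by rewrite mulr_ge0// ltW.
rewrite !killed_kernelE//; last 2 first.
- by rewrite (le_trans _ hy)// oppr_le0 ltW.
- by rewrite (le_trans _ hw)// oppr_le0 ltW.
have abc (a b c : R) : a - b - (a - c) = c - b by ring.
rewrite abc mulr0 sub0r.
set a := y + w.
have -> : bm_kernel (h ^+ 2) (h * y) (- (h * w)) = h^-1 * g a.
  rewrite bm_kernel_diff// -bm_kernelN// oppr0 (_ : - _ = h * a) ?bm_kernel_scale0//.
  by rewrite /a; ring.
have -> : bm_kernel (h ^+ 2) (h * y) (2 * - h ^+ 2 - h * w) = h^-1 * g (a + 2 * h).
  rewrite bm_kernel_diff// -bm_kernelN// oppr0 (_ : - _ = h * (a + 2 * h)) ?bm_kernel_scale0//.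
  by rewrite /a; ring.
have a0 : 0 <= a by rewrite addr_ge0.
rewrite -mulrBr ler_pdivlMl//.
(* The ratio of [g a] to [g (a + 2 h)] is [exp (2 h a + 2 h ^ 2)], which is at least [1 + 2 h a]. *)
suff : (1 + 2 * h * a) * g (a + 2 * h) <= g a by rewrite -/a; lra.
rewrite !bm_kernel1E mulrCA ler_wpM2l ?invr_ge0 ?sqrtr_ge0//.
apply: (@le_trans _ _ (expR (2 * h * a) * expR (- ((a + 2 * h) ^+ 2 / 2)))).
  by rewrite ler_wpM2r ?expR_ge0// expR_ge1Dx.
rewrite -expRD ler_expR.
have -> : 2 * h * a - (a + 2 * h) ^+ 2 / 2 = - (a ^+ 2 / 2) - 2 * h ^+ 2 by field.
by rewrite gerBl mulr_ge0// ltW.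
Qed.

Lemma measurable_dip_profile h : measurable_fun setT (fun p : R * R => dip_profile h p.1 p.2).
Proof.
apply: measurable_funM; first exact: measurable_cst.
have m12 : measurable_fun setT (fun p : R * R => p.1 + p.2) by exact: measurable_funD.
apply: measurable_funM => //; apply: measurable_bm_kernel; [exact: measurable_cst|exact: measurable_cst|].
by apply: measurable_funD => //; exact: measurable_cst.
Qed.

Lemma cvg_dip_profile y w : (fun n => dip_profile (mesh n) y w) @ \oo --> 2 * ((y + w) * g (y + w)).
Proof.
apply: cvgMr; apply: cvgMr; apply: cvg_bm_kernel => //; [exact: cvg_cst|exact: cvg_cst|].
rewrite -[X in _ --> X]addr0; apply: cvgD; first exact: cvg_cst.
by rewrite -[X in _ --> X](mulr0 2); apply: cvgMr; exact: cvg_mesh.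
Qed.

Lemma drop_profile_ge0 l h z y : 0 < h -> h ^+ 2 <= l -> 0 <= drop_profile l h z y.
Proof.
move=> h0 hl; rewrite mulr_ge0 ?(ltW h0)// subr_ge0 killed_kernel_homo ?exprn_gt0//.
by rewrite subr_ge0.
Qed.

(** If [y >= 0] the path has to cross [l - h ^ 2], and reflection gives the distance [z + y + 2 h];
    if [y < - h] the crossing is automatic. The subtracted term is the reflection at the far barrier
    [0], negligible for small [h]. A given [y] avoids the intermediate values as soon as [h] is
    small. *)
Lemma drop_profileE l h z y : 0 < h -> 0 <= z -> h ^+ 2 < l -> 0 <= h * y + l ->
  y < - h \/ 0 <= y ->
  drop_profile l h z y =
  g (z + `|y| + (if 0 <= y then 2 * h else 0)) - g ((2 * l + h * z + h * y) / h).
Proof.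
move=> h0 z0 hl y0 yh; rewrite /drop_profile /drop_kernel.
have hh : 0 < h ^+ 2 by rewrite exprn_gt0.
have hz : 0 <= h * z by rewrite mulr_ge0// ltW.
have l0 : 0 < l := lt_trans hh hl.
rewrite killed_kernelE//; last by rewrite addr_ge0// ltW.
have e1 : h * bm_kernel (h ^+ 2) (h * z + l) (2 * 0 - (h * y + l)) = g ((2 * l + h * z + h * y) / h).
  rewrite bm_kernel_diff// -bm_kernelN// oppr0.
  rewrite (_ : - _ = h * ((2 * l + h * z + h * y) / h)); last by field; rewrite gt_eqF.
  by rewrite bm_kernel_scale0// mulVKf ?gt_eqF.
have [y0'|yn] := leP 0 y.
  rewrite killed_kernelE; last 2 first.
  - by rewrite lerBlDr (le_trans (_ : l <= h * z + l))// ?lerDr// lerDl ltW.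
  - by rewrite lerBlDr (le_trans (_ : l <= h * y + l))// ?lerDr ?mulr_ge0// ?(ltW h0)// lerDl ltW.
  have abc (a b c : R) : a - b - (a - c) = c - b by ring.
  rewrite abc mulrBr e1; congr (_ - _).
  rewrite bm_kernel_diff// -bm_kernelN// oppr0 ger0_norm//.
  rewrite (_ : - _ = h * (z + y + 2 * h)); last by ring.
  by rewrite bm_kernel_scale0// mulVKf ?gt_eqF.
case: yh => [yh|]; last by rewrite leNgt yn.
rewrite killed_kernel0r ?subr0; last first.
  by rewrite addrC ltrD2l expr2 -mulrN ltr_pM2l.
rewrite mulrBr e1; congr (_ - _).
rewrite bm_kernel_diff// -bm_kernelN// oppr0 ltr0_norm// addr0.
rewrite (_ : - _ = h * (z - y)); last by ring.
by rewrite bm_kernel_scale0// mulVKf ?gt_eqF.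
Qed.

Lemma cvg_drop_profile l z y : 0 < l -> 0 <= z ->
  (fun n => drop_profile l (mesh n) z y) @ \oo --> g (z + `|y|).
Proof.
move=> l0 z0.
pose a n := g (z + `|y| + (if 0 <= y then 2 * mesh n else 0)).
pose b n := g ((2 * l + mesh n * z + mesh n * y) / mesh n).
have ca : a @ \oo --> g (z + `|y|).
  apply: cvg_bm_kernel => //; [exact: cvg_cst|exact: cvg_cst|].
  rewrite -[X in _ --> X]addr0; apply: cvgD; first exact: cvg_cst.
  have [y0|y0] := boolP (0 <= y); last exact: cvg_cst.
  by rewrite -[X in _ --> X](mulr0 2); apply: cvgMr; exact: cvg_mesh.
have small (c : R) : 0 < c -> \forall n \near \oo, mesh n < c.
  by move=> c0; apply: (cvgr_lt (0 : R)) => //; exact: cvg_mesh.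
have hy : \forall n \near \oo, mesh n * `|y| <= l.
  near=> n; apply: le_trans (_ : mesh n * (`|y| + 1) <= l).
    by rewrite ler_wpM2l ?(ltW (mesh_gt0 n))// lerDl.
  rewrite -ler_pdivlMr ?ltr_wpDl//; apply: ltW; near: n; apply: small.
  by rewrite divr_gt0// ltr_wpDl.
have hyl n : mesh n * `|y| <= l -> - l <= mesh n * y.
  move=> h; rewrite lerNl (le_trans _ h)// -mulrN ler_wpM2l ?(ltW (mesh_gt0 n))//.
  by rewrite -normrN ler_norm.
have cb : b @ \oo --> 0.
  (* At a distance of at least [l / mesh n] the Gaussian density is at most a constant times the
     inverse of that distance. *)
  pose C := (Num.sqrt (2 * pi))^-1 * expR 1 / l.
  apply: (@squeeze_cvgr _ _ _ _ (fun=> 0) (fun n => C * mesh n)).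
  - near=> n; rewrite bm_kernel_ge0/= /b; set x := _ / _.
    have xl : l / mesh n <= x.
      rewrite ler_wpM2r ?invr_ge0 ?(ltW (mesh_gt0 n))//.
      have := hyl n; have : mesh n * `|y| <= l by near: n.
      have : 0 <= mesh n * z by rewrite mulr_ge0// ltW ?mesh_gt0.
      by move=> h1 h2 /(_ h2); lra.
    have lm : 0 < l / mesh n by rewrite divr_gt0 ?mesh_gt0.
    apply: (le_trans (bm_kernel1_le _)).
    rewrite /C -[leRHS]mulrA ler_wpM2l ?mulr_ge0 ?invr_ge0 ?sqrtr_ge0 ?expR_ge0//.
    rewrite expRN (_ : l^-1 * mesh n = (l / mesh n)^-1); last by rewrite invf_div mulrC.
    rewrite lef_pV2 ?posrE ?expR_gt0//; apply: (le_trans xl).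
    by apply: le_trans (expR_ge1Dx x); rewrite lerDr.
  - exact: cvg_cst.
  - by rewrite -[X in _ --> X](mulr0 C); apply: cvgMr; exact: cvg_mesh.
have hyn : \forall n \near \oo, y < - mesh n \/ 0 <= y.
  have [y0|y0] := leP 0 y; first by near=> n; right.
  by near=> n; left; rewrite ltrNr; near: n; apply: small; rewrite oppr_gt0.
have : (a - b) @ \oo --> g (z + `|y|) - 0 by apply: cvgB.
rewrite subr0; apply: cvg_trans; apply: near_eq_cvg; near=> n.
apply/esym; apply: drop_profileE => //; first exact: mesh_gt0.
- rewrite expr2 (le_lt_trans (_ : _ <= 1 * mesh n))//.
    by rewrite ler_wpM2r ?(ltW (mesh_gt0 n))// /mesh invf_le1// ler1n.
  by rewrite mul1r; near: n; exact: small.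
- by rewrite -lerBlDr sub0r; apply: hyl; near: n.
- by near: n.
Unshelve. all: by end_near. Qed.

Lemma measurable_drop_profile l h : measurable_fun setT (fun p : R * R => drop_profile l h p.1 p.2).
Proof.
apply: measurable_funM; first exact: measurable_cst.
have m1 : measurable_fun setT (fun p : R * R => h * p.1 + l).
  by apply: measurable_funD => //; exact: measurable_funM.
have m2 : measurable_fun setT (fun p : R * R => h * p.2 + l).
  by apply: measurable_funD => //; exact: measurable_funM.
exact: (measurable_comp_pair (measurable_drop_kernel l (h ^+ 2) (h ^+ 2)) m1 m2).
Qed.

Lemma integral_above_scale h (f : R -> \bar R) : 0 < h -> measurable_fun setT f ->
  (forall x, (0 <= x)%R -> 0 <= f x)%E ->
  (\int[mu]_(x in above 0) f x = h%:E * \int[mu]_(x in above 0) f (h * x)%R)%E.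
Proof.
move=> h0 mf f0; rewrite integral_mkcond (integral_affine_pos 0 h0).
- congr (_ * _)%E; rewrite [RHS]integral_mkcond; apply: eq_integral => x _.
  rewrite !patchE addr0; congr (if _ then _ else _).
  by apply/idP/idP; rewrite !inE /above/= pmulr_rge0.
- by apply: measurable_patch0 => //; exact: measurable_above.
- by move=> x; rewrite patchE; case: ifPn => // /[!inE]; exact: f0.
Qed.
End window_profile.

Section loop_scaling.
Context {R : realType}.
Implicit Types (h l u v w x y z : R) (n : nat).
Local Notation mu := (@lebesgue_measure R).
Local Notation g := (bm_kernel 1 (0 : R)).
Variables (l h : R) (E F : R * R -> \bar R).
Hypotheses (l0 : 0 < l) (h0 : 0 < h) (hl : h ^+ 2 <= l).
Hypotheses (mE : measurable_fun setT E) (mF : measurable_fun setT F).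
Hypotheses (E0 : forall p, (0 <= E p)%E) (F0 : forall p, (0 <= F p)%E).

(* The absolute values only serve to make the integrands nonnegative everywhere. *)
Definition window_mass : \bar R :=
  (\int[mu]_(w in above 0) \int[mu]_(z in above 0) (`|w * z|%:E * E (w, z) *
     \int[mu]_(y in above 0) ((drop_kernel l (h ^+ 2) (h ^+ 2) (z + l) y)%:E *
        \int[mu]_(y' in above 0) (`|y * y'|%:E * F (y, y') *
           (dip_kernel (h ^+ 2) (h ^+ 2) y' w)%:E))))%E.

Definition scaled_dip y w : \bar R :=
  (\int[mu]_(y' in above 0) (`|y * y'|%:E * F (y, h * y')%R * (`|dip_profile h y' w|)%:E))%E.

Definition scaled_drop w z : \bar R :=
  (\int[mu]_y (`|drop_profile l h z y|%:E *
     (if (0 <= h * y + l)%R then scaled_dip (h * y + l) w else 0)))%E.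

Definition scaled_window_mass : \bar R :=
  (\int[mu]_(w in above 0) \int[mu]_(z in above 0)
     (`|w * z|%:E * E (h * w, h * z)%R * scaled_drop w z))%E.

Let m0 : measurable (above (0 : R)).
Proof. exact: measurable_above. Qed.
Let hh : 0 < h ^+ 2.
Proof. by rewrite exprn_gt0. Qed.

Let drop := drop_kernel l (h ^+ 2) (h ^+ 2).
Let dip := dip_kernel (h ^+ 2) (h ^+ 2) : R -> R -> R.

Let mdrop : measurable_fun setT (fun p : R * R => drop p.1 p.2).
Proof. exact: measurable_drop_kernel. Qed.
Let mdip : measurable_fun setT (fun p : R * R => dip p.1 p.2).
Proof. exact: measurable_dip_kernel. Qed.
Let drop0 x y : 0 <= drop x y.
Proof. by rewrite subr_ge0 killed_kernel_homo// subr_ge0. Qed.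
Let dip0 x y : 0 <= dip x y.
Proof. by apply: dip_kernel_ge0. Qed.

Let D2 y w : \bar R :=
  (\int[mu]_(y' in above 0) (`|y * y'|%:E * F (y, y') * (dip y' w)%:E))%E.
Let D1 w z : \bar R := (\int[mu]_(y in above 0) ((drop (z + l)%R y)%:E * D2 y w))%E.

Lemma above_scale_le (k : R) (f f' : R -> \bar R) : 0 <= k ->
  measurable_fun setT f -> (forall x, 0 <= f x)%E ->
  measurable_fun setT f' -> (forall x, 0 <= f' x)%E ->
  (forall x, (0 <= x)%R -> k%:E * f' x <= h%:E * f (h * x)%R)%E ->
  (k%:E * \int[mu]_(x in above 0) f' x <= \int[mu]_(x in above 0) f x)%E.
Proof.
move=> k0 mf f0 mf' f'0 ff'.
have mfh : measurable_fun setT (fun x => f (h * x)) by apply: measurableT_comp => //; exact: measurable_funM.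
rewrite [leRHS](integral_above_scale h0)// -!ge0_integralZl_EFin//.
- apply: le_ge0_integral => [x _|x x0]; last exact: ff'.
  by rewrite mule_ge0// lee_fin.
all: try exact: ltW.
all: exact: measurable_funTS.
Qed.

Let D2_ge0 y w : (0 <= D2 y w)%E.
Proof. by apply: integral_ge0 => y' _; rewrite !mule_ge0// lee_fin. Qed.
Let D1_ge0 y w : (0 <= D1 y w)%E.
Proof. by apply: integral_ge0 => y' _; rewrite !mule_ge0// lee_fin. Qed.

Let m_norm_mul (a b : R * R * R -> R) : measurable_fun setT a -> measurable_fun setT b ->
  measurable_fun setT (fun q => `|a q * b q|%:E).
Proof.
by move=> ma mb; apply/measurable_EFinP; apply: measurableT_comp => //; exact: measurable_funM.
Qed.

Let m11 : measurable_fun setT (fun q : R * R * R => q.1.1) := measurableT_comp measurable_fst measurable_fst.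
Let m12 : measurable_fun setT (fun q : R * R * R => q.1.2) := measurableT_comp measurable_snd measurable_fst.
Let m2 : measurable_fun setT (fun q : R * R * R => q.2) := measurable_snd.
Let mhM (a : R * R * R -> R) : measurable_fun setT a -> measurable_fun setT (fun q => h * a q).
Proof. by move=> ma; apply: measurable_funM => //; exact: measurable_cst. Qed.
Let mlD (a : R * R * R -> R) : measurable_fun setT a -> measurable_fun setT (fun q => a q + l).
Proof. by move=> ma; apply: measurable_funD => //; exact: measurable_cst. Qed.

Let m_pair (k : R * R -> R) (a b : R * R * R -> R) : measurable_fun setT k ->
  measurable_fun setT a -> measurable_fun setT b -> measurable_fun setT (fun q => (k (a q, b q))%:E).
Proof. by move=> mk ma mb; apply/measurable_EFinP; exact: (measurable_comp_pair mk). Qed.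

Let mD2 : measurable_fun setT (fun p : R * R => D2 p.1 p.2).
Proof.
pose k (q : R * R * R) : \bar R := (`|q.1.1 * q.2|%:E * F (q.1.1, q.2) * (dip q.2 q.1.2)%:E)%E.
apply: (@measurable_integral_param _ _ _ (above 0) k m0) => [|q]; last by rewrite !mule_ge0// lee_fin.
apply: emeasurable_funM; last exact: (m_pair mdip m2 m12).
by apply: emeasurable_funM; [exact: m_norm_mul|exact: (measurable_comp_pair mF m11 m2)].
Qed.

Let mD1 : measurable_fun setT (fun p : R * R => D1 p.1 p.2).
Proof.
pose k (q : R * R * R) : \bar R := ((drop (q.1.2 + l) q.2)%:E * D2 q.2 q.1.1)%E.
apply: (@measurable_integral_param _ _ _ (above 0) k m0) => [|q]; last by rewrite !mule_ge0// lee_fin.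
apply: emeasurable_funM; last exact: (measurable_comp_pair mD2 m2 m11).
exact: (m_pair mdrop (mlD m12) m2).
Qed.

Lemma scaled_dip_ge0 y w : (0 <= scaled_dip y w)%E.
Proof. by apply: integral_ge0 => y' _; rewrite !mule_ge0// lee_fin. Qed.

Lemma scaled_drop_ge0 y w : (0 <= scaled_drop y w)%E.
Proof.
apply: integral_ge0 => y' _; rewrite !mule_ge0//.
by case: ifP => // _; exact: scaled_dip_ge0.
Qed.

Lemma measurable_scaled_dip : measurable_fun setT (fun p : R * R => scaled_dip p.1 p.2).
Proof.
pose k (q : R * R * R) : \bar R := (`|q.1.1 * q.2|%:E * F (q.1.1, h * q.2)%R * `|dip_profile h q.2 q.1.2|%:E)%E.
apply: (@measurable_integral_param _ _ _ (above 0) k m0) => [|q]; last by rewrite !mule_ge0// lee_fin.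
apply: emeasurable_funM.
  by apply: emeasurable_funM; [exact: m_norm_mul|exact: (measurable_comp_pair mF m11 (mhM m2))].
have mp : measurable_fun setT (fun p : R * R => `|dip_profile h p.1 p.2|).
  by apply: measurableT_comp => //; exact: measurable_dip_profile.
exact: (m_pair mp m2 m12).
Qed.

Let drop_integrand (q : R * R * R) : \bar R :=
  (`|drop_profile l h q.1.2 q.2|%:E *
     (if (0 <= h * q.2 + l)%R then scaled_dip (h * q.2 + l) q.1.1 else 0))%E.

Let measurable_drop_integrand : measurable_fun setT drop_integrand.
Proof.
apply: emeasurable_funM.
  have mq : measurable_fun setT (fun p : R * R => `|drop_profile l h p.1 p.2|).
    by apply: measurableT_comp => //; exact: measurable_drop_profile.
  exact: (m_pair mq m12 m2).
have ml := mlD (mhM m2).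
apply: measurable_fun_ifT.
- by apply: measurable_fun_ler => //; exact: measurable_cst.
- exact: (measurable_comp_pair measurable_scaled_dip ml m11).
- exact: measurable_cst.
Qed.

Let drop_integrand_ge0 q : (0 <= drop_integrand q)%E.
Proof.
rewrite !mule_ge0//.
by case: ifP => // _; exact: scaled_dip_ge0.
Qed.

Lemma measurable_scaled_drop : measurable_fun setT (fun p : R * R => scaled_drop p.1 p.2).
Proof. exact: (@measurable_integral_param _ _ _ setT drop_integrand measurableT). Qed.

Let mscale_wz : measurable_fun setT (fun p : R * R => `|p.1 * p.2|%:E).
Proof. by apply/measurable_EFinP; apply: measurableT_comp => //; exact: measurable_funM. Qed.

Lemma measurable_scaled_integrand : measurable_fun setT (fun p : R * R =>
  `|p.1 * p.2|%:E * E (h * p.1, h * p.2)%R * scaled_drop p.1 p.2)%E.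
Proof.
apply: emeasurable_funM; last exact: measurable_scaled_drop.
apply: emeasurable_funM => //.
by apply: (measurable_comp_pair mE); apply: measurable_funM => //; exact: measurable_cst.
Qed.

Let measurable_window_integrand : measurable_fun setT (fun p : R * R =>
  `|p.1 * p.2|%:E * E p * D1 p.1 p.2)%E.
Proof. by apply: emeasurable_funM => //; apply: emeasurable_funM. Qed.

Let scaled_dip_le y w : 0 <= w -> ((h ^+ 2)%:E * scaled_dip y w <= D2 y (h * w))%E.
Proof.
move=> w0.
have mp (k : R * R * R -> \bar R) : measurable_fun setT k -> measurable_fun setT (fun y' => k (y, w, y')).
  by move=> mk; apply: (measurable_comp_pair mk); [exact: measurable_cst|exact: measurable_id].
have mp' (k : R * R * R -> \bar R) : measurable_fun setT k -> measurable_fun setT (fun y' => k (y, h * w, y')).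
  by move=> mk; apply: (measurable_comp_pair mk); [exact: measurable_cst|exact: measurable_id].
apply: above_scale_le.
- exact: ltW.
- apply: (mp' (fun q => `|q.1.1 * q.2|%:E * F (q.1.1, q.2) * (dip q.2 q.1.2)%:E)%E).
  apply: emeasurable_funM; last exact: (m_pair mdip m2 m12).
  by apply: emeasurable_funM; [exact: m_norm_mul|exact: (measurable_comp_pair mF m11 m2)].
- by move=> y'; rewrite !mule_ge0// lee_fin.
- apply: (mp (fun q => `|q.1.1 * q.2|%:E * F (q.1.1, h * q.2)%R * `|dip_profile h q.2 q.1.2|%:E)%E).
  apply: emeasurable_funM.
    by apply: emeasurable_funM; [exact: m_norm_mul|exact: (measurable_comp_pair mF m11 (mhM m2))].
  have mq : measurable_fun setT (fun p : R * R => `|dip_profile h p.1 p.2|).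
    by apply: measurableT_comp => //; exact: measurable_dip_profile.
  exact: (m_pair mq m2 m12).
- by move=> y'; rewrite !mule_ge0// lee_fin.
move=> y' y'0; rewrite !muleA -!EFinM (_ : h * `|y * (h * y')| = h ^+ 2 * `|y * y'|); last first.
  by rewrite mulrCA normrM (gtr0_norm h0); ring.
apply: lee_wpmul2l; first by rewrite mule_ge0// lee_fin mulr_ge0// ltW.
rewrite lee_fin ger0_norm; first exact: dip_profile_le.
by rewrite /dip_profile !mulr_ge0 ?addr_ge0 ?bm_kernel_ge0.
Qed.

Let scaled_drop_le w z : 0 <= w -> ((h ^+ 2)%:E * scaled_drop w z <= D1 (h * w) (h * z))%E.
Proof.
have alg2 (a k q : R) (y D : \bar R) : 0 <= a -> 0 <= q -> (k%:E * y <= D)%E ->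
    (k%:E * ((a * q)%:E * y) <= a%:E * (q%:E * D))%E.
  move=> a0 q0 yD; rewrite [(a * q)%:E]EFinM -muleA [leLHS]muleCA; apply: lee_wpmul2l; first by rewrite lee_fin.
  by rewrite [leLHS]muleCA; apply: lee_wpmul2l.
move=> w0.
pose f (y : R) : \bar R := ((drop (h * z + l) y)%:E * D2 y (h * w)%R)%E.
have f0 y : (0 <= f y)%E by rewrite mule_ge0// lee_fin.
have mf : measurable_fun setT f.
  apply: emeasurable_funM.
    by apply/measurable_EFinP; apply: (measurable_comp_pair mdrop); [exact: measurable_cst|exact: measurable_id].
  by apply: (measurable_comp_pair mD2); [exact: measurable_id|exact: measurable_cst].
have mfa : measurable_fun setT (f \_ (above 0)) by exact: measurable_patch0.
have fa0 y : (0 <= (f \_ (above 0)) y)%E by rewrite patchE; case: ifP.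
have mdi : measurable_fun setT (fun y : R => drop_integrand (w, z, y)).
  by apply: (measurable_comp_pair measurable_drop_integrand); [exact: measurable_cst|exact: measurable_id].
have -> : D1 (h * w) (h * z) = (\int[mu]_y (h%:E * (f \_ (above 0)) (h * y + l)%R))%E.
  rewrite /D1 integral_mkcond (integral_affine_pos l h0 mfa fa0) -ge0_integralZl_EFin//; last exact: ltW.
  by apply: measurableT_comp => //; apply: measurable_funD => //; exact: measurable_funM.
rewrite -ge0_integralZl_EFin//; [|by move=> y _; exact: (drop_integrand_ge0 (w, z, y))|exact: ltW].
apply: le_ge0_integral => y _.
  by rewrite mule_ge0 ?(drop_integrand_ge0 (w, z, y))// lee_fin ltW.
rewrite patchE; have [hy|hy] := boolP (0 <= h * y + l); last first.
  rewrite !mule0 mule_ge0 ?lee_fin ?(ltW h0)//.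
  by case: ifP => // _; exact: f0.
rewrite mem_set//.
rewrite /f ger0_norm ?drop_profile_ge0//; apply: alg2 => //; [exact: ltW|exact: scaled_dip_le].
Qed.

(** Powers of [h]: the positions [w] and [z] give [h ^ 2] by change of variables and [h ^ 2] through
    the factor [w * z]; the position [y] gives [h], absorbed in [drop_profile]; the position [y']
    gives [h] twice, by change of variables and as a factor. The total [h ^ 6] is the bound on the
    volume of a window. *)
Lemma scaled_window_mass_le : ((h ^+ 6)%:E * scaled_window_mass <= window_mass)%E.
Proof.
have alg (a k A : R) (x y D : \bar R) : 0 <= a -> 0 <= k -> 0 <= A -> (0 <= x)%E ->
    (k%:E * y <= D)%E -> ((a * k * k)%:E * (A%:E * x * y) <= a%:E * ((k * A)%:E * x * D))%E.
  move=> a0 k0 A0 x0 yD; rewrite !EFinM -!muleA; apply: lee_wpmul2l; first by rewrite lee_fin.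
  apply: lee_wpmul2l; first by rewrite lee_fin.
  rewrite muleCA; apply: lee_wpmul2l; first by rewrite lee_fin.
  by rewrite muleCA; apply: lee_wpmul2l.
have msi := measurable_scaled_integrand; have mwi := measurable_window_integrand.
have fix1 (k : R * R -> \bar R) w : measurable_fun setT k -> measurable_fun setT (fun z => k (w, z)).
  by move=> mk; apply: (measurable_comp_pair mk); [exact: measurable_cst|exact: measurable_id].
have si0 (p : R * R) : (0 <= `|p.1 * p.2|%:E * E (h * p.1, h * p.2)%R * scaled_drop p.1 p.2)%E.
  by rewrite !mule_ge0 ?scaled_drop_ge0// lee_fin.
have wi0 (p : R * R) : (0 <= `|p.1 * p.2|%:E * E p * D1 p.1 p.2)%E.
  by rewrite !mule_ge0// lee_fin.
apply: above_scale_le.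
- by rewrite exprn_ge0// ltW.
- exact: (@measurable_integral_param _ _ _ (above 0) _ m0 mwi wi0).
- by move=> w; apply: integral_ge0 => z _; exact: (wi0 (w, z)).
- exact: (@measurable_integral_param _ _ _ (above 0) _ m0 msi si0).
- by move=> w; apply: integral_ge0 => z _; exact: (si0 (w, z)).
move=> w w0; rewrite exprS EFinM -muleA; apply: lee_wpmul2l; first by rewrite lee_fin ltW.
apply: above_scale_le.
- by rewrite exprn_ge0// ltW.
- exact: (fix1 _ (h * w) mwi).
- by move=> z; exact: (wi0 (h * w, z)).
- exact: (fix1 _ w msi).
- by move=> z; exact: (si0 (w, z)).
move=> z z0.
rewrite (_ : `|h * w * (h * z)| = h ^+ 2 * `|w * z|); last first.
  by rewrite mulrACA normrM -expr2 (gtr0_norm hh).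
have -> : h ^+ 5 = h * h ^+ 2 * h ^+ 2 by ring.
apply: alg => //; [exact: ltW|exact: ltW|exact: scaled_drop_le].
Qed.
End loop_scaling.

(** * Limit of the rescaled window masses *)

Section window_limit.
Context {R : realType}.
Implicit Types (h u v w x y z : R) (n : nat).
Local Notation mu := (@lebesgue_measure R).
Local Notation g := (bm_kernel 1 (0 : R)).

Lemma lower_limit_EFin (u : R^nat) (a : R) : u @ \oo --> a -> lower_limit_ge (fun n => (u n)%:E) a%:E.
Proof. by move=> ua; apply: cvg_lower_limit; apply/fine_cvgP; split => //; near=> n. Unshelve. all: by end_near. Qed.

Variables (l : R) (E : R * R -> \bar R) (F : nat -> R * R -> \bar R) (e f : \bar R).
Hypotheses (l0 : 0 < l).
Hypotheses (mE : measurable_fun setT E) (mF : forall n, measurable_fun setT (F n)).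
Hypotheses (E0 : forall p, (0 <= E p)%E) (F0 : forall n p, (0 <= F n p)%E).
Hypotheses (e0 : (0 <= e)%E) (f0 : (0 <= f)%E).
Hypothesis lE : forall w z, 0 <= w -> 0 <= z -> lower_limit_ge (fun n => E (mesh n * w, mesh n * z)) e.
Hypothesis lF : forall y y', 0 <= y' -> lower_limit_ge (fun n => F n (mesh n * y + l, mesh n * y')) f.

Let L2 w : \bar R :=
  (\int[mu]_(y' in above 0) (`|l * y'|%:E * f * `|2 * ((y' + w) * g (y' + w))|%:E))%E.
Let L1 w z : \bar R := (\int[mu]_y ((g (z + `|y|))%:E * L2 w))%E.
Let L0 : \bar R := (\int[mu]_(w in above 0) \int[mu]_(z in above 0) (`|w * z|%:E * e * L1 w z))%E.

Let m0 : measurable (above (0 : R)).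
Proof. exact: measurable_above. Qed.

Let L2E w : 0 <= w -> L2 w = ((2 * l)%:E * f * upper_mass w)%E.
Proof.
move=> w0.
have mk : measurable_fun setT (fun y : R => (`|y * ((y + w) * g (y + w))|)%:E).
  apply/measurable_EFinP; apply: measurableT_comp => //; apply: measurable_funM => //.
  by apply: measurable_funM; [exact: measurable_funD|exact: measurable_bm_kernel1].
rewrite -integral_dip_profile// -[RHS](_ : (\int[mu]_(y in above 0) ((2 * l)%:E * f * `|y * ((y + w) * g (y + w))|%:E) = _)%E); last first.
  rewrite ge0_integralZl//; [|exact: measurable_funTS|by rewrite mule_ge0// lee_fin mulr_ge0// ltW].
  congr (_ * _)%E; apply: eq_integral => y /[!inE] y0.
  by rewrite ger0_norm// !mulr_ge0 ?addr_ge0 ?bm_kernel_ge0.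
apply: eq_integral => y /[!inE] y0.
rewrite muleAC [RHS]muleAC -!EFinM; congr (_%:E * _)%E.
by rewrite !normrM (gtr0_norm l0) [`|2|]ger0_norm//; ring.
Qed.

(** The integrals over [w] and over [z] are both [1 / 4]. Of the two factors [2], one comes from
    [dip_profile] and the other from the two signs of [y] in [g (z + |y|)]. *)
Let L0E : L0 = ((l / 4)%:E * (e * f))%E.
Proof.
have l2 : (0 <= (2 * l)%:E * f)%E by rewrite mule_ge0// lee_fin mulr_ge0// ltW.
have up0 w : (0 <= upper_mass w)%E by apply: integral_ge0 => y _; rewrite lee_fin bm_kernel_ge0.
have mup : measurable_fun setT (@upper_mass R) := measurable_upper_mass.
have L1E w z : 0 <= w -> 0 <= z -> L1 w z = ((2 * l)%:E * f * upper_mass w * (2%:E * upper_mass z))%E.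
  move=> w0 z0; rewrite /L1 L2E// -integral_upper_abs//.
  set C := (_ * upper_mass w)%E; have C0 : (0 <= C)%E by rewrite mule_ge0.
  transitivity (\int[mu]_y (C * (g (z + `|y|))%:E))%E.
    by apply: eq_integral => y _; rewrite muleC.
  rewrite ge0_integralZl//.
  - apply/measurable_EFinP; apply: measurable_bm_kernel; [exact: measurable_cst|exact: measurable_cst|].
    by apply: measurable_funD; [exact: measurable_cst|exact: normr_measurable].
  - by move=> y _; rewrite lee_fin bm_kernel_ge0.
have mz : measurable_fun setT (fun z : R => `|z|%:E * upper_mass z)%E.
  by apply: emeasurable_funM => //; apply/measurable_EFinP; exact: normr_measurable.
have z0 z : (0 <= `|z|%:E * upper_mass z)%E by rewrite mule_ge0.
have Iz : (\int[mu]_(z in above 0) (`|z|%:E * upper_mass z) = (4^-1)%:E)%E.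
  by rewrite -integral_upper_mass; apply: eq_integral => z /[!inE] z1; rewrite ger0_norm.
pose k : \bar R := (2%:E * ((2 * l)%:E * f) * e)%E.
have k0 : (0 <= k)%E by rewrite /k !mule_ge0 ?lee_fin ?mulr_ge0 ?(ltW l0).
rewrite /L0; transitivity (\int[mu]_(w in above 0) (k * (4^-1)%:E * (`|w|%:E * upper_mass w)))%E.
  apply: eq_integral => w /[!inE] w0.
  transitivity (\int[mu]_(z in above 0) (k * (`|w|%:E * upper_mass w) * (`|z|%:E * upper_mass z)))%E.
    apply: eq_integral => z /[!inE] z1; rewrite L1E// normrM EFinM /k.
    set a := (_ * f)%E; set b := upper_mass w; set c := upper_mass z.
    by rewrite (mule.[AC (3*(2*2))%AC ((6*4*3)*(1*5)*(2*7))%AC]).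
  rewrite ge0_integralZl//; [|exact: measurable_funTS|by rewrite mule_ge0].
  by rewrite Iz muleAC.
rewrite ge0_integralZl//; [|exact: measurable_funTS|by rewrite mule_ge0].
rewrite Iz /k muleAC -!muleA.
rewrite (muleC e) (muleC (4^-1)%:E) !muleA -!EFinM.
rewrite (_ : (l / 4)%R = (4^-1 * 4^-1 * (2 * (2 * l)))%R); last by field.
rewrite [LHS](mule.[ACl (1*4*5)*2*3]) -!EFinM; congr (_%:E * _ * _)%E.
by ring.
Qed.

(** One application of Fatou's lemma per position, from [y'] outwards. The ends of the excursion
    tend to [0] and those of the passage to [l] and [0], so the Bessel masses enter through their
    limits [e] and [f]. *)
Lemma window_mass_limit :
  lower_limit_ge (fun n => ((mesh n) ^- 6)%:E * window_mass l (mesh n) E (F n))%E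
    ((l / 4)%:E * (e * f))%E.
Proof.
have small (c : R) : 0 < c -> \forall n \near \oo, mesh n < c.
  by move=> c0; apply: (cvgr_lt (0 : R)) => //; exact: cvg_mesh.
rewrite -L0E; apply: (@lower_limit_near _ (fun n => scaled_window_mass l (mesh n) E (F n))).
  near=> n; have h0 : 0 < mesh n :> R := mesh_gt0 n.
  have hl : mesh n ^+ 2 <= l.
    rewrite expr2 (le_trans (_ : _ <= 1 * mesh n))//.
      by rewrite ler_wpM2r ?(ltW h0)// /mesh invf_le1// ler1n.
    by rewrite mul1r ltW//; near: n; exact: small.
  have := scaled_window_mass_le h0 hl mE (mF n) E0 (F0 n).
  have k0 : 0 <= mesh n ^- 6 :> R by rewrite invr_ge0 exprn_ge0// ltW.
  move=> /(lee_wpmul2l (_ : 0 <= (mesh n ^- 6)%:E)%E) => /(_ k0).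
  by rewrite muleA -EFinM mulVf ?mul1e// expf_neq0// gt_eqF.
have nrm (a b : R^nat) (x y : R) : a @ \oo --> x -> b @ \oo --> y ->
    lower_limit_ge (fun n => `|a n * b n|%:E) `|x * y|%:E.
  by move=> ax bY; apply: lower_limit_EFin; apply: cvg_norm; exact: cvgM.
have p0 (a : R) : 0 <= a -> (0 <= a%:E)%E by rewrite lee_fin.
have msi n := measurable_scaled_integrand l (mesh n) mE (mF n) (F0 n).
have sd0 n y w : (0 <= scaled_dip (mesh n) (F n) y w)%E by exact: scaled_dip_ge0.
have sp0 n y w : (0 <= scaled_drop l (mesh n) (F n) y w)%E by exact: scaled_drop_ge0.
have mL2 : measurable_fun setT L2.
  pose k (q : R * R) : \bar R := (`|l * q.2|%:E * f * `|2 * ((q.2 + q.1) * g (q.2 + q.1))|%:E)%E.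
  apply: (@measurable_integral_param _ _ _ (above 0) k m0) => [|q]; last by rewrite !mule_ge0.
  have m21 : measurable_fun setT (fun q : R * R => q.2 + q.1) by exact: measurable_funD.
  apply: emeasurable_funM.
    apply: emeasurable_funM; last exact: measurable_cst.
    by apply/measurable_EFinP; apply: measurableT_comp => //; exact: measurable_funM.
  apply/measurable_EFinP; apply: measurableT_comp => //; apply: measurable_funM => //.
  apply: measurable_funM => //.
  by apply: measurable_bm_kernel; [exact: measurable_cst|exact: measurable_cst|].
have L20 w : (0 <= L2 w)%E by apply: integral_ge0 => y _; rewrite !mule_ge0.
have mL1 : measurable_fun setT (fun p : R * R => L1 p.1 p.2).
  pose k (q : R * R * R) : \bar R := ((g (q.1.2 + `|q.2|))%:E * L2 q.1.1)%E.
  apply: (@measurable_integral_param _ _ _ setT k measurableT) => [|q]; last by rewrite !mule_ge0// lee_fin bm_kernel_ge0.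
  apply: emeasurable_funM.
    apply/measurable_EFinP; apply: measurable_bm_kernel; [exact: measurable_cst|exact: measurable_cst|].
    apply: measurable_funD; first exact: (measurableT_comp measurable_snd measurable_fst).
    exact: (measurableT_comp (@normr_measurable R setT) measurable_snd).
  exact: (measurableT_comp mL2 (measurableT_comp measurable_fst measurable_fst)).
have L10 w z : (0 <= L1 w z)%E by apply: integral_ge0 => y _; rewrite mule_ge0// lee_fin bm_kernel_ge0.
have mL0 : measurable_fun setT (fun p : R * R => `|p.1 * p.2|%:E * e * L1 p.1 p.2)%E.
  apply: emeasurable_funM => //; apply: emeasurable_funM; last exact: measurable_cst.
  by apply/measurable_EFinP; apply: measurableT_comp => //; exact: measurable_funM.
have fix1 (k : R * R -> \bar R) w : measurable_fun setT k -> measurable_fun setT (fun z => k (w, z)).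
  by move=> mk; apply: (measurable_comp_pair mk); [exact: measurable_cst|exact: measurable_id].
have dip_lim y w : 0 <= w ->
    lower_limit_ge (fun n => scaled_dip (mesh n) (F n) (mesh n * y + l) w) (L2 w).
  move=> w0; apply: lower_limit_integral => //.
  - move=> n; apply: measurable_funTS.
    apply: emeasurable_funM.
      apply: emeasurable_funM.
        apply/measurable_EFinP; apply: measurableT_comp => //; apply: measurable_funM => //.
      apply: (measurable_comp_pair (mF n)); [exact: measurable_cst|exact: measurable_funM].
    apply/measurable_EFinP; apply: measurableT_comp => //.
    by apply: (measurable_comp_pair (measurable_dip_profile (mesh n))); [exact: measurable_id|exact: measurable_cst].
  - apply: measurable_funTS; apply: emeasurable_funM.
      apply: emeasurable_funM; last exact: measurable_cst.
      by apply/measurable_EFinP; apply: measurableT_comp => //; exact: measurable_funM.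
    apply/measurable_EFinP; apply: measurableT_comp => //; apply: measurable_funM => //.
    by apply: measurable_funM; [exact: measurable_funD|exact: measurable_bm_kernel1].
  - by move=> n y' _; rewrite !mule_ge0.
  - by move=> y' _; rewrite !mule_ge0.
  move=> y' y'0; apply: lower_limit_mul => //.
  - by move=> n; rewrite mule_ge0.
  - by rewrite mule_ge0.
  - apply: lower_limit_mul => //; last exact: lF.
    apply: (nrm (fun n => mesh n * y + l) (fun=> y')); last exact: cvg_cst.
    rewrite -[X in _ --> X]add0r; apply: cvgD; last exact: cvg_cst.
    by rewrite -[X in _ --> X](mul0r y); apply: cvgMl; exact: cvg_mesh.
  - apply: lower_limit_EFin; apply: cvg_norm; exact: cvg_dip_profile.
have drop_lim w z : 0 <= w -> 0 <= z ->
    lower_limit_ge (fun n => scaled_drop l (mesh n) (F n) w z) (L1 w z).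
  move=> w0 z0; apply: lower_limit_integral => //.
  - move=> n; apply: emeasurable_funM.
      apply/measurable_EFinP; apply: measurableT_comp => //.
      by apply: (measurable_comp_pair (measurable_drop_profile l (mesh n))); [exact: measurable_cst|exact: measurable_id].
    have ml : measurable_fun setT (fun y : R => mesh n * y + l) by apply: measurable_funD => //; exact: measurable_funM.
    apply: measurable_fun_ifT.
    + by apply: measurable_fun_ler => //; exact: measurable_cst.
    + apply: (measurable_comp_pair (measurable_scaled_dip (mesh n) (mF n) (F0 n))) => //; exact: measurable_cst.
    + exact: measurable_cst.
  - apply: emeasurable_funM; last exact: measurable_cst.
    apply/measurable_EFinP; apply: measurable_bm_kernel; [exact: measurable_cst|exact: measurable_cst|].
    by apply: measurable_funD; [exact: measurable_cst|exact: normr_measurable].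
  - by move=> n y _; rewrite mule_ge0//; case: ifP.
  - by move=> y _; rewrite mule_ge0// lee_fin bm_kernel_ge0.
  move=> y _; apply: lower_limit_mul => //.
  - by move=> n; case: ifP.
  - by rewrite lee_fin bm_kernel_ge0.
  - apply: lower_limit_EFin; rewrite -[X in _ --> X]ger0_norm ?bm_kernel_ge0//.
    by apply: cvg_norm; exact: cvg_drop_profile.
  - apply: lower_limit_near (dip_lim y w w0).
    near=> n; rewrite ifT//.
    by near: n; exact: near_mesh_affine.
apply: lower_limit_integral => //.
- move=> n; apply: measurable_funTS.
  apply: (@measurable_integral_param _ _ _ (above 0) _ m0 (msi n)) => p.
  by rewrite !mule_ge0.
- apply: measurable_funTS.
  apply: (@measurable_integral_param _ _ _ (above 0) _ m0 mL0) => p.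
  by rewrite !mule_ge0.
- by move=> n w _; apply: integral_ge0 => z _; rewrite !mule_ge0.
- by move=> w _; apply: integral_ge0 => z _; rewrite !mule_ge0.
move=> w w0; apply: lower_limit_integral => //.
- by move=> n; apply: measurable_funTS; exact: (fix1 _ w (msi n)).
- by apply: measurable_funTS; exact: (fix1 _ w mL0).
- by move=> n z _; rewrite !mule_ge0.
- by move=> z _; rewrite !mule_ge0.
move=> z z0; apply: lower_limit_mul => //.
- by move=> n; rewrite mule_ge0.
- by rewrite mule_ge0.
- apply: lower_limit_mul => //; last exact: lE.
  exact: cst_lower_limit.
- exact: drop_lim.
Unshelve. all: by end_near. Qed.
End window_limit.

(** * Limit of the loop masses *)

Section loop_limit.
Context {R : realType}.
Implicit Types (s t x y z l : R) (c : seq (R * set R)).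
Local Notation mu := (@lebesgue_measure R).

Lemma bes3_mass_ge0 l y s x c : path <%R s (rcons (map fst c) l) -> borel_sets c ->
  (0 <= bes3_mass l y s x c)%E.
Proof.
move=> /path_rcons_lt[pc lc] mc; rewrite /bes3_mass bridge_massE; apply: path_mass_ge0.
  by move=> z; rewrite lee_fin bes3_kernel_ge0// subr_gt0.
exact: good_bes3_steps.
Qed.

Lemma measurable_bes3_mass d (U : measurableType d) l s c (a b : U -> R) :
  path <%R s (rcons (map fst c) l) -> borel_sets c ->
  measurable_fun setT a -> measurable_fun setT b ->
  measurable_fun setT (fun u => bes3_mass l (a u) s (b u) c).
Proof.
move=> /path_rcons_lt[pc lc] mc ma mb.
have h := @measurable_path_mass_param _ _ _
  (fun p : R * R => (bes3_kernel (l - last s (map fst c)) p.2 p.1)%:E)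
  (bridge_steps bes3_weight (@bes3_kernel R) s c).
under eq_fun do rewrite /bes3_mass bridge_massE.
apply: (measurable_comp_pair (h _ _ _) ma mb).
- by apply/measurable_EFinP; apply: measurable_bes3_kernel; [exact: measurable_cst|exact: measurable_snd|exact: measurable_fst].
- by move=> p; rewrite lee_fin bes3_kernel_ge0// subr_gt0.
- exact: good_bes3_steps.
Qed.

(** Lower semicontinuity in the length and in both end points. Fatou's lemma passes through each
    intermediate position, and positions [z <= 0] have weight [0]. *)
Lemma bes3_mass_lower_limit (l_ y_ x_ : R^nat) l y s x c :
  path <%R s (rcons (map fst c) l) -> (forall n, path <%R s (rcons (map fst c) (l_ n))) ->
  borel_sets c -> (forall n, 0 <= y_ n) -> (forall n, 0 <= x_ n) -> 0 <= y -> 0 <= x ->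
  l_ @ \oo --> l -> y_ @ \oo --> y -> x_ @ \oo --> x ->
  lower_limit_ge (fun n => bes3_mass (l_ n) (y_ n) s (x_ n) c) (bes3_mass l y s x c).
Proof.
move=> + + + y_0 + y0 + lc yc.
elim: c s x x_ => [|[t A] c ih] s x x_ pl pl_ mc x_0 x0 xc.
  have sl : 0 < l - s by move: pl; rewrite /= andbT subr_gt0.
  apply: lower_limit_EFin; apply: cvg_bes3_kernel => //.
  - by move=> n; have := pl_ n; rewrite /= andbT subr_gt0.
  - by apply: cvgB => //; exact: cvg_cst.
case/borel_sets_cons: mc => mA mc; move: pl => /= /andP[st pl].
have {}pl_ n : path <%R t (rcons (map fst c) (l_ n)) by have := pl_ n => /= /andP[].
have ts : 0 < t - s by rewrite subr_gt0.
have m1 u : measurable_fun setT (fun z => (bes3_kernel (t - s) u z * bes3_weight z)%:E).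
  apply/measurable_EFinP; apply: measurable_funM; last exact: measurable_bes3_weight.
  by apply: measurable_bes3_kernel; [exact: measurable_cst|exact: measurable_cst|exact: measurable_id].
have n1 u z : (0 <= (bes3_kernel (t - s) u z * bes3_weight z)%:E)%E.
  by rewrite lee_fin mulr_ge0 ?bes3_weight_ge0// bes3_kernel_ge0.
rewrite /bes3_mass /=; apply: lower_limit_integral => //.
- move=> n; apply: measurable_funTS; apply: emeasurable_funM; first exact: m1.
  by apply: (@measurable_bes3_mass _ R) => //; exact: measurable_cst.
- apply: measurable_funTS; apply: emeasurable_funM; first exact: m1.
  by apply: (@measurable_bes3_mass _ R) => //; exact: measurable_cst.
- by move=> n z _; rewrite mule_ge0//; exact: bes3_mass_ge0.
- by move=> z _; rewrite mule_ge0//; exact: bes3_mass_ge0.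
move=> z Az; have [z0|z0] := leP z 0.
  have -> : bes3_weight z = 0 by rewrite /bes3_weight ltNge z0.
  under [X in lower_limit_ge X]eq_fun do rewrite mulr0 mul0e.
  by rewrite mulr0 mul0e; exact: cst_lower_limit.
apply: lower_limit_mul => //.
- by move=> n; exact: bes3_mass_ge0.
- exact: bes3_mass_ge0.
- apply: lower_limit_EFin; apply: cvgMl; apply: cvg_bes3_kernel => //; [| |exact: cvg_cst|exact: cvg_cst].
    by move=> _; exact: ltW.
  exact: ltW.
- by apply: (ih t z (fun=> z)) => //; first [exact: cvg_cst|by move=> _; exact: ltW|exact: ltW].
Qed.

Variables (l s r : R) (ca cb c2 : seq (R * set R)).
Hypotheses (l0 : 0 < l) (s0 : 0 < s) (sr : s < r).
Hypothesis pa : path <%R 0 (rcons (map fst ca) s).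
Hypothesis pb : path <%R s (rcons (map fst cb) r).
Hypothesis p2 : path <%R 0 (rcons (map fst c2) (1 - r)).
Hypotheses (ma : borel_sets ca) (mb : borel_sets cb) (m2 : borel_sets c2).
Let c2' := [seq (p.1, shift_set l p.2) | p <- c2].

Lemma path_cat_rcons : path <%R 0 (rcons (map fst (ca ++ cb)) r).
Proof.
move/path_rcons_lt: pa => [pa1 pa2].
rewrite map_cat rcons_cat cat_path pa1/=.
case: (cb) pb => [|[t A] c0]/=; first by rewrite !andbT => _; exact: lt_trans pa2 sr.
by move=> /andP[st ->]; rewrite andbT; exact: lt_trans pa2 st.
Qed.

(** The length of the passage inside the window. As long as the short intervals leave no room for
    the times of [c2], the default [1 - r] keeps the masses well formed. *)
Let time n := if last 0 (map fst c2) < 1 - r - 2 * mesh n ^+ 2 then 1 - r - 2 * mesh n ^+ 2 else 1 - r.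

Lemma window_massE h (F : R * R -> \bar R) :
  (forall y y', F (y, y') = bes3_mass (1 - r - 2 * h ^+ 2) y' 0 y c2') ->
  window_mass l h (fun p => bes3_mass r p.2 0 p.1 (ca ++ cb)) F =
  (\int[mu]_(w in above 0) \int[mu]_(z in above 0)
     (outer_mass r ca cb w z * \int[mu]_(y in above 0) ((drop_kernel l (h ^+ 2) (h ^+ 2) (z + l) y)%:E *
        \int[mu]_(y' in above 0) (inner_mass l (h ^+ 2) r c2 y y' * (dip_kernel (h ^+ 2) (h ^+ 2) y' w)%:E))))%E.
Proof.
move=> FE.
have outE (w z : R) : 0 <= w -> 0 <= z ->
    (`|w * z|%:E * bes3_mass r z 0 w (ca ++ cb) = outer_mass r ca cb w z)%E.
  by move=> w0 z0; rewrite ger0_norm// mulr_ge0.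
have inE' (y y' : R) : 0 <= y -> 0 <= y' -> (`|y * y'|%:E * F (y, y') = inner_mass l (h ^+ 2) r c2 y y')%E.
  by move=> w0 z0; rewrite FE ger0_norm// mulr_ge0.
apply: eq_integral => w /[!inE] w0; apply: eq_integral => z /[!inE] z0.
apply: (f_equal2 (@mule R)); first exact: outE.
apply: eq_integral => y /[!inE] y0; apply: (f_equal2 (@mule R)); first by [].
apply: eq_integral => y' /[!inE] y'0; apply: (f_equal2 (@mule R)); last by [].
exact: inE'.
Qed.

Lemma loop_mass_limit :
  lower_limit_ge (fun n => ((mesh n) ^- 6)%:E *
     \int[mu]_x loop_mass l (mesh n ^+ 2) (mesh n ^+ 2) s r ca cb c2 x)%E
   ((l / 4)%:E * (bes3_mass r 0 0 0 (ca ++ cb) * bes3_mass (1 - r) 0 0 l c2'))%E.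
Proof.
have mab : borel_sets (ca ++ cb) by apply/borel_sets_cat.
have pab := path_cat_rcons.
have m2' : borel_sets c2' by apply: borel_sets_map => // p; exact: measurable_shift_set.
have f2' : map fst c2' = map fst c2 by rewrite -map_comp.
have [p21 p22] := (path_rcons_lt _ _ _).1 p2.
have p2' : path <%R 0 (rcons (map fst c2') (1 - r)) by rewrite f2'.
have pt n : path <%R 0 (rcons (map fst c2') (time n)).
  by rewrite f2'; apply/path_rcons_lt; split => //; rewrite /time; case: ifP.
have sq0 : (fun n => 2 * mesh n ^+ 2 : R) @ \oo --> 0.
  rewrite -[X in _ --> X](mulr0 2); apply: cvgMr; rewrite -[X in _ --> X](mulr0 0).
  by under eq_fun do rewrite expr2; apply: cvgM; exact: cvg_mesh.
have small (c : R) : 0 < c -> \forall n \near \oo, 2 * mesh n ^+ 2 < c.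
  by move=> c0; apply: (cvgr_lt (0 : R)).
have tE : \forall n \near \oo, last 0 (map fst c2) < 1 - r - 2 * mesh n ^+ 2.
  have c0 : 0 < 1 - r - last 0 (map fst c2) by rewrite subr_gt0.
  near=> n; rewrite ltrBrDr addrC -ltrBrDr; near: n; exact: small.
have timec : time @ \oo --> 1 - r.
  have h : (fun n => 1 - r - 2 * mesh n ^+ 2) @ \oo --> 1 - r.
    by rewrite -[X in _ --> X]subr0; apply: cvgB => //; exact: cvg_cst.
  apply: cvg_trans h; apply: near_eq_cvg; near=> n.
  by rewrite /time ifT//; near: n.
pose E (p : R * R) := bes3_mass r p.2 0 p.1 (ca ++ cb).
pose F n (p : R * R) := bes3_mass (time n) p.2 0 p.1 c2'.
have E0 p : (0 <= E p)%E by exact: bes3_mass_ge0.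
have F0 n p : (0 <= F n p)%E by exact: bes3_mass_ge0.
have mE : measurable_fun setT E by exact: measurable_bes3_mass.
have mF n : measurable_fun setT (F n) by exact: measurable_bes3_mass.
have e0 : (0 <= bes3_mass r 0 0 0 (ca ++ cb))%E by exact: bes3_mass_ge0.
have f0 : (0 <= bes3_mass (1 - r) 0 0 l c2')%E by exact: bes3_mass_ge0.
have mesh_cvg0 x : (fun n => mesh n * x : R) @ \oo --> 0.
  by rewrite -[X in _ --> X](mul0r x); apply: cvgMl; exact: cvg_mesh.
have mesh0 n x : 0 <= x -> 0 <= mesh n * x :> R by move=> x0; rewrite mulr_ge0// ltW// mesh_gt0.
have lE w z : 0 <= w -> 0 <= z ->
    lower_limit_ge (fun n => E (mesh n * w, mesh n * z)) (bes3_mass r 0 0 0 (ca ++ cb)).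
  by move=> w0 z0; apply: bes3_mass_lower_limit => //; first [exact: cvg_cst|exact: mesh_cvg0|move=> n; exact: mesh0].
have lF y y' : 0 <= y' ->
    lower_limit_ge (fun n => F n (mesh n * y + l, mesh n * y')) (bes3_mass (1 - r) 0 0 l c2').
  move=> y'0.
  apply: (@lower_limit_near _ (fun n => F n (`|mesh n * y + l|, mesh n * y'))).
    by near=> n; rewrite ger0_norm//; near: n; exact: near_mesh_affine.
  have ca' : (fun n => `|mesh n * y + l|) @ \oo --> l.
    rewrite -[X in _ --> X](gtr0_norm l0); apply: cvg_norm.
    by rewrite -[X in _ --> X]add0r; apply: cvgD => //; exact: cvg_cst.
  apply: bes3_mass_lower_limit => //;
    first [exact: mesh_cvg0|exact: ca'|exact: (ltW l0)|by move=> n /=; rewrite ?mesh0].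
have := window_mass_limit l0 mE mF E0 F0 e0 f0 lE lF.
apply: lower_limit_near; near=> n.
have h0 : 0 < mesh n :> R := mesh_gt0 n.
have hh : 0 < mesh n ^+ 2 :> R by rewrite exprn_gt0.
have hl : mesh n ^+ 2 < l.
  rewrite (lt_trans (_ : _ < 2 * mesh n ^+ 2)) ?ltr_pMl ?ltr1n//; near: n; exact: small.
have tn : last 0 (map fst c2) < 1 - r - 2 * mesh n ^+ 2 by near: n.
have pn : path <%R 0 (rcons (map fst c2) (1 - r - 2 * mesh n ^+ 2)) by apply/path_rcons_lt.
apply: lee_wpmul2l; first by rewrite lee_fin invr_ge0 exprn_ge0// ltW.
have hL := loop_mass_lower hh sr hh hl pa pb pn ma mb m2.
move: hL; move: (\int[mu]_x _)%E => J hL.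
apply: le_trans hL; rewrite le_eqVlt; apply/orP; left; apply/eqP.
apply: window_massE => // y y'; by rewrite /F /time tn.
Unshelve. all: by end_near. Qed.
End loop_limit.

(** * Windows and the Vervaat transform of a path *)

Section erosion.
Context {R : realType}.
Implicit Types (x y eta : R) (A : set R) (c : seq (R * set R)).

(** A window determines the values of the path only up to a small error, so conditions are imposed
    with a margin. The eroded set is closed whatever [A] is, and the erosions of an open set exhaust
    it. *)
Definition erode eta A : set R := [set x | forall y, `|x - y| < eta -> A y].

Lemma erode_sub eta A : 0 < eta -> erode eta A `<=` A.
Proof. by move=> eta0 x; apply; rewrite subrr normr0. Qed.

Lemma erode_setT eta : erode eta setT = setT.
Proof. by apply/seteqP; split. Qed.

Lemma measurable_erode eta A : measurable (erode eta A).
Proof.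
apply: closed_measurable; rewrite (_ : erode eta A = ~` \bigcup_(y in ~` A) ball y eta).
  by apply: open_closedC; apply: bigcup_open => y _; exact: ball_open.
apply/seteqP; split => x.
  by move=> ex [y nAy]; rewrite -ball_normE/= distrC => /ex.
move=> nx y xy; apply: contrapT => nAy; apply: nx; exists y => //.
by rewrite -ball_normE/= distrC.
Qed.

Lemma near_erode (A : set R) x : open A -> A x -> \forall n \near \oo, erode (mesh n) A x.
Proof.
move=> oA Ax; have /nbhs_ballP[e /= e0 eA] : nbhs x A by exact: open_nbhs_nbhs.
near=> n => y xy; apply: eA; rewrite -ball_normE/=; apply: (lt_trans xy).
by near: n; apply: (cvgr_lt (0 : R)) => //; exact: cvg_mesh.
Unshelve. all: by end_near. Qed.

Definition erode_seq eta c := [seq (p.1, erode eta p.2) | p <- c].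

Fixpoint each (Q : R * set R -> Prop) c : Prop :=
  if c is p :: c' then Q p /\ each Q c' else True.

Lemma each_imp (Q Q' : R * set R -> Prop) c : (forall p, Q p -> Q' p) -> each Q c -> each Q' c.
Proof. by move=> QQ'; elim: c => //= p c ih [/QQ' ? /ih]. Qed.

Lemma each_map (Q : R * set R -> Prop) g c : each Q (map g c) <-> each (fun p => Q (g p)) c.
Proof. by elim: c => //= p c ih; split => -[? /ih]. Qed.

Lemma each_cylinder (d : measure_display) (T : measurableType d) (X : R -> T -> R) c o :
  cylinder X c o <-> each (fun p => p.2 (X p.1 o)) c.
Proof.
elim: c => [|p c ih] /=; first by rewrite cylinder_nil.
by rewrite cylinder_cons; split => -[? /ih].
Qed.

Lemma path_last_le s (c : seq R) : path <%R s c -> s <= last s c.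
Proof. by elim: c s => //= t c ih s /andP[/ltW st /ih]; exact: le_trans. Qed.

Lemma each_time_le s c : path <%R s (map fst c) -> each (fun p => s < p.1 <= last s (map fst c)) c.
Proof.
elim: c s => //= p c ih s /andP[sp pc].
have pl : p.1 <= last p.1 (map fst c).
  by elim: c p.1 {ih sp} pc => //= q c ih t /andP[/ltW tq /ih]; exact: le_trans.
split; first by rewrite sp.
by apply: each_imp (ih _ pc) => q /andP[pq ->]; rewrite (lt_trans sp).
Qed.

Lemma each_and (Q Q' : R * set R -> Prop) c : each Q c -> each Q' c -> each (fun p => Q p /\ Q' p) c.
Proof. by elim: c => //= p c ih [? ?] [? ?]; split => //; exact: ih. Qed.

Lemma each_eventually (Q : R -> R * set R -> Prop) c :
  (forall p, exists2 d, 0 < d & forall e, 0 < e -> e < d -> Q e p) ->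
  exists2 d, 0 < d & forall e, 0 < e -> e < d -> each (Q e) c.
Proof.
move=> h; elim: c => /= [|p c [d d0 hd]]; first by exists 1.
have [d' d'0 hd'] := h p; exists (Num.min d d'); first by rewrite lt_min d0.
by move=> e e0; rewrite lt_min => /andP[ed ed']; split; [exact: hd'|exact: hd].
Qed.
End erosion.

Section vervaat_path.
Context {R : realType}.
Implicit Types (s t u v x r de e : R) (c : seq (R * set R)).
Variables (b : R -> R) (l : R).
Hypothesis cb : {within `[0, 1], continuous b}.
Hypotheses (b0 : b 0 = 0) (b1 : b 1 = - l) (l0 : 0 < l).

Let tau := argmin01 b.
Let m := b tau.

(** [argmin01] is an infimum of minimizers. There are minimizers arbitrarily close to it, so by
    continuity its value cannot exceed the minimum. *)
Lemma argmin01_spec : 0 <= tau <= 1 /\ forall u, 0 <= u <= 1 -> m <= b u.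
Proof.
rewrite /m /tau /argmin01; set S := [set t | _].
have [t0 t01 ht0] := EVT_min (ler01 : 0 <= 1 :> R) cb.
have St0 : S t0.
  split=> [|v v01]; first by move: t01; rewrite in_itv.
  by apply: ht0; rewrite in_itv.
have lbS : lbound S 0 by move=> t [/andP[]].
have hS : has_inf S by split; [exists t0|exists 0].
have inf0 : 0 <= inf S by apply: lb_le_inf => //; exists t0.
have inf1 : inf S <= 1.
  by apply: le_trans (ge_inf _ St0) _; [exists 0|case: St0 => /andP[]].
split => [|u u01]; first by rewrite inf0.
rewrite leNgt; apply/negP => bu.
have [||d d0 hd] := within_itv_ball (u := inf S) (e := b (inf S) - b u) cb.
- by rewrite inf0.
- by rewrite subr_gt0.
have [t [t1 t2] td] := inf_adherent d0 hS.
have inft : inf S <= t by apply: ge_inf; [exists 0|split].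
have /hd : 0 <= t <= 1 by [].
rewrite distrC ger0_norm ?subr_ge0// ltrBlDl => /(_ td).
apply/negP; rewrite -leNgt; apply: le_trans (ler_norm _); rewrite lerD2l lerN2.
exact: t2.
Qed.

Lemma argmin01_le t : 0 <= t <= 1 -> b t = m -> tau <= t.
Proof.
move=> t01 bt; apply: ge_inf; first by exists 0 => v [/andP[]].
by split => // v v01; rewrite bt; case: argmin01_spec => _; apply.
Qed.

Let tau01 : 0 <= tau <= 1. Proof. by case: argmin01_spec. Qed.
Let tau0 : 0 <= tau. Proof. by case/andP: tau01. Qed.
Let tau1 : tau <= 1. Proof. by case/andP: tau01. Qed.
Let mP u : 0 <= u <= 1 -> m <= b u. Proof. by case: argmin01_spec => _; apply. Qed.

Lemma vervaat_left t : t <= 1 - tau -> vervaat b t = b (tau + t) - m.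
Proof. by move=> h; rewrite /vervaat -/tau h. Qed.

Lemma vervaat_right t : 1 - tau <= t -> vervaat b t = b (tau + t - 1) - l - m.
Proof.
rewrite le_eqVlt => /orP[/eqP <-|h]; last by rewrite /vervaat -/tau leNgt h/= b1.
by rewrite vervaat_left// subrKC subrr b0 b1 sub0r.
Qed.

Definition level_time : R := inf [set u | 0 <= u <= 1 /\ b u <= m + l].
Local Notation T0 := level_time.

Lemma level_time_spec :
  [/\ 0 <= T0, T0 <= tau, b T0 = m + l & forall u, 0 <= u -> u < T0 -> m + l < b u].
Proof.
rewrite /level_time; set S := [set u | _].
have Stau : S tau by split => //; rewrite lerDl ltW.
have lbS : lbound S 0 by move=> t [/andP[]].
have hS : has_inf S by split; [exists tau|exists 0].
have inf0 : 0 <= inf S by apply: lb_le_inf => //; exists tau.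
have inf1 : inf S <= tau by apply: ge_inf => //; exists 0.
have infI : 0 <= inf S <= 1 by rewrite inf0 (le_trans inf1).
have before u : 0 <= u -> u < inf S -> m + l < b u.
  move=> u0 ui; rewrite ltNge; apply/negP => bu.
  suff : inf S <= u by rewrite leNgt ui.
  apply: ge_inf; first by exists 0.
  by split => //; rewrite u0 (le_trans (ltW ui))// (le_trans inf1).
split => //; apply/eqP; rewrite eq_le; apply/andP; split.
  rewrite leNgt; apply/negP => bu.
  have [||d d0 hd] := within_itv_ball (u := inf S) (e := b (inf S) - (m + l)) cb => //.
    by rewrite subr_gt0.
  have [t [t1 t2] td] := inf_adherent d0 hS.
  have inft : inf S <= t by apply: ge_inf; [exists 0|split].
  have := hd _ t1; rewrite distrC ger0_norm ?subr_ge0// ltrBlDl => /(_ td).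
  apply/negP; rewrite -leNgt; apply: le_trans (ler_norm _).
  by rewrite lerD2l lerN2.
(* At time [0] the bound comes from the end points: [b 0 = 0] and [m <= b 1 = - l]. *)
have [i0|i0] := eqVneq (inf S) 0.
  have := @mP 1; rewrite b1 lexx ler01 => /(_ isT).
  by rewrite i0 b0; lra.
have {i0}inf0' : 0 < inf S by rewrite lt_neqAle eq_sym i0.
rewrite leNgt; apply/negP => bu.
have [||d d0 hd] := within_itv_ball (u := inf S) (e := (m + l) - b (inf S)) cb => //.
  by rewrite subr_gt0.
pose v := Num.max 0 (inf S - d / 2).
have v0 : 0 <= v by rewrite le_max lexx.
have vi : v < inf S by rewrite gt_max inf0'/= ltrBlDr ltrDl divr_gt0.
have := hd v; rewrite v0 (le_trans (ltW vi))/= ?(le_trans inf1)// => /(_ isT).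
rewrite ger0_norm ?subr_ge0 ?(ltW vi)//.
have -> : inf S - v < d.
  by rewrite ltrBlDr -ltrBlDl lt_max; apply/orP; right; rewrite ltrD2l ltrN2 ltr_pdivrMr// mulr2n mulrDr mulr1 ltrDl.
move=> /(_ isT); apply/negP; rewrite -leNgt distrC; apply: le_trans (ler_norm _).
by rewrite lerD2r ltW// before.
Qed.

Definition unique_argmin : Prop := forall t, 0 <= t <= 1 -> b t = m -> t = tau.

(** A zero of the transform in [(0, 1 - tau]] would be a second time of the minimum, and a later
    zero is a time at which [b] equals [m + l]. The condition [0 < T0] makes the claimed return time
    positive. *)
Lemma first_return_level : unique_argmin -> 0 < T0 ->
  first_return (vervaat b) = T0 + (1 - tau).
Proof.
move=> uq T0p; have [_ Ttau bT before] := level_time_spec.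
apply/eqP; rewrite eq_le; apply/andP; split.
  apply: ge_inf; first by exists 0 => t [/andP[/ltW]].
  split; first by rewrite ltr_wpDr ?subr_ge0//= -lerBrDr opprB addrCA subrr addr0.
  rewrite vervaat_right; last by rewrite lerDr ltW.
  by rewrite (_ : tau + _ - 1 = T0) ?bT; ring.
apply: lb_le_inf.
  exists (T0 + (1 - tau)); split.
    by rewrite ltr_wpDr ?subr_ge0//= -lerBrDr opprB addrCA subrr addr0.
  rewrite vervaat_right; last by rewrite lerDr ltW.
  by rewrite (_ : tau + _ - 1 = T0) ?bT; ring.
move=> t [/andP[t0 t1] Vt]; rewrite leNgt; apply/negP => tT.
have [tt|tt] := leP t (1 - tau).
  move: Vt; rewrite vervaat_left// => /eqP; rewrite subr_eq0 => /eqP /uq.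
  have tt' : tau + t <= 1 by rewrite -lerBrDl.
  rewrite tt' addr_ge0 ?(ltW t0)// => /(_ isT) /eqP.
  by rewrite -subr_eq0 addrAC subrr add0r gt_eqF.
move: Vt; rewrite vervaat_right ?ltW// => /eqP; rewrite subr_eq0 subr_eq => /eqP bt.
have := before (tau + t - 1); rewrite bt addrC ltxx => h.
have : false by apply: h; lra.
by [].
Qed.

(* The two [exists2] put the hitting time of the level [m + l] just after [r - s], and the
   argmin just before [1 - s]; the time [p.1] of the excursion is the time [p.1 - s] or
   [p.1 + (1 - s)] of [b]. *)
Definition window de e c1 c2 s r x : Prop :=
  [/\ (forall u, 0 <= u <= r - s -> l <= b u + x),
      (forall u, r - s <= u <= r - s + de -> 0 <= b u + x) /\
      (exists2 u, r - s <= u <= r - s + de & b u + x < l - e),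
      (forall u, r - s + de <= u <= 1 - s - de -> 0 <= b u + x),
      (forall u, 1 - s - de <= u <= 1 - s -> - e <= b u + x) /\
      (exists2 u, 1 - s - de <= u <= 1 - s & b u + x < 0) &
      [/\ (forall u, 1 - s <= u <= 1 -> 0 <= b u + x),
          each (fun p => (p.1 < s /\ p.2 (b (p.1 + (1 - s)) + x)) \/
                         (s < p.1 /\ p.2 (b (p.1 - s) + x - l))) c1 &
          each (fun p => p.2 (b (p.1 + (r - s + de)) + x - l)) c2]].

(** The path plus [x] is negative only during the dip, so every time of the minimum lies there and
    [- e <= m + x < 0]. Staying above [l] until [r - s] then excludes the level [m + l] before that
    time, and falling below [l - e] guarantees it: the margin [e] compensates for the uncertainty on
    [m + x]. *)
Lemma window_location de e c1 c2 s r x : 0 < de -> 0 < e -> e < l -> 0 < s -> s < r -> r + 2 * de <= 1 ->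
  window de e c1 c2 s r x ->
  [/\ (forall t, 0 <= t <= 1 -> b t = m -> 1 - s - de <= t <= 1 - s),
      - e <= m + x < 0, 0 < T0 & r - s <= T0 <= r - s + de].
Proof.
move=> de0 e0 el s0 sr rd [w1 [w2 [u2 u2I u2b]] w3 [w4 [u4 u4I u4b]] [w5 _ _]].
have mx : m + x < 0.
  apply: le_lt_trans u4b; rewrite lerD2r; apply: mP.
  by move/andP: u4I => [h1 h2]; apply/andP; split; lra.
have loc t : 0 <= t <= 1 -> b t + x < 0 -> 1 - s - de <= t <= 1 - s.
  move=> /andP[t0 t1] bt; rewrite !leNgt; apply/andP; split; apply/negP => ht.
    have [h|h] := leP t (r - s).
      by have := w1 t; rewrite t0 h => /(_ isT); lra.
    have [h'|h'] := leP t (r - s + de).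
      by have := w2 t; rewrite h' ltW// => /(_ isT); lra.
    by have := w3 t; rewrite (ltW h') (ltW ht) => /(_ isT); lra.
  by have := w5 t; rewrite t1 ltW// => /(_ isT); lra.
have tauI : 1 - s - de <= tau <= 1 - s by apply: loc.
have em : - e <= m + x by exact: w4.
have [T00 Ttau bT before] := level_time_spec.
have T0r : r - s <= T0.
  rewrite leNgt; apply/negP => h; have := w1 T0; rewrite T00 ltW// bT => /(_ isT).
  by lra.
have T0r' : T0 <= r - s + de.
  have /andP[h1 h2] := u2I.
  rewrite leNgt; apply/negP => h.
  have : m + l < b u2 by apply: before; lra.
  by lra.
split => //.
- by move=> t t01 bt; apply: loc => //; rewrite bt.
- by rewrite em.
- by apply: lt_le_trans T0r; rewrite subr_gt0.
- by rewrite T0r.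
Qed.

Lemma point_near u (eta : R) : 0 <= u <= 1 -> 0 < eta -> exists2 d, 0 < d &
  forall v x, 0 <= v <= 1 -> `|u - v| < d -> `|m + x| < d -> `|b v + x - (b u - m)| < eta.
Proof.
move=> u01 eta0; have eta2 : 0 < eta / 2 by rewrite divr_gt0.
have [d d0 hd] := within_itv_ball cb u01 eta2.
exists (Num.min d (eta / 2)); first by rewrite lt_min d0.
move=> v x v01; rewrite !lt_min => /andP[ud _] /andP[_ mx].
have -> : b v + x - (b u - m) = (m + x) - (b u - b v) by ring.
by apply: le_lt_trans (ler_normB _ _) _; have := hd _ v01 ud; lra.
Qed.

Variables (eta : R) (c1 c2 : seq (R * set R)) (O : set R).
Hypothesis eta0 : 0 < eta.
Hypotheses (pc1 : path <%R 0 (map fst c1)) (pc2 : path <%R 0 (map fst c2)).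

Let Z := first_return (vervaat b).

Definition vervaat_event : Prop :=
  [/\ O Z, last 0 (map fst c1) < Z, last 0 (map fst c2) < 1 - Z,
      each (fun p => p.2 (vervaat b p.1)) c1 & each (fun p => p.2 (vervaat b (Z + p.1))) c2].

Let good e s r x := [/\ 0 < s, s < r, last 0 (map fst c1) < r,
   last 0 (map fst c2) < 1 - r - 2 * e & [/\ erode eta O r & window e e (erode_seq eta c1) (erode_seq eta c2) s r x]].

Definition located e s r x : Prop :=
  [/\ 0 < s, s < r, r + 2 * e <= 1, - e <= m + x < 0 &
      1 - s - e <= tau <= 1 - s /\ r - s <= T0 <= r - s + e].

Lemma window_first_point (p : R * set R) : exists2 d, 0 < d & forall e, 0 < e -> e < d ->
  forall s r x, located e s r x -> 0 < p.1 < r ->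
  (p.1 < s /\ (erode eta p.2) (b (p.1 + (1 - s)) + x)) \/
  (s < p.1 /\ (erode eta p.2) (b (p.1 - s) + x - l)) -> p.2 (vervaat b p.1).
Proof.
case: p => t A /=; have [tt|tt] := ltP t (1 - tau).
  have [h0|h0] := leP t 0; first by exists 1 => // e _ _ s r x _ /andP[]; rewrite ltNge h0.
  have [||d d0 hd] := @point_near (tau + t) eta => //.
    by rewrite addr_ge0 ?(ltW h0)//= -lerBrDl ltW.
  exists (Num.min d (1 - tau - t)) => [|e e0]; first by rewrite lt_min d0 subr_gt0.
  rewrite lt_min => /andP[ed et] s r x [s0 sr re /andP[mx1 mx2] [/andP[h1 h2] _]] /andP[t0 tr].
  case=> [[ts]|[st]]; last by exfalso; lra.
  apply; rewrite vervaat_left ?ltW//; apply: hd.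
  - by apply/andP; split; lra.
  - by apply: le_lt_trans ed; rewrite ler_norml; apply/andP; split; lra.
  - by apply: le_lt_trans ed; rewrite ler_norml; apply/andP; split; lra.
have [h1|h1] := leP t 1; last first.
  by exists 1 => // e e0 _ s r x [s0 sr re _ _] /andP[t0 tr]; exfalso; lra.
have [||d d0 hd] := @point_near (tau + t - 1) eta => //.
  by rewrite subr_ge0 -lerBlDl tt/= lerBlDr lerD.
exists d => // e e0 ed s r x [s0 sr re /andP[mx1 mx2] [/andP[h3 h4] _]] /andP[t0 tr].
case=> [[ts]|[st]]; first by exfalso; lra.
apply; rewrite vervaat_right//.
have -> : b (t - s) + x - l - (b (tau + t - 1) - l - m) = b (t - s) + x - (b (tau + t - 1) - m) by ring.
apply: hd.
- by apply/andP; split; lra.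
- by apply: le_lt_trans ed; rewrite ler_norml; apply/andP; split; lra.
- by apply: le_lt_trans ed; rewrite ler_norml; apply/andP; split; lra.
Qed.

Lemma window_second_point (p : R * set R) : exists2 d, 0 < d & forall e, 0 < e -> e < d ->
  forall s r x, located e s r x -> 0 < p.1 < 1 - r - 2 * e ->
  (erode eta p.2) (b (p.1 + (r - s + e)) + x - l) -> p.2 (vervaat b (T0 + (1 - tau) + p.1)).
Proof.
have [T00 Ttau _ _] := level_time_spec.
case: p => t A /=.
have [h1|h1] := leP (T0 + t) 1; last first.
  by exists 1 => // e e0 _ s r x [s0 sr re _ [_ /andP[h3 h4]]] /andP[t0 tr]; exfalso; lra.
have [h0|h0] := leP t 0; first by exists 1 => // e _ _ s r x _ /andP[]; rewrite ltNge h0.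
have [||d d0 hd] := @point_near (T0 + t) eta => //.
  by apply/andP; split; lra.
exists d => // e e0 ed s r x [s0 sr re /andP[mx1 mx2] [_ /andP[h3 h4]]] /andP[t0 tr].
apply; rewrite vervaat_right; last by lra.
rewrite (_ : tau + _ - 1 = T0 + t); last by ring.
rewrite (_ : _ - _ = b (t + (r - s + e)) + x - (b (T0 + t) - m)); last by ring.
apply: hd.
- by apply/andP; split; lra.
- by apply: le_lt_trans ed; rewrite ler_norml; apply/andP; split; lra.
- by apply: le_lt_trans ed; rewrite ler_norml; apply/andP; split; lra.
Qed.

(** The threshold [d] depends on the path. All times of the minimum of a path lie in the same
    interval of length [e], so a path with two of them belongs to no window with [e] below their
    distance, and the claim is vacuous for it. *)
Lemma window_vervaat_event : exists2 d, 0 < d & forall e, 0 < e -> e < d ->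
  forall s r x, good e s r x -> vervaat_event.
Proof.
have last2 : 0 <= last 0 (map fst c2) := path_last_le pc2.
have [uq|nuq] := pselect unique_argmin; last first.
  have [t [t01 bt ttau]] : exists t, [/\ 0 <= t <= 1, b t = m & t <> tau].
    apply: contrapT => h; apply: nuq => t t01 bt; apply: contrapT => ht.
    by apply: h; exists t.
  have tt : 0 < Num.min l (t - tau).
    rewrite lt_min l0 subr_gt0 lt_neqAle argmin01_le// andbT.
    by rewrite eq_sym; apply/eqP.
  exists (Num.min l (t - tau)) => // e e0; rewrite lt_min => /andP[el et] s r x [s0 sr h1 h2 [_ w]].
  have re : r + 2 * e <= 1 by lra.
  have [loc _ _ _] := window_location e0 e0 el s0 sr re w.
  have /andP[t1 t2] := loc t t01 bt; have /andP[t3 t4] := loc tau tau01 erefl.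
  by exfalso; lra.
have [d1 d10 hd1] := each_eventually c1 window_first_point.
have [d2 d20 hd2] := each_eventually c2 window_second_point.
exists (Num.min (Num.min d1 d2) (Num.min l (eta / 2))).
  by rewrite !lt_min d10 d20 l0/= divr_gt0.
move=> e e0; rewrite !lt_min => /andP[/andP[/(hd1 _ e0) {}hd1 /(hd2 _ e0) {}hd2] /andP[el eeta]].
move=> s r x [s0 sr lc1 lc2 [Or w]].
have re : r + 2 * e <= 1 by lra.
have [loc mx T0p T0I] := window_location e0 e0 el s0 sr re w.
have tauI := loc tau tau01 erefl.
have lo : located e s r x by split.
have ZE : Z = T0 + (1 - tau) by exact: first_return_level.
have [/andP[t1 t2] /andP[t3 t4]] := (tauI, T0I).
have [_ _ _ _ [_ w1 w2]] := w.
split.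
- by apply: Or; rewrite ZE ltr_norml; apply/andP; split; lra.
- by rewrite ZE; lra.
- by rewrite ZE; lra.
- move: w1; rewrite /erode_seq => /each_map w1.
  apply: each_imp (each_and (each_and hd1 (each_time_le pc1)) w1) => p [[h /andP[p0 pl]]] /=.
  by apply: h lo _; rewrite p0 (le_lt_trans pl).
- move: w2; rewrite /erode_seq => /each_map w2.
  apply: each_imp (each_and (each_and hd2 (each_time_le pc2)) w2) => p [[h /andP[p0 pl]]] /=.
  by rewrite ZE; apply: h lo _; rewrite p0 (le_lt_trans pl).
Qed.
End vervaat_path.

Section measurable_relations.
Context {R : realType} {d : measure_display} {U : measurableType d}.
Implicit Types (a b : U -> R).

Lemma measurable_lt_set a b : measurable_fun setT a -> measurable_fun setT b ->
  measurable [set u | a u < b u].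
Proof.
move=> ma mb; have := measurable_fun_ltr ma mb measurableT (Y := [set true]) I.
by rewrite setTI; congr measurable; apply/seteqP; split.
Qed.

Lemma measurable_le_set a b : measurable_fun setT a -> measurable_fun setT b ->
  measurable [set u | a u <= b u].
Proof.
move=> ma mb; have := measurable_fun_ler ma mb measurableT (Y := [set true]) I.
by rewrite setTI; congr measurable; apply/seteqP; split.
Qed.

Lemma measurable_preim a (A : set R) : measurable_fun setT a -> measurable A ->
  measurable [set u | A (a u)].
Proof. by move=> ma mA; have := ma measurableT _ mA; rewrite setTI. Qed.

Lemma measurable_each (Q : R * set R -> U -> Prop) (c : seq (R * set R)) : borel_sets c ->
  (forall p, measurable p.2 -> measurable [set u | Q p u]) ->
  measurable [set u | each (Q^~ u) c].
Proof.
move=> + mQ; elim: c => [_|p c ih /borel_sets_cons[mp mc]].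
  by rewrite (_ : [set _ | _] = setT); [exact: measurableT|apply/seteqP].
by apply: measurableI; [exact: mQ|exact: ih].
Qed.
End measurable_relations.

(** * Joint measurability of the process and of the windows *)

Section continuous_process.
Context {R : realType} {d : measure_display} {T : measurableType d}.
Implicit Types (t u x : R) (o : T).

Definition clamp t : R := Num.min 1 (Num.max 0 t).

Lemma clamp_itv t : 0 <= clamp t <= 1.
Proof. by rewrite /clamp le_min ler01 le_max lexx ge_min lexx. Qed.

Lemma clampE t : 0 <= t <= 1 -> clamp t = t.
Proof. by move=> /andP[t0 t1]; rewrite /clamp max_r// min_r. Qed.

Variable B : R -> T -> R.
Hypothesis mB : forall t, 0 <= t <= 1 -> measurable_fun setT (B t).
Hypothesis cB : forall o, {within `[0, 1], continuous (B ^~ o)}.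

Let bucket n t := Num.truncn (n.+1%:R * clamp t).

Let bucket_le n t : (bucket n t <= n.+1)%N.
Proof.
have /andP[t0 t1] := clamp_itv t.
have h : 0 <= n.+1%:R * clamp t by rewrite mulr_ge0.
have /andP[h1 _] := truncn_itv h.
by rewrite -(ler_nat R); apply: (le_trans h1); rewrite ler_piMr.
Qed.

Lemma measurable_clamp : measurable_fun setT clamp.
Proof. by apply: measurable_minr => //; apply: measurable_maxr. Qed.

(** [F n] evaluates the path at the last grid time up to [clamp t]; it is a finite sum of products
    of measurable functions and converges by continuity of the paths. The last index [n.+1] occurs
    at [t >= 1]. *)
Lemma measurable_continuous_process : measurable_fun setT (fun p : R * T => B (clamp p.1) p.2).
Proof.
pose F n (p : R * T) : R := \sum_(k < n.+2)
  (\1_[set t | bucket n t = k :> nat] p.1 * B (k%:R / n.+1%:R) p.2).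
have mbucket n k : measurable [set t | bucket n t = k].
  rewrite (_ : [set _ | _] = [set t | k%:R <= n.+1%:R * clamp t] `&` [set t | n.+1%:R * clamp t < k.+1%:R]).
    by apply: measurableI; [apply: measurable_le_set|apply: measurable_lt_set] => //;
       apply: measurable_funM => //; exact: measurable_clamp.
  have t0 t : 0 <= n.+1%:R * clamp t by rewrite mulr_ge0//; case/andP: (clamp_itv t).
  apply/seteqP; split => t /=; first by move=> <-; have /andP[] := truncn_itv (t0 t).
  by move=> [h1 h2]; apply: truncn_def; rewrite h1.
have kI n (k : 'I_n.+2) : (0 <= (k%:R / n.+1%:R : R)) && ((k%:R / n.+1%:R : R) <= 1).
  by rewrite divr_ge0//= ler_pdivrMr// mul1r ler_nat -ltnS.
have mF n : measurable_fun setT (F n).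
  apply: measurable_sum => k; apply: measurable_funM.
    by apply: (measurableT_comp _ measurable_fst); exact: measurable_indic.
  by apply: (measurableT_comp _ measurable_snd); exact: mB.
have FE n p : F n p = B ((bucket n p.1)%:R / n.+1%:R) p.2.
  have hk : (bucket n p.1 < n.+2)%N by rewrite ltnS.
  pose k : 'I_n.+2 := Ordinal hk.
  rewrite /F (bigD1 k)//= indicE mem_set// mul1r big1 ?addr0// => j jk.
  rewrite indicE memNset ?mul0r//= => h; move/eqP: jk; apply.
  by apply: val_inj.
apply: (measurable_fun_cvg mF) => -[t o] _ /=.
under eq_fun do rewrite FE.
have /andP[t0 t1] := clamp_itv t.
apply/cvgrPdist_lt => e e0.
have [r r0 hr] := within_itv_ball (@cB o) (clamp_itv t) e0.
near=> n; apply: hr.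
  by rewrite divr_ge0//= ler_pdivrMr// mul1r ler_nat; exact: bucket_le.
have h : 0 <= n.+1%:R * clamp t by rewrite mulr_ge0.
have /andP[h1 h2] := truncn_itv h; rewrite -/(bucket n t) in h1 h2 *.
have b1 : (bucket n t)%:R / n.+1%:R <= clamp t by rewrite ler_pdivrMr// mulrC.
have b2 : clamp t < (bucket n t)%:R / n.+1%:R + mesh n.
  by rewrite /mesh -[X in _ + X]mul1r -mulrDl natr1 ltr_pdivlMr// mulrC.
rewrite ger0_norm ?subr_ge0//; apply: (lt_trans (_ : _ < mesh n)); first by rewrite ltrBlDl.
by near: n; apply: (cvgr_lt (0 : R)) => //; exact: cvg_mesh.
Unshelve. all: by end_near. Qed.
End continuous_process.

Section stays_measurability.
Context {R : realType} {d d' : measure_display} {T : measurableType d} {U : measurableType d'}.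
Variables (B : R -> T -> R) (w : U -> T) (D : set U).
Hypothesis mB : measurable_fun setT (fun p : R * T => B p.1 p.2).
Hypothesis cB : forall o, {within `[0, 1], continuous (B ^~ o)}.
Hypotheses (mw : measurable_fun setT w) (mD : measurable D).

Lemma measurable_process_comp (f : U -> R) : measurable_fun setT f ->
  measurable_fun setT (fun p => B (f p) (w p)).
Proof. by move=> mf; exact: (measurable_comp_pair mB). Qed.

(** By continuity the uncountably many times reduce to the dyadic points of the interval, which move
    measurably with its ends [al] and [be]. *)
Lemma measurable_stays (al be : U -> R) (f : U -> R) :
  measurable_fun setT al -> measurable_fun setT be -> measurable_fun setT f ->
  (forall p, D p -> [/\ 0 <= al p, al p < be p & be p <= 1]) ->
  measurable (D `&` [set p | forall u, al p <= u <= be p -> f p <= B u (w p)]).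
Proof.
move=> mal mbe mf Dp.
pose G n k p := al p + (be p - al p) / (2 ^ n).-1.+1%:R * k%:R.
rewrite (_ : D `&` _ = D `&` \bigcap_n \bigcap_k
    [set p | (k <= (2 ^ n).-1.+1)%N -> f p <= B (G n k p) (w p)]).
  apply: measurableI => //; apply: bigcapT_measurable => n; apply: bigcapT_measurable => k.
  have [kn|kn] := leqP k (2 ^ n).-1.+1; last first.
    by rewrite (_ : [set _ | _] = setT); [exact: measurableT|apply/seteqP; split].
  rewrite (_ : [set _ | _] = [set p | f p <= B (G n k p) (w p)]); last first.
    by apply/seteqP; split => p /=; [apply|].
  apply: measurable_le_set => //; apply: measurable_process_comp.
  by apply: measurable_funD => //; apply: measurable_funM => //; apply: measurable_funM => //; exact: measurable_funB.
apply/seteqP; split => p /= [Dpp h]; split => //; have [a0 ab b1] := Dp _ Dpp.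
  move=> n _ k _ kn; apply: h; rewrite /G.
  have N0 : 0 < (2 ^ n).-1.+1%:R :> R by [].
  have ba : 0 < be p - al p by rewrite subr_gt0.
  apply/andP; split; first by rewrite lerDl mulr_ge0// divr_ge0// ltW.
  by rewrite -lerBrDl mulrAC ler_pdivrMr// ler_pM2l// ler_nat.
have H := @dyadic_above R (B ^~ (w p)) (f p) (al p) (be p) 1 a0 ab b1 (@cB (w p)).
by move=> u uI; apply: H uI => n k kn; exact: (h n Logic.I k Logic.I kn).
Qed.
End stays_measurability.

Section split_times.
Context {R : realType}.
Implicit Types (s r : R) (c : seq (R * set R)).

(** The times before [s] are read near the end of the bridge, after its minimum, and the times after
    [s] at its beginning; the window treats the two groups differently. *)
Lemma split_times s r c : path <%R 0 (map fst c) -> last 0 (map fst c) < r -> borel_sets c ->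
  0 < s -> s < r -> each (fun p => p.1 <> s) c -> exists ca cb,
  [/\ c = ca ++ cb, path <%R 0 (rcons (map fst ca) s), path <%R s (rcons (map fst cb) r),
      borel_sets ca & borel_sets cb].
Proof.
have bn : borel_sets ([::] : seq (R * set R)) by exact: borel_sets_nil.
have gen c0 u : path <%R u (map fst c0) -> last u (map fst c0) < r -> borel_sets c0 ->
    u < s -> s < r -> each (fun p => p.1 <> s) c0 -> exists ca cb,
    [/\ c0 = ca ++ cb, path <%R u (rcons (map fst ca) s), path <%R s (rcons (map fst cb) r),
        borel_sets ca & borel_sets cb].
  elim: c0 u => [|p c0 ih] u /=.
    by move=> _ _ _ us sr _; exists [::], [::]; split => //=; rewrite ?us ?sr.
  move=> /andP[up pc] lr /[dup] mpc /borel_sets_cons[mp mc] us sr [ps ec].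
  have [sp|sp|//] := ltgtP p.1 s.
    have [ca [cb [-> h1 h2 h3 h4]]] := ih _ pc lr mc sp sr ec.
    exists (p :: ca), cb; split => //=; first by rewrite up.
    by apply/borel_sets_cons; split.
  exists [::], (p :: c0); split => //=; rewrite ?us//.
  by rewrite sp/=; apply/path_rcons_lt; split.
by move=> *; exact: gen.
Qed.

Lemma each_cat (Q : R * set R -> Prop) c1 c2 : each Q (c1 ++ c2) <-> each Q c1 /\ each Q c2.
Proof. by elim: c1 => [|p c1 ih] /=; [split=> [|[]]|split=> [[? /ih[]]|[[? ?] ?]]; do ?split => //; apply/ih]. Qed.

Lemma each_iff (Q Q' : R * set R -> Prop) c : each (fun p => Q p <-> Q' p) c -> each Q c <-> each Q' c.
Proof. by elim: c => //= p c ih [h /ih h']; split => -[/h ? /h']. Qed.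

Lemma each_lt s u c : path <%R u (rcons (map fst c) s) -> each (fun p => p.1 < s) c.
Proof.
move=> /path_rcons_lt[pc ls]; apply: each_imp (each_time_le pc) => p /andP[_ pl].
exact: le_lt_trans ls.
Qed.

Lemma each_gt s r c : path <%R s (rcons (map fst c) r) -> each (fun p => s < p.1) c.
Proof.
by move=> /path_rcons_lt[pc ls]; apply: each_imp (each_time_le pc) => p /andP[].
Qed.
End split_times.

Section window_loop.
Context {R : realType} {d : measure_display} {T : measurableType d}.
Variables (B : R -> T -> R) (l de e s r x : R) (ca cb c2 : seq (R * set R)) (o : T).
Hypotheses (de0 : 0 < de) (e0 : 0 < e) (el : e < l) (s0 : 0 < s) (sr : s < r).
Hypothesis pa : path <%R 0 (rcons (map fst ca) s).
Hypothesis pb : path <%R s (rcons (map fst cb) r).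
Hypothesis p2 : path <%R 0 (rcons (map fst c2) (1 - r - 2 * de)).

Lemma window_loop_event :
  window (B ^~ o) l de e (ca ++ cb) c2 s r x <->
  loop_event l de e s r ca cb c2 (fun t o => B t o + x) o.
Proof.
set X := fun t o => B t o + x.
have ea := each_lt pa; have eb := each_gt pb.
have E1 : cylinder X [seq (p.1 - s, shift_set l p.2) | p <- cb] o <->
    each (fun p => p.2 (B (p.1 - s) o + x - l)) cb.
  by rewrite each_cylinder each_map.
have E2 : cylinder X [seq (p.1 + (r - s + de), shift_set l p.2) | p <- c2] o <->
    each (fun p => p.2 (B (p.1 + (r - s + de)) o + x - l)) c2.
  by rewrite each_cylinder each_map.
have E3 : cylinder X [seq (p.1 + (1 - s), p.2) | p <- ca] o <->
    each (fun p => p.2 (B (p.1 + (1 - s)) o + x)) ca.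
  by rewrite each_cylinder each_map.
have Eab : each (fun p => p.1 < s /\ p.2 (B (p.1 + (1 - s)) o + x) \/
      s < p.1 /\ p.2 (B (p.1 - s) o + x - l)) (ca ++ cb) <->
    each (fun p => p.2 (B (p.1 + (1 - s)) o + x)) ca /\ each (fun p => p.2 (B (p.1 - s) o + x - l)) cb.
  rewrite each_cat; split => -[h1 h2]; split.
  - apply: each_imp (each_and ea h1) => p [ps [[_//]|[sp]]].
    by have := lt_trans ps sp; rewrite ltxx.
  - apply: each_imp (each_and eb h2) => p [ps [[sp]|[_//]]].
    by have := lt_trans ps sp; rewrite ltxx.
  - by apply: each_imp (each_and ea h1) => p [ps h]; left.
  - by apply: each_imp (each_and eb h2) => p [ps h]; right.
have LE := loop_eventP l pa pb p2 X.
rewrite /loop_event; split.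
  move=> [w1 [w2 [u2 u2I u2b]] w3 [w4 [u4 u4I u4b]] [w5 /Eab[w6 w7] w8]]; split.
    by apply/LE; split => //; split => //; [exact/E1|exact/E2|exact/E3].
  move=> [/LE[_ h _ _ _]|/LE[_ _ _ h _]].
    by have := h _ u2I; rewrite leNgt u2b.
  by have := h _ u4I; rewrite leNgt u4b.
move=> [/LE[[w1 /E1 w6] w2 [w3 /E2 w8] w4 [w5 /E3 w7]] hn]; split => //.
- split => //; apply: contrapT => h; apply: hn; left; apply/LE; split => //.
  + by split => //; exact/E1.
  + by move=> u uI; rewrite leNgt; apply/negP => bu; apply: h; exists u.
  + by split => //; exact/E2.
  + by split => //; exact/E3.
- split => //; apply: contrapT => h; apply: hn; right; apply/LE; split => //.
  + by split => //; exact/E1.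
  + by split => //; exact/E2.
  + by move=> u uI; rewrite leNgt; apply/negP => bu; apply: h; exists u.
  + by split => //; exact/E3.
- by split => //; exact/Eab.
Qed.
End window_loop.

Section window_measurability.
Context {R : realType} {d : measure_display} {T : measurableType d}.
Variables (B : R -> T -> R) (l de e : R) (O : set R) (c1 c2 : seq (R * set R)).
Hypothesis mB : measurable_fun setT (fun p : R * T => B p.1 p.2).
Hypothesis cB : forall o, {within `[0, 1], continuous (B ^~ o)}.
Hypotheses (de0 : 0 < de) (mO : measurable O).
Hypotheses (pc1 : path <%R 0 (map fst c1)) (pc2 : path <%R 0 (map fst c2)).
Hypotheses (m1 : borel_sets c1) (m2 : borel_sets c2).

(* Parameters ((s, r), x) of a window, together with a path. *)
Local Notation U := (R * R * R * T)%type.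

Definition window_domain : set (R * R) :=
  [set q | [/\ 0 < q.1, q.1 < q.2, last 0 (map fst c1) < q.2,
      last 0 (map fst c2) < 1 - q.2 - 2 * de & O q.2]].

Definition window_set : set U :=
  [set p | window_domain p.1.1 /\ window (B ^~ p.2) l de e c1 c2 p.1.1.1 p.1.1.2 p.1.2].

Let last2 : 0 <= last 0 (map fst c2).
Proof. exact: path_last_le. Qed.

Let ms : measurable_fun setT (fun p : U => p.1.1.1).
Proof. exact: (measurableT_comp measurable_fst (measurableT_comp measurable_fst measurable_fst)). Qed.
Let mr : measurable_fun setT (fun p : U => p.1.1.2).
Proof. exact: (measurableT_comp measurable_snd (measurableT_comp measurable_fst measurable_fst)). Qed.
Let mx : measurable_fun setT (fun p : U => p.1.2).
Proof. exact: (measurableT_comp measurable_snd measurable_fst). Qed.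
Let mo : measurable_fun setT (fun p : U => p.2).
Proof. exact: measurable_snd. Qed.
Let mc (a : R) : measurable_fun setT (fun _ : U => a).
Proof. exact: measurable_cst. Qed.

Lemma window_domain_bounds q : window_domain q -> [/\ 0 < q.1, q.1 < q.2 & q.2 + 2 * de < 1].
Proof. by move=> [q0 q12 _ q2 _]; split => //; move: last2 q2; lra. Qed.

Lemma measurable_window_domain : measurable window_domain.
Proof.
have h1 : measurable_fun setT (fun q : R * R => q.1) by exact: measurable_fst.
have h2 : measurable_fun setT (fun q : R * R => q.2) by exact: measurable_snd.
have hc (a : R) : measurable_fun setT (fun _ : R * R => a) by exact: measurable_cst.
rewrite (_ : window_domain = [set q | 0 < q.1] `&` [set q | q.1 < q.2] `&`
  [set q | last 0 (map fst c1) < q.2] `&` [set q | last 0 (map fst c2) < 1 - q.2 - 2 * de] `&`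
  [set q | O q.2]); last first.
  by apply/seteqP; split => q /=; [move=> [? ? ? ? ?]|move=> [[[[? ?] ?] ?] ?]].
apply: measurableI; last exact: measurable_preim.
apply: measurableI; last first.
  by apply: measurable_lt_set => //; apply: measurable_funB => //; exact: measurable_funB.
by apply: measurableI; [apply: measurableI|]; apply: measurable_lt_set.
Qed.

Lemma measurable_window_set : measurable window_set.
Proof.
pose D : set U := [set p | window_domain p.1.1].
have mD : measurable D.
  have h : measurable_fun setT (fun p : U => p.1.1) by exact: (measurableT_comp measurable_fst measurable_fst).
  by have := h measurableT _ measurable_window_domain; rewrite setTI.
(* Each constraint is intersected with [D], where the intervals of the window have positive length
   and lie in [[0, 1]]. *)
have st (al be f : U -> R) := @measurable_stays R _ _ T U B (fun p => p.2) D mB cB mo mD al be f.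
pose S1 : set U := [set p | forall u, 0 <= u <= p.1.1.2 - p.1.1.1 -> l - p.1.2 <= B u p.2].
pose S2 (a : R) : set U := [set p | forall u, p.1.1.2 - p.1.1.1 <= u <= p.1.1.2 - p.1.1.1 + de -> a - p.1.2 <= B u p.2].
pose S3 : set U := [set p | forall u, p.1.1.2 - p.1.1.1 + de <= u <= 1 - p.1.1.1 - de -> 0 - p.1.2 <= B u p.2].
pose S4 (a : R) : set U := [set p | forall u, 1 - p.1.1.1 - de <= u <= 1 - p.1.1.1 -> a - p.1.2 <= B u p.2].
pose S5 : set U := [set p | forall u, 1 - p.1.1.1 <= u <= 1 -> 0 - p.1.2 <= B u p.2].
have mrs : measurable_fun setT (fun p : U => p.1.1.2 - p.1.1.1) by exact: measurable_funB.
have m1s : measurable_fun setT (fun p : U => 1 - p.1.1.1) by exact: measurable_funB.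
have max (a : R) : measurable_fun setT (fun p : U => a - p.1.2) by exact: measurable_funB.
have b1 (s r : R) : 0 < s -> s < r -> r + 2 * de < 1 -> [/\ (0 : R) <= 0, 0 < r - s & r - s <= 1].
  by have := de0; move=> *; split; lra.
have b2 (s r : R) : 0 < s -> s < r -> r + 2 * de < 1 -> [/\ 0 <= r - s, r - s < r - s + de & r - s + de <= 1].
  by have := de0; move=> *; split; lra.
have b3 (s r : R) : 0 < s -> s < r -> r + 2 * de < 1 -> [/\ 0 <= r - s + de, r - s + de < 1 - s - de & 1 - s - de <= 1].
  by have := de0; move=> *; split; lra.
have b4 (s r : R) : 0 < s -> s < r -> r + 2 * de < 1 -> [/\ 0 <= 1 - s - de, 1 - s - de < 1 - s & 1 - s <= 1].
  by have := de0; move=> *; split; lra.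
have b5 (s r : R) : 0 < s -> s < r -> r + 2 * de < 1 -> [/\ 0 <= 1 - s, 1 - s < 1 & (1 : R) <= 1].
  by have := de0; move=> *; split; lra.
have mS1 : measurable (D `&` S1).
  by apply: (st (fun=> 0)) => // p /window_domain_bounds[h1 h2 h3]; exact: (b1 _ _ h1 h2 h3).
have mS2 a : measurable (D `&` S2 a).
  apply: st => //; first exact: measurable_funD.
  by move=> p /window_domain_bounds[h1 h2 h3]; exact: (b2 _ _ h1 h2 h3).
have mS3 : measurable (D `&` S3).
  apply: st => //; [exact: measurable_funD|exact: measurable_funB|].
  by move=> p /window_domain_bounds[h1 h2 h3]; exact: (b3 _ _ h1 h2 h3).
have mS4 a : measurable (D `&` S4 a).
  apply: st => //; first exact: measurable_funB.
  by move=> p /window_domain_bounds[h1 h2 h3]; exact: (b4 _ _ h1 h2 h3).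
have mS5 : measurable (D `&` S5).
  by apply: (st _ (fun=> 1)) => // p /window_domain_bounds[h1 h2 h3]; exact: (b5 _ _ h1 h2 h3).
pose Q1 (p : R * set R) (q : U) := (p.1 < q.1.1.1 /\ p.2 (B (p.1 + (1 - q.1.1.1)) q.2 + q.1.2)) \/
   (q.1.1.1 < p.1 /\ p.2 (B (p.1 - q.1.1.1) q.2 + q.1.2 - l)).
pose Q2 (p : R * set R) (q : U) := p.2 (B (p.1 + (q.1.1.2 - q.1.1.1 + de)) q.2 + q.1.2 - l).
have mcomp (f : U -> R) : measurable_fun setT f -> measurable_fun setT (fun q => B (f q) q.2).
  by move=> mf; exact: (measurable_process_comp mB mo).
have mQ1 : measurable [set q | each (Q1^~ q) c1].
  apply: measurable_each => // p mp.
  apply: measurableU; apply: measurableI.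
  - by apply: measurable_lt_set.
  - apply: measurable_preim => //; apply: measurable_funD => //; apply: mcomp; exact: measurable_funD.
  - by apply: measurable_lt_set.
  - apply: measurable_preim => //; apply: measurable_funB => //; apply: measurable_funD => //.
    by apply: mcomp; exact: measurable_funB.
have mQ2 : measurable [set q | each (Q2^~ q) c2].
  apply: measurable_each => // p mp.
  apply: measurable_preim => //; apply: measurable_funB => //; apply: measurable_funD => //.
  by apply: mcomp; apply: measurable_funD => //; exact: measurable_funD.
(* Falling below a level at some time is the failure of a barrier condition within [D], hence the
   set differences. *)
rewrite (_ : window_set = (D `&` S1) `&` ((D `&` S2 0) `\` (D `&` S2 (l - e))) `&` (D `&` S3) `&`
  ((D `&` S4 (- e)) `\` (D `&` S4 0)) `&` (D `&` S5) `&`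
  [set q | each (Q1^~ q) c1] `&` [set q | each (Q2^~ q) c2]); last first.
  apply/seteqP; split => -[[[s r] x] o] /=.
    move=> [Dp [w1 [w2 [u2 u2I u2b]] w3 [w4 [u4 u4I u4b]] [w5 w6 w7]]].
    have le u (a : R) : a <= B u o + x -> a - x <= B u o by rewrite lerBlDr.
    have lt u (a : R) : B u o + x < a -> a - x <= B u o -> False.
      by rewrite lerBlDr leNgt => ->.
    split=> //; split=> //; split; last by split=> // u /w5/le.
    split; last first.
      by split; [split=> // u /w4/le|move=> [_ h]; exact: (lt u4 0 u4b (h _ u4I))].
    split; last by split=> // u /w3/le.
    split; first by split=> // u /w1/le.
    by split; [split=> // u /w2/le|move=> [_ h]; exact: (lt u2 _ u2b (h _ u2I))].
  have le u (a : R) : a - x <= B u o -> a <= B u o + x by rewrite lerBlDr.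
  move=> [[[[[[[Dp w1] [[_ w2] n2]] [_ w3]] [[_ w4] n4]] [_ w5]] w6] w7]; split => //.
  split=> [u /w1/le//| |u /w3/le//| |].
  - split=> [u /w2/le//|]; apply: contrapT => h; apply: n2; split => // u uI.
    by rewrite leNgt; apply/negP => bu; apply: h; exists u => //; rewrite -ltrBrDr.
  - split=> [u /w4/le//|]; apply: contrapT => h; apply: n4; split => // u uI.
    by rewrite leNgt; apply/negP => bu; apply: h; exists u => //; rewrite -ltrBrDr.
  - by split=> // u /w5/le.
apply: measurableI; last exact: mQ2.
apply: measurableI; last exact: mQ1.
apply: measurableI; last exact: mS5.
apply: measurableI; last exact: measurableD.
apply: measurableI; last exact: mS3.
by apply: measurableI; last exact: measurableD.
Qed.
End window_measurability.

(** * The limit of small windows *)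

Section erosion_limits.
Context {R : realType}.
Implicit Types (s t x y l : R) (c : seq (R * set R)).
Local Notation mu := (@lebesgue_measure R).

Lemma fst_erode_seq eta c : map fst (erode_seq eta c) = map fst c.
Proof. by rewrite -map_comp. Qed.

Lemma borel_erode_seq eta c : borel_sets c -> borel_sets (erode_seq eta c).
Proof. by apply: borel_sets_map => p _; exact: measurable_erode. Qed.

Lemma shift_erode l eta A : shift_set l (erode eta A) = erode eta (shift_set l A).
Proof.
apply/seteqP; split => x h y xy.
  by apply: h; rewrite opprB addrA subrK.
have := h (y + l); rewrite /shift_set/= addrK; apply.
by rewrite opprD addrA addrAC.
Qed.

Lemma open_shift_set l A : open A -> open (shift_set l A).
Proof.
move=> oA; apply: (open_comp (f := fun x : R => x - l)) => // x _.
by apply: cvgB; [exact: cvg_id|exact: cvg_cst].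
Qed.

Lemma shift_erode_seq l eta c : [seq (p.1, shift_set l p.2) | p <- erode_seq eta c] =
  erode_seq eta [seq (p.1, shift_set l p.2) | p <- c].
Proof. by rewrite /erode_seq -!map_comp; apply: eq_map => p /=; rewrite shift_erode. Qed.

Lemma bes3_mass_erode_limit l y s x c : path <%R s (rcons (map fst c) l) -> borel_sets c ->
  each (fun p => open p.2) c ->
  lower_limit_ge (fun n => bes3_mass l y s x (erode_seq (mesh n) c)) (bes3_mass l y s x c).
Proof.
elim: c s x => [|[t A] c ih] s x; first by move=> *; exact: cst_lower_limit.
move=> /= /andP[st pl] /borel_sets_cons[mA mc] [oA oc].
have ts : 0 < t - s by rewrite subr_gt0.
have pe n : path <%R t (rcons (map fst (erode_seq (mesh n) c)) l) by rewrite fst_erode_seq.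
have me n : borel_sets (erode_seq (mesh n) c) by exact: borel_erode_seq.
have m1 : measurable_fun setT (fun z : R => (bes3_kernel (t - s) x z * bes3_weight z)%:E).
  apply/measurable_EFinP; apply: measurable_funM; last exact: measurable_bes3_weight.
  by apply: measurable_bes3_kernel; [exact: measurable_cst|exact: measurable_cst|exact: measurable_id].
have n1 z : (0 <= (bes3_kernel (t - s) x z * bes3_weight z)%:E)%E.
  by rewrite lee_fin mulr_ge0 ?bes3_weight_ge0// bes3_kernel_ge0.
pose f n z : \bar R := ((bes3_kernel (t - s) x z * bes3_weight z)%:E * bes3_mass l y t z (erode_seq (mesh n) c))%E.
pose g z : \bar R := ((bes3_kernel (t - s) x z * bes3_weight z)%:E * bes3_mass l y t z c)%E.
have mf n : measurable_fun setT (f n).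
  apply: emeasurable_funM; first exact: m1.
  by apply: (@measurable_bes3_mass _ _ R) => //; exact: measurable_cst.
have mg : measurable_fun setT g.
  apply: emeasurable_funM; first exact: m1.
  by apply: (@measurable_bes3_mass _ _ R) => //; exact: measurable_cst.
have f0 n z : (0 <= f n z)%E by rewrite mule_ge0//; exact: bes3_mass_ge0.
have g0 z : (0 <= g z)%E by rewrite mule_ge0//; exact: bes3_mass_ge0.
suff : lower_limit_ge (fun n => \int[mu]_z (f n \_ (erode (mesh n) A)) z)%E (\int[mu]_z (g \_ A) z)%E.
  by rewrite -integral_mkcond; under eq_fun do rewrite -integral_mkcond.
apply: lower_limit_integral => //.
- by move=> n; exact: (measurable_patch0 (measurable_erode (mesh n) A) (mf n)).
- exact: measurable_patch0.
- by move=> n z _; rewrite patchE; case: ifP.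
- by move=> z _; rewrite patchE; case: ifP.
move=> z _; rewrite patchE; case: ifPn => [/[!inE] Az|nAz]; last first.
  apply: (@lower_limit_near _ (fun=> 0%E)); last exact: cst_lower_limit.
  by near=> n; rewrite patchE; case: ifP.
apply: (@lower_limit_near _ (fun n => f n z)).
  near=> n; rewrite patchE mem_set//; near: n; exact: near_erode.
apply: lower_limit_mul => //; [by move=> n; exact: bes3_mass_ge0|exact: bes3_mass_ge0|exact: cst_lower_limit|exact: ih].
Unshelve. all: by end_near. Qed.

Lemma integral_scale (a : R) (f : R -> \bar R) : 0 <= a -> measurable_fun setT f ->
  (forall x, 0 <= f x)%E -> (\int[mu]_x (a%:E * f x) = a%:E * \int[mu]_x f x)%E.
Proof. by move=> a0 mf f0; rewrite ge0_integralZl_EFin. Qed.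

Lemma lower_limit_ub (u : (\bar R)^nat) (a m : \bar R) : (forall n, (u n <= m)%E) ->
  lower_limit_ge u a -> (a <= m)%E.
Proof.
move=> um /lower_limit_geP ua; apply: (le_trans ua).
rewrite limn_einf_lim; apply: lime_le; first exact: is_cvg_einfs.
near=> n; apply: le_trans (um n); apply: ereal_inf_lbound; by exists n => /=.
Unshelve. all: by end_near. Qed.
End erosion_limits.

Section window_expectation.
Context {R : realType} {d : measure_display} {T : measurableType d}.
Variables (P : probability T R) (B : R -> T -> R) (l : R).
Local Notation mu := (@lebesgue_measure R).
Hypotheses (l0 : 0 < l) (bB : is_brownian_bridge P 1 0 (- l) B).
Hypothesis mB : measurable_fun setT (fun p : R * T => B p.1 p.2).
Variables (O : set R) (c1 c2 : seq (R * set R)).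
Hypotheses (mO : measurable O).
Hypotheses (pc1 : path <%R 0 (map fst c1)) (pc2 : path <%R 0 (map fst c2)).
Hypotheses (m1 : borel_sets c1) (m2 : borel_sets c2).
Implicit Types (s r x : R) (o : T) (n : nat).

Let cB o : {within `[0, 1], continuous (B ^~ o)}.
Proof. exact: (bb_continuous bB). Qed.

Let W n : set (R * R * R * T) := window_set B l (mesh n ^+ 2) (mesh n ^+ 2) O c1 c2.

Let mesh2 n : 0 < mesh n ^+ 2 :> R.
Proof. by rewrite exprn_gt0// mesh_gt0. Qed.

Let mW n : measurable (W n).
Proof. exact: measurable_window_set. Qed.

Let w n (p : R * R * R * T) : \bar R := (\1_(W n) p)%:E.

Let mw n : measurable_fun setT (w n).
Proof. by apply/measurable_EFinP; exact: measurable_indic. Qed.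

Let w0 n p : (0 <= w n p)%E.
Proof. by rewrite lee_fin. Qed.

Definition window_volume n o : \bar R :=
  (\int[mu]_s \int[mu]_r \int[mu]_x w n (s, r, x, o))%E.

Lemma integral_itv_indic (a e : R) : 0 <= e -> (\int[mu]_x (\1_`[a, (a + e)%R] x)%:E = e%:E)%E.
Proof.
move=> e0; rewrite integral_indic// setIT.
have h : lebesgue_measure (`[a, (a + e)%R]%classic : set R) = e%:E.
  rewrite lebesgue_measure_itv/= lte_fin; case: ifPn => [_|]; first by rewrite -EFinB addrAC subrr add0r.
  rewrite -leNgt gerDl => e1; congr EFin; apply/eqP; by rewrite eq_le e0 e1.
exact: h.
Qed.

(** Each parameter is confined to an interval of length [e]: [s] to [[1 - tau - e, 1 - tau]], [r] to
    [[T0 + s - e, T0 + s]] and [x] to [[- m - e, - m]]. The second interval moves with [s], so the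
    integrals are bounded from the inside out. *)
Lemma window_volume_le n o : mesh n ^+ 2 < l -> (window_volume n o <= (mesh n ^+ 6)%:E)%E.
Proof.
move=> hl; pose e : R := mesh n ^+ 2; have e0 : 0 < e := mesh2 n.
set tau := argmin01 (B ^~ o); set m := B tau o; set T0 := level_time (B ^~ o) l.
pose J (a x : R) : R := \1_`[a, (a + e)%R] x.
have J0 a x : 0 <= J a x by rewrite /J indicE.
have mJ a : measurable_fun setT (fun x : R => (J a x)%:E).
  by apply/measurable_EFinP; exact: measurable_indic.
have IJ a : (\int[mu]_x (J a x)%:E = e%:E)%E by exact: integral_itv_indic (ltW e0).
have bound s r x : (w n (s, r, x, o) <= (J (1 - tau - e) s)%:E * ((J (T0 + s - e) r)%:E * (J (- m - e) x)%:E))%E.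
  rewrite /w indicE; case: (boolP (_ \in _)) => [/[!inE]|_]; last first.
    by rewrite -!EFinM lee_fin !mulr_ge0.
  move=> [[/= s0 sr lr1 lr2 _] win].
  have last2 := path_last_le pc2; rewrite -/e in lr2.
  have re : r + 2 * e <= 1 by lra.
  have [loc mx _ T0I] := window_location (@cB o) (bb_start bB o) (bb_end bB o) l0 e0 e0 hl s0 sr re win.
  have [/andP[t0 t1] _] := argmin01_spec (@cB o).
  have tauI : 1 - s - e <= tau <= 1 - s by apply: loc => //; rewrite t0.
  have -> : J (1 - tau - e) s = 1 by rewrite /J indicE mem_set//= in_itv/=; move/andP: tauI => [h1 h2]; apply/andP; split; lra.
  have -> : J (T0 + s - e) r = 1 by rewrite /J indicE mem_set//= in_itv/=; move/andP: T0I => [h1 h2]; apply/andP; split; rewrite -/T0 in h1 h2; lra.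
  have -> : J (- m - e) x = 1 by rewrite /J indicE mem_set//= in_itv/=; move/andP: mx => [h1 h2]; apply/andP; split; rewrite -/tau -/m in h1 h2; lra.
  by rewrite !mule1.
have -> : (mesh n ^+ 6)%:E = (e%:E * (e%:E * e%:E))%E.
  by rewrite -!EFinM; congr EFin; rewrite /e; ring.
have CJ (c a : R) : 0 <= c -> (\int[mu]_x (c%:E * (J a x)%:E) = c%:E * e%:E)%E.
  by move=> c0; rewrite -(IJ a); apply: integral_scale => // x; rewrite lee_fin.
have step s r : (\int[mu]_x w n (s, r, x, o) <= (J (1 - tau - e) s)%:E * ((J (T0 + s - e) r)%:E * e%:E))%E.
  rewrite (_ : _ * _ = (J (1 - tau - e) s * J (T0 + s - e) r)%:E * e%:E)%E; last by rewrite EFinM muleA.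
  rewrite -(CJ _ (- m - e)) ?mulr_ge0//.
  apply: le_ge0_integral => x _; [exact: w0|].
  by apply: le_trans (bound s r x) _; rewrite EFinM -muleA.
have step2 s : (\int[mu]_r \int[mu]_x w n (s, r, x, o) <= (J (1 - tau - e) s)%:E * (e%:E * e%:E))%E.
  rewrite (_ : _ * _ = (J (1 - tau - e) s * e)%:E * e%:E)%E; last by rewrite EFinM muleA.
  rewrite -(CJ _ (T0 + s - e)); last by apply: mulr_ge0 => //; exact: ltW.
  apply: le_ge0_integral => r _; [by apply: integral_ge0 => x _; exact: w0|].
  by apply: le_trans (step s r) _; rewrite (EFinM (J (1 - tau - e) s) e) -muleA (muleC e%:E).
rewrite (_ : _ * _ = (e * e)%:E * e%:E)%E; last by rewrite EFinM muleC.
rewrite -(CJ _ (1 - tau - e)); last by apply: mulr_ge0 => //; exact: ltW.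
apply: le_ge0_integral => s _; [by apply: integral_ge0 => r _; apply: integral_ge0 => x _; exact: w0|].
by apply: le_trans (step2 s) _; rewrite EFinM muleC.
Qed.

Let wx n (q : R * R * T) : \bar R := (\int[mu]_x w n (q.1.1, q.1.2, x, q.2))%E.
Let mwx n : measurable_fun setT (wx n).
Proof.
pose k (p : R * R * T * R) := w n (p.1.1.1, p.1.1.2, p.2, p.1.2).
apply: (@measurable_integral_param _ _ _ setT k measurableT) => [|p]; last exact: w0.
apply: (measurable_comp_pair (mw n)); last exact: (measurableT_comp measurable_snd measurable_fst).
apply: measurable_fun_pair; last exact: measurable_snd.
apply: measurable_fun_pair.
  exact: (measurableT_comp measurable_fst (measurableT_comp measurable_fst measurable_fst)).
exact: (measurableT_comp measurable_snd (measurableT_comp measurable_fst measurable_fst)).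
Qed.
Let wx0 n q : (0 <= wx n q)%E.
Proof. by apply: integral_ge0 => x _; exact: w0. Qed.

Let wr n (q : R * T) : \bar R := (\int[mu]_r wx n (q.1, r, q.2))%E.
Let mwr n : measurable_fun setT (wr n).
Proof.
pose k (p : R * T * R) := wx n (p.1.1, p.2, p.1.2).
apply: (@measurable_integral_param _ _ _ setT k measurableT) => [|p]; last exact: wx0.
apply: (measurable_comp_pair (mwx n)); last exact: (measurableT_comp measurable_snd measurable_fst).
apply: measurable_fun_pair; last exact: measurable_snd.
exact: (measurableT_comp measurable_fst measurable_fst).
Qed.
Let wr0 n q : (0 <= wr n q)%E.
Proof. by apply: integral_ge0 => x _; exact: wx0. Qed.

Lemma measurable_window_volume n : measurable_fun setT (window_volume n).
Proof.
pose k (p : T * R) := wr n (p.2, p.1).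
apply: (@measurable_integral_param _ _ _ setT k measurableT) => [|p]; last exact: wr0.
exact: (measurable_comp_pair (mwr n) measurable_snd measurable_fst).
Qed.

Lemma integral_window_volume n : (\int[P]_o window_volume n o =
  \int[mu]_s \int[mu]_r \int[mu]_x P [set o | W n (s, r, x, o)])%E.
Proof.
rewrite (tonelli_set P mu measurableT measurableT (g := fun p => wr n (p.2, p.1))); last 2 first.
- exact: (measurable_comp_pair (mwr n) measurable_snd measurable_fst).
- by move=> p; exact: wr0.
apply: eq_integral => s _ /=.
have mwxs : measurable_fun setT (fun p : T * R => wx n (s, p.2, p.1)).
  apply: (measurable_comp_pair (mwx n)); last exact: measurable_fst.
  by apply: measurable_fun_pair; [exact: measurable_cst|exact: measurable_snd].
rewrite (tonelli_set P mu measurableT measurableT mwxs); last by move=> p; exact: wx0.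
apply: eq_integral => r _ /=.
have mws : measurable_fun setT (fun p : T * R => w n (s, r, p.2, p.1)).
  apply: (measurable_comp_pair (mw n)); last exact: measurable_fst.
  by apply: measurable_fun_pair; [exact: measurable_cst|exact: measurable_snd].
rewrite (tonelli_set P mu measurableT measurableT mws); last by move=> p; exact: w0.
apply: eq_integral => x _ /=.
have mS : measurable [set o | W n (s, r, x, o)].
  have h : measurable_fun setT (fun o : T => (s, r, x, o)).
    by apply: measurable_fun_pair; [exact: measurable_cst|exact: measurable_id].
  by have := h measurableT _ (mW n); rewrite setTI.
transitivity (\int[P]_o (\1_[set o | W n (s, r, x, o)] o)%:E)%E.
  apply: eq_integral => o _; rewrite /w !indicE; congr ((nat_of_bool _)%:R%:E).
by rewrite integral_indic// setIT.
Qed.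

Let pw n (q : R * R * R) : \bar R := P [set o | W n (q, o)].

Let mpw n : measurable_fun setT (pw n).
Proof.
have := @measurable_fun_fubini_tonelli_F _ _ _ T R P (w n) (mw n) (w0 n).
congr (measurable_fun setT _); apply/funext => q.
have mS : measurable [set o | W n (q, o)].
  have h : measurable_fun setT (fun o : T => (q, o)).
    by apply: measurable_fun_pair; [exact: measurable_cst|exact: measurable_id].
  by have := h measurableT _ (mW n); rewrite setTI.
rewrite /fubini_F.
transitivity (\int[P]_o (\1_[set o | W n (q, o)] o)%:E)%E.
  apply: eq_integral => o _; rewrite /w !indicE; congr ((nat_of_bool _)%:R%:E).
by rewrite integral_indic// setIT.
Qed.

Lemma measurable_window_prob n : measurable_fun setT (fun q : R * R * R =>
  P [set o | window_set B l (mesh n ^+ 2) (mesh n ^+ 2) O c1 c2 (q, o)]).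
Proof. exact: mpw. Qed.

Let c2' := [seq (p.1, shift_set l p.2) | p <- c2].
Let f2' : map fst c2' = map fst c2.
Proof. by rewrite -map_comp. Qed.
Let m2' : borel_sets c2'.
Proof. by apply: borel_sets_map => // p; exact: measurable_shift_set. Qed.

(* [l / 4 = 4 * l * (1 / 4) ^ 2], where [1 / 4] is the integral over [z, y > 0] of
   [z * p (z + y)], with [p] the standard normal density; this integral appears at
   both ends of the excursion, and [4 * l] in the kernels of the two short intervals. *)
Definition return_density r : \bar R :=
  ((l / 4 * (bm_kernel 1 0 (- l))^-1)%:E * (bes3_mass r 0 0 0 c1 * bes3_mass (1 - r) 0 0 l c2'))%E.

Definition return_domain : set (R * R) :=
  [set q | [/\ 0 < q.1, q.1 < q.2, last 0 (map fst c1) < q.2, last 0 (map fst c2) < 1 - q.2 &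
     O q.2 /\ each (fun p => p.1 <> q.1) c1]].

(** In the domain [s] avoids the times of [c1], so that the cylinder splits at [s]. Once [mesh n] is
    small enough for the window to fit, its probability is [loop_mass] divided by the density of the
    bridge, which is the same for all starting heights [x]. *)
Lemma window_prob_limit s r : return_domain (s, r) ->
  lower_limit_ge (fun n => (mesh n ^- 6)%:E * \int[mu]_x pw n (s, r, x))%E (return_density r).
Proof.
move=> [/= s0 sr lr1 lr2 [Or nt]].
have [ca [cb [cE pa pb ma mb]]] := split_times pc1 lr1 m1 s0 sr nt.
have p2 : path <%R 0 (rcons (map fst c2) (1 - r)) by apply/path_rcons_lt.
have lim := loop_mass_limit l0 sr pa pb p2 ma mb m2.
have p10 : 0 < bm_kernel 1 0 (- l) := bm_kernel_gt0 _ _ ltr01.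
pose q := (bm_kernel 1 0 (- l))^-1; have q0 : 0 <= q by rewrite invr_ge0 ltW.
have sq0 : (fun n => 2 * mesh n ^+ 2 : R) @ \oo --> 0.
  rewrite -[X in _ --> X](mulr0 2); apply: cvgMr; rewrite -[X in _ --> X](mulr0 0).
  by under eq_fun do rewrite expr2; apply: cvgM; exact: cvg_mesh.
have small (c : R) : 0 < c -> \forall n \near \oo, 2 * mesh n ^+ 2 < c.
  by move=> c0; apply: (cvgr_lt (0 : R)).
have -> : return_density r = (q%:E * ((l / 4)%:E * (bes3_mass r 0 0 0 (ca ++ cb) * bes3_mass (1 - r) 0 0 l c2')))%E.
  by rewrite /return_density -cE [RHS]muleA; congr (_ * _)%E; rewrite -EFinM (mulrC q).
have b1 := bes3_mass_ge0 0 0 (path_cat_rcons sr pa pb) ((borel_sets_cat ca cb).2 (conj ma mb)).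
have p2' : path <%R 0 (rcons (map fst c2') (1 - r)) by rewrite f2'.
have b2 := bes3_mass_ge0 0 l p2' m2'.
pose LM n x := loop_mass l (mesh n ^+ 2) (mesh n ^+ 2) s r ca cb c2 x.
have LME n : mesh n ^+ 2 < l -> 2 * mesh n ^+ 2 < 1 - r - last 0 (map fst c2) ->
    forall x, LM n x = ((bm_kernel 1 0 (- l))%:E * pw n (s, r, x))%E.
  move=> nl n2 x.
  have p2n : path <%R 0 (rcons (map fst c2) (1 - r - 2 * mesh n ^+ 2)).
    by apply/path_rcons_lt; split => //; rewrite ltrBrDr -ltrBrDl.
  have bX : is_brownian_bridge P 1 x (x - l) (fun t o => B t o + x).
    by have := bridge_shift x ltr01 bB; rewrite add0r (addrC (- l)).
  have [_ hP] := loop_event_prob (mesh2 n) sr (mesh2 n) nl pa pb p2n ma mb m2 bX.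
  have -> : pw n (s, r, x) = P (loop_event l (mesh n ^+ 2) (mesh n ^+ 2) s r ca cb c2 (fun t o => B t o + x)).
    rewrite /pw; congr (P _); apply/seteqP; split => o.
      by move=> [_ /=]; rewrite cE => h; exact/(window_loop_event B l (mesh n ^+ 2) x o pa pb p2n).
    move=> h; split; last by rewrite cE; exact/(window_loop_event B l (mesh n ^+ 2) x o pa pb p2n).
    by split => //=; rewrite ltrBrDr -ltrBrDl.
  have := bm_kernel_shift x 0 (- l) (ltr01 : 0 < 1 :> R).
  rewrite add0r (addrC (- l)) => kE; rewrite hP kE muleC -muleA -EFinM mulVf ?gt_eqF//.
  by rewrite mule1.
have nl : \forall n \near \oo, mesh n ^+ 2 < l.
  have l20 : 0 < 2 * l by rewrite mulr_gt0.
  have h := small _ l20; near=> n; rewrite -(ltr_pM2l (ltr0Sn R 1)); near: n; exact: h.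
have n2 : \forall n \near \oo, 2 * mesh n ^+ 2 < 1 - r - last 0 (map fst c2).
  by apply: small; rewrite subr_gt0.
have pw0 n x : (0 <= pw n (s, r, x))%E by exact: measure_ge0.
have mpx n : measurable_fun setT (fun x : R => pw n (s, r, x)).
  by apply: (measurable_comp_pair (mpw n)); [exact: measurable_cst|exact: measurable_id].
have p1E n : (\int[mu]_x ((bm_kernel 1 0 (- l))%:E * pw n (s, r, x)) =
    (bm_kernel 1 0 (- l))%:E * \int[mu]_x pw n (s, r, x))%E.
  have p1le := ltW p10; exact: integral_scale.
have lim' : lower_limit_ge (fun n => (mesh n ^- 6)%:E * ((bm_kernel 1 0 (- l))%:E * \int[mu]_x pw n (s, r, x)))%E
   ((l / 4)%:E * (bes3_mass r 0 0 0 (ca ++ cb) * bes3_mass (1 - r) 0 0 l c2'))%E.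
  apply: (lower_limit_near _ lim); near=> n.
  have nl' : mesh n ^+ 2 < l by near: n; exact: nl.
  have n2' : 2 * mesh n ^+ 2 < 1 - r - last 0 (map fst c2) by near: n; exact: n2.
  have lE : (\int[mu]_x LM n x = (bm_kernel 1 0 (- l))%:E * \int[mu]_x pw n (s, r, x))%E.
    by rewrite -p1E; apply: eq_integral => x _; exact: LME.
  by rewrite -lE.
have m6 n : (0 <= (mesh n ^- 6)%:E :> \bar R)%E.
  by rewrite lee_fin invr_ge0 exprn_ge0// ltW// mesh_gt0.
have Ipw n : (0 <= \int[mu]_x pw n (s, r, x))%E by apply: integral_ge0.
have lq := lower_limit_mul (fun=> (_ : 0 <= q%:E)%E) _ _ _ (@cst_lower_limit _ q%:E) lim'.
apply: (lower_limit_near _ (lq _ _ _ _)).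
- near=> n; rewrite (muleCA (mesh n ^- 6)%:E) (muleA q%:E).
  have -> : (q%:E * (bm_kernel 1 0 (- l))%:E = 1 :> \bar R)%E by rewrite -EFinM /q mulVf ?gt_eqF.
  by rewrite mul1e.
- by rewrite lee_fin.
- by move=> n; rewrite !mule_ge0// lee_fin ltW.
- by rewrite lee_fin.
- by rewrite mule_ge0 ?mule_ge0// lee_fin divr_ge0// ltW.
Unshelve. all: by end_near. Qed.
End window_expectation.

(** * The candidate joint law *)

Section return_mass.
Context {R : realType}.
Implicit Types (s t r x l : R) (c : seq (R * set R)) (O : set R).
Local Notation mu := (@lebesgue_measure R).

Lemma near_mesh_sqr (c : R) : 0 < c -> \forall n \near \oo, mesh n ^+ 2 < c.
Proof.
move=> c0; have sq0 : (fun n => mesh n ^+ 2 : R) @ \oo --> 0.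
  rewrite -[X in _ --> X](mulr0 0).
  by under eq_fun do rewrite expr2; apply: cvgM; exact: cvg_mesh.
exact: (cvgr_lt (0 : R)).
Qed.

Lemma bes3_kernel_ge0r t x : 0 <= bes3_kernel t x 0.
Proof. by rewrite bes3_kernel0 ?mulr0// mulr_ge0 ?sqrtr_ge0 ?expR_ge0. Qed.

Lemma bes3_mass0_ge0 l s x c : path <%R s (map fst c) -> (0 <= bes3_mass l 0 s x c)%E.
Proof.
elim: c s x => [|[t A] c ih] s x /=; first by move=> _; rewrite lee_fin bes3_kernel_ge0r.
move=> /andP[st pc]; apply: integral_ge0 => z _; apply: mule_ge0; last exact: ih.
by rewrite lee_fin mulr_ge0 ?bes3_weight_ge0 ?bes3_kernel_ge0 ?subr_gt0.
Qed.

Lemma measurable_bes3_mass_length d (U : measurableType d) x s c (a : U -> R) :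
  path <%R s (map fst c) -> borel_sets c -> measurable_fun setT a ->
  measurable_fun setT (fun u => bes3_mass (a u) 0 s x c).
Proof.
move=> pc mc ma.
have h := @measurable_path_mass_param _ _ _
  (fun p : R * R => (bes3_kernel (p.1 - last s (map fst c)) p.2 0)%:E)
  (bridge_steps bes3_weight (@bes3_kernel R) s c).
under eq_fun do rewrite /bes3_mass bridge_massE.
apply: (measurable_comp_pair (h _ _ _) ma (measurable_cst x)).
- apply/measurable_EFinP; apply: measurable_bes3_kernel; [|exact: measurable_snd|exact: measurable_cst].
  by apply: measurable_funB; [exact: measurable_fst|exact: measurable_cst].
- by move=> p; rewrite lee_fin bes3_kernel_ge0r.
- exact: good_bes3_steps.
Qed.

Variables (l : R) (c1 c2 : seq (R * set R)).
Hypothesis l0 : 0 < l.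
Hypotheses (pc1 : path <%R 0 (map fst c1)) (pc2 : path <%R 0 (map fst c2)).
Hypotheses (m1 : borel_sets c1) (m2 : borel_sets c2).

Let c2' := [seq (p.1, shift_set l p.2) | p <- c2].
Let pc2' : path <%R 0 (map fst c2').
Proof. by rewrite -map_comp. Qed.
Let m2' : borel_sets c2'.
Proof. by apply: borel_sets_map => // p; exact: measurable_shift_set. Qed.

Lemma return_density_ge0 r : (0 <= return_density l c1 c2 r)%E.
Proof.
apply: mule_ge0; first by rewrite lee_fin mulr_ge0 ?invr_ge0 ?bm_kernel_ge0// divr_ge0// ltW.
by apply: mule_ge0; exact: bes3_mass0_ge0.
Qed.

Lemma measurable_return_density : measurable_fun setT (return_density l c1 c2).
Proof.
apply: emeasurable_funM; first exact: measurable_cst.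
apply: emeasurable_funM; apply: measurable_bes3_mass_length => //.
by apply: measurable_funB; [exact: measurable_cst|exact: measurable_id].
Qed.

Definition return_times O : set R :=
  [set r | [/\ O r, last 0 (map fst c1) < r & last 0 (map fst c2) < 1 - r]].

Definition return_mass O : \bar R :=
  (\int[mu]_(r in return_times O) (r%:E * return_density l c1 c2 r))%E.

Lemma measurable_return_times O : measurable O -> measurable (return_times O).
Proof.
move=> mO; rewrite (_ : return_times O = O `&` [set r | last 0 (map fst c1) < r] `&`
    [set r | last 0 (map fst c2) < 1 - r]); last first.
  by apply/seteqP; split => r; [move=> [] | move=> [[]]].
apply: measurableI; [apply: measurableI => //|]; apply: measurable_lt_set => //.
by apply: measurable_funB; [exact: measurable_cst|exact: measurable_id].
Qed.

Lemma measurable_return_domain O : measurable O -> measurable (return_domain O c1 c2).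
Proof.
move=> mO.
have h1 : measurable_fun setT (fun q : R * R => q.1) by exact: measurable_fst.
have h2 : measurable_fun setT (fun q : R * R => q.2) by exact: measurable_snd.
have hc (a : R) : measurable_fun setT (fun _ : R * R => a) by exact: measurable_cst.
rewrite (_ : return_domain O c1 c2 = [set q | 0 < q.1] `&` [set q | q.1 < q.2] `&`
  [set q | return_times O q.2] `&` [set q | each (fun p => p.1 <> q.1) c1]); last first.
  apply/seteqP; split => q /=.
    by move=> [? ? ? ? [? ?]]; split => //; split.
  by move=> [[[? ?] [? ? ?]] ?].
apply: measurableI; last first.
  apply: (@measurable_each R _ _ (fun p (q : R * R) => p.1 <> q.1)) => // p _.
  rewrite (_ : [set q : R * R | p.1 <> q.1] = [set q | p.1 < q.1] `|` [set q | q.1 < p.1]).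
    by apply: measurableU; exact: measurable_lt_set.
  apply/seteqP; split => q /=.
    by move=> /eqP; rewrite neq_lt => /orP[]; [left|right].
  by move=> [pq|pq] pE; move: pq; rewrite pE ltxx.
apply: measurableI; last by apply: measurable_preim => //; exact: measurable_return_times.
by apply: measurableI; exact: measurable_lt_set.
Qed.

Lemma lebesgue_measure_split_times r : 0 <= r ->
  mu [set s | [/\ 0 < s, s < r & each (fun p => p.1 <> s) c1]] = r%:E.
Proof.
move=> r0; pose S : set R := [set` map fst c1].
have -> : [set s | [/\ 0 < s, s < r & each (fun p => p.1 <> s) c1]] = `]0, r[%classic `\` S.
  have E s : each (fun p => p.1 <> s) c1 <-> ~ (s \in map fst c1).
    elim: c1 => [|p c ih] /=; first by split.
    rewrite inE; split=> [[ps /ih sc]|h]; first by case/orP => [/eqP sp|//]; exact/ps/esym.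
    by split=> [ps|]; [apply: h; rewrite ps eqxx|apply/ih => sc; apply: h; rewrite sc orbT].
  apply/seteqP; split => s /=; rewrite in_itv/=.
    by move=> [-> -> /E h].
  by move=> [/andP[-> ->] /E h].
have cS : countable S by apply: finite_set_countable; exact: finite_seq.
have mS : measurable S.
  exact: countable_measurable.
have S0 : mu S = 0%E by exact: countable_lebesgue_measure0.
have h : mu (`]0%R, r[%classic : set R) = r%:E.
  rewrite lebesgue_measure_itv/= lte_fin; case: ifPn => [_|]; first by rewrite sube0.
  by rewrite -leNgt => r1; congr EFin; apply/eqP; rewrite eq_le r0 r1.
have SI : mu (`]0%R, r[%classic `&` S) = 0%E.
  apply/eqP; rewrite eq_le measure_ge0 andbT -S0; apply: le_measure; rewrite ?inE//.
  exact: measurableI.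
by rewrite measureD//= ?h ?ltry// SI sube0.
Qed.

(** The density does not involve [s], and for a given [r] the admissible [s] fill the interval from
    [0] to [r] up to finitely many points. *)
Lemma integral_return_domain O : measurable O ->
  (\int[mu]_s \int[mu]_r ((return_density l c1 c2 \o snd) \_ (return_domain O c1 c2)) (s, r) =
   return_mass O)%E.
Proof.
move=> mO; pose g : R * R -> \bar R := (return_density l c1 c2 \o snd) \_ (return_domain O c1 c2).
have mg : measurable_fun setT g.
  apply: measurable_patch0; first exact: measurable_return_domain.
  exact: (measurableT_comp measurable_return_density measurable_snd).
have g0 p : (0 <= g p)%E by rewrite /g patchE; case: ifP => // _; exact: return_density_ge0.
rewrite (tonelli_set mu mu measurableT measurableT mg g0) /return_mass [RHS]integral_mkcond.
apply: eq_integral => r _; rewrite patchE.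
case: ifPn => [/[!inE] -[Or lr1 lr2]|nr]; last first.
  apply: integral0_eq => s _; rewrite /g patchE memNset// => -[? ? ? ? [? _]].
  by move/negP: nr; apply; rewrite inE; split.
have r0 : 0 <= r by rewrite ltW// (le_lt_trans _ lr1)// path_last_le.
pose S := [set s | [/\ 0 < s, s < r & each (fun p => p.1 <> s) c1]].
have mS : measurable S.
  have hs : measurable_fun setT (fun s : R => s) by exact: measurable_id.
  have hr (a : R) : measurable_fun setT (fun _ : R => a) by exact: measurable_cst.
  rewrite (_ : S = [set s | 0 < s] `&` [set s | s < r] `&` [set s | each (fun p => p.1 <> s) c1]); last first.
    by apply/seteqP; split => s; [move=> []|move=> [[]]].
  apply: measurableI; first by apply: measurableI; exact: measurable_lt_set.
  apply: (@measurable_each R _ _ (fun p (s : R) => p.1 <> s)) => // p _.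
  rewrite (_ : [set s : R | p.1 <> s] = [set s | p.1 < s] `|` [set s | s < p.1]).
    by apply: measurableU; exact: measurable_lt_set.
  apply/seteqP; split => s /=.
    by move=> /eqP; rewrite neq_lt => /orP[]; [left|right].
  by move=> [pq|pq] pE; move: pq; rewrite pE ltxx.
transitivity (\int[mu]_(s in S) (cst (return_density l c1 c2 r) s))%E.
  rewrite [RHS]integral_mkcond; apply: eq_integral => s _; rewrite /g !patchE.
  have -> : ((s, r) \in return_domain O c1 c2) = (s \in S); last by [].
  by apply/idP/idP; rewrite !inE; [move=> [? ? _ _ [_ ?]]|move=> [? ? ?]].
rewrite integral_cst// muleC; congr (_ * _)%E; exact: lebesgue_measure_split_times.
Qed.
End return_mass.

(** * Domination on open sets *)

Section return_lower_bound.
Context {R : realType} {d : measure_display} {T : measurableType d}.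
Variables (P : probability T R) (B : R -> T -> R) (l : R).
Local Notation mu := (@lebesgue_measure R).
Hypotheses (l0 : 0 < l) (bB : is_brownian_bridge P 1 0 (- l) B).
Hypothesis mB : measurable_fun setT (fun p : R * T => B p.1 p.2).
Implicit Types (s r x : R) (o : T) (n : nat).

Let cB o : {within `[0, 1], continuous (B ^~ o)}.
Proof. exact: (bb_continuous bB). Qed.

Let m6 n : (0 <= (mesh n ^- 6)%:E :> \bar R)%E.
Proof. by rewrite lee_fin invr_ge0 exprn_ge0// ltW// mesh_gt0. Qed.

Lemma window_expectation_limit (O : set R) (c1 c2 : seq (R * set R)) : measurable O ->
  path <%R 0 (map fst c1) -> path <%R 0 (map fst c2) -> borel_sets c1 -> borel_sets c2 ->
  lower_limit_ge (fun n => (mesh n ^- 6)%:E * \int[P]_o window_volume B l O c1 c2 n o)%E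
    (return_mass l c1 c2 O).
Proof.
move=> mO pc1 pc2 m1 m2.
pose pw n (q : R * R * R) : \bar R := P [set o | window_set B l (mesh n ^+ 2) (mesh n ^+ 2) O c1 c2 (q, o)].
have mpw n : measurable_fun setT (pw n) by exact: (measurable_window_prob bB).
have pw0 n q : (0 <= pw n q)%E by exact: measure_ge0.
pose px n (q : R * R) : \bar R := (\int[mu]_x pw n (q, x))%E.
have mpx n : measurable_fun setT (px n).
  exact: (@measurable_integral_param _ _ _ setT (pw n) measurableT).
have px0 n q : (0 <= px n q)%E by apply: integral_ge0.
pose pr n s : \bar R := (\int[mu]_r px n (s, r))%E.
have mpr n : measurable_fun setT (pr n).
  exact: (@measurable_integral_param _ _ _ setT (px n) measurableT).
have pr0 n s : (0 <= pr n s)%E by apply: integral_ge0.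
pose g : R * R -> \bar R := (return_density l c1 c2 \o snd) \_ (return_domain O c1 c2).
have mg : measurable_fun setT g.
  apply: measurable_patch0; first exact: measurable_return_domain.
  exact: (measurableT_comp (measurable_return_density _ pc1 pc2 m1 m2) measurable_snd).
have g0 p : (0 <= g p)%E by rewrite /g patchE; case: ifP => // _; exact: return_density_ge0.
pose gr s : \bar R := (\int[mu]_r g (s, r))%E.
have mgr : measurable_fun setT gr.
  exact: (@measurable_integral_param _ _ _ setT g measurableT).
have gr0 s : (0 <= gr s)%E by apply: integral_ge0.
have sec (f : R * R -> \bar R) s : measurable_fun setT f -> measurable_fun setT (fun r : R => f (s, r)).
  by move=> mf; apply: (measurable_comp_pair mf); [exact: measurable_cst|exact: measurable_id].
have E1 n : ((mesh n ^- 6)%:E * \int[P]_o window_volume B l O c1 c2 n o =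
    \int[mu]_s ((mesh n ^- 6)%:E * pr n s))%E.
  by rewrite (integral_window_volume bB mB mO pc2 m1 m2) integral_scale// -lee_fin.
have E2 n s : ((mesh n ^- 6)%:E * pr n s = \int[mu]_r ((mesh n ^- 6)%:E * px n (s, r)))%E.
  apply/esym/integral_scale; [by rewrite -lee_fin; exact: m6|exact: sec|].
  by move=> r; exact: px0.
rewrite -(integral_return_domain l0 pc1 pc2 m1 m2 mO); under eq_fun do rewrite E1.
have msc n (f : R -> \bar R) : measurable_fun setT f ->
    measurable_fun setT (fun s : R => (mesh n ^- 6)%:E * f s)%E.
  by move=> mf; apply: emeasurable_funM => //; exact: measurable_cst.
apply: lower_limit_integral => //.
- by move=> n; exact: msc.
- by move=> n s _; apply: mule_ge0.
- by move=> s _; exact: gr0.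
move=> s _; under eq_fun do rewrite E2.
apply: lower_limit_integral => //.
- by move=> n; apply: msc; exact: sec.
- exact: sec.
- by move=> n r _; apply: mule_ge0.
move=> r _; case: (boolP ((s, r) \in return_domain O c1 c2)) => D.
  rewrite patchE D; apply: window_prob_limit => //; exact: set_mem.
rewrite patchE (negbTE D).
apply: (@lower_limit_near _ (fun=> 0%E)); last exact: cst_lower_limit.
by apply: nearW => n; apply: mule_ge0.
Qed.

Section enclosing_event.
Variables (O : set R) (c1 c2 : seq (R * set R)) (G : set T).
Hypotheses (pc1 : path <%R 0 (map fst c1)) (pc2 : path <%R 0 (map fst c2)).
Hypotheses (m1 : borel_sets c1) (m2 : borel_sets c2) (mO : measurable O).
Hypothesis (mG : measurable G).
Hypothesis GE : forall o, vervaat_event (B ^~ o) c1 c2 O -> G o.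

(** The rescaled volume [a n] is at most [1], so its integral over [G] is at most [P G]. Outside [G]
    it is eventually [0] for each path, so its integral there tends to [0] by bounded convergence,
    while the total integral has the return mass as a lower bound in the limit. *)
Lemma return_mass_erode_le eta : 0 < eta ->
  (return_mass l (erode_seq eta c1) (erode_seq eta c2) (erode eta O) <= P G)%E.
Proof.
move=> eta0.
have mOe : measurable (erode eta O) by exact: measurable_erode.
have me1 := borel_erode_seq eta m1; have me2 := borel_erode_seq eta m2.
have pe1 : path <%R 0 (map fst (erode_seq eta c1)) by rewrite fst_erode_seq.
have pe2 : path <%R 0 (map fst (erode_seq eta c2)) by rewrite fst_erode_seq.
pose wv n o := window_volume B l (erode eta O) (erode_seq eta c1) (erode_seq eta c2) n o.
have lim := window_expectation_limit mOe pe1 pe2 me1 me2.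
have mwv n : measurable_fun setT (wv n) by exact: (measurable_window_volume bB).
have wv0 n o : (0 <= wv n o)%E by do 3 (apply: integral_ge0 => ? _); rewrite lee_fin.
(* The volume bound holds for [mesh n ^ 2 < l]; the finitely many other indices get the value
   [0]. *)
pose a n o : \bar R := if mesh n ^+ 2 < l then ((mesh n ^- 6)%:E * wv n o)%E else 0%E.
have ma n : measurable_fun setT (a n).
  rewrite /a; case: (mesh n ^+ 2 < l); last exact: measurable_cst.
  by apply: emeasurable_funM => //; exact: measurable_cst.
have a0 n o : (0 <= a n o)%E by rewrite /a; case: ifP => // _; exact: mule_ge0.
have a1 n o : (a n o <= 1)%E.
  rewrite /a; case: ifP => // nl.
  apply: (@le_trans _ _ ((mesh n ^- 6)%:E * (mesh n ^+ 6)%:E)%E).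
    by apply: lee_wpmul2l; [exact: m6|exact: (window_volume_le l0 bB _ _ pe2 o nl)].
  by rewrite -EFinM mulVf// gt_eqF// exprn_gt0// mesh_gt0.
have aG o : ~ G o -> a ^~ o @ \oo --> 0%E.
  move=> nG.
  have [e e0 he] := window_vervaat_event (@cB o) (bb_start bB o) (bb_end bB o) l0 O eta0 pc1 pc2.
  apply: cvg_near_cst.
  have hn : \forall n \near \oo, mesh n ^+ 2 < e := near_mesh_sqr e0.
  near=> n; rewrite /a; case: ifP => // nl.
  have -> : wv n o = 0%E.
    apply: integral0_eq => s _; apply: integral0_eq => r _; apply: integral0_eq => x _.
    rewrite indicE memNset// => -[[/= s0 sr lr1 lr2 Or] win]; apply: nG; apply: GE.
    apply: (he (mesh n ^+ 2) _ _ s r x).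
    - by rewrite exprn_gt0// mesh_gt0.
    - by near: n.
    - by rewrite -(fst_erode_seq eta c1) -(fst_erode_seq eta c2); split.
  by rewrite mule0.
have mGC : measurable (~` G) by exact: measurableC.
have ile : forall n, (\int[P]_o a n o <= P G + \int[P]_(o in ~` G) a n o)%E.
  move=> n; rewrite -(setUv G) ge0_integral_setU//; last first.
  - by apply/disj_setPS; rewrite setICr.
  - by rewrite setUv.
  apply: leeD => //; rewrite -[leRHS]mul1e -integral_cst//.
  by apply: ge0_le_integral => //; apply: measurable_funTS.
have lim0 : (fun n => \int[P]_(o in ~` G) a n o)%E @ \oo --> 0%E.
  have ae1 : {ae P, forall o, (~` G) o -> a ^~ o @ \oo --> cst 0%E o} by apply: aeW => o; exact: aG.
  have ae2 : {ae P, forall o n, (~` G) o -> (`|a n o| <= cst 1%E o)%E}.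
    by apply: aeW => o n _; rewrite gee0_abs.
  have i1 : P.-integrable (~` G) (cst 1%E) by exact: finite_measure_integrable_cst.
  have [_ _] := dominated_convergence mGC (fun n => measurable_funTS (ma n)) (measurable_cst 0%E) ae1 i1 ae2.
  by rewrite integral0.
have lim1 : (fun n => P G + \int[P]_(o in ~` G) a n o)%E @ \oo --> P G.
  rewrite -[X in _ --> X]adde0; apply: cvgeD => //; last exact: cvg_cst.
  by rewrite fin_num_adde_defl.
apply: lower_limit_cvg lim1; apply: (lower_limit_near _ lim).
have hn : \forall n \near \oo, mesh n ^+ 2 < l := near_mesh_sqr l0.
near=> n; apply: le_trans (ile n).
have nl : mesh n ^+ 2 < l by near: n.
rewrite /a nl; under [leRHS]eq_integral => o _ do rewrite /wv.
rewrite ge0_integralZl//.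
Unshelve. all: by end_near. Qed.

(** The erosions of an open set exhaust it, so Fatou's lemma removes the margin, in the set of
    return times and in each position. *)
Lemma return_mass_le : open O -> each (fun p => open p.2) c1 -> each (fun p => open p.2) c2 ->
  (return_mass l c1 c2 O <= P G)%E.
Proof.
move=> oO o1 o2.
apply: (@lower_limit_ub _ (fun n => return_mass l (erode_seq (mesh n) c1) (erode_seq (mesh n) c2)
    (erode (mesh n) O))) => [n|]; first by apply: return_mass_erode_le; exact: mesh_gt0.
have pe1 n : path <%R 0 (map fst (erode_seq (mesh n) c1)) by rewrite fst_erode_seq.
have pe2 n : path <%R 0 (map fst (erode_seq (mesh n) c2)) by rewrite fst_erode_seq.
have me1 n := borel_erode_seq (mesh n) m1; have me2 n := borel_erode_seq (mesh n) m2.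
pose D n := return_times (erode_seq (mesh n) c1) (erode_seq (mesh n) c2) (erode (mesh n) O).
pose f n r : \bar R := (r%:E * return_density l (erode_seq (mesh n) c1) (erode_seq (mesh n) c2) r)%E.
pose g r : \bar R := (r%:E * return_density l c1 c2 r)%E.
have mf n : measurable_fun setT (f n).
  by apply: emeasurable_funM; [apply/measurable_EFinP; exact: measurable_id|exact: measurable_return_density].
have mg : measurable_fun setT g.
  by apply: emeasurable_funM; [apply/measurable_EFinP; exact: measurable_id|exact: measurable_return_density].
have f0 n r : 0 <= r -> (0 <= f n r)%E.
  by move=> r0; apply: mule_ge0; [rewrite lee_fin|exact: return_density_ge0].
have g0 r : 0 <= r -> (0 <= g r)%E.
  by move=> r0; apply: mule_ge0; [rewrite lee_fin|exact: return_density_ge0].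
have rD n r : D n r -> 0 <= r.
  by move=> [_ lr _]; rewrite ltW// (le_lt_trans _ lr)// path_last_le.
have rD' r : return_times c1 c2 O r -> 0 <= r.
  by move=> [_ lr _]; rewrite ltW// (le_lt_trans _ lr)// path_last_le.
have mD n : measurable (D n) by apply: measurable_return_times; exact: measurable_erode.
have mD' : measurable (return_times c1 c2 O) by exact: measurable_return_times.
rewrite /return_mass.
suff : lower_limit_ge (fun n => \int[mu]_r (f n \_ (D n)) r)%E (\int[mu]_r (g \_ (return_times c1 c2 O)) r)%E.
  by rewrite -integral_mkcond; under eq_fun do rewrite -integral_mkcond.
apply: lower_limit_integral => //.
- by move=> n; exact: (measurable_patch0 (mD n) (mf n)).
- exact: (measurable_patch0 mD' mg).
- by move=> n r _; rewrite patchE; case: ifPn => // /[!inE] /rD; exact: f0.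
- by move=> r _; rewrite patchE; case: ifPn => // /[!inE] /rD'; exact: g0.
move=> r _; rewrite patchE; case: ifPn => [/[!inE] Dr|nD]; last first.
  apply: (@lower_limit_near _ (fun=> 0%E)); last exact: cst_lower_limit.
  by apply: nearW => n; rewrite patchE; case: ifPn => // /[!inE] /rD; exact: f0.
have r0 := rD' _ Dr; move: Dr => [Or lr1 lr2].
apply: (@lower_limit_near _ (fun n => f n r)).
  near=> n; rewrite patchE mem_set//; split; [|by rewrite fst_erode_seq|by rewrite fst_erode_seq].
  by near: n; exact: near_erode.
have q1 : path <%R 0 (rcons (map fst c1) r) by apply/path_rcons_lt.
have q2 : path <%R 0 (rcons (map fst [seq (p.1, shift_set l p.2) | p <- c2]) (1 - r)).
  by rewrite -map_comp; apply/path_rcons_lt.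
have q2' : path <%R 0 (map fst [seq (p.1, shift_set l p.2) | p <- c2]) by have /path_rcons_lt[] := q2.
have m2' : borel_sets [seq (p.1, shift_set l p.2) | p <- c2].
  by apply: borel_sets_map => // p; exact: measurable_shift_set.
have o2' : each (fun p => open p.2) [seq (p.1, shift_set l p.2) | p <- c2].
  by apply/each_map; apply: each_imp o2 => p; exact: open_shift_set.
have L1 := @bes3_mass_erode_limit _ _ 0 _ 0 _ q1 m1 o1.
have L2 := @bes3_mass_erode_limit _ _ 0 _ l _ q2 m2' o2'.
have k0 : 0 <= l / 4 * (bm_kernel 1 0 (- l))^-1.
  by rewrite mulr_ge0 ?invr_ge0 ?bm_kernel_ge0// divr_ge0// ltW.
have e1 n : (0 <= bes3_mass r 0 0 0 (erode_seq (mesh n) c1))%E by exact: bes3_mass0_ge0.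
have e2 n : (0 <= bes3_mass (1 - r) 0 0 l (erode_seq (mesh n) [seq (p.1, shift_set l p.2) | p <- c2]))%E.
  by apply: bes3_mass0_ge0; rewrite fst_erode_seq.
have e3 : (0 <= bes3_mass r 0 0 0 c1)%E by exact: bes3_mass0_ge0.
have e4 : (0 <= bes3_mass (1 - r) 0 0 l [seq (p.1, shift_set l p.2) | p <- c2])%E by exact: bes3_mass0_ge0.
rewrite /f /g /return_density; under eq_fun do rewrite shift_erode_seq.
have L12 := lower_limit_mul e1 e2 e3 e4 L1 L2.
have e12 n := mule_ge0 (e1 n) (e2 n); have e34 := mule_ge0 e3 e4.
have k0' : (0 <= (l / 4 * (bm_kernel 1 0 (- l))^-1)%:E :> \bar R)%E by rewrite lee_fin.
have r0' : (0 <= r%:E :> \bar R)%E by rewrite lee_fin.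
have L3 := lower_limit_mul (fun=> k0') e12 k0' e34 (@cst_lower_limit _ _) L12.
have e5 n := mule_ge0 k0' (e12 n).
exact: (lower_limit_mul (fun=> r0') e5 r0' (mule_ge0 k0' e34) (@cst_lower_limit _ _) L3).
Unshelve. all: by end_near. Qed.
End enclosing_event.
End return_lower_bound.

(** * Measurability of the Vervaat transform *)

Section clamped_path.
Context {R : realType}.
Implicit Types (s t u x : R) (b : R -> R).

Lemma clamp_lip s t : `|clamp s - clamp t| <= `|s - t|.
Proof.
wlog st : s t / t <= s => [hw|].
  by have [/hw//|/ltW/hw] := leP t s; rewrite distrC (distrC s).
have h : clamp t <= clamp s.
  by rewrite /clamp le_min ge_min lexx/= ge_min; apply/orP; right; rewrite ge_max !le_max lexx st orbT.
rewrite !ger0_norm ?subr_ge0//; rewrite /clamp; case: (leP 0 s); case: (leP 0 t);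
  rewrite !minEle; do 2?case: ifPn; rewrite -?ltNge; lra.
Qed.

Lemma continuous_clamp b : {within `[0, 1], continuous b} -> continuous (b \o clamp).
Proof.
move=> cb u; apply/cvgrPdist_lt => e e0 /=.
have [r r0 hr] := within_itv_ball cb (clamp_itv u) e0.
near=> v; apply: hr; first exact: clamp_itv.
apply: le_lt_trans (clamp_lip u v) _; near: v.
by exists r => //= v; rewrite /ball/=.
Unshelve. all: by end_near. Qed.

Lemma argmin01_clamp b : argmin01 (b \o clamp) = argmin01 b.
Proof.
rewrite /argmin01; congr inf; apply/seteqP; split => t /= [t01 h]; split => // s s01.
  by have := h _ s01; rewrite !clampE.
by rewrite !clampE//; exact: h.
Qed.

Variables (b : R -> R) (l : R).
Hypothesis cb : {within `[0, 1], continuous b}.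
Hypotheses (b0 : b 0 = 0) (b1 : b 1 = - l) (l0 : 0 < l).
Let tau := argmin01 b.
Let V := vervaat b.
Let Z := first_return V.

(** A formula without case distinction, which makes continuity and measurability visible. One of its
    two moving terms is always frozen: the second at [b 0 = 0] up to [1 - tau], the first at
    [b 1 = - l] from then on. *)
Lemma vervaat_clampE t : 0 <= t <= 1 ->
  V t = b (clamp (tau + t)) + b (clamp (tau + t - 1)) - b tau.
Proof.
move=> /andP[t0 t1]; have [/andP[h0 h1] _] := argmin01_spec cb; rewrite -/tau in h0 h1.
have [h|h] := leP t (1 - tau).
  rewrite /V vervaat_left// clampE; last by apply/andP; split; lra.
  have -> : clamp (tau + t - 1) = 0 by rewrite /clamp max_l ?min_r//; lra.
  by rewrite b0 addr0.
rewrite /V (vervaat_right b0 b1 (ltW h)) (clampE (t := tau + t - 1)); last by apply/andP; split; lra.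
have -> : clamp (tau + t) = 1 by rewrite /clamp max_r ?min_l//; lra.
by rewrite b1 -/tau; lra.
Qed.

Lemma argmin01_gt0 : 0 < tau.
Proof.
have [/andP[h0 _] h] := argmin01_spec cb; rewrite lt_neqAle h0 andbT eq_sym.
apply/eqP => t0; have := h 1; rewrite lexx ler01 => /(_ isT).
by rewrite -/tau t0 b0 b1 leNgt oppr_lt0 l0.
Qed.

Lemma vervaat0 : V 0 = 0.
Proof.
have [/andP[h0 h1] _] := argmin01_spec cb.
by rewrite /V vervaat_left ?addr0 ?subrr// subr_ge0.
Qed.

Lemma vervaat1 : V 1 = - l.
Proof.
have h := argmin01_gt0; rewrite /V (vervaat_right b0 b1); last by lra.
by rewrite addrK addrAC subrr sub0r.
Qed.

Lemma continuous_vervaat : {within `[0, 1], continuous V}.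
Proof.
have cc := continuous_clamp cb.
have cV : continuous (fun t => b (clamp (tau + t)) + b (clamp (tau + t - 1)) - b tau).
  move=> t; apply: cvgB; last exact: cvg_cst.
  apply: cvgD.
    apply: (@continuous_comp _ _ _ (fun t => tau + t) (b \o clamp)); last exact: cc.
    by apply: cvgD; [exact: cvg_cst|exact: cvg_id].
  apply: (@continuous_comp _ _ _ (fun t => tau + t - 1) (b \o clamp)); last exact: cc.
  by apply: cvgB; [apply: cvgD; [exact: cvg_cst|exact: cvg_id]|exact: cvg_cst].
apply: subspace_eq_continuous (continuous_subspaceT cV).
by move=> t /set_mem/=; rewrite in_itv/= => /vervaat_clampE.
Qed.

Let S : set R := [set t | 0 < t <= 1 /\ V t = 0].

Lemma first_return_spec : [/\ 0 <= Z, Z < 1 & V Z = 0].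
Proof.
have [[t0 St0]|nS] := pselect (exists t, S t); last first.
  (* Without a zero in [(0, 1]] the infimum is that of the empty set, [0] by convention, where the
     transform vanishes too. *)
  have -> : Z = 0.
    rewrite /Z /first_return (_ : [set _ | _] = set0) ?inf0//.
    by apply/seteqP; split => // t St; apply: nS; exists t.
  by split => //; exact: vervaat0.
have lbS : lbound S 0 by move=> t [/andP[/ltW]].
have hS : has_inf S by split; [exists t0|exists 0].
have i0 : 0 <= Z by apply: lb_le_inf => //; exists t0.
have i1 : Z <= 1 by apply: le_trans (ge_inf _ St0) _; [exists 0|case: St0 => /andP[]].
have VZ : V Z = 0.
  apply/eqP; rewrite -normr_eq0 eq_le normr_ge0 andbT leNgt; apply/negP => e0.
  have i01 : 0 <= Z <= 1 by rewrite i0 i1.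
  have [r r0 hr] := within_itv_ball continuous_vervaat i01 e0.
  have [t St tr] := inf_adherent r0 hS.
  have Zt : Z <= t by apply: ge_inf => //; exists 0.
  have [/andP[tp t1] Vt] := St.
  have := hr t; rewrite (ltW tp) t1 Vt subr0 distrC ger0_norm ?subr_ge0// ltrBlDl => /(_ isT tr).
  by rewrite ltxx.
split => //; rewrite lt_neqAle i1 andbT; apply/eqP => Z1.
by have := l0; move: VZ; rewrite Z1 vervaat1; lra.
Qed.

(* [Z] is an infimum, equal to [0] when the path has no zero in (0, 1]. *)
Lemma first_return_ge a : 0 < a -> a <= 1 ->
  (a <= Z) <-> (forall t, 0 < t -> t < a -> V t <> 0) /\ (exists2 t, 0 < t <= 1 & V t = 0).
Proof.
move=> a0 a1; split=> [aZ|[h [t0 t01 Vt0]]].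
  have [[t0 [t01 Vt0]]|nS] := pselect (exists t, S t); last first.
    exfalso; move: aZ; rewrite /Z /first_return (_ : [set _ | _] = set0) ?inf0; first by lra.
    by apply/seteqP; split => // t St; apply: nS; exists t.
  split; last by exists t0.
  move=> t t0' ta Vt; suff : Z <= t by lra.
  by apply: ge_inf; [exists 0 => v [/andP[/ltW]]|split => //; rewrite t0'; lra].
apply: lb_le_inf; first by exists t0.
move=> t [/andP[tp t1] Vt]; rewrite leNgt; apply/negP => ta; exact: h Vt.
Qed.
End clamped_path.

Section clamped_bridge.
Context {R : realType}.
Variables (b : R -> R) (l : R).
Hypothesis cb : {within `[0, 1], continuous b}.
Hypotheses (b0 : b 0 = 0) (b1 : b 1 = - l).

Lemma within_clamp : {within `[0, 1], continuous (b \o clamp)}.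
Proof. exact: continuous_subspaceT (continuous_clamp cb). Qed.

Lemma vervaat_clamp t : 0 <= t <= 1 -> vervaat (b \o clamp) t = vervaat b t.
Proof.
move=> t01; have [h _] := argmin01_spec cb.
have e0 : (b \o clamp) 0 = 0 by rewrite /= clampE ?lexx ?ler01.
have e1 : (b \o clamp) 1 = - l by rewrite /= clampE ?lexx ?ler01.
rewrite (vervaat_clampE within_clamp e0 e1 t01) (vervaat_clampE cb b0 b1 t01) argmin01_clamp /=.
by rewrite !(clampE (clamp_itv _)) (clampE h).
Qed.

Lemma first_return_clamp : first_return (vervaat (b \o clamp)) = first_return (vervaat b).
Proof.
rewrite /first_return; congr inf; apply/seteqP; split => t /= [/andP[t0 t1] Vt]; split;
  rewrite ?t0 ?t1//; move: Vt; rewrite vervaat_clamp// (ltW t0)//.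
Qed.
End clamped_bridge.

Section vervaat_measurability.
Context {R : realType} {d : measure_display} {T : measurableType d}.
Implicit Types (s t u x a : R) (o : T).

Section zero_free.
Variable X : R -> T -> R.
Hypothesis mX : measurable_fun setT (fun p : R * T => X p.1 p.2).
Hypothesis cX : forall o, {within `[0, 1], continuous (X ^~ o)}.

Lemma measurable_stays_cst (Y : R -> T -> R) (a e : R) (f : T -> R) :
  measurable_fun setT (fun p : R * T => Y p.1 p.2) ->
  (forall o, {within `[0, 1], continuous (Y ^~ o)}) ->
  0 <= a -> a < e -> e <= 1 -> measurable_fun setT f ->
  measurable [set o | forall u, a <= u <= e -> f o <= Y u o].
Proof.
move=> mY cY a0 ae e1 mf.
have mid : measurable_fun setT (@id T) by exact: measurable_id.
have := @measurable_stays R _ _ T T Y id setT mY cY mid measurableT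
  (cst a) (cst e) f (measurable_cst _) (measurable_cst _) mf.
by rewrite setTI; apply.
Qed.

(** By the intermediate value theorem a path without zero keeps its sign, and by compactness it
    stays away from [0]. The absence of zeros is thereby a countable union of barrier conditions. *)
Lemma zero_free_itv o a e : 0 <= a -> a < e -> e <= 1 ->
  (forall t, a <= t <= e -> X t o <> 0) <->
  (exists n, forall t, a <= t <= e -> mesh n <= X t o) \/
  (exists n, forall t, a <= t <= e -> mesh n <= - X t o).
Proof.
move=> a0 ae e1; split; last first.
  move=> [[n h]|[n h]] t tI Xt; have := h t tI; rewrite Xt ?oppr0; have := mesh_gt0 (R := R) n; lra.
move=> nz; have ca : {within `[a, e], continuous (X ^~ o)}.
  apply: (continuous_subspaceW _ (@cX o)) => t /=; rewrite !in_itv/= => /andP[at' te].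
  by rewrite (le_trans a0 at') (le_trans te e1).
have aI : a <= a <= e by rewrite lexx ltW.
have mpos c : 0 < c -> exists n, mesh n <= c :> R.
  move=> c0; have h : \forall n \near \oo, mesh n < c :> R by apply: (cvgr_lt (0 : R)) => //; exact: cvg_mesh.
  by have [n _ hn] := h; exists n; apply/ltW/hn => /=.
have same t : a <= t <= e -> 0 < X t o * X a o.
  move=> /andP[at' te]; rewrite ltNge; apply/negP => neg.
  have ct : {within `[a, t], continuous (X ^~ o)}.
    apply: (continuous_subspaceW _ ca) => v /=; rewrite !in_itv/= => /andP[-> vt].
    by rewrite (le_trans vt te).
  have [|v] := @IVT _ (X ^~ o) a t 0 at' ct.
    rewrite ge_min le_max; apply/andP; split; rewrite -implyNb -ltNge; apply/implyP => xa;
      rewrite leNgt; apply/negP => xt; move: neg; apply/negP; rewrite -ltNge.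
      exact: mulr_gt0.
    by rewrite nmulr_rgt0.
  by rewrite in_itv/= => /andP[av vt] /=; apply: nz; rewrite av (le_trans vt te).
have cn : {within `[a, e], continuous (fun t => `|X t o|)}.
  by move=> t; apply: cvg_norm; exact: ca.
have [c cI hc] := EVT_min (ltW ae) cn.
rewrite in_itv/= in cI.
have c0 : 0 < `|X c o| by rewrite normr_gt0; apply/eqP; exact: nz.
have [n hn] := mpos _ c0.
have low t : a <= t <= e -> mesh n <= `|X t o| by move=> tI; apply: le_trans hn (hc t _); rewrite in_itv.
have [xa|xa] := ltP 0 (X a o); [left|right]; exists n => t tI; have := same t tI; have := low t tI.
  by move=> h; rewrite pmulr_lgt0// => xt; move: h; rewrite gtr0_norm.
have {}xa : X a o < 0 by rewrite lt_neqAle xa andbT; apply/eqP/nz.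
by move=> h; rewrite nmulr_lgt0// => xt; move: h; rewrite ltr0_norm.
Qed.

Lemma measurable_zero_free a e : 0 <= a -> a < e -> e <= 1 ->
  measurable [set o | forall t, a <= t <= e -> X t o <> 0].
Proof.
move=> a0 ae e1.
have mN : measurable_fun setT (fun p : R * T => - X p.1 p.2) by exact: measurable_funN.
have cN o : {within `[0, 1], continuous (fun t => - X t o)} by move=> t; apply: cvgN; exact: cX.
rewrite (_ : [set _ | _] = \bigcup_n [set o | forall t, a <= t <= e -> mesh n <= X t o] `|`
    \bigcup_n [set o | forall t, a <= t <= e -> mesh n <= - X t o]); last first.
  apply/seteqP; split => o.
    by move=> /(zero_free_itv o a0 ae e1)[[n h]|[n h]]; [left|right]; exists n.
  by move=> h; apply/(zero_free_itv o a0 ae e1); case: h => -[n _ h]; [left|right]; exists n.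
apply: measurableU; apply: bigcupT_measurable => n.
  exact: (@measurable_stays_cst X a e (fun=> mesh n)).
exact: (@measurable_stays_cst (fun t o => - X t o) a e (fun=> mesh n)).
Qed.
End zero_free.

Variables (B : R -> T -> R) (l : R).
Hypothesis l0 : 0 < l.
Hypothesis mB : measurable_fun setT (fun p : R * T => B p.1 p.2).
Hypothesis cB : forall o, {within `[0, 1], continuous (B ^~ o)}.
Hypotheses (B0 : forall o, B 0 o = 0) (B1 : forall o, B 1 o = - l).

(** As the first time of the minimum, [tau] exceeds [a] exactly when the minimum over [[0, a]] is
    larger than the global one. A rational time and an inverse integer witness the gap, which leaves
    a countable union. *)
Lemma argmin01_gt o a : 0 < a -> a < 1 -> a < argmin01 (B ^~ o) <->
  exists q : rat, exists n, forall t, 0 <= t <= a -> B (clamp (ratr q)) o + mesh n <= B t o.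
Proof.
move=> a0 a1; have [ti tm] := argmin01_spec (@cB o); set tau := argmin01 _ in ti tm *.
split=> [at'|[q [n h]]]; last first.
  rewrite ltNge; apply/negP => ta; have /andP[t0 _] := ti.
  have := h tau; rewrite t0 ta => /(_ isT); have := tm _ (clamp_itv (ratr q)).
  by have := mesh_gt0 (R := R) n; lra.
have ca : {within `[0, a], continuous (B ^~ o)}.
  apply: (continuous_subspaceW _ (@cB o)) => t /=; rewrite !in_itv/= => /andP[-> ta].
  by rewrite (le_trans ta (ltW a1)).
have [c cI hc] := EVT_min (ltW a0) ca; rewrite in_itv/= in cI.
have c01 : 0 <= c <= 1 by move: cI => /andP[-> ca']; rewrite (le_trans ca' (ltW a1)).
have gap : 0 < B c o - B tau o.
  rewrite subr_gt0 lt_neqAle tm// andbT; apply/eqP => /esym/(argmin01_le (@cB o) c01).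
  by rewrite -/tau; move: cI => /andP[_]; lra.
pose e := (B c o - B tau o) / 2; have e0 : 0 < e by rewrite divr_gt0.
have [r r0 hr] := within_itv_ball (@cB o) ti e0.
have /rat_in_itvoo[q] : tau - r < tau + r by lra.
rewrite in_itv/= => /andP[q1 q2]; exists q.
have hq : B (clamp (ratr q)) o < B tau o + e.
  have hd : `|tau - clamp (ratr q)| < r.
    rewrite -{1}(clampE ti); apply: le_lt_trans (clamp_lip _ _) _.
    by rewrite ltr_norml; apply/andP; split; lra.
  by have := hr _ (clamp_itv _) hd; rewrite ltr_norml => /andP[h _]; lra.
have h : \forall n \near \oo, mesh n < e by apply: (cvgr_lt (0 : R)) => //; exact: cvg_mesh.
have [n _ hn] := h; have {}hn : mesh n < e by apply: hn => /=.
exists n => t tI; have {}hc := hc t; rewrite in_itv/= in hc; have {hc} := hc tI.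
have ee : 2 * e = B c o - B tau o by rewrite /e mulrC divfK.
by lra.
Qed.

Lemma measurable_argmin01 : measurable_fun setT (fun o => argmin01 (B ^~ o)).
Proof.
apply: (measurability _ (RGenOInfty.measurableE R)) => _ [_ [a ->] <-].
rewrite setTI (_ : _ @^-1` _ = [set o | a < argmin01 (B ^~ o)]); last first.
  by apply/seteqP; split => o /=; rewrite in_itv/= andbT.
have [a0|a0] := leP a 0.
  rewrite (_ : [set _ | _] = setT); first exact: measurableT.
  by apply/seteqP; split => // o _; apply: le_lt_trans a0 (argmin01_gt0 (@cB o) (B0 o) (B1 o) l0).
have [a1|a1] := leP 1 a.
  rewrite (_ : [set _ | _] = set0); first exact: measurable0.
  apply/seteqP; split => // o /=; have [/andP[_ h] _] := argmin01_spec (@cB o).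
  by rewrite ltNge (le_trans h a1).
rewrite (_ : [set _ | _] = \bigcup_(q : rat) \bigcup_n
    [set o | forall t, 0 <= t <= a -> B (clamp (ratr q)) o + mesh n <= B t o]); last first.
  apply/seteqP; split => o.
    by move=> /(argmin01_gt o a0 a1)[q [n h]]; exists q => //; exists n.
  by move=> [q _ [n _ h]]; apply/(argmin01_gt o a0 a1); exists q, n.
apply: bigcupT_measurable_rat => q; apply: bigcupT_measurable => n.
apply: (@measurable_stays_cst B 0 a (fun o => B (clamp (ratr q)) o + mesh n)) => //; first exact: ltW.
apply: measurable_funD; last exact: measurable_cst.
by apply: (measurable_comp_pair mB); [exact: measurable_cst|exact: measurable_id].
Qed.

Let V t o := vervaat (B ^~ o) t.
Let Z o := first_return (V ^~ o).
Let X t o := B (clamp (argmin01 (B ^~ o) + t)) o + B (clamp (argmin01 (B ^~ o) + t - 1)) o - B (argmin01 (B ^~ o)) o.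

Let XV t o : 0 <= t <= 1 -> X t o = V t o.
Proof. by move=> t01; rewrite /X /V (vervaat_clampE (@cB o) (B0 o) (B1 o)). Qed.

Let mX : measurable_fun setT (fun p : R * T => X p.1 p.2).
Proof.
have mt : measurable_fun setT (fun p : R * T => argmin01 (B ^~ p.2)).
  exact: (measurableT_comp measurable_argmin01 measurable_snd).
have mp : measurable_fun setT (fun p : R * T => argmin01 (B ^~ p.2) + p.1).
  by apply: measurable_funD => //; exact: measurable_fst.
have mc (f : R * T -> R) : measurable_fun setT f -> measurable_fun setT (fun p => B (f p) p.2).
  by move=> mf; apply: (measurable_comp_pair mB) => //; exact: measurable_snd.
apply: measurable_funB; last exact: mc.
apply: measurable_funD; apply: mc; apply: (measurableT_comp (@measurable_clamp R)) => //.
by apply: measurable_funB => //; exact: measurable_cst.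
Qed.

Let cX o : {within `[0, 1], continuous (X ^~ o)}.
Proof.
apply: subspace_eq_continuous (continuous_vervaat (@cB o) (B0 o) (B1 o)).
by move=> t /set_mem/=; rewrite in_itv/= => t01; exact/esym/XV.
Qed.

Lemma measurable_first_return : measurable_fun setT Z.
Proof.
apply: (measurability _ (RGenCInfty.measurableE R)) => _ [_ [a ->] <-].
rewrite setTI (_ : _ @^-1` _ = [set o | a <= Z o]); last first.
  by apply/seteqP; split => o /=; rewrite in_itv/= andbT.
have Zs o := first_return_spec (@cB o) (B0 o) (B1 o) l0.
have [a0|a0] := leP a 0.
  rewrite (_ : [set _ | _] = setT); first exact: measurableT.
  by apply/seteqP; split => // o _; have [h _ _] := Zs o; exact: le_trans a0 h.
have [a1|a1] := leP a 1; last first.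
  rewrite (_ : [set _ | _] = set0); first exact: measurable0.
  apply/seteqP; split => // o /=; have [_ h _] := Zs o.
  by rewrite -/(V^~ o) -/(Z o) in h; move=> h'; lra.
(* The intervals from [a / (n + 3)] to [a - a / (n + 3)] have positive length for every [n] and
   exhaust the open interval from [0] to [a]. *)
have shrink n (u : R) : a / n.+3%:R <= u -> u <= a - a / n.+3%:R -> 0 < u /\ u < a.
  have an : 0 < a / n.+3%:R by rewrite divr_gt0.
  by move: an; set al := a / _ => an u1 u2; split; lra.
have exhaust (t : R) : 0 < t -> t < a -> exists n, (a / n.+3%:R <= t) && (t <= a - a / n.+3%:R).
  move=> t0 ta; pose c := Num.min t (a - t) / a.
  have m0 : 0 < Num.min t (a - t) by rewrite lt_min t0 subr_gt0.
  have c0 : 0 < c by rewrite divr_gt0.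
  have h : \forall n \near \oo, mesh n < c by apply: (cvgr_lt (0 : R)) => //; exact: cvg_mesh.
  have [n _ hn] := h; exists n.
  have : a / n.+3%:R <= Num.min t (a - t).
    by rewrite mulrC -ler_pdivlMr// -/c ltW//; apply: (hn n.+2) => /=; rewrite ltnW// ltnS leqnSn.
  by rewrite le_min => /andP[h1 h2]; rewrite h1/= lerBrDr addrC -lerBrDr.
pose F (al be : R) := [set o | forall t, al <= t <= be -> X t o <> 0].
rewrite (_ : [set _ | _] = (\bigcap_n F (a / n.+3%:R) (a - a / n.+3%:R)) `&`
    ~` (\bigcap_n F (mesh n.+1) 1)); last first.
  apply/seteqP; split => o /=.
    move=> /(first_return_ge (B ^~ o) a0 a1)[nz [t t01 Vt]]; split.
      move=> n _ u /andP[u1 u2]; have [u0 ua] := shrink n u u1 u2.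
      by rewrite XV; [exact: nz|apply/andP; split; [exact: ltW|exact: (le_trans (ltW ua))]].
    have /andP[t0 t1] := t01.
    have h : \forall n \near \oo, mesh n < t by apply: (cvgr_lt (0 : R)) => //; exact: cvg_mesh.
    have [n _ hn] := h; move=> /(_ n Logic.I t); rewrite t1 (ltW (hn n.+1 _))//=.
    by rewrite XV ?(ltW t0)// => /(_ isT); apply.
  move=> [nz hz]; apply/(first_return_ge (B ^~ o) a0 a1); split.
    move=> t t0 ta; have [n /andP[n1 n2]] := exhaust t t0 ta.
    by rewrite -/(V t o) -XV; [apply: (nz n) => //; rewrite n1|apply/andP; split; [exact: ltW|exact: (le_trans (ltW ta))]].
  apply: contrapT => nex; apply: hz => n _ t /andP[t0 t1] Xt; apply: nex; exists t.
    by rewrite t1 (lt_le_trans _ t0)// mesh_gt0.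
  by rewrite -/(V t o) -XV// t1 (le_trans _ t0)// ltW// mesh_gt0.
apply: measurableI.
  apply: bigcapT_measurable => n; apply: measurable_zero_free => //.
  - by rewrite divr_ge0// ltW.
  - by rewrite ltrBrDr -mulrDl ltr_pdivrMr// (_ : a + a = a * 2%:R); [rewrite ltr_pM2l// ltr_nat|ring].
  - by rewrite (le_trans _ a1)// gerBl divr_ge0// ltW.
apply: measurableC; apply: bigcapT_measurable => n; apply: measurable_zero_free => //.
- by rewrite ltW// mesh_gt0.
- by rewrite invf_lt1// ltr1n.
Qed.

Lemma measurable_vervaat (f : T -> R) : measurable_fun setT f -> (forall o, 0 <= f o <= 1) ->
  measurable_fun setT (fun o => vervaat (B ^~ o) (f o)).
Proof.
move=> mf f01; rewrite (_ : (fun _ => _) = fun o => X (f o) o).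
  by apply: (measurable_comp_pair mX) => //; exact: measurable_id.
by apply/funext => o; exact/esym/XV.
Qed.
End vervaat_measurability.

Section bridge_vervaat.
Context {R : realType} {d : measure_display} {T : measurableType d}.
Variables (P : probability T R) (B : R -> T -> R) (l : R).
Hypotheses (l0 : 0 < l) (bB : is_brownian_bridge P 1 0 (- l) B).
Implicit Types (s t u x a : R) (o : T).

Let cB o : {within `[0, 1], continuous (B ^~ o)}.
Proof. exact: (bb_continuous bB). Qed.
Let B0 o : B 0 o = 0. Proof. exact: (bb_start bB). Qed.
Let B1 o : B 1 o = - l. Proof. exact: (bb_end bB). Qed.

(** The process is specified on [[0, 1]] only. Freezing it outside gives a jointly measurable
    process with the same Vervaat transform on [[0, 1]], to which the windows apply. *)
Definition clamped t o := B (clamp t) o.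

Let cC o : {within `[0, 1], continuous (clamped ^~ o)}.
Proof. exact: (within_clamp (@cB o)). Qed.
Let C0 o : clamped 0 o = 0. Proof. by rewrite /clamped clampE ?lexx ?ler01. Qed.
Let C1 o : clamped 1 o = - l. Proof. by rewrite /clamped clampE ?lexx ?ler01. Qed.
Let mC : measurable_fun setT (fun p : R * T => clamped p.1 p.2).
Proof. by apply: measurable_continuous_process => // t t01; exact: (bb_measurable bB). Qed.

Let bC : is_brownian_bridge P 1 0 (- l) clamped.
Proof.
split => //.
  by move=> t t01; have := bb_measurable bB (clamp_itv t).
move=> c cc lc; rewrite -(bb_fdd bB cc lc); congr (P _); apply/seteqP.
have [pc _] := cc.
have E : each (fun p => clamp p.1 = p.1) c.
  apply: each_imp (each_time_le pc) => p /andP[p0 pl]; apply: clampE.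
  by rewrite (ltW p0) (le_trans pl)// ltW.
suff h o : cylinder clamped c o <-> cylinder B c o by split=> o /h.
rewrite !each_cylinder; apply: each_iff; apply: each_imp E => p pE.
by rewrite /clamped pE.
Qed.

Local Notation V o := (vervaat (B ^~ o)).
Local Notation Z o := (first_return (V o)).

Let VC o t : 0 <= t <= 1 -> vervaat (clamped ^~ o) t = V o t.
Proof. exact: (vervaat_clamp (@cB o) (B0 o) (B1 o)). Qed.

Let ZC o : first_return (vervaat (clamped ^~ o)) = Z o.
Proof. exact: (first_return_clamp (@cB o) (B0 o) (B1 o)). Qed.

Lemma bridge_first_return_spec o : [/\ 0 <= Z o, Z o < 1 & V o (Z o) = 0].
Proof. exact: (first_return_spec (@cB o) (B0 o) (B1 o) l0). Qed.

Lemma measurable_bridge_first_return : measurable_fun setT (fun o => Z o).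
Proof.
by have := measurable_first_return l0 mC cC C0 C1; under eq_fun do rewrite ZC.
Qed.

Lemma measurable_bridge_vervaat (f : T -> R) : measurable_fun setT f -> (forall o, 0 <= f o <= 1) ->
  measurable_fun setT (fun o => V o (f o)).
Proof.
move=> mf f01; have := measurable_vervaat l0 mC cC C0 C1 mf f01.
by under eq_fun do rewrite VC//.
Qed.

Section joint_law.
Variables (O : set R) (c1 c2 : seq (R * set R)).
Hypotheses (pc1 : path <%R 0 (map fst c1)) (pc2 : path <%R 0 (map fst c2)).
Hypotheses (m1 : borel_sets c1) (m2 : borel_sets c2) (mO : measurable O).

Definition return_event : set T := [set o | vervaat_event (B ^~ o) c1 c2 O].

Lemma measurable_return_event : measurable return_event.
Proof.
have mZ := measurable_bridge_first_return.
have mc (a : R) : measurable_fun setT (fun _ : T => a) by exact: measurable_cst.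
have mV (f : T -> R) : measurable_fun setT f -> measurable_fun setT (fun o => V o (clamp (f o))).
  move=> mf; apply: measurable_bridge_vervaat => [|o]; last exact: clamp_itv.
  exact: (measurableT_comp (@measurable_clamp R) mf).
rewrite (_ : return_event = [set o | O (Z o)] `&` [set o | last 0 (map fst c1) < Z o] `&`
   [set o | last 0 (map fst c2) < 1 - Z o] `&` [set o | each (fun p => p.2 (V o (clamp p.1))) c1] `&`
   [set o | each (fun p => p.2 (V o (clamp (Z o + p.1)))) c2]).
  apply: measurableI; last first.
    apply: (@measurable_each R _ _ (fun p o => p.2 (V o (clamp (Z o + p.1))))) => // p mp.
    by apply: measurable_preim => //; apply: mV; exact: measurable_funD.
  apply: measurableI; last first.
    apply: (@measurable_each R _ _ (fun p o => p.2 (V o (clamp p.1)))) => // p mp.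
    by apply: measurable_preim => //; apply: mV.
  apply: measurableI; last by apply: measurable_lt_set => //; exact: measurable_funB.
  by apply: measurableI; [exact: measurable_preim|exact: measurable_lt_set].
have E o : last 0 (map fst c1) < Z o -> each (fun p => p.2 (V o p.1) <-> p.2 (V o (clamp p.1))) c1.
  move=> lZ; have [_ Z1 _] := bridge_first_return_spec o.
  apply: each_imp (each_time_le pc1) => p /andP[p0 pl].
  by rewrite clampE// (ltW p0) (le_trans pl)// ltW// (lt_trans lZ).
have E' o : last 0 (map fst c2) < 1 - Z o ->
    each (fun p => p.2 (V o (Z o + p.1)) <-> p.2 (V o (clamp (Z o + p.1)))) c2.
  move=> lZ; have [Z0 Z1 _] := bridge_first_return_spec o.
  apply: each_imp (each_time_le pc2) => p /andP[p0 pl].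
  rewrite clampE// addr_ge0 ?(ltW p0)//= -lerBrDl.
  exact: le_trans pl (ltW lZ).
apply/seteqP; split => o /=.
  by move=> [h1 h2 h3 /(each_iff (E _ h2)) h4 /(each_iff (E' _ h3)) h5].
by move=> [[[[h1 h2] h3] /(each_iff (E _ h2)) h4] /(each_iff (E' _ h3)) h5].
Qed.

Lemma return_event_ge : open O -> each (fun p => open p.2) c1 -> each (fun p => open p.2) c2 ->
  (return_mass l c1 c2 O <= P return_event)%E.
Proof.
move=> oO o1 o2.
apply: (return_mass_le l0 bC mC pc1 pc2 m1 m2 mO measurable_return_event _ oO o1 o2) => o.
rewrite /return_event /= /vervaat_event ZC => -[h1 h2 h3 h4 h5].
have [Z0 Z1 _] := bridge_first_return_spec o.
split => //.
  apply: (each_iff _).1 h4; apply: each_imp (each_time_le pc1) => p /andP[p0 pl].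
  by rewrite VC// (ltW p0) (le_trans pl)// ltW// (lt_trans h2).
apply: (each_iff _).1 h5; apply: each_imp (each_time_le pc2) => p /andP[p0 pl].
rewrite VC// addr_ge0 ?(ltW p0)//= -lerBrDl.
exact: le_trans pl (ltW h3).
Qed.
End joint_law.
End bridge_vervaat.

(** * The joint law of the first return and of the two pieces *)

Section dominating_measures.
Context {R : realType}.
Implicit Types (A O : set R) (c p q : seq (R * set R)).

(** Equal finite totals turn the domination on open sets into the reverse inequality on closed ones.
    An open half-line is an increasing union of closed half-lines, so the measures agree on it, and
    half-lines generate the Borel sets. *)
Lemma dominating_measure_eq (m1 m2 : {measure set R -> \bar R}) :
  (m1 setT < +oo)%E -> m1 setT = m2 setT -> (forall O, open O -> m2 O <= m1 O)%E ->
  forall A, measurable A -> m1 A = m2 A.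
Proof.
move=> fin tot dom.
have fin2 : (m2 setT < +oo)%E by rewrite -tot.
have lt1 A : measurable A -> (m1 A < +oo)%E.
  by move=> mA; apply: le_lt_trans fin; apply: le_measure; rewrite ?inE.
have lt2 A : measurable A -> (m2 A < +oo)%E.
  by move=> mA; apply: le_lt_trans fin2; apply: le_measure; rewrite ?inE.
have mC (m : {measure set R -> \bar R}) A : (m setT < +oo)%E -> measurable A -> m (~` A) = (m setT - m A)%E.
  by move=> mT mA; rewrite -setTD measureD// setTI.
pose ray (a : R) : set R := `]a, +oo[%classic.
pose cray (a : R) : set R := `[a, +oo[%classic.
have mr a : measurable (ray a) by exact: measurable_itv.
have mcr a : measurable (cray a) by exact: measurable_itv.
have closed_le a : (m1 (cray a) <= m2 (cray a))%E.
  have E : cray a = ~` (`]-oo, a[%classic : set R) by rewrite setCitvl.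
  have ml : measurable (`]-oo, a[%classic : set R) by exact: measurable_itv.
  rewrite E !mC// tot; apply: leeB => //; apply: dom; exact: interval_open.
have ray_eq a : m1 (ray a) = m2 (ray a).
  apply/eqP; rewrite eq_le dom ?andbT; last exact: interval_open.
  pose F n : set R := cray (a + mesh n).
  have FU : \bigcup_n F n = ray a.
    apply/seteqP; split => x.
      by move=> [n _]; rewrite /F /cray /ray/= !in_itv/= !andbT; apply: lt_le_trans; rewrite ltrDl mesh_gt0.
    rewrite /ray/= in_itv/= andbT => ax.
    have x0 : 0 < x - a by rewrite subr_gt0.
    have h : \forall n \near \oo, mesh n < x - a by apply: (cvgr_lt (0 : R)) => //; exact: cvg_mesh.
    have [n _ hn] := h; exists n => //; rewrite /F /cray/= in_itv/= andbT -lerBrDl.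
    by apply/ltW/hn => /=.
  have ndF : nondecreasing_seq F.
    move=> n m nm; apply/subsetPset => x; rewrite /F /cray/= !in_itv/= !andbT; apply: le_trans.
    by rewrite lerD2l /mesh lef_pV2 ?posrE// ler_nat ltnS.
  have := @nondecreasing_cvg_mu _ _ _ m1 F; rewrite FU => /(_ _ _ ndF) cv.
  have {}cv : m1 \o F @ \oo --> m1 (ray a) by exact: (cv (fun n => mcr _) (mr a)).
  apply: (@lower_limit_ub _ (m1 \o F)); last exact: cvg_lower_limit.
  move=> n; apply: le_trans (closed_le _) _; apply: le_measure; rewrite ?inE//.
  by move=> x; rewrite /cray /ray/= !in_itv/= !andbT; apply: lt_le_trans; rewrite ltrDl mesh_gt0.
move=> A mA; apply: (measure_unique (@RGenOInfty.G R) (fun n => ray (- n%:R))) => //.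
- exact: RGenOInfty.measurableE.
- move=> _ _ [x ->] [y ->]; exists (Num.max x y).
  by apply/seteqP; split => z /=; rewrite !in_itv/= !andbT gt_max; [move=> [-> ->]|move=> /andP[-> ->]].
- by move=> n; eexists.
- apply/seteqP; split => // x _; exists (Num.truncn `|x|).+1 => //=.
  rewrite /ray/= in_itv/= andbT ltrNl; apply: le_lt_trans (truncnS_gt `|x|).
  by rewrite -normrN ler_norm.
- by move=> _ [x ->]; exact: ray_eq.
- by move=> n; exact: lt1.
Qed.

(** The properties of a measure for a bare set function, so that a mass of cylinders can be taken as
    a measure in one coordinate while the others are fixed. *)
Definition measure_spec (m : set R -> \bar R) : Prop :=
  [/\ m set0 = 0%E, forall A, (0 <= m A)%E &
    forall F : nat -> set R, (forall n, measurable (F n)) -> trivIset setT F ->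
      m (\bigcup_n F n) = (\sum_(n <oo) m (F n))%E].

Section spec_measure.
Variables (m : set R -> \bar R) (ms : measure_spec m).

Definition spec_measure : set R -> \bar R := m.

Let m0 : spec_measure set0 = 0%E. Proof. by case: ms. Qed.
Let mge0 A : (0 <= spec_measure A)%E. Proof. by case: ms. Qed.
Let madd : semi_sigma_additive spec_measure.
Proof.
move=> F mF tF _; case: ms => _ _ h; rewrite /spec_measure h//.
by apply: is_cvg_nneseries => n _ _; exact: mge0.
Qed.

HB.instance Definition _ := isMeasure.Build _ R R spec_measure m0 mge0 madd.

Definition measure_of_spec : {measure set R -> \bar R} := spec_measure.
End spec_measure.

Lemma dominating_spec_eq m1 m2 : measure_spec m1 -> measure_spec m2 -> (m1 setT < +oo)%E -> m1 setT = m2 setT ->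
  (forall O, open O -> m2 O <= m1 O)%E -> forall A, measurable A -> m1 A = m2 A.
Proof.
move=> s1 s2 fin tot dom.
exact: (@dominating_measure_eq (measure_of_spec s1) (measure_of_spec s2)).
Qed.

Definition coordinate_spec (M : seq (R * set R) -> \bar R) (ts : seq R) : Prop :=
  forall p t q, map fst p ++ t :: map fst q = ts -> borel_sets p -> borel_sets q ->
    measure_spec (fun A => M (p ++ (t, A) :: q)).

Definition full_cylinder (ts : seq R) : seq (R * set R) := [seq (t, setT) | t <- ts].

Lemma fst_full_cylinder ts : map fst (full_cylinder ts) = ts.
Proof. by rewrite -map_comp map_id. Qed.

Lemma borel_full_cylinder ts : borel_sets (full_cylinder ts).
Proof.
elim: ts => [|t ts ih]; first exact: borel_sets_nil.
by apply/borel_sets_cons; split => //=; exact: measurableT.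
Qed.

Lemma each_open_borel c : each (fun p : R * set R => open p.2) c -> borel_sets c.
Proof.
elim: c => [_|p c ih [op /ih oc]]; first exact: borel_sets_nil.
by apply/borel_sets_cons; split => //; exact: open_measurable.
Qed.

(** One coordinate at a time, full sets are replaced by open ones ([claim1]), then open ones by
    Borel ones ([claim2]). At each exchange the totals in that coordinate already agree, and the
    open sets give the domination. *)
Lemma dominating_cylinder_eq M N ts : coordinate_spec M ts -> coordinate_spec N ts ->
  (forall c, map fst c = ts -> borel_sets c -> M c < +oo)%E ->
  (forall c, map fst c = ts -> each (fun p : R * set R => open p.2) c -> N c <= M c)%E ->
  M (full_cylinder ts) = N (full_cylinder ts) ->
  forall c, map fst c = ts -> borel_sets c -> M c = N c.
Proof.
move=> sM sN fin dom tot.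
have finT p t q : map fst p ++ t :: map fst q = ts -> borel_sets p -> borel_sets q ->
    (M (p ++ (t, setT) :: q) < +oo)%E.
  move=> E bp bq; apply: fin; first by rewrite map_cat.
  by apply/borel_sets_cat; split => //; apply/borel_sets_cons; split => //=; exact: measurableT.
have claim1 p ts' : map fst p ++ ts' = ts -> each (fun p : R * set R => open p.2) p ->
    M (p ++ full_cylinder ts') = N (p ++ full_cylinder ts').
  elim/last_ind: p ts' => [|p [t A] ih] ts'; first by move=> /= ->.
  rewrite map_rcons -cats1 /= => E; rewrite -cats1 => /each_cat[op [oA _]].
  have E' : map fst p ++ t :: map fst (full_cylinder ts') = ts by rewrite fst_full_cylinder -E -catA.
  have bp := each_open_borel op; have bq := borel_full_cylinder ts'.
  rewrite -catA /=; apply: (dominating_spec_eq (sM _ _ _ E' bp bq) (sN _ _ _ E' bp bq) (finT _ _ _ E' bp bq)).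
  - by apply: (ih (t :: ts')) => //; rewrite -E -catA.
  - move=> O oO; apply: dom; first by rewrite map_cat.
    apply/each_cat; split => //; split => //.
    by elim: (ts') => //= u us ihu; split => //=; exact: openT.
  - exact: open_measurable.
have claim2 p q : map fst p ++ map fst q = ts -> borel_sets p -> each (fun p : R * set R => open p.2) q ->
    M (p ++ q) = N (p ++ q).
  elim/last_ind: p q => [|p [t A] ih] q.
    by move=> E _ oq; have := claim1 q [::]; rewrite !cats0; apply.
  rewrite map_rcons -cats1 /= => E; rewrite -cats1 => /borel_sets_cat[bp /borel_sets_cons[mA _]] oq.
  have E' : map fst p ++ t :: map fst q = ts by rewrite -E -catA.
  have bq := each_open_borel oq.
  rewrite -catA /=; apply: (dominating_spec_eq (sM _ _ _ E' bp bq) (sN _ _ _ E' bp bq) (finT _ _ _ E' bp bq)) => //.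
  - by apply: ih => //; split => //; exact: openT.
  - by move=> O oO; rewrite ih.
move=> c E bc; have := claim2 c [::]; rewrite !cats0; apply => //.
Qed.
End dominating_measures.

(** * The candidate law as a measure in each coordinate *)

Section bes3_mass_spec.
Context {R : realType}.
Implicit Types (s t r x y l : R) (A : set R) (c p q : seq (R * set R)).
Local Notation mu := (@lebesgue_measure R).

Lemma bes3_mass_full l s x ts : 0 <= x -> path <%R s (rcons ts l) ->
  bes3_mass l 0 s x (full_cylinder ts) = (bes3_kernel (l - s) x 0)%:E.
Proof.
elim: ts s x => [|t ts ih] s x //= x0 /andP[st pl].
have tl : t < l by have [h1 h2] := (path_rcons_lt _ _ _).1 pl; exact: le_lt_trans (path_last_le h1) h2.
transitivity (\int[mu]_z (bes3_kernel (t - s) x z * bes3_weight z * bes3_kernel (l - t) z 0)%:E)%E.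
  apply: eq_integral => z _ /=; rewrite /bes3_weight; case: ifPn => [z0|_]; last by rewrite mulr0 mul0r mul0e.
  by rewrite -/(bes3_mass l 0 t z (full_cylinder ts)) ih// ?ltW// -EFinM.
by rewrite bes3_chapman_kolmogorov ?subr_gt0// addrC addrA subrK.
Qed.

Lemma bes3_mass_le_full l s x c : path <%R s (map fst c) ->
  (bes3_mass l 0 s x c <= bes3_mass l 0 s x (full_cylinder (map fst c)))%E.
Proof.
elim: c s x => [|[t A] c ih] s x //= /andP[st pc].
have k0 z : (0 <= (bes3_kernel (t - s) x z * bes3_weight z)%:E :> \bar R)%E.
  by rewrite lee_fin mulr_ge0 ?bes3_weight_ge0 ?bes3_kernel_ge0 ?subr_gt0.
apply: (@le_trans _ _ (\int[mu]_z ((bes3_kernel (t - s) x z * bes3_weight z)%:E * bes3_mass l 0 t z c))%E).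
  by apply: le_ge0_integral_subset => // z _; apply: mule_ge0 => //; exact: bes3_mass0_ge0.
apply: le_ge0_integral => z _; first by apply: mule_ge0 => //; exact: bes3_mass0_ge0.
by apply: lee_wpmul2l => //; exact: ih.
Qed.

Lemma bes3_mass_fin l s x c : 0 <= x -> path <%R s (rcons (map fst c) l) ->
  bes3_mass l 0 s x c \is a fin_num.
Proof.
move=> x0 pl; have [pc _] := (path_rcons_lt _ _ _).1 pl.
rewrite ge0_fin_numE ?bes3_mass0_ge0//.
by apply: le_lt_trans (bes3_mass_le_full _ _ pc) _; rewrite bes3_mass_full// ltry.
Qed.

Lemma path_mass_set0 (F : R -> \bar R) (c1 c2 : seq (@step R)) (k : R -> R -> R) x : path_mass F (c1 ++ (k, set0) :: c2) x = 0%E.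
Proof.
elim: c1 x => [|[k' A] c1 ih] x /=; first by rewrite integral_set0.
by apply: integral0_eq => z _; rewrite ih mule0.
Qed.

Lemma bes3_mass_spec l s x p t q : path <%R s (map fst p ++ t :: map fst q) ->
  borel_sets p -> borel_sets q -> measure_spec (fun A => bes3_mass l 0 s x (p ++ (t, A) :: q)).
Proof.
move=> pc mp mq; pose F (z : R) : \bar R := (bes3_kernel (l - last s (map fst p ++ t :: map fst q)) z 0)%:E.
pose k x z := bes3_kernel (t - last s (map fst p)) x z * bes3_weight z.
have E A : bes3_mass l 0 s x (p ++ (t, A) :: q) =
    path_mass F (bridge_steps bes3_weight bes3_kernel s p ++ (k, A) :: bridge_steps bes3_weight bes3_kernel t q) x.
  by rewrite /bes3_mass bridge_massE map_cat bridge_steps_cat.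
have pc' A : path <%R s (map fst (p ++ (t, A) :: q)) by rewrite map_cat.
split.
- by rewrite E path_mass_set0.
- by move=> A; exact: bes3_mass0_ge0.
move=> G mG tG; rewrite E path_mass_bigcup//.
- by apply: eq_eseriesr => n _; rewrite E.
- by apply/measurable_EFinP; apply: measurable_bes3_kernel; [exact: measurable_cst|exact: measurable_id|exact: measurable_cst].
- by move=> z; rewrite lee_fin bes3_kernel_ge0r.
move=> n; have := good_bes3_steps (pc' (G n)); rewrite bridge_steps_cat; apply.
have h : borel_sets (p ++ (t, G n) :: q).
  by apply/borel_sets_cat; split => //; apply/borel_sets_cons; split => //=; exact: mG.
exact: h.
Qed.

Lemma weighted_spec (D : set R) (w : R -> \bar R) (b : R -> set R -> \bar R) :
  measurable D -> measurable_fun setT w -> (forall r, D r -> (0 <= w r)%E /\ w r \is a fin_num) ->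
  (forall r, D r -> measure_spec (b r)) ->
  (forall A, measurable A -> measurable_fun setT (b ^~ A)) ->
  measure_spec (fun A => \int[mu]_(r in D) (w r * b r A))%E.
Proof.
move=> mD mw wD bs mb; split.
- by apply: integral0_eq => r Dr; have [-> _ _] := bs _ Dr; rewrite mule0.
- move=> A; apply: integral_ge0 => r Dr; have [w0 _] := wD _ Dr; have [_ b0 _] := bs _ Dr.
  exact: mule_ge0.
move=> F mF tF; rewrite -integral_nneseries//.
- apply: eq_integral => r /[!inE] Dr; have [w0 fw] := wD _ Dr; have [_ b0 ->//] := bs _ Dr.
  by rewrite -(fineK fw) -nneseriesZl.
- by move=> n; apply: measurable_funTS; apply: emeasurable_funM => //; exact: mb.
- by move=> n r Dr; have [w0 _] := wD _ Dr; have [_ b0 _] := bs _ Dr; exact: mule_ge0.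
Qed.

Lemma shift_set_spec l (m : set R -> \bar R) : measure_spec m -> measure_spec (fun A => m (shift_set l A)).
Proof.
move=> [m0 mge0 madd]; split => //.
move=> F mF tF; rewrite -(madd (fun n => shift_set l (F n))) //.
- by move=> n; exact: measurable_shift_set.
- apply/trivIsetP => i j _ _ ij; have /trivIsetP/(_ i j Logic.I Logic.I ij) := tF.
  move=> /seteqP[h _]; apply/seteqP; split => // x [/= xi xj]; exact: (h (x - l)).
Qed.
End bes3_mass_spec.

Section return_mass_spec.
Context {R : realType}.
Variable l : R.
Hypothesis l0 : 0 < l.
Implicit Types (s t r x y : R) (A O : set R) (c p q : seq (R * set R)).
Local Notation mu := (@lebesgue_measure R).
Let shifted c := [seq (z.1, shift_set l z.2) | z <- c].
Let k : R := l / 4 * (bm_kernel 1 0 (- l))^-1.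
Let k0 : 0 <= k. Proof. by rewrite mulr_ge0 ?invr_ge0 ?bm_kernel_ge0// divr_ge0// ltW. Qed.

Let fst_shifted c : map fst (shifted c) = map fst c. Proof. by rewrite -map_comp. Qed.
Let borel_shifted c : borel_sets c -> borel_sets (shifted c).
Proof. by move=> bc; apply: borel_sets_map => // p; exact: measurable_shift_set. Qed.

Let return_times_pos c1 c2 O r : path <%R 0 (map fst c1) -> return_times c1 c2 O r -> 0 <= r.
Proof. by move=> pc [_ lr _]; rewrite ltW// (le_lt_trans _ lr)// path_last_le. Qed.

Let factor_fin x r c : 0 <= x -> path <%R 0 (map fst c) -> last 0 (map fst c) < r ->
  (0 <= bes3_mass r 0 0 x c)%E /\ bes3_mass r 0 0 x c \is a fin_num.
Proof.
move=> x0 pc lr; split; first exact: bes3_mass0_ge0.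
by apply: bes3_mass_fin => //; apply/path_rcons_lt.
Qed.

Lemma return_mass_spec1 c2 O ts : path <%R 0 ts -> path <%R 0 (map fst c2) -> borel_sets c2 ->
  measurable O -> coordinate_spec (fun c1 => return_mass l c1 c2 O) ts.
Proof.
move=> pt pc2 m2 mO p t q E mp mq.
have pc1 A : path <%R 0 (map fst (p ++ (t, A) :: q)) by rewrite map_cat /= E.
have mc1 A : measurable A -> borel_sets (p ++ (t, A) :: q).
  by move=> mA; apply/borel_sets_cat; split => //; apply/borel_sets_cons.
pose D := return_times (p ++ (t, setT) :: q) c2 O.
pose w r : \bar R := (r%:E * (k%:E * bes3_mass (1 - r) 0 0 l (shifted c2)))%E.
pose b r A := bes3_mass r 0 0 0 (p ++ (t, A) :: q).
have mid : measurable_fun setT (fun r : R => r%:E : \bar R) by apply/measurable_EFinP; exact: measurable_id.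
have := @weighted_spec R D w b; rewrite (_ : (fun A => _) = fun A => return_mass l (p ++ (t, A) :: q) c2 O).
  apply.
  - by apply: measurable_return_times => //; exact: mc1.
  - apply: emeasurable_funM => //; apply: emeasurable_funM; first exact: measurable_cst.
    apply: measurable_bes3_mass_length; [by rewrite fst_shifted|exact: borel_shifted|].
    by apply: measurable_funB; [exact: measurable_cst|exact: measurable_id].
  - move=> r Dr; have r0 := return_times_pos (pc1 _) Dr; have [_ _ lr] := Dr.
    have [b0 bf] := @factor_fin l (1 - r) (shifted c2) (ltW l0) ltac:(by rewrite fst_shifted) ltac:(by rewrite fst_shifted).
    by split; [apply: mule_ge0; [rewrite lee_fin|apply: mule_ge0; rewrite ?lee_fin]|rewrite !fin_numM].
  - by move=> r Dr; apply: bes3_mass_spec => //; rewrite E.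
  - by move=> A mA; apply: measurable_bes3_mass_length => //; exact: mc1.
apply/funext => A; rewrite /return_mass (_ : return_times (p ++ (t, A) :: q) c2 O = D); last first.
  by rewrite /D /return_times !map_cat.
by apply: eq_integral => r _; rewrite /w /b /return_density -!muleA; congr (_ * (_ * _))%E; rewrite muleC.
Qed.

Lemma return_mass_spec2 c1 O ts : path <%R 0 ts -> path <%R 0 (map fst c1) -> borel_sets c1 ->
  measurable O -> coordinate_spec (fun c2 => return_mass l c1 c2 O) ts.
Proof.
move=> pt pc1 m1 mO p t q E mp mq.
have pc2 A : path <%R 0 (map fst (p ++ (t, A) :: q)) by rewrite map_cat /= E.
have mc2 A : measurable A -> borel_sets (p ++ (t, A) :: q).
  by move=> mA; apply/borel_sets_cat; split => //; apply/borel_sets_cons.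
pose D := return_times c1 (p ++ (t, setT) :: q) O.
pose w r : \bar R := (r%:E * (k%:E * bes3_mass r 0 0 0 c1))%E.
pose b r A := bes3_mass (1 - r) 0 0 l (shifted p ++ (t, shift_set l A) :: shifted q).
have mid : measurable_fun setT (fun r : R => r%:E : \bar R) by apply/measurable_EFinP; exact: measurable_id.
have := @weighted_spec R D w b; rewrite (_ : (fun A => _) = fun A => return_mass l c1 (p ++ (t, A) :: q) O).
  apply.
  - by apply: measurable_return_times => //; exact: mc2.
  - apply: emeasurable_funM => //; apply: emeasurable_funM; first exact: measurable_cst.
    by apply: measurable_bes3_mass_length => //; exact: measurable_id.
  - move=> r Dr; have r0 := return_times_pos pc1 Dr; have [_ lr _] := Dr.
    have [b0 bf] := factor_fin (lexx 0) pc1 lr.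
    by split; [apply: mule_ge0; [rewrite lee_fin|apply: mule_ge0; rewrite ?lee_fin]|rewrite !fin_numM].
  - move=> r Dr; apply: (@shift_set_spec _ l (fun A => bes3_mass (1 - r) 0 0 l (shifted p ++ (t, A) :: shifted q))).
    by apply: bes3_mass_spec; rewrite ?fst_shifted ?E//; exact: borel_shifted.
  - move=> A mA; have := borel_shifted (mc2 A mA); rewrite /shifted map_cat /= => mc.
    apply: measurable_bes3_mass_length => //.
      by have := pc2 A; rewrite !map_cat /= -!/(shifted _) !fst_shifted.
    by apply: measurable_funB; [exact: measurable_cst|exact: measurable_id].
apply/funext => A; rewrite /return_mass (_ : return_times c1 (p ++ (t, A) :: q) O = D); last first.
  by rewrite /D /return_times !map_cat.
by apply: eq_integral => r _; rewrite /w /b /return_density -!muleA /shifted map_cat.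
Qed.

Lemma return_mass_spec c1 c2 : path <%R 0 (map fst c1) -> path <%R 0 (map fst c2) ->
  borel_sets c1 -> borel_sets c2 -> measure_spec (return_mass l c1 c2).
Proof.
move=> pc1 pc2 m1 m2; split.
- rewrite /return_mass (_ : return_times _ _ _ = set0) ?integral_set0//.
  by apply/seteqP; split => // r [].
- move=> A; apply: integral_ge0 => r /(return_times_pos pc1) r0.
  by apply: mule_ge0; [rewrite lee_fin|exact: return_density_ge0].
move=> F mF tF; rewrite /return_mass.
have -> : return_times c1 c2 (\bigcup_n F n) = \bigcup_n return_times c1 c2 (F n).
  apply/seteqP; split => r; first by move=> [[n _ Fr] h1 h2]; exists n.
  by move=> [n _ [Fr h1 h2]]; split => //; exists n.
rewrite ge0_integral_bigcup//.
- by move=> n; exact: measurable_return_times.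
- apply: measurable_funTS; apply: emeasurable_funM; last exact: measurable_return_density.
  by apply/measurable_EFinP; exact: measurable_id.
- move=> r [n _ /(return_times_pos pc1) r0].
  by apply: mule_ge0; [rewrite lee_fin|exact: return_density_ge0].
- apply/trivIsetP => i j _ _ ij; have /trivIsetP/(_ i j Logic.I Logic.I ij)/seteqP[h _] := tF.
  by apply/seteqP; split => // r [[Fi _ _] [Fj _ _]]; exact: (h r).
Qed.

(** Without constraints on the positions, Chapman-Kolmogorov removes the times; what remains of them
    is that the last ones precede the ends of the two pieces. *)
Lemma return_mass_full ts us O : path <%R 0 ts -> path <%R 0 us ->
  return_mass l (full_cylinder ts) (full_cylinder us) O =
  return_mass l [::] [::] (O `&` [set r | last 0 ts < r /\ last 0 us < 1 - r]).
Proof.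
move=> pt pu; have lt0 := path_last_le pt; have lu0 := path_last_le pu.
rewrite /return_mass (_ : return_times (full_cylinder ts) _ O =
    return_times [::] [::] (O `&` [set r | last 0 ts < r /\ last 0 us < 1 - r])); last first.
  rewrite /return_times !fst_full_cylinder; apply/seteqP; split => r /=.
    by move=> [? h1 h2]; split => //; [exact: le_lt_trans h1|exact: le_lt_trans h2].
  by move=> [[? []]].
apply: eq_integral => r /[!inE] -[[_ /= [h1 h2]] _ _].
have s1 : shifted (full_cylinder us) = full_cylinder us by rewrite /shifted -map_comp.
rewrite /return_density -/(shifted _) s1 !bes3_mass_full ?(ltW l0)//; apply/path_rcons_lt => //.
Qed.
End return_mass_spec.

(** * The explicit density and its total mass *)

Section return_law.
Context {R : realType}.
Variable l : R.
Hypothesis l0 : 0 < l.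
Implicit Types (r u a b : R).
Local Notation mu := (@lebesgue_measure R).

Definition return_law r : R :=
  l / Num.sqrt (2 * pi * r * (1 - r) ^+ 3) * expR (- (l ^+ 2 * r / (2 * (1 - r)))).

Lemma return_law_ge0 r : 0 <= return_law r.
Proof. by rewrite mulr_ge0 ?expR_ge0// divr_ge0 ?sqrtr_ge0// ltW. Qed.

Lemma measurable_return_law : measurable_fun setT return_law.
Proof.
have mid : measurable_fun setT (fun r : R => r) by exact: measurable_id.
have mc (a : R) : measurable_fun setT (fun _ : R => a) by exact: measurable_cst.
have m1 : measurable_fun setT (fun r : R => 1 - r) by exact: measurable_funB.
apply: measurable_funM.
  apply: measurable_funM => //; apply: (measurableT_comp (@measurable_inv R)).
  apply: (measurableT_comp (@measurable_sqrt R)); apply: measurable_funM; last exact: measurable_funX.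
  by apply: measurable_funM.
apply: measurableT_comp => //; apply: measurable_funN; apply: measurable_funM.
  exact: measurable_funM.
by apply: (measurableT_comp (@measurable_inv R)); exact: measurable_funM.
Qed.

(** The square roots of the two Bessel kernels are multiplied by comparing squares. The exponent is
    [l ^ 2 / (2 (1 - r)) - l ^ 2 / 2], the subtracted term coming from the density of the bridge. *)
Lemma return_law_density r : 0 < r -> r < 1 ->
  (r%:E * return_density l [::] [::] r = (return_law r)%:E)%E.
Proof.
move=> r0 r1; rewrite /return_density /bes3_mass /= !subr0 -!EFinM; congr EFin.
have pi0 := pi_gt0 R; have s0 : 0 < 1 - r by rewrite subr_gt0.
rewrite !bes3_kernel0 ?mulr0// /bes3_front bm_kernelE// subr0 mulr1 sqrrN.
rewrite !expr0n /= addr0 oppr0 mul0r expR0 mulr1 addr0 /return_law.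
set q : R := Num.sqrt (2 * pi).
have q0 : 0 < q by rewrite sqrtr_gt0 mulr_gt0.
have qq : q ^+ 2 = 2 * pi by rewrite sqr_sqrtr// mulr_ge0// ltW.
have r3 : 0 < r ^+ 3 by rewrite exprn_gt0.
have s3 : 0 < (1 - r) ^+ 3 by rewrite exprn_gt0.
set A := Num.sqrt (2 / (pi * r ^+ 3)); set C := Num.sqrt (2 / (pi * (1 - r) ^+ 3)).
set D := Num.sqrt (2 * pi * r * (1 - r) ^+ 3).
have D0 : 0 < D by rewrite sqrtr_gt0 !mulr_gt0.
have DD : D ^+ 2 = 2 * pi * r * (1 - r) ^+ 3 by rewrite sqr_sqrtr// !mulr_ge0 ?ltW.
have AC : A * C = 4 * r^-1 * (q * D)^-1.
  have p0 : 0 <= 4 * r^-1 * (q * D)^-1 by rewrite mulr_ge0 ?divr_ge0 ?invr_ge0 ?mulr_ge0// ltW.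
  apply/eqP; rewrite -(@eqrXn2 _ 2)// ?mulr_ge0 ?sqrtr_ge0//; apply/eqP.
  have AA : A ^+ 2 = 2 / (pi * r ^+ 3) by rewrite sqr_sqrtr// divr_ge0// mulr_ge0// ltW.
  have CC : C ^+ 2 = 2 / (pi * (1 - r) ^+ 3) by rewrite sqr_sqrtr// divr_ge0// mulr_ge0// ltW.
  rewrite !exprMn !exprVn exprMn qq DD AA CC.
  have alg (p v s : R) : p != 0 -> v != 0 -> s != 0 -> 2 / (p * v ^+ 3) * (2 / (p * s ^+ 3)) =
      4 ^+ 2 / v ^+ 2 / (2 * p * (2 * p * v * s ^+ 3)).
    by move=> h1 h2 h3; field; rewrite h1 h2 h3.
  by apply: alg; rewrite gt_eqF.
set e1 := expR (- (l ^+ 2 / 2)); set e2 := expR (- _ / _); set e3 := expR (- (l ^+ 2 * r / _)).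
have E : e3 * e1 = e2.
  by rewrite /e1 /e2 /e3 -expRD; congr expR; field; rewrite gt_eqF.
have e10 : 0 < e1 by exact: expR_gt0.
rewrite -E (_ : r * _ = r * l / 4 * (q * e1^-1) * (A * C) * (e3 * e1)).
  by rewrite AC; field; rewrite !gt_eqF//.
by rewrite invfM invrK; ring.
Qed.

(** This map carries the law of the absolute value of a standard normal variable to [return_law]:
    the exponent [l ^ 2 r / (2 (1 - r))] becomes [u ^ 2 / 2]. *)
Let F u := u ^+ 2 / (l ^+ 2 + u ^+ 2).
Let l2 : 0 < l ^+ 2. Proof. by rewrite exprn_gt0. Qed.
Let den u : 0 < l ^+ 2 + u ^+ 2. Proof. by rewrite ltr_wpDr ?sqr_ge0. Qed.

Let dF u : is_derive u 1 F (2 * u * l ^+ 2 / (l ^+ 2 + u ^+ 2) ^+ 2).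
Proof.
have d1 : is_derive u 1 (fun u : R => l ^+ 2 + u ^+ 2) (2 * u).
  by apply: is_derive_eq; rewrite /GRing.scale/= add0r mulr1; ring.
have -> : F = (fun u : R => 1 - l ^+ 2 * (l ^+ 2 + u ^+ 2)^-1).
  by apply/funext => v; rewrite /F; field; rewrite gt_eqF.
have d2 : is_derive u 1 (fun u : R => (l ^+ 2 + u ^+ 2)^-1) (- (l ^+ 2 + u ^+ 2) ^- 2 * (2 * u)).
  by apply: is_derive_eq; [apply: is_deriveV; rewrite gt_eqF|rewrite /GRing.scale].
apply: is_derive_eq => /=; rewrite /GRing.scale/=.
by field; rewrite gt_eqF.
Qed.

Let F' : derive1 F = fun u => 2 * u * l ^+ 2 / (l ^+ 2 + u ^+ 2) ^+ 2.
Proof. by apply/funext => u; rewrite derive1E (@derive_val _ _ _ _ _ _ _ (dF u)). Qed.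

Let cF' : continuous (derive1 F).
Proof.
rewrite F' => u; apply: cvgM.
  by apply: cvgM; [apply: cvgM; [exact: cvg_cst|exact: cvg_id]|exact: cvg_cst].
apply: cvgV; first by rewrite gt_eqF// exprn_gt0.
have sq (f : R -> R) : {for u, continuous f} -> {for u, continuous (fun x => f x ^+ 2)}.
  by move=> cf; rewrite /prop_for /continuous_at; under eq_fun do rewrite expr2; rewrite expr2; exact: cvgM.
apply: (sq (fun x => l ^+ 2 + x ^+ 2)); apply: cvgD; first exact: cvg_cst.
by apply: (sq id); exact: cvg_id.
Qed.

Let F01 u : 0 < u -> 0 < F u /\ F u < 1.
Proof.
move=> u0; split; first by rewrite divr_gt0 ?exprn_gt0.
by rewrite ltr_pdivrMr// mul1r ltrDr.
Qed.

Let return_law_F u : 0 < u -> return_law (F u) * (derive1 F) u = 2 * bm_kernel 1 0 u.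
Proof.
move=> u0; have pi0 := pi_gt0 R; have D := den u.
rewrite F' bm_kernelE// subr0 mulr1 /return_law.
have sE : 2 * pi * F u * (1 - F u) ^+ 3 = (Num.sqrt (2 * pi) * (u * l ^+ 3 / (l ^+ 2 + u ^+ 2) ^+ 2)) ^+ 2.
  have qq : Num.sqrt (2 * pi : R) ^+ 2 = 2 * pi by rewrite sqr_sqrtr// mulr_ge0// ltW.
  by rewrite exprMn qq /F; field; rewrite gt_eqF.
have p0 : 0 <= u * l ^+ 3 / (l ^+ 2 + u ^+ 2) ^+ 2.
  by rewrite divr_ge0 ?exprn_ge0 ?mulr_ge0 ?ltW// exprn_ge0// ltW.
have p1 := mulr_ge0 (sqrtr_ge0 (2 * pi : R)) p0; rewrite sE sqrtr_sqr (ger0_norm p1).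
have -> : l ^+ 2 * F u / (2 * (1 - F u)) = u ^+ 2 / 2.
  have e1 : 1 - F u = l ^+ 2 / (l ^+ 2 + u ^+ 2) by rewrite /F; field; rewrite gt_eqF.
  by rewrite e1 /F; field; rewrite !gt_eqF.
rewrite mulr1; set e := expR _; set q := Num.sqrt _.
have q0 : 0 < q by rewrite sqrtr_gt0 mulr_gt0.
by field; rewrite !gt_eqF.
Qed.

Let F_incr a b : 0 < a -> {in `[a, b] &, {homo F : x y / x < y}}.
Proof.
move=> a0 x y; rewrite !in_itv/= => /andP[ax _] /andP[ay _] xy.
have x0 := lt_le_trans a0 ax; have y0 := lt_le_trans a0 ay.
have h : F y - F x = l ^+ 2 * (y - x) * (y + x) / ((l ^+ 2 + x ^+ 2) * (l ^+ 2 + y ^+ 2)).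
  by rewrite /F; field; rewrite !gt_eqF.
rewrite -subr_gt0 h divr_gt0 ?mulr_gt0 ?den// ?subr_gt0//; exact: addr_gt0.
Qed.

Let continuous_return_law r : 0 < r -> r < 1 -> {for r, continuous return_law}.
Proof.
move=> r0 r1; have pi0 := pi_gt0 R; have s0 : 0 < 1 - r by rewrite subr_gt0.
have c1 : (fun x : R => 1 - x) @ r --> 1 - r by apply: cvgB; [exact: cvg_cst|exact: cvg_id].
apply: cvgM.
  apply: cvgM; first exact: cvg_cst.
  apply: cvgV; first by rewrite gt_eqF// sqrtr_gt0 !mulr_gt0// exprn_gt0.
  apply: (@continuous_comp _ _ _ (fun x => 2 * pi * x * (1 - x) ^+ 3) Num.sqrt); last exact: sqrt_continuous.
  apply: cvgM; first by apply: cvgM; [exact: cvg_cst|exact: cvg_id].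
  under eq_fun do rewrite !exprS expr0 mulr1; rewrite !exprS expr0 mulr1.
  by apply: cvgM => //; exact: cvgM.
apply: (@continuous_comp _ _ _ (fun x => - (l ^+ 2 * x / (2 * (1 - x)))) (@expR R)); last exact: continuous_expR.
apply: cvgN; apply: cvgM; first by apply: cvgM; [exact: cvg_cst|exact: cvg_id].
by apply: cvgV; [rewrite gt_eqF// mulr_gt0|apply: cvgM; [exact: cvg_cst|]].
Qed.

Let integral_return_law_itv a b : 0 < a -> a <= b ->
  (\int[mu]_(r in `[F a, F b]) (return_law r)%:E = \int[mu]_(u in `[a, b]) (2 * bm_kernel 1 0 u)%:E)%E.
Proof.
move=> a0 ab; have b0 := lt_le_trans a0 ab.
rewrite integration_by_substitution_increasing//.
- apply: eq_integral => u /[!inE] /=; rewrite in_itv/= => /andP[au _].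
  by rewrite -return_law_F//; exact: lt_le_trans au.
- exact: F_incr.
- by apply: (cvgP (derive1 F a)); apply: cvg_at_right_filter; exact: (cF' (x := a)).
- by apply: (cvgP (derive1 F b)); apply: cvg_at_left_filter; exact: (cF' (x := b)).
- have cF u : {for u, continuous F} by apply: differentiable_continuous; apply/derivable1_diffP; case: (dF u).
  split; first by move=> x _; case: (dF x).
    by apply: cvg_at_right_filter; exact: cF.
  by apply: cvg_at_left_filter; exact: cF.
- apply: continuous_in_subspaceT => r /set_mem/=; rewrite in_itv/= => /andP[r1 r2].
  have [h1 _] := F01 a0; have [_ h2] := F01 b0.
  by apply: continuous_return_law; [exact: lt_le_trans r1|exact: le_lt_trans h2].
Qed.

(** The substitution by [F] is made on the compact intervals [[mesh n, n + 2]], whose images keep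
    away from both ends of the unit interval. They exhaust the positive half-line, on which twice
    the normal density integrates to [1]. *)
Lemma integral_return_law_ge1 : (1 <= \int[mu]_(r in `]0%R, 1%R[) (return_law r)%:E)%E.
Proof.
pose g u : \bar R := (2 * bm_kernel 1 0 u)%:E.
have mg : measurable_fun setT g.
  apply/measurable_EFinP; apply: measurable_funM; first exact: measurable_cst.
  by have := @measurable_bm_kernel1 R 0; under eq_fun do rewrite addr0.
have g0 u : (0 <= g u)%E by rewrite lee_fin mulr_ge0 ?bm_kernel_ge0.
pose D (n : nat) : set R := `[mesh n, n.+2%:R]%classic.
have mD n : measurable (D n) by exact: measurable_itv.
have ab n : mesh n <= n.+2%:R :> R.
  by apply: (@le_trans _ _ 1); [rewrite invf_le1// ler1n|rewrite ler1n].
pose E : set R := `]0, +oo[%classic.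
have -> : 1%E = (\int[mu]_u (g \_ E) u)%E.
  rewrite -integral_mkcond /E integral_itv_obnd_cbnd; last exact: measurable_funTS.
  have E0 : above 0 = `[0, +oo[%classic :> set R.
    by apply/seteqP; split => u; rewrite /above/= in_itv/= andbT.
  rewrite -E0.
  have h0 : (0 : R) <= 2 by [].
  under eq_integral do rewrite /g EFinM.
  rewrite ge0_integralZl_EFin//; last 2 first.
  - by move=> u _; rewrite lee_fin bm_kernel_ge0.
  - apply: measurable_funTS; apply/measurable_EFinP.
    by have := @measurable_bm_kernel1 R 0; under eq_fun do rewrite addr0.
  - by rewrite integral_first_moment -EFinM mulfV.
  - exact: measurable_above.
apply: (@lower_limit_ub _ (fun n => \int[mu]_u (g \_ (D n)) u)%E).
  move=> n; rewrite -integral_mkcond -(integral_return_law_itv (mesh_gt0 n) (ab n)).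
  apply: le_ge0_integral_subset => [r|r _]; last by rewrite lee_fin return_law_ge0.
  rewrite /= !in_itv/= => /andP[r1 r2].
  have [h1 _] := F01 (mesh_gt0 n); have [_ h2] := F01 (lt_le_trans (mesh_gt0 n) (ab n)).
  by rewrite (lt_le_trans h1)// (le_lt_trans r2).
apply: lower_limit_integral => //.
- by move=> n; exact: (measurable_patch0 (mD n) mg).
- by apply: (measurable_patch0 _ mg); exact: measurable_itv.
- by move=> n u _; rewrite patchE; case: ifP.
- by move=> u _; rewrite patchE; case: ifP.
move=> u _; rewrite [X in lower_limit_ge _ X]patchE; case: ifPn => [/[!inE]|_]; last first.
  apply: (@lower_limit_near _ (fun=> 0%E)); last exact: cst_lower_limit.
  by apply: nearW => n; rewrite patchE; case: ifP.
rewrite /E/= in_itv/= andbT => u0.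
apply: (@lower_limit_near _ (fun=> g u)); last exact: cst_lower_limit.
have h1 : \forall n \near \oo, mesh n < u by apply: (cvgr_lt (0 : R)) => //; exact: cvg_mesh.
have h2 := nbhs_infty_ger u.
near=> n; rewrite patchE mem_set// /D/= in_itv/=; apply/andP; split.
  by apply: ltW; near: n; exact: h1.
have : u <= n%:R by near: n; exact: h2.
by move=> h; apply: (le_trans h); rewrite ler_nat ltnW// ltnW.
Unshelve. all: by end_near. Qed.
End return_law.

(** * Equality of the joint law with its candidate *)

Section joint_law_equality.
Context {R : realType} {d : measure_display} {T : measurableType d}.
Variables (P : probability T R) (B : R -> T -> R) (l : R).
Hypotheses (l0 : 0 < l) (bB : is_brownian_bridge P 1 0 (- l) B).
Implicit Types (t r : R) (o : T) (A O : set R) (c p q : seq (R * set R)) (ts us : seq R).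
Local Notation mu := (@lebesgue_measure R).
Local Notation ev c1 c2 O := (return_event B O c1 c2).
Local Notation rm := (return_mass l).

Lemma event_spec (f : T -> R) (E : set R -> set T) : (forall A o, E A o <-> E setT o /\ A (f o)) ->
  (forall A, measurable A -> measurable (E A)) -> measure_spec (fun A => P (E A)).
Proof.
move=> EA mE; split; last 1 first.
- move=> F mF tF; have EU : E (\bigcup_n F n) = \bigcup_n E (F n).
    apply/seteqP; split => o.
      by move=> /EA[h [n _ Fn]]; exists n => //; apply/EA.
    by move=> [n _ /EA[h Fn]]; apply/EA; split => //; exists n.
  rewrite EU measure_semi_bigcup//.
  - by move=> n; exact: mE.
  - apply/trivIsetP => i j _ _ ij; have /trivIsetP/(_ i j Logic.I Logic.I ij)/seteqP[h _] := tF.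
    by apply/seteqP; split => // o [/EA[_ oi] /EA[_ oj]]; exact: (h (f o)).
  - by apply: bigcupT_measurable => n; exact: mE.
- have -> : E set0 = set0 by apply/seteqP; split => // o /EA[].
  by rewrite measure0.
- by move=> A; exact: measure_ge0.
Qed.

Lemma event_spec1 c2 O ts : path <%R 0 ts -> path <%R 0 (map fst c2) -> borel_sets c2 ->
  measurable O -> coordinate_spec (fun c1 => P (ev c1 c2 O)) ts.
Proof.
move=> pt pc2 m2 mO p t q E mp mq.
apply: (@event_spec (fun o => vervaat (B ^~ o) t) (fun A => ev (p ++ (t, A) :: q) c2 O)).
  move=> A o; rewrite /return_event/= /vervaat_event !map_cat /=; split.
    by move=> [h1 h2 h3 /each_cat[h4 [/= h5 h6]] h7]; split => //; split => //; apply/each_cat.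
  by move=> [[h1 h2 h3 /each_cat[h4 [/= _ h6]] h7] h5]; split => //; apply/each_cat.
move=> A mA; apply: (measurable_return_event l0 bB) => //; first by rewrite map_cat /= E.
by apply/borel_sets_cat; split => //; apply/borel_sets_cons.
Qed.

Lemma event_spec2 c1 O ts : path <%R 0 ts -> path <%R 0 (map fst c1) -> borel_sets c1 ->
  measurable O -> coordinate_spec (fun c2 => P (ev c1 c2 O)) ts.
Proof.
move=> pt pc1 m1 mO p t q E mp mq.
apply: (@event_spec (fun o => vervaat (B ^~ o) (first_return (vervaat (B ^~ o)) + t)) (fun A => ev c1 (p ++ (t, A) :: q) O)).
  move=> A o; rewrite /return_event/= /vervaat_event !map_cat /=; split.
    by move=> [h1 h2 h3 h7 /each_cat[h4 [/= h5 h6]]]; split => //; split => //; apply/each_cat.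
  by move=> [[h1 h2 h3 h7 /each_cat[h4 [/= _ h6]]] h5]; split => //; apply/each_cat.
move=> A mA; apply: (measurable_return_event l0 bB) => //; first by rewrite map_cat /= E.
by apply/borel_sets_cat; split => //; apply/borel_sets_cons.
Qed.

Lemma event_spec0 c1 c2 : path <%R 0 (map fst c1) -> path <%R 0 (map fst c2) ->
  borel_sets c1 -> borel_sets c2 -> measure_spec (fun O => P (ev c1 c2 O)).
Proof.
move=> pc1 pc2 m1 m2; apply: (@event_spec (fun o => first_return (vervaat (B ^~ o)))).
  move=> A o; rewrite /return_event/= /vervaat_event; split; first by move=> [].
  by move=> [[]].
by move=> A mA; exact: (measurable_return_event l0 bB).
Qed.

Lemma return_mass_nil O : rm [::] [::] O = (\int[mu]_(r in O `&` `]0%R, 1%R[) (return_law l r)%:E)%E.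
Proof.
rewrite /return_mass (_ : return_times _ _ _ = O `&` `]0, 1[%classic).
  apply: eq_integral => r /[!inE] -[_ /=]; rewrite in_itv/= => /andP[r0 r1].
  exact: return_law_density.
apply/seteqP; split => r /=; rewrite /return_times /= in_itv/= subr_gt0.
  by move=> [? -> ->].
by move=> [? /andP[-> ->]].
Qed.

Let bn : borel_sets ([::] : seq (R * set R)). Proof. exact: borel_sets_nil. Qed.
Let Pfin (E : set T) : measurable E -> (P E < +oo)%E.
Proof. by move=> mE; rewrite ltey_eq fin_num_measure. Qed.

(** The total masses agree: the event has probability at most [1], the density has integral at least
    [1], and the former dominates the latter. *)
Lemma first_return_law O : measurable O -> P (ev [::] [::] O) = rm [::] [::] O.
Proof.
have s1 := @event_spec0 [::] [::] isT isT bn bn.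
have s2 := return_mass_spec l0 (isT : path <%R 0 (map fst [::])) (isT : path <%R 0 (map fst [::])) bn bn.
have mT := measurable_return_event l0 bB (isT : path <%R 0 (map fst [::])) (isT : path <%R 0 (map fst [::])) bn bn.
apply: (dominating_spec_eq s1 s2 (Pfin (mT _ measurableT))).
  apply/eqP; rewrite eq_le; apply/andP; split.
    rewrite return_mass_nil setTI; apply: le_trans (integral_return_law_ge1 l0).
    exact: (probability_le1 P (mT _ measurableT)).
  by apply: (return_event_ge l0 bB) => //; exact: openT.
by move=> U oU; apply: (return_event_ge l0 bB) => //; exact: open_measurable.
Qed.

Let open_full ts : each (fun z : R * set R => open z.2) (full_cylinder ts).
Proof. by elim: ts => //= t ts ih; split => //=; exact: openT. Qed.

Lemma joint_law_full ts us O : path <%R 0 ts -> path <%R 0 us -> measurable O ->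
  P (ev (full_cylinder ts) (full_cylinder us) O) = rm (full_cylinder ts) (full_cylinder us) O.
Proof.
move=> pt pu mO; rewrite return_mass_full// -first_return_law; last first.
  apply: measurableI => //; apply: measurableI; apply: measurable_lt_set => //.
  by apply: measurable_funB; [exact: measurable_cst|exact: measurable_id].
congr (P _); apply/seteqP; have lt0 := path_last_le pt; have lu0 := path_last_le pu.
have eT (f : R -> R) xs : each (fun z : R * set R => z.2 (f z.1)) (full_cylinder xs).
  by elim: xs => //= t xs ih.
rewrite /return_event; split => o /=; rewrite /vervaat_event !fst_full_cylinder /=.
  by move=> [h1 h2 h3 _ _]; split => //; [exact: le_lt_trans h2|exact: le_lt_trans h3].
move=> [[h1 [h2 h3]] _ _ _ _]; split => //.
exact: (@eT (fun t => vervaat (B ^~ o) (first_return (vervaat (B ^~ o)) + t)) us).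
Qed.

(** For an open [O]: first Borel sets on the first piece and a free second piece, then open sets on
    the first and Borel sets on the second, then Borel sets on both. The last exchange is in [O].
    Each one takes the equality of total masses from an earlier one. *)
Theorem joint_law c1 c2 O : path <%R 0 (map fst c1) -> path <%R 0 (map fst c2) ->
  borel_sets c1 -> borel_sets c2 -> measurable O -> P (ev c1 c2 O) = rm c1 c2 O.
Proof.
move=> pc1 pc2 m1 m2 mO; set ts := map fst c1; set us := map fst c2.
have pF (xs : seq R) : path <%R 0 xs -> path <%R 0 (map fst (full_cylinder xs)) by rewrite fst_full_cylinder.
have dom U c c' : open U -> map fst c = ts -> map fst c' = us ->
    each (fun z : R * set R => open z.2) c -> each (fun z : R * set R => open z.2) c' ->
    (rm c c' U <= P (ev c c' U))%E.
  move=> oU E E' oc oc'; apply: (return_event_ge l0 bB) => //; rewrite ?E ?E'//.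
  - exact: each_open_borel.
  - exact: each_open_borel.
  - exact: open_measurable.
have stage1 U c : open U -> map fst c = ts -> borel_sets c ->
    P (ev c (full_cylinder us) U) = rm c (full_cylinder us) U.
  move=> oU; have mU := open_measurable oU; have bu := borel_full_cylinder us.
  apply: (dominating_cylinder_eq (event_spec1 pc1 (pF _ pc2) bu mU)
    (return_mass_spec1 l0 pc1 (pF _ pc2) bu mU)).
  - by move=> c' E bc; apply: Pfin; apply: (measurable_return_event l0 bB); rewrite ?E//; exact: pF.
  - by move=> c' E oc'; apply: dom => //; rewrite fst_full_cylinder.
  - exact: joint_law_full.
have stage2 U c c' : open U -> map fst c = ts -> each (fun z : R * set R => open z.2) c ->
    map fst c' = us -> borel_sets c' -> P (ev c c' U) = rm c c' U.
  move=> oU E oc; have mU := open_measurable oU; have bc := each_open_borel oc.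
  have pc : path <%R 0 (map fst c) by rewrite E.
  apply: (dominating_cylinder_eq (event_spec2 pc2 pc bc mU) (return_mass_spec2 l0 pc2 pc bc mU)).
  - by move=> c'' E'' bc''; apply: Pfin; apply: (measurable_return_event l0 bB); rewrite ?E''.
  - by move=> c'' E' oc'; apply: dom.
  - exact: stage1.
have stage3 U c : open U -> map fst c = ts -> borel_sets c -> P (ev c c2 U) = rm c c2 U.
  move=> oU; have mU := open_measurable oU.
  apply: (dominating_cylinder_eq (event_spec1 pc1 pc2 m2 mU) (return_mass_spec1 l0 pc1 pc2 m2 mU)).
  - by move=> c' E bc; apply: Pfin; apply: (measurable_return_event l0 bB); rewrite ?E.
  - by move=> c' E oc'; rewrite stage2.
  - by apply: stage2 => //; rewrite fst_full_cylinder.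
apply: (dominating_spec_eq (event_spec0 pc1 pc2 m1 m2) (return_mass_spec l0 pc1 pc2 m1 m2)) => //.
  by apply: Pfin; exact: (measurable_return_event l0 bB).
  by apply: stage3 => //; exact: openT.
by move=> U oU; rewrite stage3.
Qed.
End joint_law_equality.

(** * Conditional independence *)

Section layer_cake.
Context {R : realType} {d d' : measure_display} {T : measurableType d} {U : measurableType d'}.
Variables (P : probability T R) (m : {sigma_finite_measure set U -> \bar R}).
Variables (E : set T) (Z : T -> R) (W : U -> R) (g : U -> \bar R).
Hypotheses (mE : measurable E) (mZ : measurable_fun setT Z) (mW : measurable_fun setT W).
Hypotheses (mg : measurable_fun setT g) (g0 : forall u, (0 <= g u)%E).
Hypothesis law : forall A, measurable A -> P (E `&` Z @^-1` A) = (\int[m]_(u in W @^-1` A) g u)%E.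
Local Notation mu := (@lebesgue_measure R).

(* [f x] is the measure of [{t > 0 | t < f x}], so both sides are the integral
   over [t] of their value at the indicator of [{f > t}]. *)
Lemma integral_of_law (f : R -> \bar R) : measurable_fun setT f -> (forall x, (0 <= f x)%E) ->
  (\int[P]_(o in E) f (Z o) = \int[m]_u (g u * f (W u)))%E.
Proof.
move=> mf f0; pose S : set (R * R) := [set p | 0 < p.2 /\ (p.2%:E < f p.1)%E].
have mS : measurable S.
  rewrite (_ : S = [set p | 0 < p.2] `&` [set p | (p.2%:E < f p.1)%E]); last by apply/seteqP; split.
  apply: measurableI; first by apply: measurable_lt_set; [exact: measurable_cst|exact: measurable_snd].
  rewrite -[X in measurable X]setTI; apply: emeasurable_fun_lt => //.
    by apply/measurable_EFinP; exact: measurable_snd.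
  exact: (measurableT_comp mf measurable_fst).
pose h (p : R * R) : \bar R := (\1_S p)%:E.
have mh : measurable_fun setT h by apply/measurable_EFinP; exact: measurable_indic.
have h0 p : (0 <= h p)%E by rewrite lee_fin.
have fE x : f x = (\int[mu]_t h (x, t))%E.
  rewrite (_ : (fun t => h (x, t)) = fun t => (\1_([set t | S (x, t)]) t)%:E); last first.
    by apply/funext => t; rewrite /h !indicE; congr ((nat_of_bool _)%:R%:E).
  have mSx : measurable [set t | S (x, t)].
    have hx : measurable_fun setT (fun t : R => (x, t)).
      by apply: measurable_fun_pair; [exact: measurable_cst|exact: measurable_id].
    by have := hx measurableT _ mS; rewrite setTI.
  rewrite integral_indic// setIT; have := f0 x; case fx : (f x) => [r| |] // r0.
    rewrite (_ : [set t | S (x, t)] = `]0, r[%classic).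
      have hr : mu (`]0, r[%classic : set R) = r%:E.
        rewrite lebesgue_measure_itv/= lte_fin; case: ifPn => [_|]; first by rewrite sube0.
        have r0' : 0 <= r by rewrite -lee_fin.
        by rewrite -leNgt => r1; congr EFin; apply/eqP; rewrite eq_le r1 r0'.
      by rewrite -[LHS]hr.
    apply/seteqP; split => t /=; rewrite /S/= fx lte_fin in_itv/=; first by move=> [-> ->].
    by move=> /andP[].
  rewrite (_ : [set t | S (x, t)] = `]0, +oo[%classic); last first.
    apply/seteqP; split => t /=; rewrite /S/= fx in_itv/= andbT; first by move=> [].
    by move=> t0; split => //; exact: ltry.
  have hr : mu (`]0, +oo[%classic : set R) = +oo%E.
    by rewrite lebesgue_measure_itv/= ltry addye.
  by rewrite -[LHS]hr.
have mSt t : measurable [set x | S (x, t)].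
  have hx : measurable_fun setT (fun x : R => (x, t)).
    by apply: measurable_fun_pair; [exact: measurable_id|exact: measurable_cst].
  by have := hx measurableT _ mS; rewrite setTI.
have mpre t : measurable [set o | S (Z o, t)] by have := mZ measurableT (mSt t); rewrite setTI.
under eq_integral do rewrite fE.
pose hZ (p : T * R) : \bar R := h (Z p.1, p.2).
have mhZ : measurable_fun setT hZ.
  apply: (measurable_comp_pair mh); last exact: measurable_snd.
  exact: (measurableT_comp mZ measurable_fst).
rewrite (tonelli_set P mu mE measurableT mhZ); last by move=> p; exact: h0.
pose hW (p : U * R) : \bar R := (g p.1 * h (W p.1, p.2))%E.
have mhW : measurable_fun setT hW.
  apply: emeasurable_funM; first exact: (measurableT_comp mg measurable_fst).
  apply: (measurable_comp_pair mh); last exact: measurable_snd.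
  exact: (measurableT_comp mW measurable_fst).
transitivity (\int[m]_u \int[mu]_t hW (u, t))%E; last first.
  apply: eq_integral => u _; rewrite fE /hW /= ge0_integralZl//.
  by apply: (measurable_comp_pair mh); [exact: measurable_cst|exact: measurable_id].
rewrite (tonelli_set m mu measurableT measurableT mhW); last by move=> p; apply: mule_ge0.
apply: eq_integral => t _ /=.
transitivity (P (E `&` Z @^-1` [set x | S (x, t)])).
  rewrite (_ : (fun o => hZ (o, t)) = fun o => (\1_([set o | S (Z o, t)]) o)%:E); last first.
    by apply/funext => o; rewrite /hZ /h !indicE; congr ((nat_of_bool _)%:R%:E).
  by rewrite integral_indic// setIC.
rewrite law// integral_mkcond; apply: eq_integral => u _; rewrite patchE /hW /h indicE.
by rewrite (_ : (u \in _) = ((W u, t) \in S))//; case: ifP => _; rewrite ?mule1 ?mule0.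
Qed.
End layer_cake.

Section conditional_versions.
Context {R : realType} {d : measure_display} {T : measurableType d}.
Variables (P : probability T R) (Z : T -> R).
Hypothesis mZ : measurable_fun setT Z.
Implicit Types (E : set T) (A C : set R) (q : R -> \bar R).

Definition cond_version E q : Prop := is_cond_prob P Z E q /\ forall z, (0 <= q z)%E.

Let mpre A : measurable A -> measurable (Z @^-1` A).
Proof. by move=> mA; have := mZ measurableT mA; rewrite setTI. Qed.

(** The defining property of a version, extended from sets to nonnegative functions of [Z] by
    [integral_of_law]. *)
Lemma integral_cond_version E q A (f : R -> \bar R) : cond_version E q -> measurable A ->
  measurable_fun setT f -> (forall x, (0 <= f x)%E) ->
  (\int[P]_(o in E `&` Z @^-1` A) f (Z o) = \int[P]_(o in Z @^-1` A) (q (Z o) * f (Z o)))%E.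
Proof.
move=> [[mE mq qE] q0] mA mf f0.
have mqZ : measurable_fun setT (fun o => q (Z o)) by exact: (measurableT_comp mq).
have mfA := measurable_patch0 mA mf.
have fA0 x : (0 <= (f \_ A) x)%E by rewrite patchE; case: ifP.
have pA o : (f \_ A) (Z o) = ((f \o Z) \_ (Z @^-1` A)) o by rewrite !patchE.
transitivity (\int[P]_(o in E) (f \_ A) (Z o))%E.
  by rewrite integral_mkcondr; apply: eq_integral => o _; rewrite pA.
rewrite (@integral_of_law R _ _ T T P P E Z Z (q \o Z) mE mZ mZ mqZ (fun o => q0 (Z o)) qE _ mfA fA0).
rewrite [RHS]integral_mkcond; apply: eq_integral => o _; rewrite pA !patchE.
by case: ifP => //; rewrite mule0.
Qed.

Section law_measure.
Variables (E : set T) (mE : measurable E).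

Definition law_on A : \bar R := P (E `&` Z @^-1` A).

Let law0 : law_on set0 = 0%E. Proof. by rewrite /law_on preimage_set0 setI0 measure0. Qed.
Let law_ge0 A : (0 <= law_on A)%E. Proof. exact: measure_ge0. Qed.
Let law_add : semi_sigma_additive law_on.
Proof.
move=> F mF tF mU; rewrite /law_on preimage_bigcup setI_bigcupr.
apply: measure_semi_sigma_additive.
- by move=> n; apply: measurableI => //; exact: mpre.
- apply/trivIsetP => i j _ _ ij; have /trivIsetP/(_ i j Logic.I Logic.I ij)/seteqP[h _] := tF.
  by apply/seteqP; split => // o [[_ oi] [_ oj]]; exact: (h (Z o)).
- by apply: bigcupT_measurable => n; apply: measurableI => //; exact: mpre.
Qed.
HB.instance Definition _ := isMeasure.Build _ R R law_on law0 law_ge0 law_add.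

Let law_fin : fin_num_fun law_on.
Proof. by move=> A mA; apply: fin_num_measure; apply: measurableI => //; exact: mpre. Qed.
HB.instance Definition _ := Measure_isFinite.Build _ R R law_on law_fin.

Definition finite_law : {finite_measure set R -> \bar R} := law_on.
End law_measure.

(** The version is the Radon-Nikodym derivative of the law of [Z] on [E] with respect to the law of
    [Z]. *)
Lemma cond_version_exists E : measurable E -> exists q, cond_version E q.
Proof.
move=> mE; pose nu := finite_law mE; pose la := finite_law (@measurableT _ T).
have dom : nu `<< la.
  apply/null_content_dominatesP => A mA; rewrite /nu /la /= /law_on setTI => A0.
  apply/eqP; rewrite eq_le measure_ge0 andbT -A0; apply: le_measure; rewrite ?inE.
  - by apply: measurableI => //; exact: mpre.
  - exact: mpre.
  - by move=> o [].
have [q [q0 qf iq qE]] := radon_nikodym_sigma_finite dom.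
have mq : measurable_fun setT q by exact: measurable_int iq.
exists q; split => //; split => // A mA.
have mcst : measurable_fun setT (fun _ : R => 1%E : \bar R) by exact: measurable_cst.
have law1 A' : measurable A' -> P (setT `&` Z @^-1` A') = (\int[la]_(u in id @^-1` A') 1)%E.
  by move=> mA'; rewrite integral_cst// mul1e.
have mid : measurable_fun setT (fun x : R => x) by exact: measurable_id.
have mqA := measurable_patch0 mA mq.
have qA0 x : (0 <= (q \_ A) x)%E by rewrite patchE; case: ifP.
have := @integral_of_law R _ _ T R P la setT Z id (cst 1%E) measurableT mZ mid mcst (fun=> lee01) law1 _ mqA qA0.
move=> h; transitivity (\int[la]_u (cst 1%E u * (q \_ A) u))%E.
  by rewrite -[LHS]/(nu A) qE// integral_mkcond; apply: eq_integral => u _; rewrite mul1e.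
rewrite -h [RHS]integral_mkcond; apply: eq_integral => o _; by rewrite !patchE.
Qed.

(* With [q] a version of the conditional probability of [E'] given [Z], this is
   the conditional independence of [E] and [E'] in the form
   [P(E | E', Z) = P(E | Z)]. *)
Definition indep_version E E' q : Prop := forall A, measurable A ->
  P (E `&` E' `&` Z @^-1` A) = (\int[P]_(o in E `&` Z @^-1` A) q (Z o))%E.

Lemma indep_version_prod E1 E2 q1 q2 : cond_version E1 q1 -> cond_version E2 q2 ->
  indep_version E1 E2 q2 <->
  forall A, measurable A -> P (E1 `&` E2 `&` Z @^-1` A) = (\int[P]_(o in Z @^-1` A) (q1 (Z o) * q2 (Z o)))%E.
Proof.
move=> v1 v2; have [[_ mq2 _] q20] := v2.
by split=> h A mA; rewrite h// (integral_cond_version v1).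
Qed.

Lemma indep_version_sym E1 E2 q1 q2 : cond_version E1 q1 -> cond_version E2 q2 ->
  indep_version E1 E2 q2 -> indep_version E2 E1 q1.
Proof.
move=> v1 v2 /(indep_version_prod v1 v2) h; apply/(indep_version_prod v2 v1) => A mA.
by rewrite (setIC E2) h//; apply: eq_integral => o _; rewrite muleC.
Qed.

Section fixed_event.
Variables (E' : set T) (q : R -> \bar R).
Hypothesis v' : cond_version E' q.

Let mE' : measurable E'. Proof. by have [[]] := v'. Qed.
Let mqZ D : measurable_fun D (fun o => q (Z o)).
Proof. by have [[_ mq _] _] := v'; apply: measurable_funTS; exact: (measurableT_comp mq). Qed.
Let q0 z : (0 <= q z)%E. Proof. by have [_] := v'. Qed.

Let fin E A : measurable E -> measurable A -> (P (E `&` E' `&` Z @^-1` A) < +oo)%E.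
Proof.
move=> mE mA; rewrite ltey_eq fin_num_measure//.
by apply: measurableI; [exact: measurableI|exact: mpre].
Qed.

Lemma indep_versionT : indep_version setT E' q.
Proof. by move=> A mA; have [[_ _ qE] _] := v'; rewrite !setTI qE. Qed.

Lemma indep_version0 : indep_version set0 E' q.
Proof. by move=> A mA; rewrite !set0I measure0 integral_set0. Qed.

Lemma indep_version_bigcup (F : nat -> set T) : (forall n, measurable (F n)) -> trivIset setT F ->
  (forall n, indep_version (F n) E' q) -> indep_version (\bigcup_n F n) E' q.
Proof.
move=> mF tF hF A mA; have mZA := mpre mA.
have tA G : trivIset setT (fun n => F n `&` G).
  apply/trivIsetP => i j _ _ ij; have /trivIsetP/(_ i j Logic.I Logic.I ij)/seteqP[h _] := tF.
  by apply/seteqP; split => // o [[oi _] [oj _]]; exact: (h o).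
rewrite -setIA setI_bigcupl measure_semi_bigcup.
- rewrite setI_bigcupl ge0_integral_bigcup//.
  + by apply: eq_eseriesr => n _; rewrite setIA; exact: (hF n A mA).
  + by move=> n; exact: measurableI.
- by move=> n; apply: measurableI => //; exact: measurableI.
- exact: tA.
- by apply: bigcupT_measurable => n; apply: measurableI => //; exact: measurableI.
Qed.

Lemma indep_versionC E : measurable E -> indep_version E E' q -> indep_version (~` E) E' q.
Proof.
move=> mE h A mA; have mZA := mpre mA; have mC := measurableC mE.
have hE := h A mA; have hT := indep_versionT mA.
have e1 : P (setT `&` E' `&` Z @^-1` A) = (P (E `&` E' `&` Z @^-1` A) + P (~` E `&` E' `&` Z @^-1` A))%E.
  rewrite -(setUv E) -!setIA setIUl measureU//.
  - by apply: measurableI => //; exact: measurableI.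
  - by apply: measurableI => //; exact: measurableI.
  - by rewrite setIACA setICr set0I.
have e2 : (\int[P]_(o in setT `&` Z @^-1` A) q (Z o) =
    \int[P]_(o in E `&` Z @^-1` A) q (Z o) + \int[P]_(o in ~` E `&` Z @^-1` A) q (Z o))%E.
  rewrite -(setUv E) setIUl ge0_integral_setU//.
  - exact: measurableI.
  - exact: measurableI.
  - by apply/disj_setPS; rewrite setIACA setICr set0I.
have f1 := fin mE mA; have f0 : (0 <= P (E `&` E' `&` Z @^-1` A))%E by exact: measure_ge0.
have fn : P (E `&` E' `&` Z @^-1` A) \is a fin_num by rewrite ge0_fin_numE.
have cancel (a x y : \bar R) : a \is a fin_num -> (a + x = a + y)%E -> x = y.
  by move=> fa axy; rewrite -[LHS](addeK x fa) (addeC x) axy (addeC a) addeK.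
by apply: cancel fn _; rewrite -e1 hT e2 hE.
Qed.

Lemma indep_version_restrict E C : measurable C -> indep_version E E' q ->
  indep_version (E `&` Z @^-1` C) E' q.
Proof.
move=> mC h A mA; rewrite (_ : E `&` Z @^-1` C `&` Z @^-1` A = E `&` Z @^-1` (C `&` A)); last first.
  by rewrite preimage_setI setIA.
rewrite -h; last exact: measurableI.
congr (P _); rewrite preimage_setI; apply/seteqP; split => o; first by move=> [[[? ?] ?] ?].
by move=> [[? ?] [? ?]].
Qed.

Lemma indep_version_split E C : measurable E -> measurable C ->
  indep_version (E `&` Z @^-1` C) E' q -> indep_version (E `&` Z @^-1` (~` C)) E' q ->
  indep_version E E' q.
Proof.
move=> mE mC h1 h2; pose F n := if n is 0%N then E `&` Z @^-1` C else if n is 1%N then E `&` Z @^-1` (~` C) else set0.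
have -> : E = \bigcup_n F n.
  apply/seteqP; split => o.
    by move=> Eo; have [Co|nC] := pselect (C (Z o)); [exists 0%N|exists 1%N].
  by move=> [[|[|n]] _] // [].
apply: indep_version_bigcup.
- by case=> [|[|n]] //=; apply: measurableI => //; apply: mpre => //; exact: measurableC.
- apply/trivIsetP => -[|[|i]] [|[|j]] _ _ //= _; rewrite ?set0I ?setI0//.
    by apply/seteqP; split => // o [[_ ?] [_ ?]].
  by apply/seteqP; split => // o [[_ ?] [_ ?]].
- by case=> [|[|n]] //=; exact: indep_version0.
Qed.

(** For fixed [E'] and [q] both sides of [indep_version] are additive in [E], so the admissible
    events form a Dynkin system; the product form would bring in a version for each [E]. *)
Lemma indep_version_dynkin (G : set (set T)) : setI_closed G ->
  (forall E, G E -> measurable E /\ indep_version E E' q) ->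
  forall E, <<s G >> E -> measurable E /\ indep_version E E' q.
Proof.
move=> GI hG E; rewrite -setI_closed_g_dynkin_g_sigma_algebra// => gE.
pose D := [set E | measurable E /\ indep_version E E' q].
suff dD : dynkin D by apply: (smallest_sub dD _ gE); exact: hG.
split.
- by split; [exact: measurableT|exact: indep_versionT].
- by move=> F [mF hF]; split; [exact: measurableC|exact: indep_versionC].
- move=> F tF hF; split; first by apply: bigcupT_measurable => n; case: (hF n).
  by apply: indep_version_bigcup => // n; case: (hF n).
Qed.
End fixed_event.
End conditional_versions.

(** * From cylinders to the sigma-algebra of a path with a lifetime *)

Section lifetime.
Context {R : realType} {d : measure_display} {T : measurableType d}.
Variables (P : probability T R) (Z : T -> R) (Y : R -> T -> R) (L : R -> R) (x0 x1 : R).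
Hypotheses (mZ : measurable_fun setT Z) (mL : measurable_fun setT L).
Hypothesis mY : forall u, 0 <= u -> measurable_fun setT (Y u).
Hypotheses (Y0 : forall o, Y 0 o = x0) (YL : forall u o, L (Z o) <= u -> Y u o = x1).
Variables (E' : set T) (q : R -> \bar R).
Hypothesis v' : cond_version P Z E' q.
Implicit Types (s t u : R) (A : set R) (c : seq (R * set R)) (o : T).

Local Notation cyl c := [set o | each (fun p => p.2 (Y p.1 o)) c].

Hypothesis base : forall c, path <%R 0 (map fst c) -> borel_sets c ->
  indep_version P Z ([set o | last 0 (map fst c) < L (Z o)] `&` cyl c) E' q.

Lemma measurable_each_process c : each (fun p => 0 <= p.1) c -> borel_sets c -> measurable (cyl c).
Proof.
elim: c => [_ _|p c ih [p0 pc] /borel_sets_cons[mp mc]].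
  by rewrite (_ : [set _ | _] = setT); [exact: measurableT|apply/seteqP].
by apply: measurableI; [apply: measurable_preim => //; exact: mY|exact: ih].
Qed.

Lemma path_times_ge0 c : path <%R 0 (map fst c) -> each (fun p => 0 <= p.1) c.
Proof. by move=> pc; apply: each_imp (each_time_le pc) => p /andP[/ltW]. Qed.

(** While the last time precedes the end of the lifetime this is [base]. Otherwise the path already
    sits at [x1], so the last condition is void or impossible, and a void one leaves the shorter
    cylinder restricted to an event of [Z]. *)
Lemma indep_sorted_cylinder c : path <%R 0 (map fst c) -> borel_sets c ->
  indep_version P Z (cyl c) E' q.
Proof.
elim/last_ind: c => [|c [t A] ih].
  by move=> _ _; rewrite (_ : [set _ | _] = setT); [exact: indep_versionT|apply/seteqP].
rewrite -cats1 map_cat /= => pc mc; have pc' := pc; rewrite cats1 in pc'.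
have [pc1 lt] := (path_rcons_lt _ _ _).1 pc'.
have mc1 : borel_sets c by move: mc => /borel_sets_cat[].
have mc2 := mc; have pE : path <%R 0 (map fst (c ++ [:: (t, A)])) by rewrite map_cat.
have mcc := measurable_each_process (path_times_ge0 pE) mc.
have mC : measurable [set z | t < L z] by apply: measurable_lt_set => //; exact: measurable_cst.
apply: (indep_version_split mZ v' mcc mC).
  have lE : last 0 (map fst (c ++ [:: (t, A)])) = t by rewrite map_cat last_cat.
  have := base pE mc; rewrite lE => h.
  rewrite (_ : _ `&` _ = [set o | t < L (Z o)] `&` cyl (c ++ [:: (t, A)])) //.
  by rewrite setIC.
have [Ax|nAx] := pselect (A x1).
  rewrite (_ : _ `&` _ = cyl c `&` Z @^-1` (~` [set z | t < L z])).
    by apply: indep_version_restrict => //; [exact: measurableC|exact: ih].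
  apply/seteqP; split => o [/= h nt]; split => //.
    by have [] := (each_cat _ _ _).1 h.
  apply/each_cat; split => //; split => //=; rewrite YL//.
  by rewrite leNgt; exact/negP.
rewrite (_ : _ `&` _ = set0); first exact: indep_version0.
apply/seteqP; split => // o [/= /each_cat[_ [/= At _]] nt]; apply: nAx; rewrite -(YL (u := t) (o := o))//.
by rewrite leNgt; exact/negP.
Qed.

Lemma insert_time s c t A : path <%R s (map fst c) -> s < t -> borel_sets c -> measurable A ->
  exists c', [/\ path <%R s (map fst c'), borel_sets c' &
    forall y : R -> R, each (fun p => p.2 (y p.1)) c' <-> A (y t) /\ each (fun p => p.2 (y p.1)) c].
Proof.
elim: c s => [|[t' A'] c ih] s /=.
  move=> _ st _ mA; exists [:: (t, A)]; split => //=; first by rewrite st.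
  by apply/borel_sets_cons; split => //; exact: borel_sets_nil.
move=> /andP[st' pc] st /[dup] mc /borel_sets_cons[mA' mc'] mA.
have [tt'|t't|tt'] := ltgtP t t'.
- exists ((t, A) :: (t', A') :: c); split => //=; first by rewrite st tt' pc.
  by apply/borel_sets_cons; split => //; apply/borel_sets_cons.
- have [c' [pc' mc'' h]] := ih t' pc t't mc' mA.
  exists ((t', A') :: c'); split => //=; first by rewrite st'.
    by apply/borel_sets_cons.
  move=> y; split; first by move=> [h1 /h[h2 h3]].
  by move=> [h1 [h2 h3]]; split => //; exact/h.
exists ((t, A `&` A') :: c); split => //=.
- by rewrite st tt' pc.
- by apply/borel_sets_cons; split => //=; exact: measurableI.
by move=> y; rewrite tt'; split; [move=> [[? ?] ?]|move=> [? [? ?]]].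
Qed.

(** The sigma-algebra is generated by values at arbitrary times. Repeated times intersect their
    sets, and a condition at time [0] is decided by the starting point. *)
Lemma sorted_times c : each (fun p => 0 <= p.1) c -> borel_sets c ->
  exists c', [/\ path <%R 0 (map fst c'), borel_sets c' &
    forall y : R -> R, y 0 = x0 -> each (fun p => p.2 (y p.1)) c' <-> each (fun p => p.2 (y p.1)) c].
Proof.
elim: c => [_ _|[t A] c ih /= [t0 ec] /borel_sets_cons[mA mc]]; first by exists [::]; split => //; exact: borel_sets_nil.
have [c' [pc' mc' h]] := ih ec mc.
have [t00|t00] := eqVneq t 0; last first.
  have tp : 0 < t by rewrite lt_neqAle eq_sym t00.
  have [c'' [pc'' mc'' h'']] := insert_time pc' tp mc' mA.
  exists c''; split => // y y0; split; first by move=> /h''[? /(h _ y0)].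
  by move=> [? /(h _ y0) ?]; exact/h''.
have [Ax|nAx] := pselect (A x0).
  by exists c'; split => // y y0; rewrite t00 y0; split; [move=> /(h _ y0)|move=> [_ /(h _ y0)]].
(* An impossible condition at time [0] is encoded by the empty set at time [1]. *)
have [c'' [pc'' mc'' h'']] := insert_time pc' (ltr01 : 0 < 1 :> R) mc' measurable0.
by exists c''; split => // y y0; rewrite t00 y0; split; [move=> /h''[]|move=> []].
Qed.

Lemma indep_sigma_path E : sigma_path Y E -> measurable E /\ indep_version P Z E E' q.
Proof.
pose G : set (set T) := [set E | exists c, [/\ each (fun p => 0 <= p.1) c, borel_sets c & E = cyl c]].
move=> sE; apply: (@indep_version_dynkin _ _ _ P Z mZ E' q v' G).
- move=> _ _ [c1 [t1 m1 ->]] [c2 [t2 m2 ->]]; exists (c1 ++ c2); split.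
  + exact/each_cat.
  + exact/borel_sets_cat.
  + by apply/seteqP; split => o /=; [move=> [? ?]; exact/each_cat|move=> /each_cat].
- move=> _ [c [tc mc ->]]; split; first exact: measurable_each_process.
  have [c' [pc' mc' h]] := sorted_times tc mc.
  rewrite (_ : [set o | _] = cyl c'); first exact: indep_sorted_cylinder.
  by apply/seteqP; split => o /=; [move=> ?; exact/(h (Y ^~ o) (Y0 o))|move=> /(h (Y ^~ o) (Y0 o))].
apply: (smallest_sub (smallest_sigma_algebra setT G) _ sE) => _ [u [A [u0 mA ->]]].
apply: sub_gen_smallest.
exists [:: (u, A)]; split => //=.
  by apply/borel_sets_cons; split => //; exact: borel_sets_nil.
by apply/seteqP; split => o /=; [|move=> []].
Qed.
End lifetime.

(** * The two pieces and their conditional laws *)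

Section decomposition.
Context {R : realType} {d : measure_display} {T : measurableType d}.
Variables (P : probability T R) (B : R -> T -> R) (l : R).
Hypotheses (l0 : 0 < l) (bB : is_brownian_bridge P 1 0 (- l) B).
Implicit Types (t u r z : R) (o : T) (A : set R) (c : seq (R * set R)).
Local Notation mu := (@lebesgue_measure R).
Local Notation V o := (vervaat (B ^~ o)).

Definition return_time o : R := first_return (V o).
Definition first_piece u o : R := V o (Num.min u (return_time o)).
Definition second_piece u o : R := V o (Num.min (return_time o + u) 1).
Local Notation Z := return_time.
Local Notation Y1 := first_piece.
Local Notation Y2 := second_piece.

Let cB o : {within `[0, 1], continuous (B ^~ o)}.
Proof. exact: (bb_continuous bB). Qed.
Let B0 o : B 0 o = 0. Proof. exact: (bb_start bB). Qed.
Let B1 o : B 1 o = - l. Proof. exact: (bb_end bB). Qed.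

Lemma return_time_itv o : 0 <= Z o /\ Z o < 1.
Proof. by have [] := bridge_first_return_spec l0 bB o. Qed.

Lemma vervaat_return_time o : V o (Z o) = 0.
Proof. by have [] := bridge_first_return_spec l0 bB o. Qed.

Lemma measurable_return_time : measurable_fun setT Z.
Proof. exact: (measurable_bridge_first_return l0 bB). Qed.

Let mZ := measurable_return_time.

Let mpre A : measurable A -> measurable (Z @^-1` A).
Proof. by move=> mA; have := mZ measurableT mA; rewrite setTI. Qed.

Lemma measurable_first_piece u : 0 <= u -> measurable_fun setT (Y1 u).
Proof.
move=> u0; apply: (measurable_bridge_vervaat l0 bB (f := fun o => Num.min u (Z o))) => [|o].
  by apply: measurable_minr; [exact: measurable_cst|exact: mZ].
have [h0 h1] := return_time_itv o.
by rewrite le_min u0 h0 ge_min (ltW h1) orbT.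
Qed.

Lemma measurable_second_piece u : 0 <= u -> measurable_fun setT (Y2 u).
Proof.
move=> u0; apply: (measurable_bridge_vervaat l0 bB (f := fun o => Num.min (Z o + u) 1)) => [|o].
  apply: measurable_minr; last exact: measurable_cst.
  by apply: measurable_funD; [exact: mZ|exact: measurable_cst].
have [h0 h1] := return_time_itv o.
by rewrite le_min addr_ge0//= ler01 ge_min lexx orbT.
Qed.

Lemma first_piece0 o : Y1 0 o = 0.
Proof.
have [h0 h1] := return_time_itv o.
by rewrite /first_piece min_l// (vervaat0 (@cB o)).
Qed.

Lemma first_piece_end u o : Z o <= u -> Y1 u o = 0.
Proof. by move=> Zu; rewrite /first_piece min_r// vervaat_return_time. Qed.

Lemma second_piece0 o : Y2 0 o = 0.
Proof.
have [h0 h1] := return_time_itv o.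
by rewrite /second_piece addr0 min_l ?ltW// vervaat_return_time.
Qed.

Lemma second_piece_end u o : 1 - Z o <= u -> Y2 u o = - l.
Proof.
move=> Zu; rewrite /second_piece min_r; last by move: Zu; rewrite lerBlDl.
exact: (vervaat1 (@cB o) (B0 o) (B1 o) l0).
Qed.

Let cV o : continuous (V o \o clamp).
Proof. exact: continuous_clamp (continuous_vervaat (@cB o) (B0 o) (B1 o)). Qed.

Lemma continuous_first_piece o : {within `[0, Z o], continuous (Y1 ^~ o)}.
Proof.
have [h0 h1] := return_time_itv o.
apply: subspace_eq_continuous (continuous_subspaceT (@cV o)) => u /set_mem/=.
rewrite in_itv/= => /andP[u0 uZ]; rewrite /from_subspace/= /first_piece min_l// clampE//.
by rewrite u0 (le_trans uZ)// ltW.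
Qed.

Lemma continuous_second_piece o : {within `[0, 1 - Z o], continuous (Y2 ^~ o)}.
Proof.
have [h0 h1] := return_time_itv o.
have cS : continuous (fun u => (V o \o clamp) (Z o + u)).
  move=> u; apply: (@continuous_comp _ _ _ (fun u => Z o + u) (V o \o clamp)); last exact: cV.
  by apply: cvgD; [exact: cvg_cst|exact: cvg_id].
apply: subspace_eq_continuous (continuous_subspaceT cS) => u /set_mem/=.
rewrite in_itv/= lerBrDl => /andP[u0 uZ]; rewrite /from_subspace/= /second_piece min_l// clampE//.
by rewrite addr_ge0.
Qed.

Local Notation E1 c := ([set o | last 0 (map (@fst R (set R)) c) < Z o] `&` [set o | each (fun p => p.2 (Y1 p.1 o)) c]).
Local Notation E2 c := ([set o | last 0 (map (@fst R (set R)) c) < 1 - Z o] `&` [set o | each (fun p => p.2 (Y2 p.1 o)) c]).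

Lemma return_event_pieces c1 c2 A : path <%R 0 (map fst c1) -> path <%R 0 (map fst c2) ->
  return_event B A c1 c2 = E1 c1 `&` E2 c2 `&` Z @^-1` A.
Proof.
move=> p1 p2.
have e1 o : last 0 (map fst c1) < Z o ->
    each (fun p => p.2 (V o p.1)) c1 <-> each (fun p => p.2 (Y1 p.1 o)) c1.
  move=> h; apply: each_iff; apply: each_imp (each_time_le p1) => p /andP[_ pl].
  by rewrite /first_piece min_l// ltW// (le_lt_trans pl h).
have e2 o : last 0 (map fst c2) < 1 - Z o ->
    each (fun p => p.2 (V o (Z o + p.1))) c2 <-> each (fun p => p.2 (Y2 p.1 o)) c2.
  move=> h; apply: each_iff; apply: each_imp (each_time_le p2) => p /andP[_ pl].
  by rewrite /second_piece min_l// -lerBrDl ltW// (le_lt_trans pl h).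
apply/seteqP; split => o; rewrite /return_event /= /vervaat_event.
  by move=> [h1 h2 h3 /(e1 _ h2) h4 /(e2 _ h3) h5].
by move=> [[[h2 h4] [h3 h5]] h1]; split => //; [exact/(e1 _ h2)|exact/(e2 _ h3)].
Qed.

Let bn : borel_sets ([::] : seq (R * set R)). Proof. exact: borel_sets_nil. Qed.

Lemma second_event_nil : E2 [::] = setT.
Proof.
by apply/seteqP; split => // o _ /=; have [h0 h1] := return_time_itv o; rewrite subr_gt0.
Qed.

Lemma measurable_first_event c : path <%R 0 (map fst c) -> borel_sets c -> measurable (E1 c).
Proof.
move=> pc mc; have := measurable_return_event l0 bB pc (isT : path <%R 0 (map fst [::])) mc bn measurableT.
by rewrite return_event_pieces// second_event_nil preimage_setT !setIT.
Qed.

Lemma measurable_second_event c : path <%R 0 (map fst c) -> borel_sets c -> measurable (E2 c).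
Proof.
move=> pc mc; apply: measurableI; last first.
  by apply: (measurable_each_process measurable_second_piece) mc; exact: path_times_ge0.
apply: measurable_lt_set; first exact: measurable_cst.
by apply: measurable_funB; [exact: measurable_cst|exact: mZ].
Qed.

(** As an infimum, [Z] may be [0] on some paths. Its law has mass [1] on the open unit interval, so
    these paths have probability zero. *)
Lemma first_event_nil : P (E1 [::]) = 1%E.
Proof.
have h : P (E1 [::]) = (\int[mu]_(r in `]0%R, 1%R[) (return_law l r)%:E)%E.
  have := first_return_law l0 bB measurableT.
  by rewrite return_event_pieces// second_event_nil preimage_setT !setIT return_mass_nil setTI.
have m := measurable_first_event (isT : path <%R 0 (map fst [::])) bn.
by apply/eqP; rewrite eq_le (probability_le1 P m) h integral_return_law_ge1.
Qed.

Lemma prob_first_event_nil E : measurable E -> P (E1 [::] `&` E) = P E.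
Proof.
move=> mE; have mD := measurable_first_event (isT : path <%R 0 (map fst [::])) bn.
have mC := measurableC mD.
have n0 : P (~` E1 [::] `&` E) = 0%E.
  apply/eqP; rewrite eq_le measure_ge0 andbT.
  have <- : P (~` E1 [::]) = 0%E by rewrite probability_setC// [X in (_ - X)%E]first_event_nil subee.
  by apply: le_measure; rewrite ?inE//; exact: measurableI.
rewrite -[in RHS](setTI E) -(setUv (E1 [::])) setIUl measureU//.
- by rewrite [X in (_ + X)%E]n0 adde0.
- exact: measurableI.
- exact: measurableI.
- by rewrite setIACA setICr set0I.
Qed.

Lemma return_time_law A : measurable A ->
  P (Z @^-1` A) = (\int[mu]_(r in A `&` `]0%R, 1%R[) (return_law l r)%:E)%E.
Proof.
move=> mA; rewrite -return_mass_nil -(first_return_law l0 bB mA) return_event_pieces//.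
by rewrite second_event_nil setIT prob_first_event_nil//; exact: mpre.
Qed.

Lemma integral_return_time (f : R -> \bar R) A : measurable A -> measurable_fun setT f ->
  (forall z, (0 <= f z)%E) ->
  (\int[P]_(o in Z @^-1` A) f (Z o) = \int[mu]_(r in A `&` `]0%R, 1%R[) ((return_law l r)%:E * f r))%E.
Proof.
move=> mA mf f0; pose D : set R := `]0, 1[%classic.
pose g : R -> \bar R := (fun r => (return_law l r)%:E) \_ D.
have mg : measurable_fun setT g.
  apply: measurable_patch0; first exact: measurable_itv.
  by apply/measurable_EFinP; exact: measurable_return_law.
have g0 r : (0 <= g r)%E by rewrite /g patchE; case: ifP => // _; rewrite lee_fin return_law_ge0.
have law A' : measurable A' -> P (setT `&` Z @^-1` A') = (\int[mu]_(r in id @^-1` A') g r)%E.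
  by move=> mA'; rewrite setTI return_time_law// integral_mkcondr.
have mid : measurable_fun setT (fun x : R => x) by exact: measurable_id.
have fA0 z : (0 <= (f \_ A) z)%E by rewrite patchE; case: ifP.
have := @integral_of_law R _ _ T (measurableTypeR R) P (@lebesgue_measure R) setT Z id g measurableT mZ mid mg g0 law _ (measurable_patch0 mA mf) fA0.
move=> h; transitivity (\int[P]_o (f \_ A) (Z o))%E.
  by rewrite integral_mkcond; apply: eq_integral => o _; rewrite !patchE.
rewrite h [RHS]integral_mkcond; apply: eq_integral => r _.
rewrite /g !patchE in_setI; case: (r \in A); last by rewrite mule0.
by rewrite /=; case: ifP => //; rewrite mul0e.
Qed.

Definition excursion_version c z : \bar R :=
  if last_time c < z then brownian_excursion_fdd z c else 0%E.
Definition passage_version c z : \bar R :=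
  if last_time c < 1 - z then first_passage_bridge_fdd (- l) (1 - z) c else 0%E.
Local Notation q1 := excursion_version.
Local Notation q2 := passage_version.

Let c' c := [seq (p.1, shift_set l p.2) | p <- c].
Let fst_c' c : map fst (c' c) = map fst c. Proof. by rewrite -map_comp. Qed.
Let borel_c' c : borel_sets c -> borel_sets (c' c).
Proof. by apply: borel_sets_map => p; exact: measurable_shift_set. Qed.

Lemma excursion_fddE r c :
  brownian_excursion_fdd r c = (bes3_mass r 0 0 0 c * ((bes3_kernel r 0 0)^-1)%:E)%E.
Proof. by []. Qed.

Lemma passage_fddE r c :
  first_passage_bridge_fdd (- l) r c = (bes3_mass r 0 0 l (c' c) * ((bes3_kernel r l 0)^-1)%:E)%E.
Proof.
rewrite /first_passage_bridge_fdd normrN gtr0_norm// /bes3_bridge_fdd /bridge_fdd.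
congr (bridge_mass _ _ _ _ _ _ _ * _)%E; apply: eq_map => p; congr pair.
by apply/seteqP; split => r'; rewrite /shift_set /= addrC.
Qed.

Lemma excursion_version_ge0 c z : path <%R 0 (map fst c) -> (0 <= q1 c z)%E.
Proof.
move=> pc; rewrite /excursion_version; case: ifP => // _.
by rewrite excursion_fddE mule_ge0 ?bes3_mass0_ge0// lee_fin invr_ge0 bes3_kernel_ge0r.
Qed.

Lemma passage_version_ge0 c z : path <%R 0 (map fst c) -> (0 <= q2 c z)%E.
Proof.
move=> pc; rewrite /passage_version; case: ifP => // _.
rewrite passage_fddE mule_ge0 ?bes3_mass0_ge0 ?fst_c'//.
by rewrite lee_fin invr_ge0 bes3_kernel_ge0r.
Qed.

Let mid : measurable_fun setT (fun z : R => z). Proof. exact: measurable_id. Qed.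
Let mcst (a : R) : measurable_fun setT (fun _ : R => a). Proof. exact: measurable_cst. Qed.
Let m1z : measurable_fun setT (fun z : R => 1 - z).
Proof. exact: measurable_funB. Qed.

Let measurable_version (a : R -> R) (s x : R) c : measurable_fun setT a ->
  path <%R 0 (map fst c) -> borel_sets c ->
  measurable_fun setT (fun z => if s < a z then (bes3_mass (a z) 0 0 x c * ((bes3_kernel (a z) x 0)^-1)%:E)%E else 0%E).
Proof.
move=> ma pc mc; apply: measurable_fun_ifT.
- exact: measurable_fun_ltr.
- apply: emeasurable_funM; first exact: measurable_bes3_mass_length.
  apply/measurable_EFinP; apply: (measurableT_comp (@measurable_inv R)).
  exact: measurable_bes3_kernel.
- exact: measurable_cst.
Qed.

Lemma measurable_excursion_version c : path <%R 0 (map fst c) -> borel_sets c ->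
  measurable_fun setT (q1 c).
Proof. by move=> pc mc; exact: measurable_version. Qed.

Lemma measurable_passage_version c : path <%R 0 (map fst c) -> borel_sets c ->
  measurable_fun setT (q2 c).
Proof.
move=> pc mc; rewrite /passage_version; under eq_fun do rewrite passage_fddE.
by apply: measurable_version; rewrite ?fst_c'//; exact: borel_c'.
Qed.

Lemma excursion_version_nil z : 0 < z -> q1 [::] z = 1%E.
Proof.
move=> z0; rewrite /excursion_version /last_time/= z0 excursion_fddE /bes3_mass /= subr0 -EFinM mulfV//.
by rewrite bes3_kernel0 ?mulr0// gt_eqF ?bes3_front_gt0.
Qed.

Lemma passage_version_nil z : z < 1 -> q2 [::] z = 1%E.
Proof.
move=> z1; have s0 : 0 < 1 - z by rewrite subr_gt0.
rewrite /passage_version /last_time/= s0 passage_fddE /bes3_mass /= subr0 -EFinM mulfV//.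
by rewrite bes3_kernel0 ?mulr0// gt_eqF ?bes3_front_gt0.
Qed.

(** The kernels that normalize the two bridges, at [(0, 0)] over [r] and at [(l, 0)] over [1 - r],
    are the Bessel factors of the density without constraints. *)
Lemma return_density_factor r c1 c2 : 0 < r -> r < 1 ->
  path <%R 0 (rcons (map fst c1) r) -> path <%R 0 (rcons (map fst c2) (1 - r)) ->
  (r%:E * return_density l c1 c2 r =
   (return_law l r)%:E * (brownian_excursion_fdd r c1 * first_passage_bridge_fdd (- l) (1 - r) c2))%E.
Proof.
move=> r0 r1 p1 p2; rewrite -return_law_density// excursion_fddE passage_fddE /return_density.
rewrite {3}/bes3_mass {3}/bes3_mass /= !subr0.
have s0 : 0 < 1 - r by rewrite subr_gt0.
have f1 : bes3_mass r 0 0 0 c1 \is a fin_num by exact: bes3_mass_fin.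
have f2 : bes3_mass (1 - r) 0 0 l (c' c2) \is a fin_num.
  by apply: bes3_mass_fin; rewrite ?fst_c'// ltW.
rewrite -(fineK f1) -(fineK f2).
have k1 : 0 < bes3_kernel r 0 0 by rewrite bes3_kernel0 ?mulr0// bes3_front_gt0.
have k2 : 0 < bes3_kernel (1 - r) l 0 by rewrite bes3_kernel0 ?mulr0// bes3_front_gt0.
rewrite -!EFinM; congr EFin; have x0 : bes3_kernel r 0 0 != 0 by rewrite gt_eqF.
have y0 : bes3_kernel (1 - r) l 0 != 0 by rewrite gt_eqF.
move: (bes3_kernel r 0 0) (bes3_kernel (1 - r) l 0) (fine _) (fine _) (l / 4 * _) x0 y0 => x y u v K x0 y0.
by field; rewrite x0 y0.
Qed.

(** Conditional independence on cylinders. With the empty list for one of the pieces it also gives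
    the conditional law of the other. *)
Lemma pieces_law c1 c2 A : path <%R 0 (map fst c1) -> path <%R 0 (map fst c2) ->
  borel_sets c1 -> borel_sets c2 -> measurable A ->
  P (E1 c1 `&` E2 c2 `&` Z @^-1` A) = (\int[P]_(o in Z @^-1` A) (q1 c1 (Z o) * q2 c2 (Z o)))%E.
Proof.
move=> p1 p2 m1 m2 mA; rewrite -return_event_pieces// (joint_law l0 bB)//.
rewrite (@integral_return_time (fun z => (q1 c1 z * q2 c2 z)%E)) //; first last.
- by move=> z; apply: mule_ge0; [exact: excursion_version_ge0|exact: passage_version_ge0].
- by apply: emeasurable_funM; [exact: measurable_excursion_version|exact: measurable_passage_version].
rewrite /return_mass [LHS]integral_mkcond [RHS]integral_mkcond; apply: eq_integral => r _.
have l1 := path_last_le p1; have l2 := path_last_le p2.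
rewrite !patchE; case: ifPn => [/set_mem[Ar h1 h2]|nr].
  have r0 := le_lt_trans l1 h1; have r1 := le_lt_trans l2 h2; rewrite subr_gt0 in r1.
  rewrite mem_set; last by split => //=; rewrite in_itv/= r0.
  by rewrite /excursion_version /passage_version /last_time h1 h2 return_density_factor//; apply/path_rcons_lt.
case: ifPn => // /set_mem[Ar /=]; rewrite in_itv/= => /andP[r0 r1].
rewrite /excursion_version /passage_version /last_time; case: ifPn => h1; last by rewrite mul0e mule0.
case: ifPn => h2; last by rewrite !mule0.
by move/negP: nr; rewrite inE => -[].
Qed.

Lemma first_cond_version c : path <%R 0 (map fst c) -> borel_sets c ->
  cond_version P Z (E1 c) (q1 c).
Proof.
move=> pc mc; split=> [|z]; last exact: excursion_version_ge0.
have mq := measurable_excursion_version pc mc.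
split => //; first exact: measurable_first_event.
move=> A mA; have := @pieces_law c [::] A pc isT mc bn mA.
rewrite second_event_nil setIT => ->; apply: eq_integral => o _.
by have [_ h1] := return_time_itv o; rewrite passage_version_nil// mule1.
Qed.

Lemma second_cond_version c : path <%R 0 (map fst c) -> borel_sets c ->
  cond_version P Z (E2 c) (q2 c).
Proof.
move=> pc mc; split=> [|z]; last exact: passage_version_ge0.
have mq := measurable_passage_version pc mc.
have m1 := @measurable_excursion_version [::] isT bn.
have mE := measurable_second_event pc mc.
split => // A mA; have := @pieces_law [::] c A isT pc bn mc mA.
(* The empty cylinder of the first piece is the event [0 < Z], of probability one. *)
rewrite -setIA prob_first_event_nil => [->|]; last by apply: measurableI => //; exact: mpre.
have q20 z := passage_version_ge0 z pc.
rewrite (@integral_return_time (q2 c))// (@integral_return_time (fun z => (q1 [::] z * q2 c z)%E)) //; first last.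
- by move=> z; apply: mule_ge0 => //; exact: excursion_version_ge0.
- exact: emeasurable_funM.
apply: eq_integral => r /set_mem[_ /=]; rewrite in_itv/= => /andP[r0 _].
by rewrite excursion_version_nil// mul1e.
Qed.

(** The Dynkin argument is made twice: an event of the first path against the cylinders of the
    second, then, the relation being symmetric, an event of the second path against that event of
    the first. *)
Lemma pieces_cond_independent : cond_independent P Z Y1 Y2.
Proof.
move=> F1 F2 s1 s2.
have step c2 : path <%R 0 (map fst c2) -> borel_sets c2 ->
    measurable F1 /\ indep_version P Z F1 (E2 c2) (q2 c2).
  move=> p2 m2; apply: (@indep_sigma_path R d T P Z Y1 id 0 0 mZ mid measurable_first_piece
    first_piece0 first_piece_end _ _ (second_cond_version p2 m2) _ F1 s1) => c1 p1 m1.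
  apply/(indep_version_prod mZ (first_cond_version p1 m1) (second_cond_version p2 m2)) => A mA.
  exact: pieces_law.
have [mF1 _] := @step [::] isT bn.
have [q v] := cond_version_exists P mZ mF1.
have [mF2 h2] : measurable F2 /\ indep_version P Z F2 F1 q.
  apply: (@indep_sigma_path R d T P Z Y2 (fun z => 1 - z) 0 (- l) mZ m1z measurable_second_piece
    second_piece0 second_piece_end _ _ v _ F2 s2) => c2 p2 m2.
  by apply: (indep_version_sym mZ v (second_cond_version p2 m2)); case: (step c2 p2 m2).
have [q' v'] := cond_version_exists P mZ mF2.
exists q, q'; have [cq _] := v; have [cq' _] := v'; split => //.
have [_ mq _] := cq; have [_ mq' _] := cq'.
split; [exact: measurableI|exact: emeasurable_funM|] => A mA.
by have := (indep_version_prod mZ v' v).1 h2 A mA; rewrite (setIC F1) => ->; apply: eq_integral => o _; rewrite muleC.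
Qed.

Let cylinderE (Y : R -> T -> R) c : cylinder Y c = [set o | each (fun p => p.2 (Y p.1 o)) c].
Proof. by apply/seteqP; split => o /each_cylinder. Qed.

Lemma first_piece_excursion : cond_brownian_excursion P Z Y1 (fun z => z).
Proof.
split; first by apply: aeW => o; split; [exact: continuous_first_piece|exact: first_piece0|exact: first_piece_end].
by move=> c [pc mc]; rewrite cylinderE; have [] := first_cond_version pc mc.
Qed.

Lemma second_piece_first_passage : cond_first_passage_bridge P (- l) Z Y2 (fun z => 1 - z).
Proof.
split; first by apply: aeW => o; split; [exact: continuous_second_piece|exact: second_piece0|exact: second_piece_end].
by move=> c [pc mc]; rewrite cylinderE; have [] := second_cond_version pc mc.
Qed.

Lemma return_time_density : has_density P Z `]0, 1[ (return_law l).
Proof. by split => // A mA; exact: return_time_law. Qed.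
End decomposition.

Theorem theorem1p3 (R : realType) (d : measure_display) (T : measurableType d)
    (P : probability T R) (lambda : R) (B : R -> T -> R) :
  lambda < 0 ->
  is_brownian_bridge P 1 0 lambda B ->
  let V : R -> T -> R := fun t o => vervaat (fun s => B s o) t in
  let Z : T -> R := fun o => first_return (fun t => V t o) in
  let Y1 : R -> T -> R := fun u o => V (Num.min u (Z o)) o in
  let Y2 : R -> T -> R := fun u o => V (Num.min (Z o + u) 1) o in
  [/\ has_density P Z `]0, 1[
        (fun t => `|lambda| / Num.sqrt (2 * pi * t * (1 - t) ^+ 3) *
                  expR (- (lambda ^+ 2 * t / (2 * (1 - t))))),
      cond_independent P Z Y1 Y2,
      cond_brownian_excursion P Z Y1 (fun z => z) &
      cond_first_passage_bridge P lambda Z Y2 (fun z => 1 - z)].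
Proof.
move=> lam0 bB; have l0 : 0 < - lambda by rewrite oppr_gt0.
have bB' : is_brownian_bridge P 1 0 (- - lambda) B by rewrite opprK.
have lawE : return_law (- lambda) = fun t => `|lambda| / Num.sqrt (2 * pi * t * (1 - t) ^+ 3) *
    expR (- (lambda ^+ 2 * t / (2 * (1 - t)))).
  by apply/funext => t; rewrite /return_law ltr0_norm// sqrrN.
split.
- by rewrite -lawE; exact: return_time_density l0 bB'.
- exact: pieces_cond_independent l0 bB'.
- exact: first_piece_excursion l0 bB'.
- by have := second_piece_first_passage l0 bB'; rewrite opprK.
Qed.
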